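(* Let $M$ be a smooth manifold and $(V,\partial)$ a cochain complex. Then the diagram of maps of sets $$\begin{array}{ccc} \mathrm{Rep}_\infty(TM,V) & \xrightarrow{\ \int\ } & \mathrm{Rep}_\infty(\pi_\infty(M),V)\\ {\scriptstyle \mathsf{T}_{\le 2}}\downarrow & & \downarrow{\scriptstyle \mathsf{T}_{\le 2}}\\ \mathsf{Flat}(M,\mathsf{gl}(V)) & \xrightarrow{\ \mathsf{Hol}\ } & \mathrm{Rep}(\pi_{\le 2}(M),\mathsf{GL}(V)) \end{array}$$ commutes. That is, for every flat superconnection $\alpha$ on $M$ with values in $(V,\partial)$, the representations $\mathsf{T}_{\le 2}(\int\alpha)$ and $\mathsf{Hol}_{\mathsf{T}_{\le 2}(\alpha)}$ of the fundamental $2$-groupoid of $M$ in $\mathsf{GL}(V)$ are equal.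
   Context: **Conventions.** A cochain complex $(V,\partial)$ is a finite-dimensional $\mathbb{Z}$-graded real vector space with a differential of degree $+1$. $\mathrm{End}^k(V)$ is the space of degree $k$ linear endomorphisms; for $\varphi\in\mathrm{End}^k(V)$, $[\partial,\varphi]=\partial\varphi-(-1)^k\varphi\partial$. $I=[0,1]$; on $I^2$ the horizontal coordinate is $t$ and the vertical one is $s$, written $(t,s)$. $\Delta_k=\{(t_1,\dots,t_k)\in\mathbb{R}^k: 1\ge t_1\ge\cdots\ge t_k\ge 0\}$. Integrals over $\Delta_k\times I$ use the orientation $dt_1\wedge\cdots\wedge dt_k\wedge ds$. Paths, simplices and homotopies are piecewise smooth. $\gamma^{-1}(t)=\gamma(1-t)$. **Flat superconnections.** On $\Omega(M)\otimes\mathrm{End}(V)$ use the product $(\omega\otimes\varphi)\circ(\eta\otimes\psi)=(-1)^{|\varphi||\eta|}(\omega\wedge\eta)\otimes\varphi\psi$ (similarly for forms on other manifolds). A flat superconnection on $M$ with values in $(V,\partial)$ is a form $\alpha=\alpha^1+\alpha^2+\cdots$ with $\alpha^i\in\Omega^i(M)\otimes\mathrm{End}^{1-i}(V)$ such that the operator $D=\partial+d+\alpha$ on $\Omega(M)\otimes V$ satisfies $D^2=0$, where $\partial(\omega\otimes v)=(-1)^{|\omega|}\omega\otimes\partial v$, $d(\omega\otimes v)=d\omega\otimes v$, $(\omega\otimes\varphi)(\eta\otimes v)=(-1)^{|\varphi||\eta|}\omega\wedge\eta\otimes\varphi v$. Equivalently $[\partial,\alpha^n]+d\alpha^{n-1}+\sum_{i+j=n}\alpha^i\circ\alpha^j=0$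 for all $n\ge 1$, where $[\partial,\omega\otimes\varphi]=(-1)^{|\omega|}\omega\otimes[\partial,\varphi]$. The set of these is $\mathrm{Rep}_\infty(TM,V)$. **Representations up to homotopy of $\pi_\infty(M)$.** $\pi_\infty(M)$ is the simplicial set of simplices $\sigma:\Delta_k\to M$, with face maps $d_i=\partial_i^*$, where $\partial_i:\Delta_k\to\Delta_{k+1}$ is $\partial_0(t_1,\dots,t_k)=(1,t_1,\dots,t_k)$, $\partial_i(t_1,\dots,t_k)=(t_1,\dots,t_i,t_i,\dots,t_k)$ for $0<i<k+1$, $\partial_{k+1}(t_1,\dots,t_k)=(t_1,\dots,t_k,0)$, and degeneracies $s_i$ induced by the standard maps omitting a coordinate. A representation up to homotopy of $\pi_\infty(M)$ on $(V,\partial)$ is a family $\beta=(\beta^n)_{n\ge1}$, $\beta^n$ assigning to each $n$-simplex $\sigma$ an element $\beta^n(\sigma)\in\mathrm{End}^{1-n}(V)$, with $$[\partial,\beta^n(\sigma)]=\sum_{j=1}^{n-1}(-1)^j\beta^{n-1}(d_j\sigma)+\sum_{j=1}^{n-1}(-1)^{j+1}(\beta^j\cup\beta^{n-j})(\sigma),$$ where $(\beta^i\cup\beta^j)(\sigma)=\beta^i(d_{i+1}\cdots d_{i+j}\sigma)\,\beta^j((d_0)^i\sigma)$, and with $\beta^1(s_0x)=\mathrm{id}$ and $\beta^n(s_i\sigma)=0$ for $n>1$. The set of these is $\mathrm{Rep}_\infty(\pi_\infty(M),V)$. It is called well behaved if $\beta^2(\sigma)=0$ for every $2$-simplex of rank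 $<2$. **The map $\int$.** It is the map on objects underlying the integration $A_\infty$-functor of Igusa, Block–Smith and Arias Abad–Schätz from flat superconnections to representations up to homotopy; its values are well behaved. Only $\beta^1,\beta^2$ of $\beta=\int\alpha$ enter the statement. They are: $\beta^1(\gamma)$ is the parallel transport of $\alpha^1$ along $t\mapsto\gamma(1-t)$, i.e. the inverse of $g_\gamma(1)$, where $g_\gamma'(t)=-\alpha^1(\gamma'(t))g_\gamma(t)$, $g_\gamma(0)=1$. And $$\beta^2(\sigma)=\sum_{m,n\ge0}(-1)^{m+n+1}\int_{\Delta_{m+n+1}\times I}\Theta_{(m+n+1)}^*\big(p_1^*\sigma^*\alpha^1\wedge\cdots\wedge p_m^*\sigma^*\alpha^1\wedge p_{m+1}^*\sigma^*\alpha^2\wedge p_{m+2}^*\sigma^*\alpha^1\wedge\cdots\wedge p_{m+n+1}^*\sigma^*\alpha^1\big),$$ an absolutely convergent sum. Here $p_i:(\Delta_2)^{\times k}\to\Delta_2$ is the $i$-th projection, $\Theta_{(k)}:\Delta_k\times I\to(\Delta_2)^{\times k}$, $(t_1,\dots,t_k,s)\mapsto(\Theta(t_1,s),\dots,\Theta(t_k,s))$, $\Theta=q\circ\lambda$, $q:I^2\to\Delta_2$, $q(t,s)=(\max\{t,s\},s)$, and $\lambda:I^2\to I^2$ is such that $\lambda(-,s)$ is the piecewise linear path running through $(s,1)\to(s,0)\to(0,0)$, arriving at $(s,0)$ at time $t=1/2$. **Crossed modules.** A Lie crossed module is a Lie group homomorphism $\delta:E\to G$ with a left action $\rhd$ of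 $G$ on $E$ by Lie group automorphisms such that $\delta(g\rhd e)=g\,\delta(e)\,g^{-1}$ and $\delta(e)\rhd f=efe^{-1}$. A differential Lie crossed module is the infinitesimal version ($\delta:\mathfrak e\to\mathfrak g$ with action of $\mathfrak g$ on $\mathfrak e$ by derivations, $\delta(X\rhd v)=[X,\delta v]$, $(\delta v)\rhd w=[v,w]$). - $\mathsf{GL}(V)$: $\mathsf{GL}^0(V)$ is the group of automorphisms of the complex $(V,\partial)$; $\mathsf{GL}^{-1}(V)=\mathrm{End}^{-1}(V)'/[\partial,\mathrm{End}^{-2}(V)]$, where $\mathrm{End}^{-1}(V)'=\{s\in\mathrm{End}^{-1}(V):[\partial,s]+\mathrm{id}\text{ invertible}\}$ with product $s*t=s+t+s[\partial,t]$ (unit $0$); $\delta(s)=[\partial,s]+\mathrm{id}$; $\phi\rhd s=\phi s\phi^{-1}$. - $\mathsf{gl}(V)$: $\mathsf{gl}^0(V)$ is the Lie algebra of degree $0$ cochain maps $V\to V$; $\mathsf{gl}^{-1}(V)=\mathrm{End}^{-1}(V)/[\partial,\mathrm{End}^{-2}(V)]$ with bracket $[s,t]=s\partial t-t\partial s+st\partial-ts\partial$; $\delta(s)=\partial s+s\partial$; $\phi\rhd s=\phi s-s\phi$. It is the differential Lie crossed module of $\mathsf{GL}(V)$. **Flat 2-connections.** For a differential Lie crossed module $\mathsf g=(\delta:\mathfrak e\to\mathfrak g)$, $\mathsf{Flat}(M,\mathsf g)$ is the set of pairs $(A,B)$, $A\in\Omega^1(M,\mathfrak g)$, $B\in\Omega^2(M,\mathfrak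 e)$, with $\delta B=dA+\frac12[A,A]$ and $dB+A\wedge^{\rhd}B=0$, where $\wedge^\rhd$ is the wedge product of forms combined with the action. **Representations of $\pi_{\le2}(M)$.** A $2$-path is a piecewise smooth $\Gamma:I^2\to M$ constant on each of the two vertical sides; $\Gamma_s(t)=\Gamma(t,s)$. An element of $\mathrm{Rep}(\pi_{\le2}(M),\mathsf G)$, $\mathsf G=(\delta:E\to G)$, assigns to every path $\gamma$ an element $\mathsf{Hol}(\gamma)\in G$ and to every $2$-path $\Gamma$ an element $\mathsf{Hol}(\Gamma)\in E$ such that constant paths and constant $2$-paths go to $1$; $2$-paths homotopic relative to the boundary have equal values; $\delta(\mathsf{Hol}(\Gamma))=\mathsf{Hol}(\Gamma_0)^{-1}\mathsf{Hol}(\Gamma_1)$; and compositions are preserved: $\mathsf{Hol}(\gamma\text{ then }\gamma')=\mathsf{Hol}(\gamma')\mathsf{Hol}(\gamma)$; stacking $\Gamma'$ on top of $\Gamma$ (when $\Gamma_1=\Gamma'_0$) gives $\mathsf{Hol}(\Gamma)\mathsf{Hol}(\Gamma')$; placing $\Gamma'$ to the right of $\Gamma$ gives $(\mathsf{Hol}(\Gamma_0)^{-1}\rhd\mathsf{Hol}(\Gamma'))\,\mathsf{Hol}(\Gamma)$. **The map $\mathsf{Hol}$.** For $(A,B)\in\mathsf{Flat}(M,\mathsf g)$: $\mathsf{Hol}_{(A,B)}(\gamma)=g_\gamma(1)$, where $g_\gamma'(t)=-(R_{g_\gamma(t)})_*A(\gamma'(t))$, $g_\gamma(0)=1$; and $\mathsf{Hol}_{(A,B)}(\Gamma)=h(1)$,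 where $h:[0,1]\to E$ solves $h'(s)=(L_{h(s)})_*\big(\int_0^1 g_{\Gamma_s}(t)^{-1}\rhd B(\partial_t\Gamma,\partial_s\Gamma)\,dt\big)$, $h(0)=1$. Here $R_g$ and $L_e$ are right and left multiplication, their differentials taken at $1$. **The truncations.** For $\alpha\in\mathrm{Rep}_\infty(TM,V)$: $\mathsf{T}_{\le2}(\alpha)=(A,B)$ with $A=\alpha^1$, $B=-\pi\circ\alpha^2$, $\pi:\mathrm{End}^{-1}(V)\to\mathsf{gl}^{-1}(V)$ the projection. For well behaved $\beta\in\mathrm{Rep}_\infty(\pi_\infty(M),V)$: $\mathsf{T}_{\le2}(\beta)$ assigns $\beta^1(\gamma^{-1})$ to a path $\gamma$, and to a $2$-path $\Gamma$ the class in $\mathsf{GL}^{-1}(V)$ of $(\beta^2(\Gamma_b)-\beta^2(\Gamma_a))\beta^1(\Gamma_1^{-1})$, where $\Gamma_a=\Gamma\circ a$, $\Gamma_b=\Gamma\circ b$, with $a,b:\Delta_2=\{1\ge t\ge s\ge0\}\to I^2$, $a(t,s)=(s,t)$, $b(t,s)=(t,s)$. *)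

(* Defs.v *)
From HB Require Import structures.
From mathcomp Require Import all_boot all_order all_algebra all_fingroup.
From mathcomp Require Import generic_quotient ring_quotient.
From mathcomp Require Import all_classical all_reals all_analysis.
From mathcomp Require Import ring.

Set Implicit Arguments.
Unset Strict Implicit.
Unset Printing Implicit Defensive.

Import Order.TTheory GRing.Theory Num.Theory.
Import numFieldNormedType.Exports.

Local Open Scope classical_set_scope.
Local Open Scope ring_scope.
Local Open Scope quotient_scope.

Section QuotientSpace.
Variables (K : fieldType) (U : vectType K) (W : {vspace U}).

Definition quotv : Type := Quotient.quot (W : {pred U}).

HB.instance Definition _ := GRing.Zmodule.on quotv.

Definition projq (u : U) : quotv := \pi_(Quotient.quot (W : {pred U})) u.
Definition reprq (x : quotv) : U := repr (x : Quotient.quot (W : {pred U})).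

Lemma reprqK : cancel reprq projq.
Proof. by move=> x; rewrite /projq /reprq reprK. Qed.

Lemma projq_eq (u v : U) : (projq u == projq v) = (u - v \in W).
Proof. by rewrite /projq Quotient.idealrBE. Qed.

Lemma projqD (u v : U) : projq (u + v) = projq u + projq v.
Proof. by rewrite /projq !piE. Qed.

Lemma reprq_proj (u : U) : reprq (projq u) - u \in W.
Proof. by rewrite -projq_eq reprqK. Qed.

Definition scaleq (a : K) (x : quotv) : quotv := projq (a *: reprq x).

Lemma projqZ (a : K) (u : U) : projq (a *: u) = scaleq a (projq u).
Proof.
apply/eqP; rewrite projq_eq -scalerBr memvZ //.
by rewrite -opprB rpredN reprq_proj.
Qed.

Lemma scaleqA a b x : scaleq a (scaleq b x) = scaleq (a * b) x.
Proof. by rewrite [scaleq b x]/scaleq -projqZ scalerA. Qed.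
Lemma scale1q : left_id 1 scaleq.
Proof. by move=> x; rewrite /scaleq scale1r reprqK. Qed.
Lemma scaleqDr : right_distributive scaleq +%R.
Proof.
move=> a x y; rewrite -[x]reprqK -[y]reprqK -projqD -!projqZ.
by rewrite scalerDr projqD.
Qed.
Lemma scaleqDl x : {morph scaleq^~ x : a b / a + b}.
Proof. by move=> a b; rewrite /scaleq scalerDl projqD. Qed.

HB.instance Definition _ :=
  GRing.Zmodule_isLmodule.Build K quotv scaleqA scale1q scaleqDr scaleqDl.

Lemma projq_is_linear : linear projq.
Proof. by move=> a u v; rewrite projqD projqZ. Qed.
HB.instance Definition _ := GRing.isLinear.Build K U quotv _ projq projq_is_linear.

Lemma quotv_vect_iso : Vector.axiom (\dim (W^C)%VS) quotv.
Proof.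
pose c := (W^C)%VS; pose p := daddv_pi c W.
have cW : (c :&: W = 0)%VS by rewrite capvC capv_compl.
have pW w : w \in W -> p w = 0.
  move=> wW; have /(_ w) := daddv_pi_add cW.
  rewrite addvC addv_complf memvf => /(_ isT).
  have WC : (W :&: c = 0)%VS by rewrite capv_compl.
  by rewrite (daddv_pi_id WC wW) => /(canRL (addrK _)); rewrite subrr.
have pE u v : projq u = projq v -> p u = p v.
  by move/eqP; rewrite projq_eq => /pW /eqP; rewrite linearB subr_eq0 => /eqP.
have pK u : projq (p u) = projq u.
  apply/eqP; rewrite projq_eq.
  have /(_ u) := daddv_pi_add cW.
  rewrite addvC addv_complf memvf => /(_ isT) <-.
  rewrite -/p; set w := daddv_pi W c u.
  have -> : p (p u + w) = p u.
    rewrite linearD /= (pW w) ?memv_pi// addr0.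
    by rewrite /p daddv_pi_proj.
  by rewrite opprD addNKr rpredN memv_pi.
exists (fun x => \row_i coord (vbasis c) i (p (reprq x))).
  move=> a x y; apply/rowP => i; rewrite !mxE -linearP; congr (coord _ _ _).
  rewrite -linearP; apply: pE; rewrite linearP /=.
  by rewrite !reprqK.
exists (fun rw : 'rV_(\dim c) => projq (\sum_i rw 0 i *: (vbasis c)`_i)).
  move=> x /=; rewrite -[RHS]reprqK -[RHS]pK; congr projq.
  rewrite [RHS](coord_vbasis (memv_pi c W (reprq x))); apply: eq_bigr => i _.
  by rewrite mxE.
move=> rw; apply/rowP=> i; rewrite mxE.
set s := \sum_i _.
have -> : p (reprq (projq s)) = s.
  rewrite (pE _ s) ?reprqK// /p daddv_pi_id//.
  by apply: rpred_sum => j _; rewrite rpredZ ?vbasis_mem ?memt_nth.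
by rewrite coord_sum_free ?(basis_free (vbasisP c)).
Qed.

HB.instance Definition _ := Lmodule_hasFinDim.Build K quotv quotv_vect_iso.

End QuotientSpace.

Section SubspaceOf.
Variables (K : fieldType) (U : vectType K) (P : U -> Prop).

(* The subspace of the vectors satisfying P; see subspace_ofP. *)
Definition subspace_of : {vspace U} :=
  xget 0%VS [set W : {vspace U} | forall u, u \in W <-> P u].

Lemma subspace_ofP : P 0 -> (forall a u v, P u -> P v -> P (a *: u + v)) ->
  forall u, u \in subspace_of <-> P u.
Proof.
move=> P0 Plin; pose sub (W : {vspace U}) := forall u, u \in W -> P u.
pose good d := `[< exists2 W : {vspace U}, sub W & \dim W = d >].
have ex : exists d, good d.
  exists 0%N; apply/asboolP; exists 0%VS; last by rewrite dimv0.
  by move=> u; rewrite memv0 => /eqP ->.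
have bnd d : good d -> (d <= \dim {:U})%N.
  by move=> /asboolP [W _ <-]; rewrite dimvS ?subvf.
have [_ /asboolP[W subW <-] maxW] := ex_maxnP ex bnd.
suff WP : [set W : {vspace U} | forall u, u \in W <-> P u] W by exact: (xgetI _ WP).
move=> u; split=> [/subW//|Pu].
have subWu : sub (W + <[u]>)%VS.
  move=> _ /memv_addP[w wW [_ /vlineP[a ->] ->]].
  by rewrite addrC; apply: Plin => //; exact: subW.
have /maxW dimle : good (\dim (W + <[u]>)) by apply/asboolP; exists (W + <[u]>)%VS.
have /eqP -> : (W == W + <[u]>)%VS by rewrite eqEdim addvSl.
by rewrite (subvP (addvSr W <[u]>)) ?memv_line.
Qed.

End SubspaceOf.

Lemma coord_inj (K : fieldType) (U : vectType K) (u v : U) :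
  (forall j, coord (vbasis {:U}) j u = coord (vbasis {:U}) j v) -> u = v.
Proof.
move=> e; rewrite (coord_vbasis (memvf u)) (coord_vbasis (memvf v)).
by apply: eq_bigr => j _; rewrite e.
Qed.

Record cochain_complex (R : realType) := Complex {
  cspace :> vectType R;
  grade : int -> {vspace cspace};
  cdiff : 'End(cspace);
  grade_direct : exists s : seq int, [/\ uniq s,
    forall k, k \notin s -> grade k = 0%VS,
    directv (\sum_(k <- s) grade k) &
    (\sum_(k <- s) grade k)%VS = fullv];
  diff_grade : forall k, (cdiff @: grade k <= grade (k + 1))%VS;
  diff_diff : (cdiff \o cdiff)%VF = 0 }.

Section ComplexEnd.
Variables (R : realType) (V : cochain_complex R).
Local Notation d := (cdiff V).
Implicit Types f g s t : 'End(V).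

Definition homogeneous (k : int) f :=
  forall i, (f @: grade V i <= grade V (i + k))%VS.

Definition gcomm (k : int) f : 'End(V) := (d \o f)%VF - (-1) ^ k *: (f \o d)%VF.

Definition exact1 : {vspace 'End(V)} :=
  subspace_of (fun s => exists2 r, homogeneous (-2) r & s = gcomm (-2) r).

Lemma homogeneous_lin k a f g :
  homogeneous k f -> homogeneous k g -> homogeneous k (a *: f + g).
Proof.
move=> hf hg i; apply/subvP => _ /memv_imgP[v vi ->].
rewrite add_lfunE scale_lfunE memvD ?memvZ//.
  by apply: (subvP (hf i)); rewrite memv_img.
by apply: (subvP (hg i)); rewrite memv_img.
Qed.

Lemma homogeneous0 k : homogeneous k 0.
Proof. by move=> i; apply/subvP => _ /memv_imgP[v vi ->]; rewrite zero_lfunE mem0v. Qed.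

Lemma comm_lin k a f g : gcomm k (a *: f + g) = a *: gcomm k f + gcomm k g.
Proof.
rewrite /gcomm comp_lfunDr comp_lfunDl -comp_lfunZr -comp_lfunZl.
by rewrite !scalerDr scalerN !scalerA mulrC opprD addrACA.
Qed.

Lemma exact1P s :
  s \in exact1 <-> exists2 r, homogeneous (-2) r & s = gcomm (-2) r.
Proof.
apply: subspace_ofP s => [|a _ _ [r hr ->] [q hq ->]].
  by exists 0; [exact: homogeneous0|rewrite /gcomm comp_lfun0r comp_lfun0l scaler0 subr0].
by exists (a *: r + q); [exact: homogeneous_lin|rewrite comm_lin].
Qed.

(* The space End(V) / [d, End^-2(V)], of which gl^-1(V) is the subspace of
   classes of endomorphisms of degree -1.  Every representative of such a
   class has degree -1, because [d, End^-2(V)] lies in End^-1(V). *)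
Definition qEnd := quotv exact1.
Definition pi1 : 'End(V) -> qEnd := @projq R _ exact1.
Definition rep1 : qEnd -> 'End(V) := @reprq R _ exact1.

Definition gl0 f := homogeneous 0 f /\ (d \o f = f \o d)%VF.
Definition gl1 (x : qEnd) := exists2 s, homogeneous (-1) s & x = pi1 s.

Definition glbracket f g : 'End(V) := (f \o g)%VF - (g \o f)%VF.
Definition gldelta (x : qEnd) : 'End(V) := (d \o rep1 x)%VF + (rep1 x \o d)%VF.
Definition glact f (x : qEnd) : qEnd := pi1 ((f \o rep1 x)%VF - (rep1 x \o f)%VF).

Definition invertible f := lker f == 0%VS.
Definition GL0 f := gl0 f /\ invertible f.
Definition End1 s := homogeneous (-1) s /\ invertible (gcomm (-1) s + \1%VF).
Definition GL1 (x : qEnd) := exists2 s, End1 s & x = pi1 s.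
Definition GL1mul (x y : qEnd) : qEnd :=
  pi1 (rep1 x + rep1 y + (rep1 x \o gcomm (-1) (rep1 y))%VF).
Definition GLact f (x : qEnd) : qEnd := pi1 (f \o rep1 x \o f^-1)%VF.

Lemma rep1E s : exists2 r, homogeneous (-2) r & rep1 (pi1 s) = s + gcomm (-2) r.
Proof.
have /exact1P[r hr e] := reprq_proj exact1 s.
by exists r => //; rewrite -e addrC subrK.
Qed.

Lemma pi1_eq s t : (exists2 r, homogeneous (-2) r & s = t + gcomm (-2) r) ->
  pi1 s = pi1 t.
Proof.
move=> [r hr ->]; apply/eqP; rewrite projq_eq addrAC subrr add0r.
by apply/exact1P; exists r.
Qed.

Lemma comm2E r : gcomm (-2) r = (d \o r)%VF - (r \o d)%VF.
Proof. by rewrite /gcomm (_ : (-1 : R) ^ (-2) = 1) ?scale1r// -exprnN sqrrN expr1n invr1. Qed.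

Lemma comm1E r : gcomm (-1) r = (d \o r)%VF + (r \o d)%VF.
Proof. by rewrite /gcomm (_ : (-1 : R) ^ (-1) = -1) ?scaleN1r ?opprK// exprN1 invrN invr1. Qed.

Lemma homogeneous_comp k l f g : homogeneous k f -> homogeneous l g ->
  homogeneous (k + l) (f \o g)%VF.
Proof.
move=> hf hg i; rewrite limg_comp (subv_trans (limgS f (hg i)))//.
by rewrite (subv_trans (hf _))// -addrA [l + k]addrC.
Qed.

Lemma homogeneous_diff : homogeneous 1 d.
Proof. exact: diff_grade. Qed.

Lemma diff_diffl f : (d \o (d \o f))%VF = 0.
Proof. by rewrite comp_lfunA diff_diff comp_lfun0l. Qed.

Lemma diff_diffr f : (f \o d \o d)%VF = 0.
Proof. by rewrite -comp_lfunA diff_diff comp_lfun0r. Qed.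

Let compE := (comp_lfunDl, comp_lfunDr, comp_lfunNl, comp_lfunNr).

Lemma comm1_exact r : gcomm (-1) (gcomm (-2) r) = 0.
Proof.
rewrite comm1E comm2E !compE diff_diffl diff_diffr sub0r subr0.
by rewrite comp_lfunA addNr.
Qed.

Lemma comm1D s t : gcomm (-1) (s + t) = gcomm (-1) s + gcomm (-1) t.
Proof. by rewrite -[s in LHS]scale1r comm_lin scale1r. Qed.

Lemma gldelta_pi s : gldelta (pi1 s) = (d \o s)%VF + (s \o d)%VF.
Proof.
have [r hr e] := rep1E s.
by rewrite /gldelta e -comm1E comm1D comm1_exact addr0 comm1E.
Qed.

Lemma glact_pi f s : gl0 f -> glact f (pi1 s) = pi1 ((f \o s)%VF - (s \o f)%VF).
Proof.
move=> [hf cf]; have [r hr e] := rep1E s; apply: pi1_eq.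
exists ((f \o r)%VF - (r \o f)%VF).
  rewrite -scaleN1r addrC; apply: homogeneous_lin.
    by have := homogeneous_comp hr hf; rewrite addr0.
  by have := homogeneous_comp hf hr; rewrite add0r.
rewrite e !comm2E !compE; move: cf; rewrite !comp_lfunA => cf.
rewrite cf -(comp_lfunA r d f) cf comp_lfunA.
by apply: coord_inj => j; rewrite !linearE /=; ring.
Qed.

Lemma homogeneousV f : homogeneous 0 f -> invertible f -> homogeneous 0 (f^-1)%VF.
Proof.
move=> hf finv i; have hi := hf i; rewrite addr0 in hi *.
have /eqP fi : (f @: grade V i)%VS == grade V i.
  by rewrite eqEdim hi /= limg_dim_eq//; move/eqP: finv => ->; rewrite capv0.
by rewrite -[X in (_ @: X <= _)%VS]fi -limg_comp lker0_compVf// lim1g.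
Qed.

Lemma GLact_pi f s : GL0 f -> GLact f (pi1 s) = pi1 (f \o s \o f^-1)%VF.
Proof.
move=> [[hf cf] finv]; have [r hr e] := rep1E s; apply: pi1_eq.
have fK : (f \o f^-1 = \1)%VF by rewrite lker0_compfV.
have Kf : (f^-1 \o f = \1)%VF by rewrite lker0_compVf.
have cV : (d \o f^-1 = f^-1 \o d)%VF.
  by rewrite -[LHS]comp_lfun1l -Kf -comp_lfunA [X in (_ \o X)%VF]comp_lfunA -cf
     -(comp_lfunA d) fK comp_lfun1r.
exists (f \o r \o f^-1)%VF.
  have h := homogeneous_comp hf hr; rewrite add0r in h.
  by have := homogeneous_comp h (homogeneousV hf finv); rewrite addr0.
rewrite e !comm2E !compE !comp_lfunA cf; congr (_ + (_ - _)).
by rewrite -!comp_lfunA cV.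
Qed.

Lemma GL1mul_pi s t : homogeneous (-1) t ->
  GL1mul (pi1 s) (pi1 t) = pi1 (s + t + (s \o gcomm (-1) t)%VF).
Proof.
move=> ht; have [r hr es] := rep1E s; have [q hq et] := rep1E t.
have ct : (d \o gcomm (-1) t = gcomm (-1) t \o d)%VF.
  by rewrite comm1E !compE diff_diffl diff_diffr add0r addr0 comp_lfunA.
have hct : homogeneous 0 (gcomm (-1) t).
  rewrite comm1E -[(d \o t)%VF]scale1r; apply: homogeneous_lin.
    exact: (homogeneous_comp homogeneous_diff ht).
  exact: (homogeneous_comp ht homogeneous_diff).
apply: pi1_eq; exists (r + q + (r \o gcomm (-1) t)%VF).
  rewrite -[r + q]scale1r; apply: homogeneous_lin.
    by rewrite -[r]scale1r; apply: homogeneous_lin.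
  by have := homogeneous_comp hr hct; rewrite addr0.
rewrite es et comm1D comm1_exact addr0.
move: (gcomm (-1) t) ct => c ct.
rewrite !comm2E !compE -(comp_lfunA _ c d) -ct !comp_lfunA.
by apply: coord_inj => j; rewrite !linearE /=; ring.
Qed.

End ComplexEnd.

Section Calculus.
Variables (R : realType) (X : normedModType R) (W : vectType R).

(* Functions with values in a finite-dimensional space W are differentiated and
   integrated coordinatewise, in a fixed basis of W. *)
Definition crd (j : 'I_(\dim {:W})) (w : W) : R^o := coord (vbasis {:W}) j w.

Definition of_crd (c : 'I_(\dim {:W}) -> R) : W :=
  \sum_j c j *: (vbasis {:W})`_j.

(* For an open set U in a finite-dimensional X, f is of class C^k on U. *)
Fixpoint Ck (k : nat) (U : set X) (f : X -> R^o) : Prop :=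
  (forall x, U x -> {for x, continuous f}) /\
  (if k is k'.+1 then
     forall v, (forall x, U x -> derivable f x v) /\ Ck k' U ('D_v f)
   else True).

Definition is_smooth (U : set X) (F : X -> W) :=
  forall k j, Ck k U (fun x => crd j (F x)).

Definition vderive (F : X -> W) (x v : X) : W :=
  of_crd (fun j => 'D_v (fun y => crd j (F y)) x).

Definition is_vderive (F : X -> W) (x v : X) (w : W) :=
  forall j, is_derive x v (fun y => crd j (F y)) (crd j w).

Definition vcontinuous (K : set X) (F : X -> W) :=
  forall j, {within K, continuous (fun x => crd j (F x))}.

Definition vintegral (a b : R) (F : R -> W) : W :=
  of_crd (fun j => \int[lebesgue_measure]_(t in `[a, b]) crd j (F t)).

Definition vlim (u : nat -> W) : W :=
  of_crd (fun j => lim ((fun N => crd j (u N)) @ \oo)).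

End Calculus.

(* Iterated integral over the points b >= t_1 >= ... >= t_k >= 0. *)
Fixpoint simplex_integral (R : realType) (W : vectType R) (k : nat) (b : R)
    (F : seq R -> W) : W :=
  if k is k'.+1 then
    vintegral 0 b (fun t => simplex_integral k' t (fun ts => F (t :: ts)))
  else F [::].

Section Multilinear.
Variables (R : realType) (X : lmodType R).

Definition vform (k : nat) (W : Type) := ('I_k -> X) -> W.

Definition update_vec k (v : 'I_k -> X) (i : 'I_k) (x : X) : 'I_k -> X :=
  fun j => if j == i then x else v j.

Definition alternating k (W : lmodType R) (w : vform k W) :=
  (forall v i a x y, w (update_vec v i (a *: x + y)) =
     a *: w (update_vec v i x) + w (update_vec v i y)) /\
  (forall v i j, i != j -> v i = v j -> w v = 0).

Definition wedge_form (W1 W2 W3 : vectType R) (op : W1 -> W2 -> W3) p q n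
    (e : (p + q)%N = n) (w1 : vform p W1) (w2 : vform q W2) : vform n W3 :=
  fun v => ((p`! * q`!)%N%:R)^-1 *: \sum_(s : 'S_n) (-1) ^+ s *:
    op (w1 (fun a => v (s (cast_ord e (lshift q a)))))
       (w2 (fun b => v (s (cast_ord e (rshift p b))))).

(* The product of a p-form with values in End^deg(V) and a q-form with values
   in End(V). *)
Definition sprod (V : cochain_complex R) (deg : int) p q n (e : (p + q)%N = n)
    (w1 : vform p 'End(V)) (w2 : vform q 'End(V)) : vform n 'End(V) :=
  fun v => (-1) ^ (deg * q%:Z) *:
    wedge_form (fun f g : 'End(V) => (f \o g)%VF) e w1 w2 v.

(* The product w_i o w_(i+1) o ..., where the factor w_j has form degree the
   corresponding entry m of ms, and values in End^(1-m)(V). *)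
Fixpoint sprods (V : cochain_complex R) (w : nat -> forall m, vform m 'End(V))
    (i : nat) (ms : seq nat) : vform (sumn ms) 'End(V) :=
  if ms is m :: ms' then
    sprod (1 - m%:Z) (erefl (m + sumn ms')%N) (w i m) (@sprods V w i.+1 ms')
  else fun _ => \1%VF.

Definition pair2 (x y : X) : 'I_2 -> X := fun i => if i == ord0 then x else y.

End Multilinear.

Arguments sprods {R X V} w i ms _.

Record chart (R : realType) (n : nat) (T : topologicalType) := Chart {
  chart_dom : set T;
  chart_fun :> T -> 'rV[R]_n;
  chart_inv : 'rV[R]_n -> T;
  dom_open : open chart_dom;
  img_open : open (chart_fun @` chart_dom);
  chart_funK : forall p, chart_dom p -> chart_inv (chart_fun p) = p;
  chart_cont : forall p, chart_dom p -> {for p, continuous chart_fun};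
  inv_cont : forall x, (chart_fun @` chart_dom) x -> {for x, continuous chart_inv} }.

Record manifold (R : realType) (n : nat) := Manifold {
  points :> topologicalType;
  points_hausdorff : hausdorff_space points;
  points_second_countable : @second_countable points;
  atlas : Type;
  chart_of : atlas -> chart R n points;
  atlas_cover : forall p, exists c, chart_dom (chart_of c) p;
  atlas_smooth : forall c c',
    is_smooth (chart_of c @` (chart_dom (chart_of c) `&` chart_dom (chart_of c')))
      (chart_of c' \o chart_inv (chart_of c)) }.

Definition chart_img (R : realType) n (M : manifold R n) (c : atlas M) :
  set 'rV[R]_n := chart_of c @` chart_dom (chart_of c).

Definition chart_at (R : realType) n (M : manifold R n) (p : M) : atlas M :=
  projT1 (cid (atlas_cover p)).

Section Forms.
Variables (R : realType) (n : nat) (M : manifold R n).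

(* A form is given by its expressions in the charts; only their values on the
   images of the charts matter. *)
Definition dform (k : nat) (W : Type) :=
  atlas M -> 'rV[R]_n -> vform 'rV[R]_n k W.

Definition is_form k (W : vectType R) (w : dform k W) :=
  [/\ forall c x, chart_img c x -> alternating (w c x),
      forall c v, is_smooth (chart_img c) (fun x => w c x v) &
      forall c c' p v, chart_dom (chart_of c) p -> chart_dom (chart_of c') p ->
        w c (chart_of c p) v =
        w c' (chart_of c' p) (fun a =>
          vderive (chart_of c' \o chart_inv (chart_of c)) (chart_of c p) (v a))].

Definition extd k (W : vectType R) (w : dform k W) : dform k.+1 W :=
  fun c x v => \sum_(i < k.+1) (-1) ^+ i *:
    vderive (fun y => w c y (fun a => v (lift i a))) x (v i).

Definition pullback (X : normedModType R) (f : X -> M) k (W : Type)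
    (w : dform k W) : X -> vform X k W :=
  fun x v => let c := chart_at (f x) in
    w c (chart_of c (f x)) (fun a => vderive (chart_of c \o f) x (v a)).

Definition smooth_on (X : normedModType R) (S : set X) (f : X -> M) :=
  forall x, S x -> exists (c : atlas M) (U : set X) (F : X -> 'rV[R]_n),
    [/\ open U, U x, is_smooth U F &
        forall y, U y -> S y -> chart_dom (chart_of c) (f y) /\ chart_of c (f y) = F y].

(* f is smooth on the subset S if it extends, locally around every point of S,
   to a smooth map defined on an open set; it is piecewise smooth on S if it is
   continuous and smooth on each piece of a finite cover of S by polyhedra. *)
Definition polyhedron (X : normedModType R) (P : set X) :=
  exists m (l : 'I_m -> {linear X -> R^o}) (b : 'I_m -> R),
    P = [set x | forall i, l i x <= b i].

Definition piecewise_smooth (X : normedModType R) (S : set X) (f : X -> M) :=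
  {within S, continuous f} /\
  exists m (P : 'I_m -> set X), [/\ forall i, polyhedron (P i),
    S `<=` \bigcup_i P i & forall i, smooth_on (S `&` P i) f].

Definition unit_itv : set R^o := [set t | 0 <= t <= 1].

(* Maps defined on a subset such as [0, 1] are represented by total functions,
   whose values outside the subset are never used. *)
Definition is_path (g : R^o -> M) := piecewise_smooth unit_itv g.

Definition is_two_path (G : R^o * R^o -> M) :=
  piecewise_smooth (unit_itv `*` unit_itv) G /\
  forall s, unit_itv s -> G (0, s) = G (0, 0) /\ G (1, s) = G (1, 0).

End Forms.

Arguments unit_itv {R}.
Arguments is_path {R n M}.
Arguments is_two_path {R n M}.

Section Diagram.
Variables (R : realType) (n : nat) (M : manifold R n) (V : cochain_complex R).

(* alpha = alpha^1 + alpha^2 + ...; the index 0, where alpha vanishes, is only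
   there to simplify the sums.  The equation is the one in form degree k + 1. *)
Definition flat_superconnection (alpha : forall k, dform M k 'End(V)) :=
  [/\ forall k, is_form (alpha k),
      forall c x v, chart_img c x -> alpha 0%N c x v = 0,
      forall k c x v, chart_img c x -> homogeneous (1 - k%:Z) (alpha k c x v) &
      forall k c x v, chart_img c x ->
        (-1) ^+ k.+1 *: gcomm (1 - k.+1%:Z) (alpha k.+1 c x v)
        + extd (alpha k) c x v
        + \sum_(i < k.+2) sprod (1 - i%:Z) (subnKC (leq_ord i))
            (alpha i c x) (alpha (k.+1 - i)%N c x) v = 0].

Definition flat_2connection (A : dform M 1 'End(V)) (B : dform M 2 (qEnd V)) :=
  [/\ is_form A /\ is_form B,
      forall c x v, chart_img c x -> gl0 (A c x v),
      forall c x v, chart_img c x -> gl1 (B c x v),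
      forall c x v, chart_img c x ->
        gldelta (B c x v) = extd A c x v
          + 2^-1 *: wedge_form (@glbracket R V) (erefl 2) (A c x) (A c x) v &
      forall c x v, chart_img c x ->
        extd B c x v + wedge_form (@glact R V) (erefl 3) (A c x) (B c x) v = 0].

Definition trunc_form (alpha : forall k, dform M k 'End(V)) :
    dform M 1 'End(V) * dform M 2 (qEnd V) :=
  (alpha 1%N, fun c x v => - pi1 (alpha 2%N c x v)).

(* h is continuous on [0, 1] and solves h' = field(t, h), except possibly at
   finitely many times: the right-hand sides below come from piecewise smooth
   maps, and are undefined at their breaks. *)
Definition ode (W : vectType R) (h : R^o -> W) (field : R^o -> W -> W) :=
  vcontinuous unit_itv h /\
  exists S : seq R, forall t : R^o, 0 < t < 1 -> t \notin S ->
    is_vderive h t 1 (field t (h t)).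

Definition is_transport (A : dform M 1 'End(V)) (gamma : R^o -> M)
    (g : R^o -> 'End(V)) :=
  [/\ g 0 = \1%VF, forall t, unit_itv t -> GL0 (g t) &
      ode g (fun t gt => - (pullback gamma A t (fun _ => 1) \o gt)%VF)].

(* The solution is unique on [0, 1]. *)
Definition transport A gamma (t : R) : 'End(V) :=
  xget \1%VF [set f | exists2 g, is_transport A gamma g & g t = f].

(* The differential at the unit 0 of the left multiplication by h in GL^-1(V),
   an open subset of the vector space gl^-1(V). *)
Definition left_differential (h x : qEnd V) : qEnd V :=
  vderive (fun e : R^o => GL1mul h (e *: x)) 0 1.

Definition is_surface_transport (A : dform M 1 'End(V)) (B : dform M 2 (qEnd V))
    (G : R^o * R^o -> M) (h : R^o -> qEnd V) :=
  [/\ h 0 = 0, forall s, unit_itv s -> GL1 (h s) &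
      ode h (fun s hs => left_differential hs (vintegral 0 1 (fun t =>
        GLact (transport A (fun u => G (u, s)) t)^-1%VF
          (pullback G B (t, s) (pair2 (1, 0) (0, 1))))))].

(* The values on paths and on 2-paths of a representation of the fundamental
   2-groupoid in GL(V). *)
Definition holonomy :=
  (((R^o -> M) -> 'End(V)) * ((R^o * R^o -> M) -> qEnd V))%type.

Definition Hol (AB : dform M 1 'End(V) * dform M 2 (qEnd V)) : holonomy :=
  (fun gamma => transport AB.1 gamma 1,
   fun G => xget 0 [set x | exists2 h,
     is_surface_transport AB.1 AB.2 G h & h 1 = x]).

(* Equality of values in GL^0(V) on paths, and in GL^-1(V) on 2-paths. *)
Definition same_holonomy (H H' : holonomy) :=
  (forall gamma, is_path gamma -> GL0 (H.1 gamma) /\ H.1 gamma = H'.1 gamma) /\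
  (forall G, is_two_path G -> GL1 (H.2 G) /\ H.2 G = H'.2 G).

Definition lambda_map (p : R^o * R^o) : R^o * R^o :=
  if p.1 <= 2^-1 then (p.2, 1 - 2 * p.1) else (p.2 * (2 - 2 * p.1), 0).

Definition qmap (p : R^o * R^o) : R^o * R^o := (Num.max p.1 p.2, p.2).

Definition Theta (p : R^o * R^o) : R^o * R^o := qmap (lambda_map p).

(* The form Theta_(k)^*(p_1^* sigma^* alpha^1 o ... o p_(m+1)^* sigma^* alpha^2
   o ... o p_(m+p+1)^* sigma^* alpha^1), k = m + p + 1, on R^(k + 1), with
   coordinates (t_1, ..., t_k, s).  Its i-th factor is the pullback along
   sigma o p_i o Theta_(k), which sends (t_1, ..., t_k, s) to
   sigma (Theta (t_i, s)). *)
Definition int2_form (alpha : forall k, dform M k 'End(V))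
    (sigma : R^o * R^o -> M) (m p : nat) (x : 'rV[R]_(m + p).+2) :
    vform 'rV[R]_(m + p).+2 (sumn (nseq m 1%N ++ 2%N :: nseq p 1%N)) 'End(V) :=
  sprods (fun i k => pullback (fun y : 'rV[R]_(m + p).+2 =>
      sigma (Theta (y 0 (inord i), y 0 ord_max))) (alpha k) x)
    0 (nseq m 1%N ++ 2%N :: nseq p 1%N).

Definition int2_term (alpha : forall k, dform M k 'End(V))
    (sigma : R^o * R^o -> M) (m p : nat) : 'End(V) :=
  simplex_integral (m + p + 1) 1 (fun ts => vintegral 0 1 (fun s =>
    int2_form alpha sigma (\row_(j < (m + p).+2) (rcons ts s)`_j)
      (fun a => delta_mx 0 (inord a)))).

(* The components of degrees 1 and 2 of the representation up to homotopy of the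
   simplicial set of M obtained by integration, and its truncation, which does
   not depend on the other components. *)
Definition int1 (alpha : forall k, dform M k 'End(V)) (gamma : R^o -> M) : 'End(V) :=
  transport (alpha 1%N) (fun t => gamma (1 - t)) 1.

(* An absolutely convergent double series, summed over squares. *)
Definition int2 (alpha : forall k, dform M k 'End(V)) (sigma : R^o * R^o -> M) :
    'End(V) :=
  vlim (fun N => \sum_(m < N) \sum_(p < N)
    (-1) ^+ (m + p + 1) *: int2_term alpha sigma m p).

Definition cochain12 :=
  (((R^o -> M) -> 'End(V)) * ((R^o * R^o -> M) -> 'End(V)))%type.

Definition integration (alpha : forall k, dform M k 'End(V)) : cochain12 :=
  (int1 alpha, int2 alpha).

Definition trunc_rep (beta : cochain12) : holonomy :=
  (fun gamma : R^o -> M => beta.1 (fun t : R^o => gamma (1 - t)),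
   fun G : R^o * R^o -> M =>
     let Ga := fun p : R^o * R^o => G (p.2, p.1) in
     let Gb := fun p : R^o * R^o => G (p.1, p.2) in
     let G1inv := fun t : R^o => G (1 - t, 1) in
     pi1 (comp_lfun (beta.2 Gb - beta.2 Ga) (beta.1 G1inv))).

End Diagram.

(* Main.v *)
(* Let C(y, x) be the integral over [0, x] x {y} of alpha^2, conjugated by the
   transport along the level y from the left side.  By flatness alpha^2 bounds
   minus the curvature of alpha^1, so the nonabelian Stokes formula turns b =
   - [d, C] into the logarithmic derivative of the gauge transformations that
   compare transports: along the vertical line x the gauge v_x solves v' = - b(., x) v,
   and along the diagonal one has v' = - b(y, y) v.  Resumming the series, which is
   the Picard series of the linear equation of the transport along the paths
   Theta(., s), the value on the two simplices of the 2-path becomes, up to the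
   gauge, - int_0^1 (N(s) v_s(s)^-1 + C(s, s)) v(s) ds v(1)^-1, with N(s) the
   integral of the curvature along the vertical line s.  On the other side
   h(x, y) = - int_0^y v_x^-1 C(., x) satisfies v_x^-1 = 1 + [d, h(x, .)], so that
   h(1, .) is the surface transport.  Modulo [d, End^-2(V)], r |-> h(r, r) and the
   previous expression, with r as upper limit, solve the same linear equation,
   hence they have the same value at r = 1. *)

From HB Require Import structures.
From mathcomp Require Import all_boot all_order all_algebra all_fingroup.
From mathcomp Require Import all_classical all_reals all_analysis.
From mathcomp Require Import measurable_realfun ring lra.
Require Import Defs.

Set Implicit Arguments.
Unset Strict Implicit.
Unset Printing Implicit Defensive.

Import Order.TTheory GRing.Theory Num.Theory.
Import numFieldNormedType.Exports.

Local Open Scope classical_set_scope.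
Local Open Scope ring_scope.


(** * Integration of piecewise continuous functions *)

Section PiecewiseContinuous.
Variable R : realType.
Local Notation mu := (@lebesgue_measure R).
Implicit Types (a b M : R) (f g : R -> R).

(** Two obstacles shape the proof. A 2-path is smooth only on polyhedral pieces, so pullbacks are
    uncontrolled along edges and nothing may be differentiated twice. Hence equations are read in
    integrated form ([vprim]), off finitely many times, and generic means off finitely many levels
    and, on each remaining level, off finitely many points. Smooth dependence of transports on
    parameters is never invoked: the Stokes formula is a limit, by dominated convergence, of
    difference quotients between two nearby levels, in which only first derivatives survive. It is
    proved within one chart and propagated along the level from the left side, which is constant.
    Fubini is likewise obtained from one-variable primitives. The second obstacle is that values in
    GL^-1(V) are classes, so the decisive identities hold only modulo [d, End^-2(V)]. A fixed linear
    projection [kap] along that space turns them into linear differential equations in End(V), whose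
    solutions are unique modulo it. *)

Definition pcb M a b f := exists S : seq R, forall t, a < t < b -> t \notin S ->
  `|f t| <= M /\ {for t, continuous f}.

(** Nothing is required at the ends or at the exceptional points, where integrands coming from
    piecewise smooth maps take arbitrary values. The bound is explicit in [pcb] because dominated
    convergence needs one bound for a whole family, while the exceptional set may vary with the
    member. *)
Definition pc a b f := exists M, pcb M a b f.

Lemma near_notin (S : seq R) (t : R) : t \notin S -> \forall u \near t, u \notin S.
Proof.
elim: S => [|x S IH]; first by move=> _; near=> u.
rewrite inE negb_or => /andP[tx /IH tS]; near=> u.
rewrite inE negb_or; apply/andP; split; last by near: u.
by near: u; apply: open_nbhs_nbhs; split; [exact: open_neq|exact: tx].
Unshelve. all: by end_near. Qed.

Lemma near_itvoo a b (t : R) : a < t < b -> \forall u \near t, a < u < b.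
Proof.
move=> /andP[at_ tb]; near=> u; apply/andP; split; near: u.
  exact: lt_nbhsr.
exact: lt_nbhsl.
Unshelve. all: by end_near. Qed.

Lemma pcb_cst (k : R) a b : pcb `|k| a b (fun=> k).
Proof. by exists [::] => t _ _; split => //; exact: cvg_cst. Qed.

Lemma pcb_sub M a b a' b' f : a <= a' -> b' <= b -> pcb M a b f -> pcb M a' b' f.
Proof.
by move=> aa bb [S h]; exists S => t /andP[ta tb]; apply: h; rewrite (le_lt_trans aa) // (lt_le_trans tb).
Qed.

Lemma pc_sub a b a' b' f : a <= a' -> b' <= b -> pc a b f -> pc a' b' f.
Proof. by move=> aa bb [M h]; exists M; apply: pcb_sub h. Qed.

Lemma pcb_add M N a b f g : pcb M a b f -> pcb N a b g -> pcb (M + N) a b (fun t => f t + g t).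
Proof.
move=> [S h] [T k]; exists (S ++ T) => t tab; rewrite mem_cat negb_or => /andP[tS tT].
have [fM cf] := h _ tab tS; have [gN cg] := k _ tab tT; split; last exact: continuousD.
by rewrite (le_trans (ler_normD _ _))// lerD.
Qed.

Lemma pcb_mul M N a b f g : pcb M a b f -> pcb N a b g -> pcb (M * N) a b (fun t => f t * g t).
Proof.
move=> [S h] [T k]; exists (S ++ T) => t tab; rewrite mem_cat negb_or => /andP[tS tT].
have [fM cf] := h _ tab tS; have [gN cg] := k _ tab tT; split; last exact: continuousM.
by rewrite normrM ler_pM.
Qed.

Lemma pcb_norm M a b f : pcb M a b f -> pcb M a b (fun t => `|f t|).
Proof.
move=> [S h]; exists S => t tab /(h _ tab)[fM cf]; split; first by rewrite normr_id.
by apply: continuous_comp => //; exact: norm_continuous.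
Qed.

Lemma pc_cst k a b : pc a b (fun=> k). Proof. by exists `|k|; exact: pcb_cst. Qed.
Lemma pc_add a b f g : pc a b f -> pc a b g -> pc a b (fun t => f t + g t).
Proof. by move=> [M ?] [N ?]; exists (M + N); exact: pcb_add. Qed.
Lemma pc_mul a b f g : pc a b f -> pc a b g -> pc a b (fun t => f t * g t).
Proof. by move=> [M ?] [N ?]; exists (M * N); exact: pcb_mul. Qed.
Lemma pc_norm a b f : pc a b f -> pc a b (fun t => `|f t|).
Proof. by move=> [M ?]; exists M; exact: pcb_norm. Qed.
Lemma pc_opp a b f : pc a b f -> pc a b (fun t => - f t).
Proof.
move=> pf; have := pc_mul (pc_cst (-1) a b) pf.
by under [X in pc _ _ X]funext do rewrite mulN1r.
Qed.
Lemma pc_sub_fun a b f g : pc a b f -> pc a b g -> pc a b (fun t => f t - g t).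
Proof. by move=> pf pg; apply: pc_add => //; exact: pc_opp. Qed.

Lemma pc_sum (I : Type) (r : seq I) a b (F : I -> R -> R) :
  (forall i, pc a b (F i)) -> pc a b (fun t => \sum_(i <- r) F i t).
Proof.
move=> pF; elim: r => [|i r IH].
  by under [X in pc _ _ X]funext do rewrite big_nil; exact: pc_cst.
by under [X in pc _ _ X]funext do rewrite big_cons; exact: pc_add.
Qed.

Lemma pcb_eq M a b f g (S : seq R) : (forall t, a < t < b -> t \notin S -> f t = g t) ->
  pcb M a b f -> pcb M a b g.
Proof.
move=> fg [T h]; exists (S ++ T) => t tab; rewrite mem_cat negb_or => /andP[tS tT].
have [fM cf] := h _ tab tT; split; first by rewrite -fg.
rewrite /prop_for /continuous_at -(fg t)//; apply: cvg_trans cf; apply: near_eq_cvg; near=> u.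
apply: fg; first by near: u; exact: near_itvoo.
by near: u; exact: near_notin.
Unshelve. all: by end_near. Qed.

Lemma pc_eq a b f g (S : seq R) : (forall t, a < t < b -> t \notin S -> f t = g t) ->
  pc a b f -> pc a b g.
Proof. by move=> fg [M h]; exists M; exact: (pcb_eq fg h). Qed.

Lemma seq_bound (S : seq R) f : exists M, forall t, t \in S -> f t <= M.
Proof.
elim: S => [|x S [M h]]; first by exists 0.
exists (Num.max M (f x)) => t; rewrite inE le_max => /predU1P[->|/h ->//].
by rewrite lexx orbT.
Qed.

Lemma pc_bounded a b f : pc a b f -> exists M, forall t, a <= t <= b -> `|f t| <= M.
Proof.
move=> [M [S h]]; have [N hN] := seq_bound [:: a, b & S] (fun t => `|f t|).
exists (Num.max M N) => t tab; rewrite le_max.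
have [/hN->|] := boolP (t \in [:: a, b & S]); first by rewrite orbT.
rewrite !inE !negb_or => /and3P[ta tb tS].
have /h[]// : a < t < b; last by move=> ->.
by case/andP: tab => a1 b1; rewrite !lt_neqAle a1 b1 eq_sym ta tb.
Qed.

Lemma measurable_seq_subset (S : seq R) (A : set R) : measurable (A `&` [set` S]).
Proof.
elim: S => [|x S IH].
  rewrite (_ : _ `&` _ = set0); first exact: measurable0.
  by apply/seteqP; split=> t // -[].
rewrite (_ : _ `&` _ = (A `&` [set x]) `|` (A `&` [set` S])).
  apply: measurableU => //.
  have [Ax|nAx] := pselect (A x).
    by rewrite (_ : _ `&` _ = [set x])//; apply/seteqP; split=> [t []//|t ->].
  rewrite (_ : _ `&` _ = set0); first exact: measurable0.
  by apply/seteqP; split=> t // -[/[swap] ->].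
apply/seteqP; split=> t; last by case=> -[At tS]; split=> //=; rewrite inE tS ?eqxx ?orbT.
by case=> At; rewrite /= inE => /orP[/eqP tx|tS]; [left|right].
Qed.

(** Up to a finite set, all of whose subsets are measurable, the interval is the open set [O], on
    which the function is continuous. *)
Lemma measurable_pc a b f : pc a b f -> measurable_fun `[a, b] f.
Proof.
move=> [M [S h]].
pose T := [:: a, b & S]; pose O := [set t | a < t < b /\ t \notin T].
have mT : measurable [set` T] by rewrite -[X in measurable X]setTI; exact: measurable_seq_subset.
have oO : open O.
  rewrite openE => t [/near_itvoo tab /near_notin tT]; rewrite /interior.
  by near=> u; split; near: u.
have mO : measurable O by exact: open_measurable.
apply: (@measurable_funS _ _ _ _ (O `|` [set` T])).
- exact: measurableU.
- move=> t /= /[!in_itv]/= /andP[at_ tb].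
  have [|tT] := boolP (t \in T); first by right.
  left; split => //=; rewrite !lt_neqAle at_ tb !andbT.
  by apply/andP; split; apply: contraNneq tT => e; rewrite /T !inE e eqxx ?orbT.
- apply/measurable_funU => //; split.
    apply: open_continuous_measurable_fun => // t /set_mem[tab].
    by rewrite !inE !negb_or => /and3P[_ _ /(h _ tab)[]].
  by move=> _ Y mY; rewrite setIC; exact: measurable_seq_subset.
Unshelve. all: by end_near. Qed.

Lemma integrable_pc a b f : a <= b -> pc a b f -> mu.-integrable `[a, b] (EFin \o f).
Proof.
move=> ab pf; apply: measurable_bounded_integrable => //.
- by rewrite /= lebesgue_measure_itv/=; case: ifPn => _ //; rewrite -EFinB ltry.
- exact: measurable_pc.
- have [M hM] := pc_bounded pf; exists M; split; first exact: num_real.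
  by move=> x Mx t /=; rewrite in_itv/= => /hM /le_trans; apply; exact: ltW.
Qed.

End PiecewiseContinuous.

Section PiecewiseIntegral.
Variable R : realType.
Local Notation mu := (@lebesgue_measure R).
Implicit Types (a b c M : R) (f g : R -> R).

Definition ig a b f : R := \int[mu]_(t in `[a, b]) f t.

Lemma eq_ig a b f g : (forall t, a <= t <= b -> f t = g t) -> ig a b f = ig a b g.
Proof. by move=> fg; apply: eq_Rintegral => t; rewrite inE/= in_itv/= => /fg. Qed.

Lemma measurable_seq (S : seq R) : measurable [set` S].
Proof. by rewrite -[X in measurable X]setTI; exact: measurable_seq_subset. Qed.

Lemma null_seq (S : nat -> seq R) : mu (\bigcup_n [set` S n]) = 0%E.
Proof.
apply: countable_lebesgue_measure0; apply: bigcup_countable => // n _.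
exact/finite_set_countable/finite_seq.
Qed.

(** Countably many finite exceptional sets, one for each term of a sequence of functions, are still
    negligible. *)
Lemma ae_off_seq (P : R -> Prop) (S : nat -> seq R) :
  (forall t, (forall n, t \notin S n) -> P t) -> {ae mu, forall t, P t}.
Proof.
move=> SP; exists (\bigcup_n [set` S n]); split.
- by apply: bigcup_measurable => n _; exact: measurable_seq.
- exact: null_seq.
- move=> t /= nP; apply: contrapT => nS; apply: nP; apply: SP => n.
  by apply/negP => tS; apply: nS; exists n.
Qed.

Lemma eq_ig_off a b f g (S : seq R) : a <= b -> pc a b f ->
  (forall t, a < t < b -> t \notin S -> f t = g t) -> ig a b f = ig a b g.
Proof.
move=> ab pf fg; have pg := pc_eq fg pf; rewrite /ig /Rintegral; congr fine.
apply: ae_eq_integral => //.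
- exact: (measurable_int mu (integrable_pc ab pf)).
- exact: (measurable_int mu (integrable_pc ab pg)).
- apply: (ae_off_seq (S := fun=> [:: a, b & S])) => t /(_ 0%N).
  rewrite !inE !negb_or => /and3P[ta tb tS] /=; rewrite in_itv/= => /andP[a1 b1].
  by rewrite fg// !lt_neqAle a1 b1 eq_sym ta tb.
Qed.

Lemma ig_add a b f g : a <= b -> pc a b f -> pc a b g ->
  ig a b (fun t => f t + g t) = ig a b f + ig a b g.
Proof. by move=> ab pf pg; apply: RintegralD => //; exact: integrable_pc. Qed.

Lemma ig_scale k a b f : a <= b -> pc a b f -> ig a b (fun t => k * f t) = k * ig a b f.
Proof. by move=> ab pf; apply: RintegralZl => //; exact: integrable_pc. Qed.

Lemma ig_cst k a b : a <= b -> ig a b (fun=> k) = k * (b - a).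
Proof.
move=> ab; rewrite /ig Rintegral_cst//= lebesgue_measure_itv/=.
rewrite lte_fin; case: ltP => [_|ba]; first by rewrite -EFinB.
by rewrite (_ : a = b) ?subrr //; apply/eqP; rewrite eq_le ab ba.
Qed.

Lemma ig_point a f : ig a a f = 0.
Proof. by rewrite /ig set_itv1 Rintegral_set1. Qed.

Lemma ig_le a b f g (S : seq R) : a <= b -> pc a b f -> pc a b g ->
  (forall t, a < t < b -> t \notin S -> f t <= g t) -> ig a b f <= ig a b g.
Proof.
(* The maximum dominates [f] everywhere and changes [g] only at the exceptional points or at the
   ends, which the integral does not see. *)
move=> ab pf pg fg; pose h t := Num.max (g t) (f t).
have hg t : a < t < b -> t \notin S -> g t = h t.
  by move=> tab tS; rewrite /h max_l// fg.
have ph := pc_eq hg pg.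
rewrite [leRHS](eq_ig_off ab pg hg); apply: le_Rintegral => //; try exact: integrable_pc.
by move=> t _; rewrite /h le_max lexx orbT.
Qed.

Lemma ig_sum (I : Type) (r : seq I) a b (F : I -> R -> R) : a <= b ->
  (forall i, pc a b (F i)) ->
  ig a b (fun t => \sum_(i <- r) F i t) = \sum_(i <- r) ig a b (F i).
Proof.
move=> ab pF; elim: r => [|i r IH].
  rewrite big_nil (_ : (fun t => _) = fun=> 0) ?ig_cst ?mul0r//.
  by apply/funext => t; rewrite big_nil.
rewrite big_cons -IH -ig_add//; last exact: pc_sum.
by congr (ig a b _); apply/funext => t; rewrite big_cons.
Qed.

Lemma ig_norm a b f : a <= b -> pc a b f -> `|ig a b f| <= ig a b (fun t => `|f t|).
Proof. by move=> ab pf; apply: le_normr_Rintegral => //; exact: integrable_pc. Qed.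

Lemma ig_chasles a c b f : a <= c <= b -> pc a b f -> ig a b f = ig a c f + ig c b f.
Proof.
move=> /andP[ac cb] pf; have ab := le_trans ac cb.
rewrite /ig -(@Rintegral_itv_obnd_cbnd _ c); last first.
  by apply: integrableS (integrable_pc ab pf) => //; apply: subset_itvr; rewrite bnd_simp.
by rewrite -(@Rintegral_itvB _ _ (BLeft a)) ?bnd_simp ?subrKC//; exact: integrable_pc.
Qed.

Lemma ig_cont a b f : a <= b -> pc a b f -> {within `[a, b], continuous (fun x => ig a x f)}.
Proof. by move=> ab pf; apply: parameterized_integral_continuous => //; exact: integrable_pc. Qed.

Lemma ig_derive a b f t : a < t < b -> pc a b f -> {for t, continuous f} ->
  is_derive t 1 (fun x => ig a x f : R^o) (f t).
Proof.
move=> /andP[at_ tb] pf cf.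
have ab := ltW (lt_trans at_ tb).
have [df dE] := continuous_FTC1_closed tb (integrable_pc ab pf) at_ cf.
exact: (DeriveDef df (etrans (esym (derive1E _ _)) dE)).
Qed.

(** Induction on the exceptional points: one inside the interval splits it in two, and continuity at
    the common end glues the constants. Without exceptional points this is the mean value
    theorem. *)
Lemma const_off_seq (F : R -> R^o) (S : seq R) a b : a <= b ->
  {within `[a, b], continuous F} ->
  (forall t : R, a < t < b -> t \notin S -> is_derive (t : R^o) 1 F 0) -> F a = F b.
Proof.
elim: S a b => [|x S IH] a b ab cF dF.
  have [t| |c _] := @MVT_segment R F (fun=> 0) a b ab; first by rewrite in_itv/= => /dF; exact.
    exact: cF.
  by rewrite mul0r => /eqP; rewrite subr_eq0 => /eqP.
have [/andP[ax xb]|nx] := boolP (a < x < b); last first.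
  apply: IH => // t tab tS; apply: dF => //; rewrite inE negb_or tS andbT.
  by apply: contraNneq nx => <-.
transitivity (F x); apply: IH; try exact: ltW.
- apply: continuous_subspaceW cF => t /=; rewrite !in_itv/= => /andP[-> /le_trans -> //].
  exact: ltW.
- move=> t /andP[at_ tx] tS; apply: dF; first by rewrite at_ (lt_trans tx).
  by rewrite inE negb_or tS andbT lt_eqF.
- apply: continuous_subspaceW cF => t /=; rewrite !in_itv/= => /andP[xt ->].
  by rewrite andbT (le_trans _ xt)// ltW.
- move=> t /andP[xt tb] tS; apply: dF; first by rewrite tb andbT (lt_trans ax).
  by rewrite inE negb_or tS andbT gt_eqF.
Qed.

(** The integrated form of F' = f, silent about exceptional times; [sprimP] recovers the
    differential form. One form serves for the Leibniz rule, the other for estimates. *)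
Definition sprim a b F f := pc a b f /\ forall t, a <= t <= b -> F t = F a + ig a t f.

Lemma sprimP a b F f : a <= b -> sprim a b F f <->
  [/\ pc a b f, {within `[a, b], continuous (F : R -> R)} &
   exists S : seq R, forall t : R, a < t < b -> t \notin S -> is_derive (t : R^o) 1 (F : R^o -> R^o) (f t)].
Proof.
move=> ab; split=> [[pf FE]|[pf cF [S dF]]]; last first.
  split => // t /andP[at_ tb].
  have [M [T h]] := pf.
  suff : F a - ig a a f = F t - ig a t f by rewrite ig_point subr0 => ->; rewrite subrK.
  apply: (@const_off_seq (fun t => F t - ig a t f) (S ++ T)) => //.
    have c1 : {within `[a, t], continuous (F : R -> R^o)}.
      apply: (continuous_subspaceW _ cF) => u /=; rewrite !in_itv/= => /andP[-> ut].
      exact: (le_trans ut tb).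
    have c2 : {within `[a, t], continuous (fun t => ig a t f : R^o)}.
      by apply: ig_cont => //; apply: pc_sub pf.
    by move=> x; exact: (@continuousB _ _ (subspace `[a, t]) F (fun t => ig a t f) x (c1 x) (c2 x)).
  move=> u /andP[au ut]; rewrite mem_cat negb_or => /andP[uS uT].
  have uab : a < u < b by rewrite au (lt_le_trans ut).
  rewrite -(subrr (f u)); apply: is_deriveB; first exact: dF.
  by apply: (ig_derive uab pf); have [] := h _ uab uT.
split => //.
  apply: (@subspace_eq_continuous _ _ _ (fun t => F a + ig a t f)).
    by move=> t /set_mem /=; rewrite in_itv/= => /FE.
  have c2 : {within `[a, b], continuous (fun t => ig a t f : R^o)} by exact: ig_cont.
  by move=> x; apply: (@continuousD _ R^o (subspace `[a, b]) (cst (F a)) (fun t => ig a t f) x _ (c2 x)); exact: cst_continuous.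
have [M [T h]] := pf; exists T => t tab tT.
apply: (@near_eq_is_derive _ R^o R^o (fun u => F a + ig a u f)).
  near=> u; rewrite (FE u)//.
  have /andP[au ub]: a < u < b by near: u; exact: near_itvoo.
  by rewrite !ltW.
rewrite -[f t]add0r; apply: is_deriveD.
by apply: (ig_derive tab pf); have [] := h _ tab tT.
Unshelve. all: by end_near. Qed.

End PiecewiseIntegral.

(** * Dominated convergence along a parameter *)

Section DominatedConvergence.
Variable R : realType.
Local Notation mu := (@lebesgue_measure R).
Implicit Types (a b c M : R) (f g : R -> R).

Lemma dominated_seq a b (u : nat -> R -> R) f M : a <= b ->
  (forall n, pcb M a b (u n)) -> pc a b f ->
  (exists S : seq R, forall t, a < t < b -> t \notin S -> u n t @[n --> \oo] --> f t) ->
  ig a b (fun t => `|u n t - f t|) @[n --> \oo] --> (0 : R^o).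
Proof.
move=> ab pu pf [S hS].
have pun n : pc a b (u n) by exists M.
have [T hT] := choice pu.
have mi := integrable_pc ab.
have [//| | | | | |_ + _] := @dominated_convergence _ _ R mu `[a, b] _
  (fun n t => (u n t)%:E) (EFin \o f) (cst M%:E).
- by move=> n; exact: (measurable_int mu (mi _ (pun n))).
- exact: (measurable_int mu (mi _ pf)).
- apply: (ae_off_seq (S := fun=> [:: a, b & S])) => t /(_ 0%N).
  rewrite !inE !negb_or => /and3P[ta tb tS] /=; rewrite in_itv/= => /andP[a1 b1].
  by apply: cvg_EFin; [exact: nearW|apply: hS => //; rewrite !lt_neqAle a1 b1 eq_sym ta tb].
- exact: (mi _ (pc_cst M a b)).
- apply: (ae_off_seq (S := fun n => [:: a, b & T n])) => t tT n /=; rewrite in_itv/= => /andP[a1 b1].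
  have := tT n; rewrite !inE !negb_or => /and3P[ta tb tS].
  by rewrite lee_fin; have [] // := hT n t; rewrite !lt_neqAle a1 b1 eq_sym ta tb.
move=> /fine_cvg; apply: cvg_trans; apply: near_eq_cvg; near=> n.
rewrite /= (_ : (fun t => _) = fun t => (`|u n t - f t|)%:E)//.
Unshelve. all: by end_near. Qed.

(** Reduction to sequences: if the limit failed, parameters violating it could be chosen in the
    balls of radius 1/(n+1), and they would contradict the sequential statement. *)
Lemma pc_dominated_cvg (T : pseudoMetricType R) (D : set T) (e0 : T) a b
    (F : T -> R -> R) f M : a <= b ->
  (\forall e \near within D (nbhs e0), pcb M a b (F e)) -> pc a b f ->
  (exists S : seq R, forall t, a < t < b -> t \notin S ->
    F e t @[e --> within D (nbhs e0)] --> (f t : R^o)) ->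
  ig a b (fun t => `|F e t - f t|) @[e --> within D (nbhs e0)] --> (0 : R^o).
Proof.
move=> ab pF pf [S hS]; apply/cvgrPdist_lt => eta eta0; apply: contrapT => nh.
have ex n : exists e, [/\ D e, ball e0 n.+1%:R^-1 e, pcb M a b (F e) &
    eta <= `|0 - ig a b (fun t => `|F e t - f t|)|].
  apply: contrapT => nex; apply: nh; rewrite near_withinE; move: pF; rewrite near_withinE => pF.
  near=> e => De; rewrite ltNge; apply/negP => le; apply: nex; exists e; split=> //.
    near: e; apply/nbhs_ballP; exists n.+1%:R^-1; rewrite //=; exact: ball_center.
  by move: De; near: e.
have [u hu] := choice ex.
have /cvgrPdist_lt /(_ _ eta0) : ig a b (fun t => `|F (u n) t - f t|) @[n --> \oo] --> (0 : R^o).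
  apply: (@dominated_seq _ _ _ _ M) => //; first by move=> n; have [] := hu n.
  exists S => t tab tS; apply: cvg_trans (hS t tab tS).
  move=> A; rewrite /nbhs/= => /nbhs_ballP[/= d d0 hd].
  near=> n; apply: hd.
    have [_ + _ _] := hu n; apply: le_ball; apply: ltW; near: n; exact: (near_infty_natSinv_lt (PosNum d0)).
  by have [] := hu n.
move=> [N _ /(_ _ (leqnn N))]; have [_ _ _] := hu N.
by rewrite leNgt => /negP + ?; apply.
Unshelve. all: by end_near. Qed.

End DominatedConvergence.

(** * Calculus in finite-dimensional spaces *)

Section Vectors.
Variable R : realType.
Implicit Types (W : vectType R).

(** Composition in either order and evaluation of linear maps are all instances, so limits, bounds
    and the Leibniz rule are proved once for an arbitrary bilinear [op]. *)
Definition bil (W1 W2 W3 : vectType R) (op : W1 -> W2 -> W3) :=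
  (forall v, linear (op^~ v)) /\ (forall u, linear (op u)).

Lemma crd_is_linear W j : linear (@crd R W j : W -> R^o).
Proof. by move=> a u v; rewrite /crd linearP. Qed.
HB.instance Definition _ W j := GRing.isLinear.Build R W R^o _ (@crd R W j) (@crd_is_linear W j).

Lemma crdD W j (u v : W) : crd j (u + v) = (crd j u : R) + (crd j v : R).
Proof. exact: linearD. Qed.
Lemma crdB W j (u v : W) : crd j (u - v) = (crd j u : R) - (crd j v : R).
Proof. exact: linearB. Qed.
Lemma crdZ W j a (u : W) : crd j (a *: u) = a * (crd j u : R).
Proof. exact: linearZ. Qed.
Lemma crd0 W j : crd j (0 : W) = 0 :> R.
Proof. exact: linear0. Qed.

Lemma of_crdK W c j : crd j (@of_crd R W c) = c j.
Proof. by rewrite /crd /of_crd coord_sum_free// (basis_free (vbasisP _)). Qed.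

Lemma crd_inj W (u v : W) : (forall j, crd j u = crd j v) -> u = v.
Proof. exact: coord_inj. Qed.

Lemma sum_crd W (u : W) : u = \sum_j crd j u *: (vbasis {:W})`_j.
Proof. exact: (coord_vbasis (memvf u)). Qed.

Lemma bil_sumE (W1 W2 W3 : vectType R) (op : W1 -> W2 -> W3) : bil op -> forall u v,
  op u v = \sum_k \sum_l (crd k u * crd l v) *: op (vbasis {:W1})`_k (vbasis {:W2})`_l.
Proof.
move=> [opl opr] u v.
pose fl v := HB.pack_for {linear W1 -> W3} (op^~ v) (GRing.isLinear.Build R W1 W3 _ (op^~ v) (opl v)).
pose fr u := HB.pack_for {linear W2 -> W3} (op u) (GRing.isLinear.Build R W2 W3 _ (op u) (opr u)).
rewrite {1}(sum_crd u) -[LHS]/(fl v _) linear_sum; apply: eq_bigr => k _.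
rewrite linearZ/= -[op _ v]/(fr _ v) [in LHS](sum_crd v) linear_sum scaler_sumr.
by apply: eq_bigr => l _; rewrite linearZ/= scalerA.
Qed.

Lemma bil_crd (W1 W2 W3 : vectType R) (op : W1 -> W2 -> W3) : bil op -> forall u v j,
  crd j (op u v) = \sum_k \sum_l crd k u * crd l v * crd j (op (vbasis {:W1})`_k (vbasis {:W2})`_l).
Proof.
move=> b u v j; rewrite (bil_sumE b) linear_sum; apply: eq_bigr => k _.
by rewrite linear_sum; apply: eq_bigr => l _; rewrite linearZ.
Qed.

Lemma lin_crd (W1 W2 : vectType R) (L : {linear W1 -> W2}) u j :
  crd j (L u) = \sum_k crd k u * crd j (L (vbasis {:W1})`_k).
Proof.
rewrite {1}(sum_crd u) !linear_sum; apply: eq_bigr => k _.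
by rewrite !linearZ.
Qed.

(** Since derivatives and integrals are taken coordinatewise, the norm given by the coordinates is
    directly compatible with both ([vcvg_vn], [vint_norm]). *)
Definition vn W (w : W) : R := \sum_j `|crd j w|.

Lemma vn_ge0 W (w : W) : 0 <= vn w. Proof. by apply: sumr_ge0 => j _. Qed.
Lemma vn0 W : vn (0 : W) = 0.
Proof. by rewrite /vn big1// => j _; rewrite linear0 normr0. Qed.
Lemma vnD W (u v : W) : vn (u + v) <= vn u + vn v.
Proof. by rewrite -big_split; apply: ler_sum => j _; rewrite linearD ler_normD. Qed.
Lemma vnZ W a (u : W) : vn (a *: u) = `|a| * vn u.
Proof. by rewrite mulr_sumr; apply: eq_bigr => j _; rewrite linearZ normrM. Qed.
Lemma vnN W (u : W) : vn (- u) = vn u.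
Proof. by rewrite -scaleN1r vnZ normrN1 mul1r. Qed.
Lemma vnB W (u v : W) : vn (u - v) <= vn u + vn v.
Proof. by rewrite -(vnN v) vnD. Qed.
Lemma vn_eq0 W (u : W) : vn u = 0 -> u = 0.
Proof.
move/eqP; rewrite psumr_eq0// => /allP h; apply: crd_inj => j.
by have /= := h j (mem_index_enum j); rewrite linear0 normr_eq0 => /eqP.
Qed.
Lemma crd_vn W (u : W) j : `|crd j u| <= vn u.
Proof. by rewrite /vn (bigD1 j)//= lerDl sumr_ge0. Qed.
Lemma vn_sum W (I : Type) (r : seq I) (F : I -> W) :
  vn (\sum_(i <- r) F i) <= \sum_(i <- r) vn (F i).
Proof.
elim: r => [|i r IH]; first by rewrite !big_nil vn0.
by rewrite !big_cons (le_trans (vnD _ _))// lerD2l.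
Qed.

Lemma vn_bil (W1 W2 W3 : vectType R) (op : W1 -> W2 -> W3) : bil op ->
  exists2 K, 0 <= K & forall u v, vn (op u v) <= K * vn u * vn v.
Proof.
move=> b; pose e k l := vn (op (vbasis {:W1})`_k (vbasis {:W2})`_l).
exists (\sum_(k < \dim {:W1}) \sum_(l < \dim {:W2}) e k l).
  by apply: sumr_ge0 => k _; apply: sumr_ge0 => l _; exact: vn_ge0.
move=> u v; rewrite (bil_sumE b) (le_trans (vn_sum _ _))// -mulrA mulr_suml.
apply: ler_sum => k _; rewrite (le_trans (vn_sum _ _))// mulr_suml; apply: ler_sum => l _.
rewrite vnZ normrM mulrC ler_wpM2l ?vn_ge0//.
by rewrite ler_pM// crd_vn.
Qed.

Lemma vn_lin (W1 W2 : vectType R) (L : {linear W1 -> W2}) :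
  exists2 K, 0 <= K & forall u, vn (L u) <= K * vn u.
Proof.
exists (\sum_(k < \dim {:W1}) vn (L (vbasis {:W1})`_k)).
  by apply: sumr_ge0 => k _; exact: vn_ge0.
move=> u; rewrite {1}(sum_crd u) linear_sum (le_trans (vn_sum _ _))// mulr_suml.
apply: ler_sum => k _; rewrite linearZ vnZ mulrC ler_wpM2l ?vn_ge0//.
exact: crd_vn.
Qed.

Section Cvg.
Variables (T : Type) (G : set_system T).
Context {FG : Filter G}.

Definition vcvg W (F : T -> W) (l : W) := forall j, crd j (F x) @[x --> G] --> crd j l.

Lemma vcvg_cst W (l : W) : vcvg (fun=> l) l.
Proof. by move=> j; exact: cvg_cst. Qed.
Lemma vcvgD W F f (H : T -> W) h : vcvg F f -> vcvg H h -> vcvg (fun x => F x + H x) (f + h).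
Proof.
move=> cF cH j; rewrite linearD; under eq_fun do rewrite linearD.
exact: cvgD (cF j) (cH j).
Qed.
Lemma vcvg_lin (W1 W2 : vectType R) (L : {linear W1 -> W2}) F f :
  vcvg F f -> vcvg (fun x => L (F x)) (L f).
Proof.
move=> cF j; rewrite lin_crd; under eq_fun do rewrite lin_crd.
by apply: cvg_big => [|k _]; [exact: add_continuous|apply: cvgMl; exact: cF].
Qed.
Lemma vcvg_bil (W1 W2 W3 : vectType R) (op : W1 -> W2 -> W3) F f H h : bil op ->
  vcvg F f -> vcvg H h -> vcvg (fun x => op (F x) (H x)) (op f h).
Proof.
move=> b cF cH j; rewrite bil_crd//; under eq_fun do rewrite bil_crd//.
apply: cvg_big => [|k _]; first exact: add_continuous.
apply: cvg_big => [|l _]; first exact: add_continuous.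
by apply: cvgMl; apply: cvgM; [exact: cF|exact: cH].
Qed.
Lemma vcvgZ W (a : T -> R) (al : R) F (f : W) :
  a x @[x --> G] --> al -> vcvg F f -> vcvg (fun x => a x *: F x) (al *: f).
Proof.
move=> ca cF j; rewrite linearZ; under eq_fun do rewrite linearZ.
by apply: cvgM => //; exact: cF.
Qed.
Lemma vcvgZl W (a : R) F (f : W) : vcvg F f -> vcvg (fun x => a *: F x) (a *: f).
Proof. by apply: vcvgZ; exact: cvg_cst. Qed.
Lemma vcvgN W F (f : W) : vcvg F f -> vcvg (fun x => - F x) (- f).
Proof. by move=> /(vcvgZl (a := -1)); rewrite scaleN1r; under eq_fun do rewrite scaleN1r. Qed.
Lemma vcvgB W F f (H : T -> W) h : vcvg F f -> vcvg H h -> vcvg (fun x => F x - H x) (f - h).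
Proof. by move=> cF /vcvgN; exact: vcvgD. Qed.

Lemma vcvg_vn W F (f : W) : vcvg F f <-> vn (F x - f) @[x --> G] --> (0 : R).
Proof.
split=> [cF|/cvgrPdist_lt h j].
  rewrite [X in _ --> X](_ : _ = \sum_(j < \dim {:W}) `|crd j f - crd j f| :> R); last first.
    by rewrite big1// => j _; rewrite subrr normr0.
  rewrite /vn; apply: cvg_big => [|j _]; first exact: add_continuous.
  under eq_fun do rewrite linearB; apply: cvg_norm; apply: cvgB; [exact: cF|exact: cvg_cst].
apply/cvgrPdist_lt => e e0; have := h e e0; apply: filterS => x.
rewrite sub0r normrN ger0_norm ?vn_ge0// => /(le_lt_trans _); apply.
by rewrite -linearB -opprB linearN normrN crd_vn.
Qed.

Lemma vcvg_vn_le W F (f : W) e : vcvg F f -> 0 < e -> \forall x \near G, vn (F x - f) <= e.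
Proof.
move=> /vcvg_vn/cvgrPdist_le h /h; apply: filterS => x.
by rewrite sub0r normrN ger0_norm ?vn_ge0.
Qed.

Lemma vcvg_squeeze W F (f : W) (e : T -> R) : (\forall x \near G, vn (F x - f) <= e x) ->
  e x @[x --> G] --> (0 : R) -> vcvg F f.
Proof.
move=> he ce; apply/vcvg_vn; apply: (squeeze_cvgr _ (cvg_cst _) ce).
by apply: filterS he => x ->; rewrite vn_ge0.
Qed.

Lemma vcvg_near W F H (f : W) : (\forall x \near G, F x = H x) -> vcvg F f -> vcvg H f.
Proof.
move=> FH cF j; apply: cvg_trans (cF j); apply: near_eq_cvg.
by apply: filterS FH => x ->.
Qed.

Lemma vcvg_norm W F (f : W) : vcvg F f -> vn (F x) @[x --> G] --> vn f.
Proof.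
move=> cF; rewrite /vn; apply: cvg_big => [|j _]; first exact: add_continuous.
by apply: cvg_norm; exact: cF.
Qed.

Lemma vcvg_bounded W F (f : W) : vcvg F f -> \forall x \near G, vn (F x) <= vn f + 1.
Proof.
move=> /vcvg_norm /cvgrPdist_lt /(_ _ ltr01); apply: filterS => x.
by rewrite distrC ltr_norml => /andP[_]; rewrite ltrBlDl => /ltW.
Qed.

End Cvg.

Lemma vcvg_trans W (T : Type) (G G' : set_system T) (F : T -> W) (f : W) :
  G' `=>` G -> vcvg G F f -> vcvg G' F f.
Proof. by move=> GG cF j; apply: cvg_trans (cF j) => A /=; exact: GG. Qed.

Lemma vcvg_comp W (S T : Type) (G : set_system T) (H : set_system S) (u : S -> T) (F : T -> W) (f : W) :
  u x @[x --> H] --> G -> vcvg G F f -> vcvg H (F \o u) f.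
Proof. by move=> cu cF j; exact: (cvg_comp _ _ cu (cF j)). Qed.

Lemma vcvg_unique W (T : Type) (G : set_system T) {PG : ProperFilter G} (F : T -> W) (f g : W) :
  vcvg G F f -> vcvg G F g -> f = g.
Proof.
move=> cf cg; apply: crd_inj => j.
exact: (cvg_unique _ (cf j) (cg j)).
Qed.

End Vectors.

Arguments vcvg_cst {R T} G {FG W} l j.
Arguments vcvg_lin {R T G FG W1 W2} L {F f} _ j t _.
Arguments vcvgZl {R T G FG W} a {F f} _ j t _.

Section VectorDerivative.
Variable R : realType.
Implicit Types (W : vectType R).

Lemma is_vderiveP (X : normedModType R) W (F : X -> W) x v w :
  is_vderive F x v w <->
  vcvg 0^' (fun h : R => h^-1 *: (F (h *: v + x) - F x)) w.
Proof.
split=> h j.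
  have [] := h j; rewrite /derivable/= => + dE; rewrite -dE => dF.
  by under eq_fun do rewrite linearZ linearB; exact: dF.
have hj : h0^-1 *: (crd j (F (h0 *: v + x)) - crd j (F x) : R^o) @[h0 --> 0^'] --> (crd j w : R^o).
  by apply: cvg_trans (h j); apply: near_eq_cvg; near=> e; rewrite linearZ linearB.
split; first by apply/cvg_ex; exists (crd j w).
exact: cvg_lim hj.
Unshelve. all: by end_near. Qed.

Lemma is_vderive_vderive (X : normedModType R) W (F : X -> W) x v w :
  is_vderive F x v w -> vderive F x v = w.
Proof. by move=> h; apply: crd_inj => j; rewrite of_crdK; case: (h j). Qed.

Lemma vderive_is_vderive (X : normedModType R) W (F : X -> W) x v :
  (forall j, derivable (fun y => crd j (F y)) x v) -> is_vderive F x v (vderive F x v).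
Proof. by move=> h j; rewrite of_crdK; exact: derivableP. Qed.

Section Line.
Variables (X : normedModType R) (x v : X).
Local Notation line := (fun h : R => h *: v + x).

Lemma is_vderive_line W (F : X -> W) w : is_vderive F x v w ->
  vcvg 0^' (fun h : R => F (h *: v + x)) (F x).
Proof.
move=> /is_vderiveP h.
have c0 : h0 @[h0 --> (0:R)^'] --> (0 : R) by apply: cvg_within_filter; exact: cvg_id.
generalize (vcvgD (vcvgZ c0 h) (vcvg_cst (0:R)^' (F x))); rewrite scale0r add0r; apply: vcvg_near.
near=> e; have e0 : e != 0 by near: e; exact: nbhs_dnbhs_neq.
by rewrite scalerA mulfV// scale1r subrK.
Unshelve. all: by end_near. Qed.

Lemma is_vderive_lin (W1 W2 : vectType R) (L : {linear W1 -> W2}) (F : X -> W1) w :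
  is_vderive F x v w -> is_vderive (fun y => L (F y)) x v (L w).
Proof.
move=> /is_vderiveP h; apply/is_vderiveP; generalize (vcvg_lin L h); apply: vcvg_near.
by near=> e; rewrite linearZ linearB.
Unshelve. all: by end_near. Qed.

Lemma is_vderiveD W (F G : X -> W) f g : is_vderive F x v f -> is_vderive G x v g ->
  is_vderive (fun y => F y + G y) x v (f + g).
Proof.
move=> /is_vderiveP hf /is_vderiveP hg; apply/is_vderiveP; generalize (vcvgD hf hg); apply: vcvg_near.
by near=> e; rewrite -scalerDr opprD addrACA.
Unshelve. all: by end_near. Qed.

(** The increment splits into the increment of [F] against [G] at the moved point plus [F x] against
    the increment of [G], so only the continuity of [G] along the line is used. *)
Lemma is_vderive_bil (W1 W2 W3 : vectType R) (op : W1 -> W2 -> W3) F G f g : bil op ->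
  is_vderive F x v f -> is_vderive G x v g ->
  is_vderive (fun y => op (F y) (G y)) x v (op f (G x) + op (F x) g).
Proof.
move=> b dF dG; have [opl opr] := b.
have opBl u u' w : op (u - u') w = op u w - op u' w.
  by have := opl w (-1) u' u; rewrite !scaleN1r ![- _ + _]addrC.
have opBr u w w' : op u (w - w') = op u w - op u w'.
  by have := opr u (-1) w' w; rewrite !scaleN1r ![- _ + _]addrC.
have op0l w : op 0 w = 0 by rewrite -(subrr 0) opBl subrr.
have op0r u : op u 0 = 0 by rewrite -(subrr 0) opBr subrr.
have opZl a u w : op (a *: u) w = a *: op u w.
  by have := opl w a u 0; rewrite op0l !addr0.
have opZr a u w : op u (a *: w) = a *: op u w.
  by have := opr u a w 0; rewrite op0r !addr0.
pose proof (vcvg_bil b (iffLR (is_vderiveP _ _ _ _) dF) (is_vderive_line dG)) as h1.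
pose proof (vcvg_bil b (vcvg_cst (0:R)^' (F x)) (iffLR (is_vderiveP _ _ _ _) dG)) as h2.
apply/is_vderiveP; generalize (vcvgD h1 h2); apply: vcvg_near.
by near=> e; rewrite opZl opZr opBl opBr -scalerDr addrA subrK.
Unshelve. all: by end_near. Qed.

Lemma is_vderive_cst W (w : W) : is_vderive (fun=> w) x v 0.
Proof.
apply/is_vderiveP; generalize (vcvg_cst (0:R)^' (0 : W)); apply: vcvg_near.
by near=> e; rewrite subrr scaler0.
Unshelve. all: by end_near. Qed.

Lemma is_vderive_near W (F G : X -> W) w : (\forall e \near (0:R)^', F (e *: v + x) = G (e *: v + x)) ->
  F x = G x -> is_vderive F x v w -> is_vderive G x v w.
Proof.
move=> FG FGx /is_vderiveP h; apply/is_vderiveP; move: h; apply: vcvg_near.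
by near=> e; rewrite -FGx; congr (_ *: (_ - _)); near: e.
Unshelve. all: by end_near. Qed.

End Line.

Lemma is_vderiveN (X : normedModType R) W (F : X -> W) x v f :
  is_vderive F x v f -> is_vderive (fun y => - F y) x v (- f).
Proof. exact: (is_vderive_lin -%R). Qed.

Lemma is_vderiveB (X : normedModType R) W (F G : X -> W) x v f g : is_vderive F x v f -> is_vderive G x v g ->
  is_vderive (fun y => F y - G y) x v (f - g).
Proof. by move=> hf /is_vderiveN; exact: is_vderiveD. Qed.

Lemma is_vderive_along (X : normedModType R) W (F : X -> W) x v w :
  is_vderive F x v w <-> is_vderive (fun h : R^o => F (h *: v + x)) 0 1 w.
Proof.
split=> /is_vderiveP h; apply/is_vderiveP; move: h; apply: vcvg_near; near=> e.
  by rewrite scale0r add0r addr0 /GRing.scale/= mulr1.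
by rewrite scale0r add0r addr0 /GRing.scale/= mulr1.
Unshelve. all: by end_near. Qed.

Lemma is_vderive_affine W (F : R^o -> W) (k c t : R) w :
  is_vderive F (k * t + c) 1 w -> is_vderive (fun s : R^o => F (k * s + c)) t 1 (k *: w).
Proof.
(* For k = 0 the inner map is constant and does not preserve the punctured neighbourhood of 0. *)
move=> dF; have [->|k0] := eqVneq k 0.
  rewrite scale0r; have := is_vderive_cst (t : R^o) 1 (F c); apply: is_vderive_near.
    by near=> e; rewrite mul0r add0r.
  by rewrite mul0r add0r.
apply/is_vderiveP; move/is_vderiveP : dF => dF.
have ck0 : k * h @[h --> (0:R)^'] --> (0 : R).
  rewrite -[X in _ --> X](mulr0 k); apply: cvgMr.
  by apply: cvg_within_filter; exact: cvg_id.
have ck : k * h @[h --> (0:R)^'] --> (0:R)^'.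
  move=> A /ck0 hA; change (\forall h \near (0:R)^', k * h != 0 -> A (k * h)) in hA.
  change (\forall h \near (0:R)^', A (k * h)); near=> h.
  have : k * h != 0 -> A (k * h) by near: h; exact: hA.
  by apply; rewrite mulf_neq0//; near: h; exact: nbhs_dnbhs_neq.
generalize (vcvgZl k (vcvg_comp ck dF)); apply: vcvg_near.
near=> e; have e0 : e != 0 by near: e; exact: nbhs_dnbhs_neq.
rewrite /= scalerA invfM mulrA mulfV// mul1r; congr (_ *: (F _ - _)).
by rewrite /GRing.scale/= !mulr1; ring.
Unshelve. all: by end_near. Qed.

End VectorDerivative.

Section VectorIntegral.
Variable R : realType.
Implicit Types (W : vectType R) (a b M : R).

Definition vcts W (F : R -> W) (t : R) := vcvg (nbhs t) F (F t).

Definition vpcb W M a b (F : R -> W) := exists S : seq R, forall t, a < t < b -> t \notin S ->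
  vn (F t) <= M /\ vcts F t.

Definition vpc W a b (F : R -> W) := exists M, vpcb M a b F.

Lemma vcts_near W (F G : R -> W) t : (\forall u \near t, F u = G u) -> vcts F t -> vcts G t.
Proof. by move=> FG; rewrite /vcts -(nbhs_singleton FG); exact: vcvg_near. Qed.

Lemma pcb_crd W M a b (F : R -> W) j : vpcb M a b F -> pcb M a b (fun t => crd j (F t)).
Proof.
move=> [S h]; exists S => t tab /(h _ tab)[FM cF]; split; last exact: cF.
exact: le_trans (crd_vn _ _) FM.
Qed.

Lemma pc_crd W a b (F : R -> W) j : vpc a b F -> pc a b (fun t => crd j (F t)).
Proof. by move=> [M h]; exists M; exact: pcb_crd. Qed.

(** Finitely many conditions, each with its own exceptional set, share the union of these sets. *)
Lemma ex_seq_fin (T : eqType) (I : finType) (P : I -> T -> Prop) (Q : T -> Prop) :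
  (forall i, exists S : seq T, forall t, Q t -> t \notin S -> P i t) ->
  exists S : seq T, forall t, Q t -> t \notin S -> forall i, P i t.
Proof.
move=> /choice[S h]; exists (flatten [seq S i | i <- enum I]) => t Qt tS i.
apply: h => //; apply: contra tS => tS; apply/flatten_mapP; exists i => //.
exact: mem_enum.
Qed.

Lemma vpc_crd W a b (F : R -> W) : (forall j, pc a b (fun t => crd j (F t))) -> vpc a b F.
Proof.
move=> /choice[M hM]; have [S h] := ex_seq_fin hM.
exists (\sum_j M j), S => t tab tS; have {}h := h _ tab tS; split.
  by apply: ler_sum => j _; have [] := h j.
by move=> j; have [] := h j.
Qed.

Lemma vpcb_ge0 W M a b (F : R -> W) : a < b -> vpcb M a b F -> 0 <= M.
Proof.
move=> ab [S h]; suff [t /andP[tab tS]] : exists t, (a < t < b) && (t \notin S).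
  by have [FM _] := h _ tab tS; exact: le_trans (vn_ge0 _) FM.
elim: S a b ab {h} => [|x S IH] a b ab.
  by exists ((a + b) / 2); rewrite andbT; apply/andP; split; lra.
have [/andP[ax xb]|nx] := boolP (a < x < b).
  have [t /andP[/andP[at_ tx] tS]] := IH _ _ ax; exists t.
  by rewrite at_ (lt_trans tx xb) inE negb_or tS lt_eqF.
have [t /andP[tab tS]] := IH _ _ ab; exists t; rewrite tab inE negb_or tS andbT.
by apply: contraNneq nx => <-.
Qed.

Lemma vpcb_sub W M a b a' b' (F : R -> W) : a <= a' -> b' <= b -> vpcb M a b F -> vpcb M a' b' F.
Proof.
by move=> aa bb [S h]; exists S => t /andP[ta tb]; apply: h; rewrite (le_lt_trans aa)// (lt_le_trans tb).
Qed.

Lemma vpc_sub W a b a' b' (F : R -> W) : a <= a' -> b' <= b -> vpc a b F -> vpc a' b' F.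
Proof. by move=> aa bb [M h]; exists M; exact: vpcb_sub h. Qed.

Lemma vpcb_eq W M a b (F G : R -> W) (S : seq R) :
  (forall t, a < t < b -> t \notin S -> F t = G t) -> vpcb M a b F -> vpcb M a b G.
Proof.
move=> FG [T h]; exists (S ++ T) => t tab; rewrite mem_cat negb_or => /andP[tS tT].
have [FM cF] := h _ tab tT; rewrite -FG//; split => //; move: cF; apply: vcts_near.
near=> u; apply: FG; first by near: u; exact: near_itvoo.
by near: u; exact: near_notin.
Unshelve. all: by end_near. Qed.

Lemma vpc_eq W a b (F G : R -> W) (S : seq R) :
  (forall t, a < t < b -> t \notin S -> F t = G t) -> vpc a b F -> vpc a b G.
Proof. by move=> FG [M h]; exists M; exact: (vpcb_eq FG h). Qed.

Lemma vpcb_bil (W1 W2 W3 : vectType R) (op : W1 -> W2 -> W3) K M N a b F G : bil op ->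
  0 <= K -> (forall u v, vn (op u v) <= K * vn u * vn v) ->
  vpcb M a b F -> vpcb N a b G -> vpcb (K * M * N) a b (fun t => op (F t) (G t)).
Proof.
move=> bo K0 hK [S h] [T k]; exists (S ++ T) => t tab; rewrite mem_cat negb_or => /andP[tS tT].
have [FM cF] := h _ tab tS; have [GN cG] := k _ tab tT; split; last exact: vcvg_bil.
by rewrite (le_trans (hK _ _))// ler_pM ?mulr_ge0 ?vn_ge0// ler_wpM2l.
Qed.

Lemma vpc_bil (W1 W2 W3 : vectType R) (op : W1 -> W2 -> W3) a b F G : bil op ->
  vpc a b F -> vpc a b G -> vpc a b (fun t => op (F t) (G t)).
Proof.
move=> bo [M h] [N k]; have [K K0 hK] := vn_bil bo; exists (K * M * N).
exact: vpcb_bil.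
Qed.

Lemma vpc_cst W (w : W) a b : vpc a b (fun=> w).
Proof. by exists (vn w), [::] => t _ _; split=> //; exact: vcvg_cst. Qed.

Lemma vpcD W a b (F G : R -> W) : vpc a b F -> vpc a b G -> vpc a b (fun t => F t + G t).
Proof.
move=> [M [S h]] [N [T k]]; exists (M + N), (S ++ T) => t tab.
rewrite mem_cat negb_or => /andP[tS tT].
have [FM cF] := h _ tab tS; have [GN cG] := k _ tab tT; split; last exact: vcvgD.
by rewrite (le_trans (vnD _ _))// lerD.
Qed.

Lemma vpc_lin (W1 W2 : vectType R) (L : {linear W1 -> W2}) a b F :
  vpc a b F -> vpc a b (fun t => L (F t)).
Proof.
move=> [M [S h]]; have [K K0 hK] := vn_lin L; exists (K * M), S => t tab tS.
have [FM cF] := h _ tab tS; split; last exact: (vcvg_lin L cF).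
by rewrite (le_trans (hK _))// ler_wpM2l.
Qed.

Lemma vpcN W a b (F : R -> W) : vpc a b F -> vpc a b (fun t => - F t).
Proof. exact: (vpc_lin -%R). Qed.

Lemma vpcB W a b (F G : R -> W) : vpc a b F -> vpc a b G -> vpc a b (fun t => F t - G t).
Proof. by move=> pF /vpcN; exact: vpcD. Qed.

Lemma vpcZ W a b k (F : R -> W) : vpc a b F -> vpc a b (fun t => k *: F t).
Proof. exact: (vpc_lin ( *:%R k)). Qed.

Lemma pc_vn W a b (F : R -> W) : vpc a b F -> pc a b (fun t => vn (F t)).
Proof.
move=> [M [S h]]; exists M, S => t tab /(h _ tab)[FM cF].
split; first by rewrite ger0_norm ?vn_ge0.
exact: vcvg_norm cF.
Qed.

Lemma crd_vint W a b (F : R -> W) j : crd j (vintegral a b F) = ig a b (fun t => crd j (F t)).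
Proof. by rewrite /vintegral of_crdK. Qed.

Lemma vint_lin (W1 W2 : vectType R) (L : {linear W1 -> W2}) a b F : a <= b -> vpc a b F ->
  vintegral a b (fun t => L (F t)) = L (vintegral a b F).
Proof.
move=> ab pF; apply: crd_inj => j; rewrite crd_vint lin_crd.
rewrite (_ : (fun t => _) = fun t => \sum_(k < \dim {:W1}) crd j (L (vbasis {:W1})`_k) * crd k (F t)); last first.
  by apply/funext => t; rewrite lin_crd; apply: eq_bigr => k _; rewrite mulrC.
rewrite ig_sum//; last by move=> k; apply: pc_mul; [exact: pc_cst|exact: pc_crd].
by apply: eq_bigr => k _; rewrite ig_scale ?crd_vint 1?mulrC//; exact: pc_crd.
Qed.

Lemma vintD W a b (F G : R -> W) : a <= b -> vpc a b F -> vpc a b G ->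
  vintegral a b (fun t => F t + G t) = vintegral a b F + vintegral a b G.
Proof.
move=> ab pF pG; apply: crd_inj => j; rewrite crdD !crd_vint.
rewrite -ig_add//; try exact: pc_crd.
by congr (ig _ _ _); apply/funext => t; rewrite crdD.
Qed.

Lemma vintN W a b (F : R -> W) : a <= b -> vpc a b F ->
  vintegral a b (fun t => - F t) = - vintegral a b F.
Proof. exact: (vint_lin -%R). Qed.

Lemma vintB W a b (F G : R -> W) : a <= b -> vpc a b F -> vpc a b G ->
  vintegral a b (fun t => F t - G t) = vintegral a b F - vintegral a b G.
Proof. by move=> ab pF pG; rewrite vintD ?vintN//; exact: vpcN. Qed.

Lemma vintZ W a b k (F : R -> W) : a <= b -> vpc a b F ->
  vintegral a b (fun t => k *: F t) = k *: vintegral a b F.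
Proof. exact: (vint_lin ( *:%R k)). Qed.

Lemma eq_vint W a b (F G : R -> W) : (forall t, a <= t <= b -> F t = G t) ->
  vintegral a b F = vintegral a b G.
Proof.
move=> FG; apply: crd_inj => j; rewrite !crd_vint; apply: eq_ig => t tab.
by rewrite FG.
Qed.

Lemma eq_vint_off W a b (F G : R -> W) (S : seq R) : a <= b -> vpc a b F ->
  (forall t, a < t < b -> t \notin S -> F t = G t) -> vintegral a b F = vintegral a b G.
Proof.
move=> ab pF FG; apply: crd_inj => j; rewrite !crd_vint.
by apply: (eq_ig_off ab _ (S := S)) => [|t tab tS]; [exact: pc_crd|rewrite FG].
Qed.

Lemma vint_point W a (F : R -> W) : vintegral a a F = 0.
Proof. by apply: crd_inj => j; rewrite crd_vint ig_point crd0. Qed.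

Lemma vint0 W a b : vintegral a b (fun=> 0 : W) = 0.
Proof.
apply: crd_inj => j; rewrite crd_vint crd0 /ig.
by rewrite Rintegral_cst ?mul0r.
Qed.

Lemma vint_chasles W a c b (F : R -> W) : a <= c <= b -> vpc a b F ->
  vintegral a b F = vintegral a c F + vintegral c b F.
Proof.
move=> acb pF; apply: crd_inj => j; rewrite crdD !crd_vint; apply: ig_chasles => //.
exact: pc_crd.
Qed.

Lemma vint_norm W a b (F : R -> W) : a <= b -> vpc a b F ->
  vn (vintegral a b F) <= ig a b (fun t => vn (F t)).
Proof.
move=> ab pF; rewrite /vn ig_sum//; last by move=> j; apply: pc_norm; exact: pc_crd.
apply: ler_sum => j _; rewrite crd_vint; apply: ig_norm => //; exact: pc_crd.
Qed.

Lemma vint_bound W M a b (F : R -> W) : a <= b -> vpcb M a b F ->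
  vn (vintegral a b F) <= M * (b - a).
Proof.
move=> ab pF; have vF : vpc a b F by exists M.
rewrite (le_trans (vint_norm ab vF))// -ig_cst//; have [S h] := pF.
apply: (ig_le (S := S)) => //; [exact: pc_vn|exact: pc_cst|by move=> t tab /(h _ tab)[]].
Qed.

Lemma dominated_vcvg W (T : pseudoMetricType R) (D : set T) (e0 : T) a b
    (F : T -> R -> W) f M : a <= b ->
  (\forall e \near within D (nbhs e0), vpcb M a b (F e)) -> vpc a b f ->
  (exists S : seq R, forall t, a < t < b -> t \notin S ->
    vcvg (within D (nbhs e0)) (F^~ t) (f t)) ->
  ig a b (fun t => vn (F e t - f t)) @[e --> within D (nbhs e0)] --> (0 : R^o).
Proof.
move=> ab pF pf [S h].
have hj j : ig a b (fun t => `|crd j (F e t) - crd j (f t)|) @[e --> within D (nbhs e0)] --> (0 : R^o).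
  apply: (pc_dominated_cvg (M := M)) => //.
  - by apply: filterS pF => e; exact: pcb_crd.
  - exact: pc_crd.
  - by exists S => t tab tS; exact: h.
have : \sum_(j < \dim {:W}) ig a b (fun t => `|crd j (F e t) - crd j (f t)|)
    @[e --> within D (nbhs e0)] --> \sum_(j < \dim {:W}) (0 : R^o).
  by apply: cvg_big => [|j _]; [exact: add_continuous|exact: hj].
rewrite big1//; apply: cvg_trans; apply: near_eq_cvg; apply: filterS pF => e pFe.
have vF : vpc a b (F e) by exists M.
rewrite -ig_sum//; last first.
  by move=> j; apply: pc_norm; apply: pc_sub_fun; exact: pc_crd.
by congr (ig _ _ _); apply/funext => t; apply: eq_bigr => j _; rewrite crdB.
Qed.

Lemma dominated_vint W (T : pseudoMetricType R) (D : set T) (e0 : T) a b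
    (F : T -> R -> W) f M : a <= b ->
  (\forall e \near within D (nbhs e0), vpcb M a b (F e)) -> vpc a b f ->
  (exists S : seq R, forall t, a < t < b -> t \notin S ->
    vcvg (within D (nbhs e0)) (F^~ t) (f t)) ->
  vcvg (within D (nbhs e0)) (fun e => vintegral a b (F e)) (vintegral a b f).
Proof.
move=> ab pF pf h; have c := dominated_vcvg ab pF pf h.
apply: (vcvg_squeeze _ c); apply: filterS pF => e pFe.
have vF : vpc a b (F e) by exists M.
by rewrite -vintB// vint_norm//; exact: vpcB.
Qed.

Definition vprim W a b (F f : R -> W) :=
  vpc a b f /\ forall t, a <= t <= b -> F t = F a + vintegral a t f.

Lemma vprim_crd W a b (F f : R -> W) :
  vprim a b F f <-> forall j, sprim a b (fun t => crd j (F t)) (fun t => crd j (f t)).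
Proof.
split=> [[pf h] j|h].
  by split=> [|t tab]; [exact: pc_crd|rewrite h// crdD crd_vint].
split=> [|t tab]; first by apply: vpc_crd => j; have [] := h j.
by apply: crd_inj => j; rewrite crdD crd_vint; have [_ ->] := h j.
Qed.

Lemma vprimP W a b (F f : R -> W) : a <= b -> vprim a b F f <->
  [/\ vpc a b f, vcontinuous `[a, b] F &
   exists S : seq R, forall t : R^o, a < t < b -> t \notin S -> is_vderive (F : R^o -> W) t 1 (f t)].
Proof.
move=> ab; split=> [pF|[pf cF [S dF]]].
  have h j := iffLR (sprimP _ _ ab) (iffLR (vprim_crd _ _ _ _) pF j).
  split; [by case: pF|by move=> j; have [] := h j|].
  by apply: ex_seq_fin => j; have [_ _ [S]] := h j; exists S.
apply/vprim_crd => j; apply/sprimP => //; split; [exact: pc_crd|exact: cF|].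
by exists S => t tab tS; exact: dF.
Qed.

Lemma vprim_pc W a b (F f : R -> W) : a <= b -> vprim a b F f -> vpc a b F.
Proof.
move=> ab [pf FE]; have [M hM] := pf.
exists (vn (F a) + M * (b - a)), [::] => t /andP[at_ tb] _; split.
  rewrite FE ?(ltW at_) ?(ltW tb)// (le_trans (vnD _ _))// lerD2l.
  rewrite (le_trans (vint_bound (ltW at_) (vpcb_sub _ _ hM)))// ?(ltW tb)//.
  rewrite ler_wpM2l ?lerD2r ?(ltW tb)//.
  exact: vpcb_ge0 (lt_trans at_ tb) hM.
have [_ cF _] := iffLR (vprimP _ _ ab) (conj pf FE).
move=> j; have [c _ _] := iffLR (continuous_within_itvP _ (lt_trans at_ tb)) (cF j).
by apply: c; rewrite in_itv/= at_.
Qed.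

End VectorIntegral.

Section Primitives.
Variable R : realType.
Implicit Types (W : vectType R) (a b M : R).

Lemma vprim_cts W a b (F f : R -> W) t : vprim a b F f -> a < t < b -> vcts F t.
Proof.
move=> pF /andP[at_ tb]; have ab := lt_trans at_ tb.
have [_ cF _] := iffLR (vprimP _ _ (ltW ab)) pF.
move=> j; have [c _ _] := iffLR (continuous_within_itvP _ ab) (cF j).
by apply: c; rewrite in_itv/= at_.
Qed.

Lemma vprim_int W a b (f : R -> W) : vpc a b f -> vprim a b (fun t => vintegral a t f) f.
Proof. by move=> pf; split=> // t _; rewrite vint_point add0r. Qed.

Lemma vprim_cst0 W a b (w : W) : vprim a b (fun=> w) (fun=> 0).
Proof. by split=> [|t _]; [exact: vpc_cst|rewrite vint0 addr0]. Qed.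

Lemma vprim_sub W a b a' b' (F f : R -> W) : a <= a' -> a' <= b' -> b' <= b ->
  vprim a b F f -> vprim a' b' F f.
Proof.
move=> aa ab bb [pf h]; split=> [|t /andP[at_ tb]]; first exact: vpc_sub pf.
rewrite (h t) ?(le_trans aa at_) ?(le_trans tb bb)//.
rewrite (h a') ?aa ?(le_trans ab bb)// -addrA -vint_chasles ?aa//.
by apply: vpc_sub pf => //; exact: le_trans bb.
Qed.

Lemma vprim_eq W a b (F G f g : R -> W) (S : seq R) : a <= b ->
  (forall t, a <= t <= b -> F t = G t) -> (forall t, a < t < b -> t \notin S -> f t = g t) ->
  vprim a b F f -> vprim a b G g.
Proof.
move=> ab FG fg [pf h]; split=> [|t tab]; first exact: (vpc_eq fg pf).
have /andP[at_ tb] := tab.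
rewrite -!FG ?lexx// h//; congr (_ + _); apply: (eq_vint_off (S := S)) => //.
  exact: vpc_sub pf.
by move=> u /andP[au ut]; apply: fg; rewrite au (lt_le_trans ut tb).
Qed.

Lemma vprim_lin (W1 W2 : vectType R) (L : {linear W1 -> W2}) a b F f :
  vprim a b F f -> vprim a b (fun t => L (F t)) (fun t => L (f t)).
Proof.
move=> [pf h]; split=> [|t /andP[at_ tb]]; first exact: vpc_lin.
by rewrite h ?at_// linearD vint_lin//; exact: vpc_sub pf.
Qed.

Lemma vprimD W a b (F G f g : R -> W) : vprim a b F f -> vprim a b G g ->
  vprim a b (fun t => F t + G t) (fun t => f t + g t).
Proof.
move=> [pf h] [pg k]; split=> [|t /andP[at_ tb]]; first exact: vpcD.
rewrite h ?at_// k ?at_// addrACA vintD//.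
  exact: vpc_sub pf.
exact: vpc_sub pg.
Qed.

Lemma vprimN W a b (F f : R -> W) : vprim a b F f -> vprim a b (fun t => - F t) (fun t => - f t).
Proof. exact: (vprim_lin -%R). Qed.

Lemma vprimB W a b (F G f g : R -> W) : vprim a b F f -> vprim a b G g ->
  vprim a b (fun t => F t - G t) (fun t => f t - g t).
Proof. by move=> h /vprimN; exact: vprimD. Qed.

Lemma vcontinuous_bil (W1 W2 W3 : vectType R) (op : W1 -> W2 -> W3) (K : set R^o) F G :
  bil op -> vcontinuous K F -> vcontinuous K G -> vcontinuous K (fun t => op (F t) (G t)).
Proof.
move=> bo cF cG j; apply/subspace_continuousP => x Kx.
have cF' : vcvg (within K (nbhs x)) F (F x) by move=> k; have /subspace_continuousP := cF k; apply.
have cG' : vcvg (within K (nbhs x)) G (G x) by move=> k; have /subspace_continuousP := cG k; apply.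
exact: (vcvg_bil bo cF' cG').
Qed.

Lemma vprim_bil (W1 W2 W3 : vectType R) (op : W1 -> W2 -> W3) a b F G f g : a <= b -> bil op ->
  vprim a b F f -> vprim a b G g ->
  vprim a b (fun t => op (F t) (G t)) (fun t => op (f t) (G t) + op (F t) (g t)).
Proof.
move=> ab bo pF pG; have [pf cF [S dF]] := iffLR (vprimP _ _ ab) pF.
have [pg cG [T dG]] := iffLR (vprimP _ _ ab) pG.
apply/vprimP => //; split; [|exact: vcontinuous_bil|].
  by apply: vpcD; apply: vpc_bil => //; [exact: (vprim_pc ab pG)|exact: (vprim_pc ab pF)].
exists (S ++ T) => t tab; rewrite mem_cat negb_or => /andP[tS tT].
by apply: is_vderive_bil => //; [exact: dF|exact: dG].
Qed.

Lemma vprim_const W a b (F f : R -> W) (S : seq R) : a <= b ->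
  (forall t, a < t < b -> t \notin S -> f t = 0) -> vprim a b F f ->
  forall t, a <= t <= b -> F t = F a.
Proof.
move=> ab f0 [pf h] t tab; have /andP[at_ tb] := tab.
rewrite h// (eq_vint_off (G := fun=> 0) (S := S)) ?vint0 ?addr0//.
  exact: vpc_sub pf.
by move=> u /andP[au ut]; apply: f0; rewrite au (lt_le_trans ut tb).
Qed.

(** With [vprim_const], the way most identities between transports are proved: equal initial values,
    and equal derivatives off finitely many times. *)
Lemma vprim_unique W a b (F G f g : R -> W) (S : seq R) : a <= b ->
  (forall t, a < t < b -> t \notin S -> f t = g t) -> F a = G a ->
  vprim a b F f -> vprim a b G g -> forall t, a <= t <= b -> F t = G t.
Proof.
move=> ab fg FG pF pG t tab; have fg0 u : a < u < b -> u \notin S -> f u - g u = 0.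
  by move=> uab uS; rewrite fg// subrr.
have /eqP := vprim_const ab fg0 (vprimB pF pG) tab.
by rewrite FG subrr subr_eq0 => /eqP.
Qed.

Lemma affine_cvg (k c t : R) : k * s + c @[s --> t] --> k * t + c.
Proof. by apply: cvgD; [apply: cvgMr; exact: cvg_id|exact: cvg_cst]. Qed.

Lemma vprim_affine W a b a' b' (k c : R) (F f : R -> W) : a <= b -> a' <= b' -> k != 0 ->
  (forall s, a' <= s <= b' -> a <= k * s + c <= b) ->
  (forall s, a' < s < b' -> a < k * s + c < b) ->
  vprim a b F f -> vprim a' b' (fun s => F (k * s + c)) (fun s => k *: f (k * s + c)).
Proof.
move=> ab ab' k0 kc kc' pF; have [[M [T hf]] cF [S dF]] := iffLR (vprimP _ _ ab) pF.
(* The preimages of the exceptional times under the affine map; they are finite in number because k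
   is nonzero. *)
pose inv (S : seq R) := [seq (u - c) / k | u <- S].
have inv_notin (U : seq R) s : s \notin inv U -> k * s + c \notin U.
  by apply: contra => h; apply/mapP; exists (k * s + c); rewrite // addrK mulrC mulKf.
apply/vprimP => //; split.
- apply: vpcZ; exists M, (inv T) => s sab /inv_notin sT.
  have [fM cf] := hf _ (kc' _ sab) sT; split => //.
  exact: (vcvg_comp (@affine_cvg k c s) cf).
- move=> j; apply/subspace_continuousP => s /= sab.
  have /subspace_continuousP := cF j; move=> /(_ (k * s + c)).
  have : `[a, b]%classic (k * s + c) by move: sab => /=; rewrite !in_itv/=; exact: kc.
  move=> /[swap] /[apply] c1 A /c1 A1.
  change (\forall u \near nbhs s, `[a', b']%classic u -> A (crd j (F (k * u + c)))).
  change (\forall u \near nbhs (k * s + c), `[a, b]%classic u -> A (crd j (F u))) in A1.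
  have h0 : \forall u \near nbhs s, `[a, b]%classic (k * u + c) -> A (crd j (F (k * u + c))).
    exact: (@affine_cvg k c s _ A1).
  move: h0; apply: filterS => u h uab; apply: h.
  by move: uab => /=; rewrite !in_itv/=; exact: kc.
- exists (inv S) => s sab /inv_notin sS.
  by apply: is_vderive_affine; apply: dF => //; exact: kc'.
Qed.

End Primitives.

Lemma addrDBK (V : zmodType) (x y z : V) : x + (y + z) - (x + y) = z.
Proof. by rewrite addrA [x + y + z]addrC addrK. Qed.

Lemma subr4 (V : zmodType) (a b c d : V) : a - b = (c - d) + ((a - c) - (b - d)).
Proof. by rewrite opprB [RHS]addrCA !subrKA. Qed.

(** * Linear differential equations *)

Section LinearODE.
Variable R : realType.
Implicit Types (W : vectType R).

(** With radii 2 C / 2^n the intervals around the [u n] are nested, so their left ends increase to a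
    point lying in all of them. The rate comes together with the limit. *)
Lemma geometric_cvg (u : nat -> R) C : (forall n, `|u n.+1 - u n| <= C * 2^-1 ^+ n) ->
  exists l : R, forall n, `|l - u n| <= 2 * C * 2^-1 ^+ n.
Proof.
move=> hu; pose e n := 2 * C * 2^-1 ^+ n.
have eS n : e n = e n.+1 + C * 2^-1 ^+ n by rewrite /e exprS; field.
have C0 : 0 <= C by have := le_trans (normr_ge0 _) (hu 0%N); rewrite expr0 mulr1.
have e0 n : 0 <= e n by rewrite /e !mulr_ge0// exprn_ge0.
pose lo n := u n - e n; pose hi n := u n + e n.
have loS n : lo n <= lo n.+1.
  by have := hu n; rewrite ler_norml /lo => /andP[h _]; have := eS n; lra.
have hiS n : hi n.+1 <= hi n.
  by have := hu n; rewrite ler_norml /hi => /andP[_ h]; have := eS n; lra.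
have lo_nd : nondecreasing_seq lo by apply/nondecreasing_seqP.
have hi_ni : nonincreasing_seq hi by apply/nonincreasing_seqP.
have lohi n m : lo n <= hi m.
  apply: le_trans (lo_nd _ _ (leq_maxl n m)) _; apply: le_trans (hi_ni _ _ (leq_maxr n m)).
  by rewrite /lo /hi; have := e0 (maxn n m); lra.
have cv : cvgn lo.
  by apply: nondecreasing_is_cvgn => //; exists (hi 0%N) => _ [n _ <-]; exact: lohi.
exists (limn lo) => n; rewrite ler_distl; apply/andP; split.
  exact: (nondecreasing_cvgn_le lo_nd cv n).
by apply: (limr_le cv); near=> m; exact: lohi.
Unshelve. all: by end_near. Qed.

Lemma le_geometric (x y C : R) : (forall n, x <= y + C * 2^-1 ^+ n) -> x <= y.
Proof.
move=> h; rewrite leNgt; apply/negP => yx.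
have : C * 2^-1 ^+ n @[n --> \oo] --> C * 0.
  by apply: cvgMr; apply: cvg_expr; rewrite ger0_norm//; lra.
rewrite mulr0 => /cvgrPdist_lt /(_ (x - y)); rewrite subr_gt0 => /(_ yx)[N _ /(_ N (leqnn N))].
by rewrite /= sub0r normrN => /ltr_normlW; have := h N; lra.
Qed.

(** The origin of the contraction factor: integrating l times the weight exp(2 l t) gives less than
    half of the weight. *)
Lemma ig_expR (l t : R) : 0 <= t -> ig 0 t (fun u => l * expR (2 * l * u)) = (expR (2 * l * t) - 1) / 2.
Proof.
move=> t0; pose F u := expR (2 * l * u) / 2.
have dF (u : R) : is_derive (u : R^o) 1 (F : R^o -> R^o) (l * expR (2 * l * u)).
  rewrite /F; apply: is_derive_eq; rewrite /GRing.scale/=; by field.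
have cF (u : R) : {for u, continuous F}.
  by apply: differentiable_continuous; apply/derivable1_diffP; have [] := dF u.
have cf (u : R) : {for u, continuous (fun u => l * expR (2 * l * u))}.
  apply: cvgMr; apply: continuous_comp; last exact: continuous_expR.
  by apply: cvgMr; exact: cvg_id.
have [_ /(_ t)] : sprim 0 t F (fun u => l * expR (2 * l * u)).
  apply/sprimP => //; split.
  - exists (`|l| * expR (2 * `|l| * t)), [::] => u /andP[u0 ut] _; split => //.
    rewrite normrM ler_wpM2l// ger0_norm ?expR_ge0// ler_expR.
    rewrite -!mulrA ler_wpM2l// (le_trans (ler_norm _))// normrM ler_wpM2l//.
    by rewrite gtr0_norm// ltW.
  - by apply: continuous_subspaceT => u; exact: cF.
  - by exists [::] => u _ _; exact: dF.
rewrite t0 lexx => /(_ isT); rewrite /F mulr0 expR0 => h.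
by lra.
Qed.

Section Picard.
Variables (W1 W : vectType R) (op : W1 -> W -> W).
Hypothesis bop : bil op.
Variables (K M : R) (K0 : 0 <= K) (M0 : 0 <= M).
Hypothesis hK : forall u v, vn (op u v) <= K * vn u * vn v.
Variables (a : R -> W1) (w0 : W).
Hypothesis pa : vpcb M 0 1 a.

Fixpoint picard (n : nat) : R -> W :=
  if n is m.+1 then fun t => w0 + vintegral 0 t (fun u => op (a u) (picard m u)) else fun=> w0.

Let l := K * M.
Let E t := expR (2 * l * t).

Let l0 : 0 <= l. Proof. exact: mulr_ge0. Qed.

Lemma vpc_picard n : vpc 0 1 (picard n).
Proof.
elim: n => [|n IH]; first exact: vpc_cst.
apply: vpcD; first exact: vpc_cst.
apply: (@vprim_pc _ _ _ _ _ (fun u => op (a u) (picard n u))) => //.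
by apply: vprim_int; apply: vpc_bil => //; exists M.
Qed.

Let vpc_op n : vpc 0 1 (fun u => op (a u) (picard n u)).
Proof. by apply: vpc_bil => //; [exists M|exact: vpc_picard]. Qed.

Let E1 (t : R) : 0 <= t -> 1 <= E t.
Proof. by move=> t0; rewrite -expR0 ler_expR !mulr_ge0. Qed.

(** Measured against the weight [E t] = exp(2 K M t), the integral operator of the equation
    contracts by 1/2 on the whole of [0, 1], so the interval need not be subdivided. *)
Lemma vint_op_le (F : R -> W) D t : 0 <= t <= 1 -> 0 <= D -> vpc 0 1 F ->
  (forall u, 0 <= u <= 1 -> vn (F u) <= D * E u) ->
  vn (vintegral 0 t (fun u => op (a u) (F u))) <= D * ((E t - 1) / 2).
Proof.
move=> /andP[t0 t1] D0 pF FD.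
have pO : vpc 0 t (fun u => op (a u) (F u)).
  by apply: (vpc_sub (lexx 0) t1); apply: vpc_bil => //; exists M.
have pE : pc 0 t (fun u => l * expR (2 * l * u)).
  have cf (u : R) : {for u, continuous (fun u => l * expR (2 * l * u))}.
    apply: cvgMr; apply: continuous_comp; last exact: continuous_expR.
    by apply: cvgMr; exact: cvg_id.
  exists (l * E 1), [::] => u /andP[u0 ut] _; split => //.
  rewrite ger0_norm ?mulr_ge0 ?expR_ge0// ler_wpM2l// ler_expR ler_wpM2l ?mulr_ge0//.
  exact: ltW (lt_le_trans ut t1).
rewrite (le_trans (vint_norm t0 pO))// -ig_expR// -ig_scale//.
have [S h] := pa.
apply: (ig_le (S := S)) => //; [exact: pc_vn|by apply: pc_mul => //; exact: pc_cst|].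
move=> u /andP[u0 ut] uS.
have u1 : u < 1 := lt_le_trans ut t1.
have [aM _] : vn (a u) <= M /\ vcts a u by apply: h; rewrite ?u0.
rewrite (le_trans (hK _ _))// mulrCA ler_pM ?mulr_ge0 ?vn_ge0// ?ler_wpM2l//.
by apply: FD; rewrite !ltW.
Qed.

Lemma picard_le n t : 0 <= t <= 1 -> vn (picard n t) <= vn w0 * E t.
Proof.
elim: n t => [|n IH] t t01; have /andP[t0 t1] := t01.
  by rewrite ler_peMr ?vn_ge0 ?E1.
rewrite /= (le_trans (vnD _ _))//.
have h := vint_op_le t01 (vn_ge0 w0) (vpc_picard n) IH.
rewrite (le_trans (lerD (lexx _) h))// -[X in X + _]mulr1 -mulrDr ler_wpM2l ?vn_ge0//.
by have := E1 t0; lra.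
Qed.

Lemma picardB_le n t : 0 <= t <= 1 ->
  vn (picard n.+1 t - picard n t) <= vn w0 * 2^-1 ^+ n * E t.
Proof.
elim: n t => [|n IH] t t01; have /andP[t0 t1] := t01.
  have h := vint_op_le t01 (vn_ge0 w0) (vpc_cst w0 0 1) (picard_le 0).
  rewrite /= [w0 + _]addrC addrK (le_trans h)// expr0 mulr1 ler_wpM2l ?vn_ge0//.
  by have := E1 t0; lra.
rewrite /= [w0 + _]addrC opprD addrA addrK -vintB//; last 2 first.
  exact: (vpc_sub (lexx 0) t1 (vpc_op n.+1)).
  exact: (vpc_sub (lexx 0) t1 (vpc_op n)).
have [opl opr] := bop.
rewrite (_ : (fun u => _) = fun u => op (a u) (picard n.+1 u - picard n u)); last first.
  apply/funext => u; have := opr (a u) (-1) (picard n u) (picard n.+1 u).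
  by rewrite !scaleN1r ![- _ + _]addrC.
have D0 : 0 <= vn w0 * 2^-1 ^+ n by rewrite mulr_ge0 ?vn_ge0// exprn_ge0.
have pB : vpc 0 1 (fun u => picard n.+1 u - picard n u) by apply: vpcB; exact: vpc_picard.
rewrite (le_trans (vint_op_le t01 D0 pB IH))// exprS; have := E1 t0.
have -> : vn w0 * (2^-1 * 2^-1 ^+ n) * E t = vn w0 * 2^-1 ^+ n * (E t / 2) by field.
by move=> ?; rewrite ler_wpM2l//; lra.
Qed.

(** Besides existence it records a bound depending only on K, M and the initial value, needed for
    families of fields, and the rate of convergence of the iterates, needed when these are confined
    to a subspace. *)
Lemma linear_ode : exists g : R -> W, [/\ g 0 = w0,
  vprim 0 1 g (fun t => op (a t) (g t)),
  forall t, 0 <= t <= 1 -> vn (g t) <= vn w0 * expR (2 * (K * M)) &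
  exists C, forall n t, 0 <= t <= 1 -> vn (g t - picard n t) <= C * 2^-1 ^+ n].
Proof.
have Et t : 0 <= t <= 1 -> E t <= E 1.
  by move=> /andP[_ t1]; rewrite ler_expR ler_wpM2l ?mulr_ge0.
pose C := vn w0 * E 1.
have C0 : 0 <= C by rewrite mulr_ge0 ?vn_ge0// expR_ge0.
have hB n t : 0 <= t <= 1 -> vn (picard n.+1 t - picard n t) <= C * 2^-1 ^+ n.
  move=> t01; rewrite (le_trans (picardB_le n t01))// /C mulrAC.
  rewrite ler_wpM2r ?exprn_ge0// ler_wpM2l ?vn_ge0//; exact: Et.
have ex tj : exists lim : R, 0 <= tj.1 <= 1 -> forall n,
    `|lim - crd (tj.2 : 'I_(\dim {:W})) (picard n tj.1)| <= 2 * C * 2^-1 ^+ n.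
  case: tj => t j /=; have [t01|nt] := boolP (0 <= t <= 1); last by exists 0.
  have [|lim hlim] := @geometric_cvg (fun n => crd j (picard n t)) C; last by exists lim.
  by move=> n; rewrite -crdB (le_trans (crd_vn _ _))// hB.
have [L hL] := choice ex.
pose g t := of_crd (fun j => L (t, j)) : W.
pose C' := (\dim {:W})%:R * (2 * C).
have gP n t : 0 <= t <= 1 -> vn (g t - picard n t) <= C' * 2^-1 ^+ n.
  move=> t01; rewrite /vn /C' -mulrA mulr_natl -[X in _ *+ X](card_ord (\dim {:W})) -sumr_const.
  apply: ler_sum => j _; rewrite crdB of_crdK.
  exact: (hL (t, j)).
have C'0 : 0 <= C' by apply: mulr_ge0; [exact: ler0n|apply: mulr_ge0; [exact: ler0n|exact: C0]].
have g_le t : 0 <= t <= 1 -> vn (g t) <= vn w0 * E 1.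
  move=> t01; apply: (@le_geometric _ _ C') => n.
  rewrite -(subrK (picard n t) (g t)) (le_trans (vnD _ _))// addrC lerD// ?gP//.
  by rewrite (le_trans (picard_le n t01))// ler_wpM2l ?vn_ge0// Et.
(* Lipschitz bounds uniform in [n] pass to the limit. They make [g] continuous, which is needed
   before it can be put under the integral. *)
have pic_lip n s t : 0 <= s -> s <= t -> t <= 1 -> vn (picard n t - picard n s) <= l * C * (t - s).
  case: n => [|n] s0 st t1.
    by rewrite /= subrr vn0; apply: mulr_ge0; [apply: mulr_ge0; [exact: l0|exact: C0]|rewrite subr_ge0].
  have pO := vpc_op n.
  rewrite /= (vint_chasles (c := s)) ?s0//; last exact: (vpc_sub (lexx 0) t1 pO).
  rewrite addrDBK.
  apply: vint_bound => //; have [S h] := pa; have [T k] := vpc_picard n.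
  have [M' [U hU]] := pO.
  exists (S ++ U) => u /andP[su ut]; rewrite mem_cat negb_or => /andP[uS uU].
  have u0 : 0 < u := le_lt_trans s0 su; have u1 : u < 1 := lt_le_trans ut t1.
  have [aM _] : vn (a u) <= M /\ vcts a u by apply: h; rewrite ?u0.
  have [_ ?] := hU u (introT andP (conj u0 u1)) uU; split => //.
  rewrite (le_trans (hK _ _))// ler_pM ?mulr_ge0 ?vn_ge0// ?ler_wpM2l//.
  rewrite (le_trans (picard_le n _)) ?(ltW u0) ?(ltW u1)// ler_wpM2l ?vn_ge0//.
  by rewrite Et// (ltW u0) ltW.
have g_lip s t : 0 <= s -> s <= t -> t <= 1 -> vn (g t - g s) <= l * C * (t - s).
  move=> s0 st t1; apply: (@le_geometric _ _ (2 * C')) => n.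
  rewrite (subr4 (g t) (g s) (picard n t) (picard n s)).
  rewrite (le_trans (vnD _ _))// lerD ?pic_lip// (le_trans (vnB _ _))//.
  rewrite -mulrA mulr2n mulrDl !mul1r lerD// gP// ?s0 ?(le_trans st t1)// ?t1 ?andbT.
  exact: le_trans st.
have pg : vpc 0 1 g.
  exists (vn w0 * E 1), [::] => t /andP[t0 t1] _; split; first by rewrite g_le// !ltW.
  apply: (@vcvg_squeeze _ _ _ _ _ _ _ (fun u => l * C * `|u - t|)).
    near=> u; have /andP[u0 u1] : 0 < u < 1 by near: u; apply: near_itvoo; rewrite t0.
    have [tu|ut] := leP t u.
      by rewrite (ger0_norm (_ : 0 <= u - t)) ?subr_ge0// g_lip// ltW.
    by rewrite -vnN opprB distrC (ger0_norm (_ : 0 <= t - u)) ?subr_ge0 ?(ltW ut)// g_lip// ltW.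
  rewrite -[X in _ --> X](mulr0 (l * C)); apply: cvgMr.
  rewrite -(normr0 R) -(subrr t); apply: cvg_norm; apply: cvgB; [exact: cvg_id|exact: cvg_cst].
have pOg : vpc 0 1 (fun u => op (a u) (g u)) by apply: vpc_bil => //; exists M.
have gE t : 0 <= t <= 1 -> g t = w0 + vintegral 0 t (fun u => op (a u) (g u)).
  move=> t01; have /andP[t0 t1] := t01.
  apply/eqP; rewrite -subr_eq0; apply/eqP; apply: vn_eq0.
  apply/eqP; rewrite eq_le vn_ge0 andbT.
  apply: (@le_geometric _ _ (C' + C' * E 1)) => n; rewrite add0r.
  rewrite -(subrK (picard n.+1 t) (g t)) -addrA (le_trans (vnD _ _))// mulrDl lerD//.
    rewrite (le_trans (gP n.+1 t t01))// ler_wpM2l// exprS ler_piMl ?exprn_ge0//; lra.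
  rewrite /= opprD addrACA subrr add0r -vintB//; last 2 first.
    exact: (vpc_sub (lexx 0) t1 (vpc_op n)).
    exact: (vpc_sub (lexx 0) t1 pOg).
  have [opl opr] := bop.
  rewrite (_ : (fun u => _) = fun u => op (a u) (picard n u - g u)); last first.
    apply/funext => u; have := opr (a u) (-1) (g u) (picard n u).
    by rewrite !scaleN1r ![- _ + _]addrC.
  have D0 : 0 <= C' * 2^-1 ^+ n by rewrite mulr_ge0// exprn_ge0.
  have pB : vpc 0 1 (fun u => picard n u - g u) by apply: vpcB => //; exact: vpc_picard.
  rewrite (le_trans (vint_op_le t01 D0 pB _))//.
    move=> u u01; have /andP[u0 _] := u01.
    rewrite -vnN opprB (le_trans (gP n u u01))// ler_peMr// E1//.
  rewrite [leRHS]mulrAC ler_wpM2l//.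
  by have := Et _ t01; have := E1 t0; lra.
have g0 : g 0 = w0 by have := gE 0; rewrite lexx ler01 => /(_ isT) ->; rewrite vint_point addr0.
exists g; split=> //.
- by split=> // t t01; rewrite g0; exact: gE.
- by move=> t t01; rewrite (le_trans (g_le t t01))// /E mulr1.
- by exists C'.
Unshelve. all: by end_near. Qed.

End Picard.
End LinearODE.

Section Subspaces.
Variables (R : realType) (U : vectType R) (P : U -> Prop).
Hypotheses (P0 : P 0) (Plin : forall a u v, P u -> P v -> P (a *: u + v)).

Local Notation q := (@projq R U (subspace_of P)).

(** Being the kernel of a linear map, the subspace is stable under limits and integrals, with no
    appeal to a topology on the space. *)
Lemma subspace_projP u : P u <-> q u = 0.
Proof.
split=> [Pu|qu].
  apply/eqP; rewrite -(linear0 q) projq_eq subr0; exact/subspace_ofP.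
by apply/subspace_ofP => //; rewrite -[u]subr0 -projq_eq qu linear0.
Qed.

Lemma subspace_vcvg (T : Type) (G : set_system T) {PG : ProperFilter G} (F : T -> U) f :
  (\forall x \near G, P (F x)) -> vcvg G F f -> P f.
Proof.
move=> PF cF; apply/subspace_projP; apply: (vcvg_unique (vcvg_lin q cF)).
generalize (vcvg_cst G (0 : quotv (subspace_of P))); apply: vcvg_near.
by apply: filterS PF => x /subspace_projP h; symmetry.
Qed.

Lemma subspace_vint a b (F : R -> U) (S : seq R) : a <= b -> vpc a b F ->
  (forall t, a < t < b -> t \notin S -> P (F t)) -> P (vintegral a b F).
Proof.
move=> ab pF PF; apply/subspace_projP; rewrite -(vint_lin q)//.
rewrite (eq_vint_off (G := fun=> 0) (S := S)) ?vint0//; first exact: (vpc_lin q).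
by move=> t tab tS; apply/subspace_projP; exact: PF.
Qed.

End Subspaces.

(** * Evolution operators of linear equations *)

Section Evolution.
Variables (R : realType) (V : vectType R).
Local Notation E := 'End(V).
Implicit Types (a b g : R -> E).

Lemma bil_comp : bil (fun f g : E => (f \o g)%VF).
Proof.
split=> [v a u u'|u a v v']; apply/lfunP => x.
  by rewrite !(add_lfunE, scale_lfunE, comp_lfunE).
by rewrite !(add_lfunE, scale_lfunE, comp_lfunE) linearP.
Qed.

Lemma bil_Ncomp : bil (fun f g : E => - (f \o g)%VF).
Proof.
have [l r] := bil_comp; split=> [v a u u'|u a v v']; rewrite ?l ?r opprD scalerN //.
Qed.

Lemma bil_compC : bil (fun f g : E => (g \o f)%VF).
Proof. by have [l r] := bil_comp. Qed.

Lemma vn_comp : exists2 K, 0 <= K & forall u v : E, vn (u \o v)%VF <= K * vn u * vn v.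
Proof. exact: (vn_bil bil_comp). Qed.

Definition is_evo a g := g 0 = \1%VF /\ vprim 0 1 g (fun t => - (a t \o g t)%VF).

Definition evo a : R -> E := xget (fun=> \1%VF) [set g | is_evo a g].

Definition evi a (t : R) : E := (evo a t)^-1%VF.

(** The inverse comes from solving q' = q a separately: the product of [q] with the evolution is
    constant, so [q] is a left inverse, and a two-sided one in finite dimension. [K] depends only on
    the space and the bounds only on that of the field, as families of fields require. *)
Lemma evo_spec : exists2 K, 0 <= K & forall M a, 0 <= M -> vpcb M 0 1 a ->
  [/\ is_evo a (evo a), evi a 0 = \1%VF /\ vprim 0 1 (evi a) (fun t => (evi a t \o a t)%VF),
   forall t, 0 <= t <= 1 -> (evo a t \o evi a t = \1)%VF /\ (evi a t \o evo a t = \1)%VF &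
   forall t, 0 <= t <= 1 -> vn (evo a t) <= K * expR (K * M) /\ vn (evi a t) <= K * expR (K * M)].
Proof.
have [K K0 hK] := vn_comp.
have hK' (u v : E) : vn (- (u \o v)%VF) <= K * vn u * vn v by rewrite vnN hK.
have hK'' (u v : E) : vn (v \o u)%VF <= K * vn u * vn v by rewrite mulrAC hK.
have I0 := vn_ge0 (\1%VF : E).
exists (vn (\1%VF : E) + 2 * K); first by rewrite addr_ge0// mulr_ge0.
move=> M a M0 pa.
have pca : vpc 0 1 a by exists M.
have [g [g0 pg gM _]] := linear_ode bil_Ncomp K0 M0 hK' (\1%VF : E) pa.
have [q [q0 pq qM _]] := linear_ode bil_compC K0 M0 hK'' (\1%VF : E) pa.
have : is_evo a (evo a) by apply: (@xgetPex _ _ [set g | is_evo a g]); exists g.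
move=> eP; split => //.
all: have [e0 pe] := eP.
all: have ge t : 0 <= t <= 1 -> (q t \o evo a t = \1)%VF by
  move=> t01; have h : forall t, 0 < t < 1 -> t \notin [::] ->
    (q t \o a t \o evo a t)%VF + (q t \o - (a t \o evo a t))%VF = 0 by
    [move=> u _ _; rewrite comp_lfunNr comp_lfunA subrr];
  rewrite (vprim_const ler01 h (vprim_bil ler01 bil_comp pq pe))// q0 e0 comp_lfun1l.
all: have inv t : 0 <= t <= 1 -> q t = evi a t /\ lker (evo a t) == 0%VS by
  move=> t01; have k0 : lker (evo a t) == 0%VS by
    [apply/lker0P => x y xy;
     rewrite -[x]id_lfunE -[y]id_lfunE -(ge t t01) !comp_lfunE /= xy];
  split => //; rewrite -[q t]comp_lfun1r -(lker0_compfV k0) comp_lfunA ge// comp_lfun1l.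
- split.
    by rewrite -(inv 0 _).1// lexx ler01.
  apply: (vprim_eq (S := [::]) ler01 _ _ pq) => t; first by move=> /inv[].
  by move=> /andP[t0 t1] _; rewrite -(inv t _).1// !ltW.
- move=> t /inv[qE k0]; split; first exact: lker0_compfV.
  exact: lker0_compVf.
- have ebound x : x <= vn (\1%VF : E) * expR (2 * (K * M)) ->
      x <= (vn (\1%VF : E) + 2 * K) * expR ((vn (\1%VF : E) + 2 * K) * M).
    move=> /le_trans; apply; rewrite ler_pM ?expR_ge0// ?lerDl ?mulr_ge0//.
    by rewrite ler_expR [leRHS]mulrDl -(mulrA 2) lerDr mulr_ge0.
  move=> t t01; split; apply: ebound; last by have [<- _] := inv t t01; exact: qM.
  have -> : evo a t = g t; last exact: gM.
  have h : forall t, 0 < t < 1 -> t \notin [::] ->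
    (q t \o a t \o g t)%VF + (q t \o - (a t \o g t))%VF = 0.
    by move=> u _ _; rewrite comp_lfunNr comp_lfunA subrr.
  have qg : (q t \o g t = \1)%VF.
    by rewrite (vprim_const ler01 h (vprim_bil ler01 bil_comp pq pg))// q0 g0 comp_lfun1l.
  have [qE k0] := inv t t01.
  by rewrite -[LHS]comp_lfun1r -qg comp_lfunA qE lker0_compfV// comp_lfun1l.
Qed.

Section OneField.
Variable a : R -> E.
Hypothesis pa : vpc 0 1 a.

Let spec : [/\ is_evo a (evo a), evi a 0 = \1%VF /\ vprim 0 1 (evi a) (fun t => (evi a t \o a t)%VF) &
   forall t, 0 <= t <= 1 -> (evo a t \o evi a t = \1)%VF /\ (evi a t \o evo a t = \1)%VF].
Proof.
have [K K0 h] := evo_spec; have [M hM] := pa.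
by have [] := h M a (vpcb_ge0 ltr01 hM) hM.
Qed.

Lemma evo0 : evo a 0 = \1%VF. Proof. by have [[]] := spec. Qed.
Lemma evi0 : evi a 0 = \1%VF. Proof. by have [_ []] := spec. Qed.
Lemma evo_prim : vprim 0 1 (evo a) (fun t => - (a t \o evo a t)%VF).
Proof. by have [[]] := spec. Qed.
Lemma evi_prim : vprim 0 1 (evi a) (fun t => (evi a t \o a t)%VF).
Proof. by have [_ []] := spec. Qed.
Lemma evoK t : 0 <= t <= 1 -> (evi a t \o evo a t = \1)%VF.
Proof. by have [_ _ h] := spec => /h[]. Qed.
Lemma eviK t : 0 <= t <= 1 -> (evo a t \o evi a t = \1)%VF.
Proof. by have [_ _ h] := spec => /h[]. Qed.

(** A solution on a subinterval is the transport of its own value at the left end. A path made of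
    several stretches is treated one stretch at a time in this way. *)
Lemma evo_unique p q (k kd : R -> E) (S : seq R) : 0 <= p -> p <= q -> q <= 1 ->
  (forall t, p < t < q -> t \notin S -> kd t = - (a t \o k t)%VF) ->
  vprim p q k kd ->
  forall t, p <= t <= q -> (evo a t \o (evi a p \o k p))%VF = k t.
Proof.
move=> p0 pq q1 kdE pk t tpq; have /andP[pt tq] := tpq.
have p1 : p <= 1 := le_trans pq q1.
have t01 : 0 <= t <= 1 by rewrite (le_trans p0 pt) (le_trans tq q1).
have h : forall t, p < t < q -> t \notin S ->
    (evi a t \o a t \o k t)%VF + (evi a t \o kd t)%VF = 0.
  by move=> u upq uS; rewrite kdE// comp_lfunNr comp_lfunA subrr.
have pe := vprim_sub p0 pq q1 evi_prim.
rewrite -(vprim_const pq h (vprim_bil pq bil_comp pe pk) tpq) comp_lfunA eviK//.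
by rewrite comp_lfun1l.
Qed.

End OneField.

(** Variation of constants: [evi a u \o evo b u] has derivative
    [evi a u \o (a u - b u) \o evo b u]. *)
Lemma evo_diff a b t : vpc 0 1 a -> vpc 0 1 b -> 0 <= t <= 1 ->
  evo b t - evo a t = (evo a t \o vintegral 0 t (fun u => evi a u \o (a u - b u) \o evo b u))%VF.
Proof.
move=> pa pb t01; have p := vprim_bil ler01 bil_comp (evi_prim pa) (evo_prim pb).
have pd : vprim 0 1 (fun u => (evi a u \o evo b u)%VF) (fun u => (evi a u \o (a u - b u) \o evo b u)%VF).
  apply: (vprim_eq (S := [::]) ler01 _ _ p) => // u _ _.
  by rewrite comp_lfunDr comp_lfunDl !comp_lfunNr comp_lfunNl -!comp_lfunA.
have [_ /(_ t t01)] := pd; rewrite evi0// evo0// comp_lfun1l => h.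
rewrite (_ : vintegral _ _ _ = (evi a t \o evo b t)%VF - \1%VF); last by rewrite h addrC addKr.
by rewrite comp_lfunDr comp_lfunNr comp_lfun1r comp_lfunA eviK// comp_lfun1l.
Qed.

Lemma evi_diff a b t : vpc 0 1 a -> vpc 0 1 b -> 0 <= t <= 1 ->
  evi b t - evi a t = (vintegral 0 t (fun u => evi b u \o (b u - a u) \o evo a u) \o evi a t)%VF.
Proof.
move=> pa pb t01; have h := evo_diff pb pa t01.
have -> : evi b t - evi a t = (evi b t \o (evo a t - evo b t) \o evi a t)%VF.
  rewrite comp_lfunDr comp_lfunNr comp_lfunDl comp_lfunNl evoK// comp_lfun1l.
  by rewrite -comp_lfunA eviK// comp_lfun1r.
by rewrite h comp_lfunA evoK// comp_lfun1l.
Qed.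

(** Transport is Lipschitz in the field for the L^1 distance, uniformly over fields with the same
    bound. Pointwise convergence of fields off exceptional times then gives, by dominated
    convergence, the continuity of transports in parameters. *)
Lemma evo_dist M : 0 <= M -> exists2 C, 0 <= C & forall a b, vpcb M 0 1 a -> vpcb M 0 1 b ->
  forall t, 0 <= t <= 1 ->
  [/\ vn (evo a t) <= C, vn (evi a t) <= C,
      vn (evo a t - evo b t) <= C * ig 0 1 (fun u => vn (a u - b u)) &
      vn (evi a t - evi b t) <= C * ig 0 1 (fun u => vn (a u - b u))].
Proof.
move=> M0; have [K K0 hE] := evo_spec; have [L L0 hL] := vn_comp.
pose B := K * expR (K * M); have B0 : 0 <= B by rewrite mulr_ge0// expR_ge0.
pose C := L ^+ 3 * B ^+ 3; have C0 : 0 <= C by rewrite mulr_ge0// exprn_ge0.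
exists (B + C); first exact: addr_ge0.
move=> a b ha hb t t01; have [_ _ _ eB] := hE _ _ M0 ha; have [_ _ _ fB] := hE _ _ M0 hb.
have pa : vpc 0 1 a by exists M.
have pb : vpc 0 1 b by exists M.
have /andP[t0 t1] := t01.
have [eaB iaB] := eB t t01.
have tri (f g h : E) x : vn f <= B -> vn h <= B -> vn g <= x -> vn (f \o g \o h)%VF <= L ^+ 2 * B ^+ 2 * x.
  move=> fB' hB gx; rewrite (le_trans (hL _ _))//.
  rewrite (le_trans (ler_wpM2r (vn_ge0 _) (ler_wpM2l L0 (hL f g))))//.
  have -> : L ^+ 2 * B ^+ 2 * x = L * (L * B * x) * B by ring.
  by rewrite ler_pM ?mulr_ge0 ?vn_ge0// ler_wpM2l// ler_pM ?mulr_ge0 ?vn_ge0// ler_wpM2l.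
have intB (x y : R -> E) (d : R -> E) : (forall u, 0 <= u <= 1 -> vn (x u) <= B) ->
    (forall u, 0 <= u <= 1 -> vn (y u) <= B) ->
    vpc 0 1 x -> vpc 0 1 y -> vpc 0 1 d ->
    vn (vintegral 0 t (fun u => x u \o d u \o y u)%VF) <= L ^+ 2 * B ^+ 2 * ig 0 1 (fun u => vn (d u)).
  move=> xB yB px py pd.
  have pxdy : vpc 0 t (fun u => x u \o d u \o y u)%VF.
    by apply: (vpc_sub (lexx 0) t1); apply: (vpc_bil bil_comp) => //; exact: (vpc_bil bil_comp).
  have pvd : pc 0 1 (fun u => vn (d u)) by exact: pc_vn.
  rewrite (le_trans (vint_norm t0 pxdy))// (@le_trans _ _ (ig 0 t (fun u => L ^+ 2 * B ^+ 2 * vn (d u))))//.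
    apply: (ig_le (S := [::])) => //; first exact: pc_vn.
      by apply: pc_mul; [exact: pc_cst|exact: pc_sub pvd].
    move=> u /andP[u0 ut] _; have u01 : 0 <= u <= 1 by rewrite ltW//= ltW// (lt_le_trans ut).
    by apply: tri; [exact: xB|exact: yB|].
  rewrite ig_scale//; last exact: pc_sub pvd.
  rewrite ler_wpM2l ?mulr_ge0 ?exprn_ge0//.
  rewrite (ig_chasles (a := 0) (b := 1) (c := t))// lerDl.
  by apply: Rintegral_ge0 => u _; exact: vn_ge0.
have vnC (x y : R -> E) : (fun u => vn (x u - y u)) = (fun u => vn (y u - x u)).
  by apply/funext => u; rewrite -vnN opprB.
have ig0 : 0 <= ig 0 1 (fun u => vn (a u - b u)).
  by apply: Rintegral_ge0 => u _; exact: vn_ge0.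
have fin x : vn x <= L * B * (L ^+ 2 * B ^+ 2 * ig 0 1 (fun u => vn (a u - b u))) ->
    vn (x : E) <= (B + C) * ig 0 1 (fun u => vn (a u - b u)).
  move=> /le_trans; apply; have -> : L * B * (L ^+ 2 * B ^+ 2 * ig 0 1 (fun u => vn (a u - b u))) = C * ig 0 1 (fun u => vn (a u - b u)) by rewrite /C; ring.
  by rewrite ler_wpM2r// lerDr.
have pev c : vpc 0 1 c -> vpc 0 1 (evo c) by move=> pc'; exact: (vprim_pc ler01 (evo_prim pc')).
have pei c : vpc 0 1 c -> vpc 0 1 (evi c) by move=> pc'; exact: (vprim_pc ler01 (evi_prim pc')).
split; [by rewrite (le_trans eaB)// lerDl|by rewrite (le_trans iaB)// lerDl| |].
- apply: fin; rewrite -vnN opprB (evo_diff pa pb t01) (le_trans (hL _ _))//.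
  rewrite ler_pM ?mulr_ge0 ?vn_ge0// ?ler_wpM2l//.
  apply: (intB (evi a) (evo b) (fun u => a u - b u)) => //; try by [exact: pei|exact: pev|exact: vpcB].
    by move=> u /eB[].
  by move=> u /fB[].
- apply: fin; rewrite (evi_diff pb pa t01) (le_trans (hL _ _))//.
  have [_ ibB] := fB t t01.
  rewrite [leLHS]mulrAC ler_pM ?mulr_ge0 ?vn_ge0// ?ler_wpM2l//.
  apply: (intB (evi a) (evo b) (fun u => a u - b u)) => //; try by [exact: pei|exact: pev|exact: vpcB].
    by move=> u /eB[].
  by move=> u /fB[].
Qed.

(** The Picard iterates stay in the subspace, hence so does their limit. Applied to cochain maps of
    degree 0, it keeps transports of the connection among them. *)
Lemma evo_subspace (P : E -> Prop) a : P 0 -> (forall k u v, P u -> P v -> P (k *: u + v)) ->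
  P \1%VF -> (forall t u, P u -> P (a t \o u)%VF) -> vpc 0 1 a ->
  forall t, 0 <= t <= 1 -> P (evo a t).
Proof.
move=> P0 Plin P1 Pa pa t t01; have [M hM] := pa.
have [K K0 hK] := vn_comp.
have hK' (u v : E) : vn (- (u \o v)%VF) <= K * vn u * vn v by rewrite vnN hK.
have M0 := vpcb_ge0 ltr01 hM.
have [g [g0 pg gM [C hC]]] := linear_ode bil_Ncomp K0 M0 hK' (\1%VF : E) hM.
have PN u : P u -> P (- u).
  by move=> Pu; rewrite -[- u]addr0 -scaleN1r; exact: Plin.
have -> : evo a t = g t.
  have := @evo_unique a pa 0 1 g _ [::] (lexx _) ler01 (lexx _) _ pg t t01 => <- //.
  by rewrite evi0// g0 !comp_lfun1r.
have Pp n u : 0 <= u <= 1 -> P (picard (fun f g : E => - (f \o g)%VF) a \1%VF n u).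
  elim: n u => [|n IH] u /andP[u0 u1] //=.
  rewrite -[X in X + _]scale1r; apply: (Plin) => //.
  apply: (subspace_vint P0 Plin (S := [::])) => //.
    apply: (vpc_sub (lexx 0) u1); apply: (vpc_bil bil_Ncomp) => //.
    exact: (vpc_picard bil_Ncomp _ hM).
  move=> v /andP[v0 vu] _; apply: PN; apply: Pa; apply: IH.
  by rewrite ltW//= ltW// (lt_le_trans vu).
apply: (subspace_vcvg P0 Plin (G := \oo) (F := fun n => picard (fun f g : E => - (f \o g)%VF) a \1%VF n t)).
  by near=> n; exact: Pp.
apply: (vcvg_squeeze (e := fun n => C * 2^-1 ^+ n)).
  by near=> n; rewrite -vnN opprB hC.
rewrite -[X in _ --> X](mulr0 C); apply: cvgMr; apply: cvg_expr.
by rewrite ger0_norm//; lra.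
Unshelve. all: by end_near. Qed.

End Evolution.

(** * Smooth maps, and their pieces on the unit square *)

Section C1Calculus.
Variable R : realType.

Lemma is_vderive_on_line (X : normedModType R) (W : vectType R) (F : X -> W) p d (u : R) w :
  is_vderive F (u *: d + p) d w -> is_vderive (fun h : R^o => F (h *: d + p)) u 1 w.
Proof.
move=> /is_vderiveP h; apply/is_vderiveP; move: h; apply: vcvg_near; near=> e.
by rewrite scalerDl -addrA /GRing.scale/= mulr1.
Unshelve. all: by end_near. Qed.

Lemma vcts_within (W : vectType R) (F : R -> W) (K : set R^o) :
  (forall t, K t -> vcts F t) -> vcontinuous K F.
Proof.
move=> h j; apply/subspace_continuousP => t Kt.
by apply: cvg_within_filter; exact: (h t Kt j).
Qed.

(** Only directional derivatives are required, each continuous in the point for a fixed direction;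
    their linearity in the direction and the chain rule are consequences. *)
Definition C1at (X : normedModType R) (W : vectType R) (F : X -> W) (q : X) :=
  \forall p \near q, vcvg (nbhs p) F (F p) /\ forall v,
    is_vderive F p v (vderive F p v) /\ vcvg (nbhs p) (fun x => vderive F x v) (vderive F p v).

Lemma C1at_near (X : normedModType R) (W : vectType R) (F : X -> W) q :
  C1at F q -> \forall p \near q, C1at F p.
Proof. by move=> h; apply: near_join. Qed.

Lemma C1at_smooth (X : normedModType R) (W : vectType R) (F : X -> W) (U : set X) q :
  nbhs q U -> is_smooth U F -> C1at F q.
Proof.
move=> qU sF; near=> p; have Up : U p by near: p.
have h j := sF 1%N j.
have dF v x : U x -> is_vderive F x v (vderive F x v).
  by move=> Ux; apply: vderive_is_vderive => j; have [_ /(_ v)[]] := h j; move=> /(_ _ Ux).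
split=> [j|v]; first by have [c _] := h j; exact: (c p Up).
split; first exact: dF.
move=> j; rewrite /vderive of_crdK; under eq_fun do rewrite of_crdK.
by have [_ /(_ v)[_ [/(_ p Up)]]] := h j.
Unshelve. all: by end_near. Qed.

Lemma vcvg_topo_lt (n : nat) (T : Type) (G : set_system T) {FG : Filter G} (F : T -> 'rV[R]_n) z e :
  vcvg G F z -> 0 < e -> \forall t \near G, `|F t - z| < e.
Proof.
move=> cF e0.
(* The added 1 keeps the constant positive in dimension 0. *)
pose C := \sum_(k < \dim {:'rV[R]_n}) `|(vbasis {:'rV[R]_n})`_k| + 1.
have C0 : 0 < C by rewrite ltr_wpDl// sumr_ge0.
have eC : 0 < e / (2 * C) by rewrite divr_gt0// mulr_gt0.
apply: filterS (vcvg_vn_le cF eC) => t h.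
rewrite (sum_crd (F t - z)); apply: le_lt_trans (ler_norm_sum _ _ _) _.
apply: (@le_lt_trans _ _ (vn (F t - z) * C)); last first.
  rewrite -ltr_pdivlMr//; apply: le_lt_trans h _.
  by rewrite invfM mulrA ltr_pM2r ?invr_gt0// ltr_pdivrMr// ltr_pMr// ltr1n.
rewrite mulrDr mulr1 mulr_sumr -[X in X <= _]addr0 lerD ?vn_ge0//.
by apply: ler_sum => k _; rewrite normrZ ler_wpM2r// crd_vn.
Qed.

Lemma vcvg_topo (n : nat) (T : Type) (G : set_system T) {FG : Filter G} (F : T -> 'rV[R]_n) z :
  vcvg G F z -> F t @[t --> G] --> z.
Proof.
move=> cF; apply/cvgrPdist_lt => e e0; apply: filterS (vcvg_topo_lt cF e0) => t.
by rewrite distrC.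
Qed.

Section Chain.
Variables (n : nat) (W : vectType R) (g : 'rV[R]_n -> W).
Local Notation B := (vbasis {:'rV[R]_n}).
Local Notation N := (\dim {:'rV[R]_n}).

(** A mean value inequality along [v], uniform in the base point [p]: the chain rule applies it at
    base points that move with the increment. *)
Lemma C1at_increment z0 v : C1at g z0 -> forall eta, 0 < eta -> \forall r \near 0^'+, forall p (s : R),
  `|p - z0| < r -> `|s *: v + p - z0| < r ->
  vn (g (s *: v + p) - g p - s *: vderive g z0 v) <= eta * `|s|.
Proof.
move=> Cg eta eta0.
have [cg0 /(_ v)[dg0 cd0]] := nbhs_singleton Cg.
have hb : \forall p \near z0, [/\ is_vderive g p v (vderive g p v), vcvg (nbhs p) g (g p),
   vcvg (nbhs p) (fun x => vderive g x v) (vderive g p v) & vn (vderive g p v - vderive g z0 v) <= eta].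
  near=> p.
  have [cg /(_ v)[dg cd]] : vcvg (nbhs p) g (g p) /\ forall v,
    is_vderive g p v (vderive g p v) /\ vcvg (nbhs p) (fun x => vderive g x v) (vderive g p v).
    by near: p; exact: Cg.
  split => //; near: p.
  exact: (vcvg_vn_le cd0 eta0).
have /nbhs_ballP[r0 /= r00 hr0] := hb.
near=> r => p s pr sr.
have rr0 : r <= r0 by near: r; exact: nbhs_right_le.
have seg (u : R) : 0 <= u <= 1 -> ball z0 r0 (u *: (s *: v) + p).
  move=> /andP[u0 u1]; rewrite -ball_normE /= distrC.
  have -> : u *: (s *: v) + p - z0 = u *: (s *: v + p - z0) + (1 - u) *: (p - z0).
    rewrite scalerBl scale1r -[s *: v + p - z0]addrA scalerDr.
    by rewrite [p - z0 - _]addrC addrA addrK addrA.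
  apply: lt_le_trans rr0; apply: le_lt_trans (ler_normD _ _) _.
  rewrite !normrZ ger0_norm// ger0_norm ?subr_ge0//.
  have [->|u0'] := eqVneq u 0; first by rewrite mul0r add0r subr0 mul1r.
  have up : 0 < u by rewrite lt_neqAle eq_sym u0'.
  have -> : r = u * r + (1 - u) * r by ring.
  by rewrite ltr_leD// ?ltr_pM2l// ler_wpM2l ?subr_ge0// ltW.
pose F u := g (u *: (s *: v) + p) - (u * s) *: vderive g z0 v.
pose f u := s *: (vderive g (u *: (s *: v) + p) v - vderive g z0 v).
have [->|s0] := eqVneq s 0.
  by rewrite scale0r add0r scale0r subrr subr0 vn0 normr0 mulr0.
have line_cts (u : R) : u *: (s *: v) + p @[u --> u] --> u *: (s *: v) + p.
  by apply: cvgD; [apply: cvgZr_tmp; exact: cvg_id|exact: cvg_cst].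
have ctsF u : 0 <= u <= 1 -> vcts F u.
  move=> u01; have [_ cg _ _] := hr0 _ (seg u u01).
  apply: vcvgB; first exact: (vcvg_comp (line_cts u) cg).
  by apply: vcvgZ; [apply: cvgMl; exact: cvg_id|exact: vcvg_cst].
have bf : vpcb (eta * `|s|) 0 1 f.
  exists [::] => u /andP[u0 u1] _; have [_ _ cd le] := hr0 _ (seg u (introT andP (conj (ltW u0) (ltW u1)))).
  split; first by rewrite vnZ mulrC ler_wpM2r.
  by apply: vcvgZl; apply: vcvgB; [exact: (vcvg_comp (line_cts u) cd)|exact: vcvg_cst].
have pF : vprim 0 1 F f.
  apply/vprimP => //; split; first by exists (eta * `|s|).
    by apply: vcts_within => u; rewrite /= in_itv/=; exact: ctsF.
  exists [::] => u /andP[u0 u1] _; have [dg _ _ _] := hr0 _ (seg u (introT andP (conj (ltW u0) (ltW u1)))).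
  rewrite /f scalerBr; apply: is_vderiveB.
    apply: is_vderive_on_line; apply/is_vderiveP; move/is_vderiveP: dg => dg.
    have ck : h * s @[h --> (0:R)^'] --> (0:R)^'.
      move=> A; rewrite !/nbhs/= !/nbhs/= => hA.
      have c0 : h * s @[h --> (0:R)^'] --> (0 : R).
        rewrite -[X in _ --> X](mul0r s); apply: cvgMl.
        by apply: cvg_within_filter; exact: cvg_id.
      have hA' := c0 _ hA.
      change (\forall h \near (0:R)^', h * s != 0 -> A (h * s)) in hA'.
      change (\forall h \near (0:R)^', A (h * s)); near=> h.
      have : h * s != 0 -> A (h * s) by near: h; exact: hA'.
      by apply; rewrite mulf_neq0//; near: h; exact: nbhs_dnbhs_neq.
    generalize (vcvgZl s (vcvg_comp ck dg)); apply: vcvg_near.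
    have e1 (h : R) : s * (h * s)^-1 = h^-1 by rewrite invfM mulrCA mulfV// mulr1.
    by near=> h; rewrite /= (scalerA h s v) [LHS]scalerA e1.
  apply/is_vderiveP; generalize (vcvg_cst (0:R)^' (s *: vderive g z0 v)); apply: vcvg_near.
  near=> h; have h0 : h != 0 by near: h; exact: nbhs_dnbhs_neq.
  by rewrite -scalerBl scalerA /GRing.scale/= mulr1 -mulrBl addrK mulrA mulVf// mul1r.
have [_ /(_ 1)] := pF; rewrite lexx ler01 => /(_ isT) F1.
rewrite (_ : g (s *: v + p) - g p - s *: vderive g z0 v = F 1 - F 0); last first.
  by rewrite /F scale1r mul1r scale0r add0r mul0r scale0r subr0 addrAC.
rewrite F1 [F 0 + _]addrC addrK (le_trans (vint_bound ler01 bf))// subr0 mulr1 //.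
Unshelve. all: by end_near. Qed.

Lemma C1at_chain (X : normedModType R) (F : X -> 'rV[R]_n) p d w : C1at g (F p) ->
  is_vderive F p d w ->
  is_vderive (fun x => g (F x)) p d (\sum_(k < N) crd k w *: vderive g (F p) B`_k).
Proof.
move=> Cg dF; set z0 := F p; apply/is_vderiveP.
(* The increment of [F] is walked through one coordinate at a time, the first [k] being already
   moved in [P k]. Each step is along a fixed basis vector, where [C1at_increment] applies. *)
pose P k (h : R) := \sum_(j < N) (if (j < k)%N then crd j (F (h *: d + p)) else crd j z0) *: B`_j.
have P0 h : P 0%N h = z0 by rewrite [RHS]sum_crd; apply: eq_bigr.
have PN h : P N h = F (h *: d + p) by rewrite [RHS]sum_crd; apply: eq_bigr => j _; rewrite ltn_ord.
have PS (k : 'I_N) h : P k.+1 h = crd k (F (h *: d + p) - z0) *: B`_k + P k h.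
  rewrite /P (bigD1 k)//= [in RHS](bigD1 k)//= ltnSn ltnn addrA -scalerDl crdB subrK; congr (_ + _).
  by apply: eq_bigr => j jk; rewrite ltnS leq_eqVlt (negbTE jk : (nat_of_ord j == k) = false).
have cF : vcvg (0:R)^' (fun h => F (h *: d + p)) z0 by exact: is_vderive_line dF.
have cP k : vcvg (0:R)^' (P k) z0.
  rewrite [X in vcvg _ _ X]sum_crd => i; rewrite /P linear_sum; under eq_fun do rewrite linear_sum.
  apply: cvg_big => [|j _]; first exact: add_continuous.
  rewrite linearZ; under eq_fun do rewrite linearZ.
  by apply: cvgMl; case: (j < k)%N; [exact: cF|exact: cvg_cst].
have term (k : 'I_N) : vcvg (0:R)^' (fun h => h^-1 *: (g (P k.+1 h) - g (P k h)))
    (crd k w *: vderive g z0 B`_k).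
  pose del h := crd k (F (h *: d + p) - z0) : R.
  have cdel : h^-1 * del h @[h --> (0:R)^'] --> (crd k w : R).
    by have := iffLR (is_vderiveP _ _ _ _) dF k; under eq_fun do rewrite crdZ.
  apply/vcvg_vn/cvgrPdist_le => e e0; have e20 : 0 < e / 2 by rewrite divr_gt0.
  pose c := `|crd k w| + 1; have c0 : 0 < c by rewrite ltr_wpDl.
  have e2 : 0 < e / 2 / c by rewrite !divr_gt0.
  have /cvgrPdist_lt cdel1 := cdel.
  pose proof (vcvgZ cdel (vcvg_cst (0:R)^' (vderive g z0 B`_k))) as hz.
  have hz' : \forall h \near (0:R)^', vn ((h^-1 * del h) *: vderive g z0 B`_k - crd k w *: vderive g z0 B`_k) <= e / 2.
    exact: (vcvg_vn_le hz e20).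
  have [r [r0 hr]] : exists r, 0 < r /\ forall p (s : R),
      `|p - z0| < r -> `|s *: B`_k + p - z0| < r ->
      vn (g (s *: B`_k + p) - g p - s *: vderive g z0 B`_k) <= e / 2 / c * `|s|.
    have [r /= r0 hr] := C1at_increment B`_k Cg e2; exists (r / 2); rewrite divr_gt0//; split=> //.
    by apply: hr; rewrite /= ?divr_gt0// sub0r normrN gtr0_norm ?divr_gt0// ltr_pdivrMr// ltr_pMr// ltr1n.
  have n1 : \forall h \near (0:R)^', `|P k h - z0| < r by exact: (vcvg_topo_lt (cP k) r0).
  have n2 : \forall h \near (0:R)^', `|P k.+1 h - z0| < r by exact: (vcvg_topo_lt (cP k.+1) r0).
  near=> h; have h0 : h != 0 by near: h; exact: nbhs_dnbhs_neq.
  rewrite sub0r normrN ger0_norm ?vn_ge0//.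
  have -> : h^-1 *: (g (P k.+1 h) - g (P k h)) - crd k w *: vderive g z0 B`_k =
     h^-1 *: (g (P k.+1 h) - g (P k h) - del h *: vderive g z0 B`_k) +
     ((h^-1 * del h) *: vderive g z0 B`_k - crd k w *: vderive g z0 B`_k).
    by rewrite [in RHS]scalerBr (scalerA h^-1 (del h)) addrA subrK.
  have -> : e = e / 2 + e / 2 by field.
  rewrite (le_trans (vnD _ _))// lerD//; last first.
    by near: h; exact: hz'.
  rewrite vnZ PS.
  have : vn (g (del h *: B`_k + P k h) - g (P k h) - del h *: vderive g z0 B`_k) <= e / 2 / c * `|del h|.
    apply: hr; first by near: h; exact: n1.
    by rewrite -PS; near: h; exact: n2.
  move=> /(ler_wpM2l (normr_ge0 h^-1)) /le_trans; apply.
  rewrite mulrCA -normrM.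
  have hc : `|h^-1 * del h| <= c.
    have : `|crd k w - h^-1 * del h| < 1 by near: h; exact: (cdel1 _ ltr01).
    move=> h1; have -> : h^-1 * del h = crd k w - (crd k w - h^-1 * del h) by ring.
    by rewrite (le_trans (ler_normB _ _))// lerD2l ltW.
  by rewrite -[leRHS](divfK (lt0r_neq0 c0)) ler_wpM2l// ltW.
have -> : (fun h : R => h^-1 *: (g (F (h *: d + p)) - g (F p))) =
    fun h => \sum_(k < N) h^-1 *: (g (P k.+1 h) - g (P k h)).
  apply/funext => h; rewrite -scaler_sumr; congr (_ *: _).
  rewrite -(big_mkord xpredT (fun k => g (P k.+1 h) - g (P k h))) telescope_sumr//.
  by rewrite PN P0.
move=> j; rewrite linear_sum; under eq_fun do rewrite linear_sum.
by apply: cvg_big => [|k _]; [exact: add_continuous|exact: term].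
Unshelve. all: by end_near. Qed.

Lemma C1at_vderive z w : C1at g z -> vderive g z w = \sum_(k < N) crd k w *: vderive g z B`_k.
Proof.
move=> Cg; apply: is_vderive_vderive.
have dI : is_vderive (fun x : 'rV[R]_n => x) z w w.
  apply/is_vderiveP; generalize (vcvg_cst (0:R)^' w); apply: vcvg_near; near=> h.
  by rewrite addrK scalerA mulVf ?scale1r//; near: h; exact: nbhs_dnbhs_neq.
exact: (C1at_chain (F := fun x => x) Cg dI).
Unshelve. all: by end_near. Qed.

Lemma C1at_chainE (X : normedModType R) (F : X -> 'rV[R]_n) p d w : C1at g (F p) ->
  is_vderive F p d w -> is_vderive (fun x => g (F x)) p d (vderive g (F p) w).
Proof. by move=> Cg dF; rewrite (C1at_vderive _ Cg); exact: C1at_chain. Qed.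

Lemma C1at_vderive_cvg (T : Type) (G : set_system T) {FG : Filter G} (F w : T -> 'rV[R]_n) z0 w0 :
  C1at g z0 -> vcvg G F z0 -> vcvg G w w0 ->
  vcvg G (fun t => vderive g (F t) (w t)) (vderive g z0 w0).
Proof.
move=> Cg cF cw.
have ct : F t @[t --> G] --> z0 by exact: vcvg_topo.
have : vcvg G (fun t => \sum_(k < N) crd k (w t) *: vderive g (F t) B`_k)
    (\sum_(k < N) crd k w0 *: vderive g z0 B`_k).
  move=> j; rewrite linear_sum; under eq_fun do rewrite linear_sum.
  apply: cvg_big => [|k _]; first exact: add_continuous.
  rewrite linearZ; under eq_fun do rewrite linearZ.
  apply: cvgM; first exact: cw.
  have [_ /(_ B`_k)[_ cd]] := nbhs_singleton Cg.
  have h : vcvg G (fun t => vderive g (F t) B`_k) (vderive g z0 B`_k) by exact: (vcvg_comp ct cd).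
  exact: h.
rewrite -(C1at_vderive _ Cg); apply: vcvg_near.
have : \forall t \near G, C1at g (F t) by apply: ct; exact: (C1at_near Cg).
by apply: filterS => t Ct; rewrite -(C1at_vderive _ Ct).
Qed.

End Chain.

Lemma C1at_comp (n : nat) (X : normedModType R) (W : vectType R) (F : X -> 'rV[R]_n) (g : 'rV[R]_n -> W) q :
  C1at F q -> C1at g (F q) -> C1at (fun x => g (F x)) q.
Proof.
move=> CF Cg.
have cFq : F x @[x --> q] --> F q by apply: vcvg_topo; have [] := nbhs_singleton CF.
have Cgn : \forall p \near q, C1at g (F p) by apply: cFq; exact: (C1at_near Cg).
have Cgnn : \forall p \near q, \forall p' \near p, C1at g (F p') by exact: near_join.
have CFn := C1at_near CF.
near=> p.
have CFp : C1at F p by near: p.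
have Cgp : C1at g (F p) by near: p.
have [cF dF] := nbhs_singleton CFp.
have [cg _] := nbhs_singleton Cgp.
have dgF x v : C1at F x -> C1at g (F x) -> vderive (fun x => g (F x)) x v = vderive g (F x) (vderive F x v).
  move=> CFx Cgx; apply: is_vderive_vderive; apply: C1at_chainE => //.
  by have [_ /(_ v)[]] := nbhs_singleton CFx.
split; first exact: (vcvg_comp (vcvg_topo cF) cg).
move=> v; have [dFv cDF] := dF v; rewrite dgF//; split; first exact: C1at_chainE.
generalize (C1at_vderive_cvg Cgp cF cDF); apply: vcvg_near; near=> x.
have CFx : C1at F x by near: x; exact: (C1at_near CFp).
have Cgx : C1at g (F x) by near: x; apply: (vcvg_topo cF); exact: (C1at_near Cgp).
exact: (esym (dgF x v CFx Cgx)).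
Unshelve. all: by end_near. Qed.

End C1Calculus.

Lemma nbhs_forall (T : topologicalType) (q : T) (k : nat) (P : 'I_k -> T -> Prop) :
  (forall i, \forall x \near q, P i x) -> \forall x \near q, forall i, P i x.
Proof. exact: filter_forall. Qed.

Section Forms.
Variables (R : realType) (n : nat) (M : manifold R n) (W : vectType R).
Local Notation B := (vbasis {:'rV[R]_n}).
Local Notation N := (\dim {:'rV[R]_n}).

Lemma form1_linear (w : vform 'rV[R]_n 1 W) : alternating w ->
  linear (fun v : 'rV[R]_n => w (fun _ => v)).
Proof.
move=> [al _] a u v; have := al (fun=> 0) ord0 a u v.
have E x : update_vec (fun=> 0) ord0 x = fun _ : 'I_1 => x :> 'rV[R]_n.
  by apply/funext => i; rewrite /update_vec (ord1 i) eqxx.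
by rewrite !E.
Qed.

Lemma form2_bil (w : vform 'rV[R]_n 2 W) : alternating w -> bil (fun u v => w (pair2 u v)).
Proof.
move=> [al _]; split=> [v a x y|u a x y].
- have := al (pair2 0 v) ord0 a x y.
  have E z : update_vec (pair2 0 v) ord0 z = pair2 z v.
    by apply/funext => i; rewrite /update_vec /pair2; case: (i == ord0).
  by rewrite !E.
- have := al (pair2 u 0) ord_max a x y.
  have E z : update_vec (pair2 u 0) ord_max z = pair2 u z.
    apply/funext => i; rewrite /update_vec /pair2.
    by case: i => -[|[|//]] i /=.
  by rewrite !E.
Qed.

Lemma pair2_eta (v : 'I_2 -> 'rV[R]_n) : v = pair2 (v ord0) (v ord_max).
Proof.
apply/funext => i; rewrite /pair2; case: eqP => [->//|ne]; congr v; apply: val_inj.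
by case: i ne => -[|[|//]] i /= ne //; case: ne; apply: val_inj.
Qed.

(** Joint continuity in the point and in the vectors, along an arbitrary filter. In degrees 1 and 2
    it follows by expanding the vectors in a basis, which leaves finitely many functions of the
    point. *)
Definition contform k (w : dform M k W) := forall c z0, chart_img c z0 ->
  forall (T : Type) (G : set_system T) (FG : Filter G) (F : T -> 'rV[R]_n) (U : T -> 'I_k -> 'rV[R]_n) u0,
  vcvg G F z0 -> (forall a, vcvg G (fun t => U t a) (u0 a)) ->
  vcvg G (fun t => w c (F t) (U t)) (w c z0 u0).

Lemma is_form_C1at k (w : dform M k W) c z v : is_form w -> chart_img c z -> C1at (fun x => w c x v) z.
Proof.
move=> [_ sw _] cz; apply: (C1at_smooth (U := chart_img c)); last exact: sw.
by apply: open_nbhs_nbhs; split => //; exact: img_open.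
Qed.

Lemma chart_img_near c (z0 : 'rV[R]_n) (T : Type) (G : set_system T) {FG : Filter G} (F : T -> 'rV[R]_n) :
  @chart_img _ _ M c z0 -> vcvg G F z0 -> \forall t \near G, @chart_img _ _ M c (F t).
Proof.
move=> cz cF; have ct : F t @[t --> G] --> z0 by exact: vcvg_topo.
by apply: ct; apply: open_nbhs_nbhs; split => //; exact: img_open.
Qed.

Lemma form_cvg k (w : dform M k W) v c z0 (T : Type) (G : set_system T) {FG : Filter G} (F : T -> 'rV[R]_n) :
  is_form w -> chart_img c z0 -> vcvg G F z0 -> vcvg G (fun t => w c (F t) v) (w c z0 v).
Proof.
move=> fw cz cF; have [cw _] := nbhs_singleton (is_form_C1at v fw cz).
exact: (vcvg_comp (vcvg_topo cF) cw).
Qed.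

Lemma contform1 (w : dform M 1 W) : is_form w -> contform w.
Proof.
move=> fw c z0 cz T G FG F U u0 cF cU; have [al _ _] := fw.
have E z u : chart_img c z -> w c z u = \sum_(k < N) crd k (u ord0) *: w c z (fun _ => B`_k).
  move=> cz'; have lw := form1_linear (al c z cz').
  pose f := HB.pack_for {linear 'rV[R]_n -> W} (fun v : 'rV[R]_n => w c z (fun _ => v))
    (GRing.isLinear.Build R 'rV[R]_n W _ (fun v : 'rV[R]_n => w c z (fun _ => v)) lw).
  rewrite (_ : u = fun _ => u ord0); last by apply/funext => i; rewrite (ord1 i).
  rewrite -[LHS]/(f (u ord0)) [in LHS](sum_crd (u ord0)) linear_sum.
  by apply: eq_bigr => k _; rewrite linearZ.
have cN : \forall t \near G, chart_img c (F t) by exact: (chart_img_near cz cF).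
apply: (vcvg_near (F := fun t => \sum_(k < N) crd k (U t ord0) *: w c (F t) (fun _ => B`_k))).
  by apply: filterS cN => t ct; rewrite -E.
rewrite E// => j; rewrite linear_sum; under eq_fun do rewrite linear_sum.
apply: cvg_big => [|k _]; first exact: add_continuous.
rewrite linearZ; under eq_fun do rewrite linearZ.
apply: cvgM; first exact: cU.
have h : vcvg G (fun t => w c (F t) (fun _ => B`_k)) (w c z0 (fun _ => B`_k)) by exact: form_cvg.
exact: h.
Qed.

Lemma contform2 (w : dform M 2 W) : is_form w -> contform w.
Proof.
move=> fw c z0 cz T G FG F U u0 cF cU; have [al _ _] := fw.
have E z u : chart_img c z -> w c z u = \sum_(k < N) \sum_(l < N)
    (crd k (u ord0) * crd l (u ord_max)) *: w c z (pair2 B`_k B`_l).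
  move=> cz'; rewrite {1}(pair2_eta u); exact: (bil_sumE (form2_bil (al c z cz'))).
have cN : \forall t \near G, chart_img c (F t) by exact: (chart_img_near cz cF).
apply: (vcvg_near (F := fun t => \sum_(k < N) \sum_(l < N)
    (crd k (U t ord0) * crd l (U t ord_max)) *: w c (F t) (pair2 B`_k B`_l))).
  by apply: filterS cN => t ct; rewrite -E.
rewrite E// => j; rewrite linear_sum; under eq_fun do rewrite linear_sum.
apply: cvg_big => [|k _]; first exact: add_continuous.
rewrite linear_sum; under eq_fun do rewrite linear_sum.
apply: cvg_big => [|l _]; first exact: add_continuous.
rewrite linearZ; under eq_fun do rewrite linearZ.
apply: cvgM; first by apply: cvgM; exact: cU.
have h : vcvg G (fun t => w c (F t) (pair2 B`_k B`_l)) (w c z0 (pair2 B`_k B`_l)) by exact: form_cvg.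
exact: h.
Qed.

End Forms.

(** * Polyhedral pieces of the unit square and generic points *)

Record halfspaces (R : realType) := HalfSpaces {
  hs_num : nat;
  hs_form : 'I_hs_num -> {linear (R^o * R^o)%type -> R^o};
  hs_bound : 'I_hs_num -> R }.

Section Pieces.
Variable R : realType.
Local Notation X := (R^o * R^o)%type.

Definition square : set X := unit_itv `*` unit_itv.

Definition hs_set (q : halfspaces R) : set X := [set x | forall j : 'I_(hs_num q), hs_form j x <= hs_bound j].

Lemma lin2E (l : {linear X -> R^o}) (x : X) : l x = x.1 * l (1, 0) + x.2 * l (0, 1) :> R.
Proof.
have {1}-> : x = x.1 *: ((1, 0) : X) + x.2 *: ((0, 1) : X).
  by case: x => a b /=; congr pair; rewrite /= /GRing.scale/= ?mulr1 ?mulr0 ?addr0 ?add0r.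
by rewrite linearD !linearZ.
Qed.

Lemma lin2_cts (l : {linear X -> R^o}) : continuous l.
Proof.
move=> x; rewrite (_ : GRing.Linear.sort l = fun x : X => x.1 * l (1, 0) + x.2 * l (0, 1)); last first.
  by apply/funext => y; exact: lin2E.
by apply: cvgD; apply: cvgMl; [exact: cvg_fst|exact: cvg_snd].
Qed.

Variables (k : nat) (pol : 'I_k -> halfspaces R).

(* Near a point of the square which is generic for the direction d, the line
   through that point in the direction d stays in the pieces containing it. *)
Definition dgen (d p : X) := [/\ square p, p.1 = 0 \/ p.1 = 1 -> d.1 = 0,
  p.2 = 0 \/ p.2 = 1 -> d.2 = 0 &
  forall i (j : 'I_(hs_num (pol i))), hs_form j p = hs_bound j -> hs_form j d = 0].

Lemma affine_root (d p b : R) : d != 0 -> exists S : seq R, forall u, True -> u \notin S -> u * d + p != b.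
Proof.
move=> d0; exists [:: (b - p) / d] => u _; rewrite inE; apply: contra => /eqP <-.
by rewrite addrK mulfK.
Qed.

(** A line meets a wall not parallel to it in at most one point, and a wall parallel to [d] imposes
    no condition. *)
Lemma dgen_line (p d : X) : exists S : seq R, forall u, True -> u \notin S ->
  square (u *: d + p) -> dgen d (u *: d + p).
Proof.
have h (d0 p0 b : R) : exists S : seq R, forall u : R, True -> u \notin S -> u * d0 + p0 = b -> d0 = 0.
  have [->|d00] := eqVneq d0 0; first by exists [::].
  have [S hS] := affine_root p0 b d00; exists S => u _ uS /eqP.
  by rewrite (negbTE (hS u I uS)).
have [S1 h1] := h d.1 p.1 0; have [S2 h2] := h d.1 p.1 1.
have [S3 h3] := h d.2 p.2 0; have [S4 h4] := h d.2 p.2 1.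
have [S5 h5] : exists S : seq R, forall u : R, True -> u \notin S ->
    forall i (j : 'I_(hs_num (pol i))), hs_form j (u *: d + p) = hs_bound j -> hs_form j d = 0.
  apply: ex_seq_fin => i; apply: ex_seq_fin => j.
  have [S hS] := h (hs_form j d) (hs_form j p) (hs_bound j).
  by exists S => u _ uS; rewrite linearD linearZ; exact: hS.
exists (S1 ++ S2 ++ S3 ++ S4 ++ S5) => u _; rewrite !mem_cat !negb_or => /and5P[u1 u2 u3 u4 u5] sq.
split => //.
- by case; [exact: (h1 u I u1)|exact: (h2 u I u2)].
- by case; [exact: (h3 u I u3)|exact: (h4 u I u4)].
- exact: (h5 u I u5).
Qed.

Lemma near_neq_cts (T : topologicalType) (f : T -> R) (p : T) (b : R) :
  {for p, continuous f} -> f p != b -> \forall x \near p, f x != b.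
Proof.
move=> cf fb; have h : \forall y \near f p, y != b.
  by apply: open_nbhs_nbhs; split; [exact: open_neq|exact: fb].
exact: (cf _ h).
Qed.

(** For each wall, either [p] is off it, and then so are the nearby points, or [d] is parallel to
    it, which does not depend on the point. *)
Lemma dgen_open d p : dgen d p -> \forall x \near p, square x -> dgen d x.
Proof.
move=> [sp p1 p2 pl].
have c1 : {for p, continuous (fun x : X => x.1 : R)} by exact: cvg_fst.
have c2 : {for p, continuous (fun x : X => x.2 : R)} by exact: cvg_snd.
have h (T : topologicalType) (x0 : T) (f : T -> R) b (Q : Prop) : {for x0, continuous f} ->
    (f x0 = b -> Q) -> \forall x \near x0, f x = b -> Q.
  move=> cf fQ; have [e|ne] := eqVneq (f x0) b.
    by have q := fQ e; near=> x.
  have n := near_neq_cts cf ne; near=> x => e.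
  by have : f x != b by [near: x; exact: n]; rewrite e eqxx.
have n1 := h _ _ _ 0 (d.1 = 0) c1 (fun e => p1 (or_introl e)).
have n2 := h _ _ _ 1 (d.1 = 0) c1 (fun e => p1 (or_intror e)).
have n3 := h _ _ _ 0 (d.2 = 0) c2 (fun e => p2 (or_introl e)).
have n4 := h _ _ _ 1 (d.2 = 0) c2 (fun e => p2 (or_intror e)).
have n50 i (j : 'I_(hs_num (pol i))) : \forall x \near p, hs_form j x = hs_bound j -> hs_form j d = 0.
  by apply: (h _ _ (fun x => hs_form j x : R)) => //; [exact: lin2_cts|exact: pl].
have n5 := nbhs_forall (fun i => nbhs_forall (n50 i)).
near=> x => sx; split => //.
- by case; [near: x; exact: n1|near: x; exact: n2].
- by case; [near: x; exact: n3|near: x; exact: n4].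
- by near: x; exact: n5.
Unshelve. all: by end_near. Qed.

Lemma line_cvg (p d : X) : u *: d + p @[u --> (0:R)] --> p.
Proof.
rewrite -[X in _ --> X](add0r p) -(scale0r d).
by apply: cvgD; [apply: cvgZr_tmp; exact: cvg_id|exact: cvg_cst].
Qed.

(** Strict inequalities persist for small [u]; the tight ones stay tight along the line, because [d]
    is parallel to their walls. *)
Lemma dgen_germ d p i : dgen d p -> hs_set (pol i) p ->
  \forall u \near (0:R), square (u *: d + p) /\ hs_set (pol i) (u *: d + p).
Proof.
move=> [[/andP[p10 p11] /andP[p20 p21]] d1 d2 dl] hp.
have h (f : R -> R) (b c : R) : (forall u, f u = u * c + f 0) -> f 0 <= b -> (f 0 = b -> c = 0) ->
    \forall u \near (0:R), f u <= b.
  move=> fE; rewrite le_eqVlt => /orP[/eqP e /(_ e) c0|f0 _].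
    by near=> u; rewrite fE c0 mulr0 add0r e.
  have cf : f u @[u --> (0:R)] --> f 0.
    rewrite (_ : f = fun u => c * u + f 0); last by apply/funext => u; rewrite mulrC.
    exact: affine_cvg.
  have nb : \forall v \near f 0, v < b by exact: lt_nbhsl.
  have nb' : \forall u \near (0:R), f u < b by exact: (cf _ nb).
  by near=> u; apply: ltW; near: u.
have coord (x e : R) : 0 <= x -> x <= 1 -> (x = 0 \/ x = 1 -> e = 0) ->
    \forall u \near (0:R), 0 <= u * e + x <= 1.
  move=> x0 x1 xe; near=> u; apply/andP; split; near: u.
    have := h (fun u => - (u * e + x)) 0 (- e).
    rewrite mul0r add0r oppr_le0 => /(_ _ x0) H; apply: filterS (H _ _) => [u|u|].
    - by rewrite oppr_le0.
    - by rewrite mulrN opprD.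
    - by move=> /eqP; rewrite oppr_eq0 => /eqP x00; rewrite xe ?oppr0//; left.
  have := h (fun u => u * e + x) 1 e; rewrite mul0r add0r; apply => //.
  by move=> x11; apply: xe; right.
have hh0 (j : 'I_(hs_num (pol i))) : \forall u \near (0:R), hs_form j (u *: d + p) <= hs_bound j.
  have := h (fun u => hs_form j (u *: d + p)) (hs_bound j) (hs_form j d).
  rewrite scale0r add0r; apply; [|exact: hp|exact: dl].
  by move=> u; rewrite linearD linearZ.
have hh := nbhs_forall hh0.
have c1 := coord _ _ p10 p11 d1; have c2 := coord _ _ p20 p21 d2.
near=> u; split; [split|]; near: u; [exact: c1|exact: c2|exact: hh].
Unshelve. all: by end_near. Qed.

(** Near [p] only the pieces containing [p] are met, so local statements need smooth extensions for
    those alone. *)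
Lemma piece_closed p : \forall x \near p, forall i, hs_set (pol i) x -> hs_set (pol i) p.
Proof.
suff n0 i : \forall x \near p, hs_set (pol i) x -> hs_set (pol i) p by exact: (nbhs_forall n0).
have [hp|hp] := pselect (hs_set (pol i) p); first by near=> x.
have [j /negP] : exists j : 'I_(hs_num (pol i)), ~ (hs_form j p <= hs_bound j).
  by apply: contrapT => nex; apply: hp => j; apply: contrapT => nj; apply: nex; exists j.
rewrite -ltNge => lt.
have n : \forall x \near p, hs_bound j < hs_form j x.
  have nb : \forall v \near (hs_form j p : R), hs_bound j < v by exact: lt_nbhsr.
  exact: (@lin2_cts (hs_form j) p _ nb).
near=> x => /(_ j); rewrite leNgt => /negP[]; near: x; exact: n.
Unshelve. all: by end_near. Qed.

Hypothesis cover : square `<=` \bigcup_i hs_set (pol i).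

Section Patched.
Variable W : vectType R.

(** The functions representing [Q] on different pieces may disagree at [q], as derivatives do across
    an edge. This suffices to bound [Q] at generic points near [q], and gives continuity when [q]
    itself is generic, since all representatives then take the value [Q q] there. *)
Definition patchedC (Q : X -> W) (gen : X -> Prop) q := forall i, hs_set (pol i) q ->
  exists H, vcvg (nbhs q) H (H q) /\
    \forall p \near q, square p -> hs_set (pol i) p -> gen p -> Q p = H p.

Lemma patchedC_bounded Q gen q : patchedC Q gen q ->
  exists L, \forall p \near q, square p -> gen p -> vn (Q p) <= L.
Proof.
move=> pQ; have ex i : exists L, 0 <= L /\ (hs_set (pol i) q ->
    \forall p \near q, square p -> hs_set (pol i) p -> gen p -> vn (Q p) <= L).
  have [hq|hq] := pselect (hs_set (pol i) q); last by exists 0.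
  have [H [cH QH]] := pQ i hq; exists (vn (H q) + 1); split; first by rewrite addr_ge0// vn_ge0.
  move=> _; have b := vcvg_bounded cH; near=> p => sp hp gp.
  by rewrite (near QH p _)//; near: p; exact: b.
have [L hL] := choice ex; exists (\sum_i L i).
have nc := piece_closed q.
have nL0 i : \forall p \near q, hs_set (pol i) q -> square p -> hs_set (pol i) p -> gen p -> vn (Q p) <= L i.
  have [_ h] := hL i.
  have [hq|hq] := pselect (hs_set (pol i) q); last by near=> p.
  by apply: filterS (h hq) => p hp _.
have nL := nbhs_forall nL0.
near=> p => sp gp; have [i _ hi] := cover sp.
have hq : hs_set (pol i) q by apply: (near nc p _ i hi).
apply: (@le_trans _ _ (L i)); first exact: (near nL p _ i hq sp hi gp).
by rewrite (bigD1 i)//= lerDl sumr_ge0// => j _; have [] := hL j.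
Unshelve. all: by end_near. Qed.

Lemma patchedC_cvg Q (gen : X -> Prop) q : patchedC Q gen q -> square q -> gen q ->
  (\forall p \near q, square p -> gen p) -> vcvg (within square (nbhs q)) Q (Q q).
Proof.
move=> pQ sq gq ng; apply/vcvg_vn/cvgrPdist_le => e e0.
have nc := piece_closed q.
have nH0 i : \forall p \near q, hs_set (pol i) q -> square p -> hs_set (pol i) p -> gen p ->
    vn (Q p - Q q) <= e.
  have [hq|hq] := pselect (hs_set (pol i) q); last by near=> p.
  have [H [cH QH]] := pQ i hq; have b := vcvg_vn_le cH e0.
  have Qq : Q q = H q by apply: (nbhs_singleton QH).
  near=> p => _ sp hp gp; rewrite Qq (near QH p _)//; near: p; exact: b.
have nH := nbhs_forall nH0.
rewrite near_withinE; near=> p => sp; rewrite sub0r normrN ger0_norm ?vn_ge0//.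
have [i _ hi] := cover sp.
have hq : hs_set (pol i) q by apply: (near nc p _ i hi).
have gp : square p -> gen p by near: p; exact: ng.
have nHp : forall i, hs_set (pol i) q -> square p -> hs_set (pol i) p -> gen p -> vn (Q p - Q q) <= e.
  by near: p; exact: nH.
exact: (nHp i hq sp hi (gp sp)).
Unshelve. all: by end_near. Qed.

Definition patched (y : X -> W) q := forall i, hs_set (pol i) q ->
  exists H, C1at H q /\ \forall p \near q, square p -> hs_set (pol i) p -> y p = H p.

Lemma patched_patchedC y q : patched y q -> patchedC y (fun _ => True) q.
Proof.
move=> py i hq; have [H [CH yH]] := py i hq; exists H; split; first by have [] := nbhs_singleton CH.
by near=> p => sp hp _; apply: (near yH p).
Unshelve. all: by end_near. Qed.

(** At a generic point, even on the boundary of a piece, the line in direction [d] stays in the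
    piece, so the derivative is that of the extension. *)
Lemma patched_piece_vderive (y H : X -> W) q d i : C1at H q ->
  (\forall p \near q, square p -> hs_set (pol i) p -> y p = H p) ->
  \forall p \near q, dgen d p -> hs_set (pol i) p -> is_vderive y p d (vderive H p d).
Proof.
move=> CH yH; have yHn := near_join yH; near=> p => gp hp.
have [_ /(_ d)[dH _]] : vcvg (nbhs p) H (H p) /\ forall v,
  is_vderive H p v (vderive H p v) /\ vcvg (nbhs p) (fun x => vderive H x v) (vderive H p v).
  by near: p; exact: CH.
have yHp : \forall x \near p, square x -> hs_set (pol i) x -> y x = H x by near: p; exact: yHn.
have gm := dgen_germ gp hp.
have [sp _ _ _] := gp.
have yHu : \forall u \near (0:R), square (u *: d + p) -> hs_set (pol i) (u *: d + p) -> y (u *: d + p) = H (u *: d + p).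
  exact: (@line_cvg p d _ yHp).
apply: (is_vderive_near _ _ dH); last by symmetry; apply: (nbhs_singleton yHp).
apply: cvg_within; near=> u.
have [su hu] : square (u *: d + p) /\ hs_set (pol i) (u *: d + p) by near: u; exact: gm.
symmetry; have : square (u *: d + p) -> hs_set (pol i) (u *: d + p) -> y (u *: d + p) = H (u *: d + p).
  by near: u; exact: yHu.
by apply.
Unshelve. all: by end_near. Qed.

Lemma patched_is_vderive y q d : patched y q ->
  \forall p \near q, dgen d p -> is_vderive y p d (vderive y p d).
Proof.
move=> py; have nc := piece_closed q.
have n0 i : \forall p \near q, hs_set (pol i) q -> dgen d p -> hs_set (pol i) p ->
    is_vderive y p d (vderive y p d).
  have [hq|hq] := pselect (hs_set (pol i) q); last by near=> p.
  have [H [CH yH]] := py i hq; have h := patched_piece_vderive d CH yH.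
  near=> p => _ gp hp.
  have dy : dgen d p -> hs_set (pol i) p -> is_vderive y p d (vderive H p d) by near: p; exact: h.
  by rewrite (is_vderive_vderive (dy gp hp)); exact: dy.
have n := nbhs_forall n0.
near=> p => gp; have [sp _ _ _] := gp; have [i _ hi] := cover sp.
have hq : hs_set (pol i) q by apply: (near nc p _ i hi).
exact: (near n p _ i hq gp hi).
Unshelve. all: by end_near. Qed.

Lemma patched_vderive_patchedC y q d : patched y q -> patchedC (fun p => vderive y p d) (dgen d) q.
Proof.
move=> py i hq; have [H [CH yH]] := py i hq; exists (fun p => vderive H p d); split.
  by have [_ /(_ d)[]] := nbhs_singleton CH.
have h := patched_piece_vderive d CH yH.
near=> p => _ hp gp; apply: is_vderive_vderive; exact: (near h p _ gp hp).
Unshelve. all: by end_near. Qed.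

End Patched.
End Pieces.

Arguments square {R}.

(** * Pullbacks along a piecewise smooth map of the square *)

Section SquareMap.
Variables (R : realType) (n : nat) (M : manifold R n).
Local Notation X := (R^o * R^o)%type.

Lemma C1at_transition (c c' : atlas M) p : chart_dom (chart_of c) p -> chart_dom (chart_of c') p ->
  C1at (fun x => chart_of c' (chart_inv (chart_of c) x)) (chart_of c p).
Proof.
move=> cp cp'; apply: (C1at_smooth (U := chart_of c @` (chart_dom (chart_of c) `&` chart_dom (chart_of c')))); last first.
  exact: atlas_smooth.
have ci : (chart_of c @` chart_dom (chart_of c)) (chart_of c p) by exists p.
have n1 : \forall x \near chart_of c p, (chart_of c @` chart_dom (chart_of c)) x.
  by apply: open_nbhs_nbhs; split => //; exact: img_open.
have n2 : \forall x \near chart_of c p, chart_dom (chart_of c') (chart_inv (chart_of c) x).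
  apply: (inv_cont ci); rewrite chart_funK//; apply: open_nbhs_nbhs; split => //.
  exact: dom_open.
apply: filterS (filterI n1 n2) => x [[y cy <-]].
by rewrite chart_funK// => cy'; exists y.
Qed.

Definition mdgen k (pol : 'I_k -> halfspaces R) l (v : 'I_l -> X) (p : X) := forall a, dgen pol (v a) p.

Variable G : X -> M.

Lemma piecewise_pieces : piecewise_smooth square G -> exists k (pol : 'I_k -> halfspaces R),
  [/\ square `<=` \bigcup_i hs_set (pol i), {within square, continuous G} &
      forall i, smooth_on (square `&` hs_set (pol i)) G].
Proof.
move=> [cG [k [P [pP cov sm]]]].
have ex i : exists q : halfspaces R, P i = hs_set q.
  by have [m [l [b ->]]] := pP i; exists (HalfSpaces l b).
have [pol hpol] := choice ex.
exists k, pol; split=> //; last by move=> i; rewrite -hpol.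
by move=> x /cov[i _ Px]; exists i => //; rewrite -hpol.
Qed.

Variables (k : nat) (pol : 'I_k -> halfspaces R).
Hypothesis cover : square `<=` \bigcup_i hs_set (pol i).
Hypothesis cG : {within square, continuous G}.
Hypothesis sm : forall i, smooth_on (square `&` hs_set (pol i)) G.

Section LocalChart.
Variables (q : X) (c : atlas M).
Hypotheses (sq : square q) (cq : chart_dom (chart_of c) (G q)).

Local Notation z := (fun p => chart_of c (G p)).

Lemma near_chart_dom : \forall p \near q, square p -> chart_dom (chart_of c) (G p).
Proof.
have /subspace_continuousP /(_ q sq) h := cG.
have n1 : \forall y \near G q, chart_dom (chart_of c) y.
  by apply: open_nbhs_nbhs; split => //; exact: dom_open.
exact: (h _ n1).
Qed.

Lemma patched_chart : patched pol z q.
Proof.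
move=> i hq; have [c' [U [F [oU Uq sF hF]]]] := sm (conj sq hq).
have [cq' Fq] := hF q Uq (conj sq hq).
have CF : C1at F q by apply: (C1at_smooth _ sF); exact: open_nbhs_nbhs.
have Ct := C1at_transition cq' cq; rewrite Fq in Ct.
exists (fun x => chart_of c (chart_inv (chart_of c') (F x))); split.
  exact: (C1at_comp CF Ct).
have nU : \forall p \near q, U p by exact: open_nbhs_nbhs.
near=> p => sp hp; have Up : U p by near: p.
have [cp' <-] := hF p Up (conj sp hp).
by rewrite chart_funK.
Unshelve. all: by end_near. Qed.

Lemma patched_comp (W : vectType R) (g : 'rV[R]_n -> W) : C1at g (z q) -> patched pol (fun p => g (z p)) q.
Proof.
move=> Cg i hq; have [H [CH zH]] := patched_chart hq.
have Hq : z q = H q by apply: (nbhs_singleton zH).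
exists (fun x => g (H x)); split; first by apply: C1at_comp => //; rewrite -Hq.
by apply: filterS zH => p h sp hp; rewrite h.
Qed.

Lemma near_chart_vderive d : \forall p \near q, dgen pol d p -> is_vderive z p d (vderive z p d).
Proof. exact: (patched_is_vderive cover d (@patched_chart)). Qed.

(** [pullback] uses the chart chosen at [G p], which may jump with [p]. The compatibility of the
    form with changes of charts, together with the chain rule, allows one fixed chart near [q],
    without which no continuity could be stated. *)
Lemma near_pullback (W : vectType R) l (w : dform M l W) (v : 'I_l -> X) : is_form w ->
  \forall p \near q, square p -> mdgen pol v p ->
    pullback G w p v = w c (z p) (fun a => vderive z p (v a)).
Proof.
move=> [_ _ compat].
have nd := near_chart_dom; have ndd := near_join nd.
have nv := nbhs_forall (fun a => near_chart_vderive (v a)).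
near=> p => sp gp.
have cp : chart_dom (chart_of c) (G p) by (have h : square p -> chart_dom (chart_of c) (G p) by near: p); exact: h.
pose c' := chart_at (G p).
have cp' : chart_dom (chart_of c') (G p) by exact: (projT2 (cid (atlas_cover (G p)))).
rewrite /pullback -/c' (compat c c' (G p) _ cp cp'); congr (w c' _ _); apply/funext => a.
have dz : is_vderive z p (v a) (vderive z p (v a)).
  have h : forall a, dgen pol (v a) p -> is_vderive z p (v a) (vderive z p (v a)) by near: p; exact: nv.
  exact: h.
have Ct := C1at_transition cp cp'.
have dc := C1at_chainE Ct dz.
have ndp : \forall x \near p, square x -> chart_dom (chart_of c) (G x) by near: p; exact: ndd.
have [i _ hi] := cover sp.
have gm := dgen_germ (gp a) hi.
have nl : \forall u \near (0:R), square (u *: v a + p) -> chart_dom (chart_of c) (G (u *: v a + p)).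
  exact: (@line_cvg R p (v a) _ ndp).
apply: is_vderive_vderive; apply: (is_vderive_near _ _ dc); last by rewrite chart_funK.
apply: cvg_within; near=> u; rewrite chart_funK//.
have [su _] : square (u *: v a + p) /\ hs_set (pol i) (u *: v a + p) by near: u; exact: gm.
have h : square (u *: v a + p) -> chart_dom (chart_of c) (G (u *: v a + p)) by near: u; exact: nl.
exact: h.
Unshelve. all: by end_near. Qed.

Lemma patchedC_pullback (W : vectType R) l (w : dform M l W) (v : 'I_l -> X) : is_form w -> contform w ->
  patchedC pol (fun p => pullback G w p v) (mdgen pol v) q.
Proof.
move=> fw cw i hq; have [H [CH zH]] := patched_chart hq.
have Hq : z q = H q by apply: (nbhs_singleton zH).
exists (fun p => w c (H p) (fun a => vderive H p (v a))); split.
  have [cH dH] := nbhs_singleton CH.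
  apply: (cw c (H q)) => //.
  - by rewrite -Hq; exists (G q).
  - by move=> a; have [_] := dH (v a).
have nv := nbhs_forall (fun a => patched_piece_vderive (v a) CH zH).
have np := near_pullback v fw.
near=> p => sp hp gp.
have -> : pullback G w p v = w c (z p) (fun a => vderive z p (v a)).
  have h : square p -> mdgen pol v p -> pullback G w p v = w c (z p) (fun a => vderive z p (v a)) by near: p; exact: np.
  exact: h.
have -> : z p = H p.
  have h : square p -> hs_set (pol i) p -> z p = H p by near: p; exact: zH.
  exact: h.
congr (w c _ _); apply/funext => a; apply: is_vderive_vderive.
have h : forall a, dgen pol (v a) p -> hs_set (pol i) p -> is_vderive z p (v a) (vderive H p (v a)).
  by near: p; exact: nv.
exact: h.
Unshelve. all: by end_near. Qed.

End LocalChart.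

Lemma chart_atP (x : M) : chart_dom (chart_of (chart_at x)) x.
Proof. exact: (projT2 (cid (atlas_cover x))). Qed.

Lemma mdgen_open l (v : 'I_l -> X) q : mdgen pol v q -> \forall p \near q, square p -> mdgen pol v p.
Proof.
move=> gq; have h := nbhs_forall (fun a => dgen_open (gq a)).
by apply: filterS h => p hp sp a; exact: hp.
Qed.

Lemma square_compact : compact (square : set X).
Proof.
have h : compact (unit_itv : set R^o).
  rewrite (_ : unit_itv = `[0, 1]%classic :> set R); first exact: segment_compact.
  by apply/seteqP; split=> t; rewrite /= in_itv.
exact: compact_setX.
Qed.

Section Pullback.
Variables (W : vectType R) (l : nat) (w : dform M l W) (v : 'I_l -> X).
Hypotheses (fw : is_form w) (cw : contform w).

Lemma pullback_cvg q : square q -> mdgen pol v q ->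
  vcvg (within square (nbhs q)) (fun p => pullback G w p v) (pullback G w q v).
Proof.
move=> sq gq; apply: (patchedC_cvg cover (patchedC_pullback sq (chart_atP (G q)) v fw cw)) => //.
exact: mdgen_open.
Qed.

(** Each point has a neighbourhood with a bound, coming from the finitely many pieces; compactness
    of the square makes the bound uniform. *)
Lemma pullback_bounded : exists2 L, 0 <= L &
  forall p, square p -> mdgen pol v p -> vn (pullback G w p v) <= L.
Proof.
have /compact_near_coveringP nc := square_compact.
have h : forall q, square q -> \forall q' \near q & L \near pinfty_nbhs R,
    square q' -> mdgen pol v q' -> vn (pullback G w q' v) <= L.
  move=> q sq; have [L hL] := patchedC_bounded cover (patchedC_pullback sq (chart_atP (G q)) v fw cw).
  exists ([set p | square p -> mdgen pol v p -> vn (pullback G w p v) <= L], [set L' | L <= L']).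
    by split => //=; apply: nbhs_pinfty_ge; exact: num_real.
  by move=> [p L'] /= [h1 h2] sp gp; apply: le_trans h2; exact: h1.
have H : \forall L \near pinfty_nbhs R, square `<=` (fun p => square p -> mdgen pol v p -> vn (pullback G w p v) <= L).
  exact: (nc R (pinfty_nbhs R) (fun L p => square p -> mdgen pol v p -> vn (pullback G w p v) <= L) _ h).
have [L [L0 hL]] : exists L, 0 <= L /\ square `<=` (fun p => square p -> mdgen pol v p -> vn (pullback G w p v) <= L).
  near (pinfty_nbhs R) => L; exists L; split; near: L; [by apply: nbhs_pinfty_ge; exact: num_real|exact: H].
by exists L => // p sp gp; exact: hL.
Unshelve. all: by end_near. Qed.

End Pullback.

Lemma vderive_line (W : vectType R) (F : X -> W) d p (u : R) :
  vderive (fun h : R^o => F (h *: d + p)) u 1 = vderive F (u *: d + p) d.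
Proof.
rewrite /vderive; congr (of_crd _); apply/funext => j; rewrite /derive; f_equal; f_equal.
by apply/funext => h; rewrite /= scalerDl -addrA /GRing.scale/= mulr1.
Qed.

Lemma pullback_line (W : Type) (w : dform M 1 W) d p (u : R) :
  pullback (fun h : R^o => G (h *: d + p)) w u (fun _ => 1) = pullback G w (u *: d + p) (fun _ => d).
Proof.
pose c := chart_of (chart_at (G (u *: d + p))).
have E : (fun _ : 'I_1 => vderive (c \o (fun h : R^o => G (h *: d + p))) u 1) =
    (fun _ => vderive (c \o G) (u *: d + p) d).
  by apply/funext => a; exact: (vderive_line (c \o G)).
exact: (congr1 (w (chart_at (G (u *: d + p))) (c (G (u *: d + p)))) E).
Qed.

Definition line_in d p := forall u : R, 0 <= u <= 1 -> square (u *: d + p).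

Lemma vpcb_line (W : vectType R) (w : dform M 1 W) L d p : is_form w -> line_in d p ->
  (forall p, square p -> mdgen pol (fun _ : 'I_1 => d) p -> vn (pullback G w p (fun _ => d)) <= L) ->
  vpcb L 0 1 (fun u => pullback G w (u *: d + p) (fun _ => d)).
Proof.
move=> fw ld hL; have [S hS] := dgen_line pol p d.
exists S => u /andP[u0 u1] uS.
have su : square (u *: d + p) by apply: ld; rewrite !ltW.
have gu : mdgen pol (fun _ : 'I_1 => d) (u *: d + p) by move=> a; exact: hS.
split; first exact: hL.
have ct : x *: d + p @[x --> u] --> within square (nbhs (u *: d + p)).
  move=> A hA; have h : x *: d + p @[x --> u] --> u *: d + p.
    by apply: cvgD; [apply: cvgZr_tmp; exact: cvg_id|exact: cvg_cst].
  have hA' : \forall x \near u, square (x *: d + p) -> A (x *: d + p) by exact: (h _ hA).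
  have nu : \forall x \near u, 0 < x < 1 by apply: near_itvoo; rewrite u0.
  change (\forall x \near u, A (x *: d + p)).
  apply: filterS2 hA' nu => x h1 /andP[x0 x1]; apply: h1; apply: ld; rewrite !ltW//.
exact: (vcvg_comp ct (pullback_cvg fw (contform1 fw) su gu)).
Qed.

End SquareMap.

(** * Parallel transport *)

Section Transport.
Variables (R : realType) (V : cochain_complex R).
Local Notation E := 'End(V).

Lemma unit_itvE : (unit_itv : set R^o) = `[0, 1]%classic.
Proof. by apply/seteqP; split=> t; rewrite /= in_itv. Qed.

Lemma zero_derivative (W : vectType R) (F : R^o -> W) (S : seq R) : vcontinuous unit_itv F ->
  (forall t : R^o, 0 < t < 1 -> t \notin S -> is_vderive F t 1 0) ->
  forall t, 0 <= t <= 1 -> F t = F 0.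
Proof.
move=> cF dF t /andP[t0 t1]; apply: crd_inj => j; symmetry.
apply: (@const_off_seq _ (fun t => crd j (F t)) S 0 t t0).
  have := cF j; rewrite unit_itvE; apply: continuous_subspaceW => x /=.
  by rewrite !in_itv/= => /andP[-> xt]; exact: le_trans xt t1.
move=> u /andP[u0 ut] uS; rewrite -(crd0 j).
by apply: dF => //; rewrite u0 (lt_le_trans ut).
Qed.

Lemma vprim_vcontinuous (W : vectType R) (F f : R -> W) : vprim 0 1 F f -> vcontinuous unit_itv (F : R^o -> W).
Proof. by move=> /(vprimP _ _ ler01)[_ cF _] j; rewrite unit_itvE; exact: cF. Qed.

Lemma gl0_0 : gl0 (0 : E).
Proof. by split; [exact: homogeneous0|rewrite comp_lfun0l comp_lfun0r]. Qed.

Lemma gl0_lin a (u v : E) : gl0 u -> gl0 v -> gl0 (a *: u + v).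
Proof.
move=> [hu cu] [hv cv]; split; first exact: homogeneous_lin.
by rewrite comp_lfunDr comp_lfunDl -comp_lfunZr -comp_lfunZl cu cv.
Qed.

Lemma gl0_1 : gl0 (\1%VF : E).
Proof.
split; last by rewrite comp_lfun1l comp_lfun1r.
by move=> i; rewrite lim1g addr0.
Qed.

Lemma gl0_comp (u v : E) : gl0 u -> gl0 v -> gl0 (u \o v)%VF.
Proof.
move=> [hu cu] [hv cv]; split; first by have := homogeneous_comp hu hv; rewrite addr0.
by rewrite comp_lfunA cu -comp_lfunA cv comp_lfunA.
Qed.

Lemma gl0_evo (a : R -> E) t : vpc 0 1 a -> (forall u, gl0 (a u)) -> 0 <= t <= 1 -> gl0 (evo a t).
Proof.
move=> pa ga; apply: (evo_subspace gl0_0) => //; [exact: gl0_lin|exact: gl0_1|].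
by move=> u v; exact: gl0_comp.
Qed.

Lemma GL0_evo (a : R -> E) t : vpc 0 1 a -> (forall u, gl0 (a u)) -> 0 <= t <= 1 -> GL0 (evo a t).
Proof.
move=> pa ga t01; split; first exact: gl0_evo.
apply/lker0P => x y xy; rewrite -[x]id_lfunE -[y]id_lfunE -(evoK pa t01).
by rewrite !comp_lfunE xy.
Qed.

Lemma gl0_inv (f : E) : GL0 f -> gl0 (f^-1)%VF.
Proof.
move=> [[hf cf] fi]; split; first exact: homogeneousV.
rewrite -[LHS]comp_lfun1l -(lker0_compVf fi) -comp_lfunA [X in (_ \o X)%VF]comp_lfunA -cf.
by rewrite -(comp_lfunA (cdiff V)) lker0_compfV// comp_lfun1r.
Qed.

Lemma gl0_evi (a : R -> E) t : vpc 0 1 a -> (forall u, gl0 (a u)) -> 0 <= t <= 1 -> gl0 (evi a t).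
Proof. by move=> pa ga t01; apply: gl0_inv; exact: GL0_evo. Qed.

Lemma transportE n (M : manifold R n) (A : dform M 1 E) (gamma : R^o -> M) (a : R -> E) t :
  (forall u, pullback gamma A u (fun _ => 1) = a u) -> vpc 0 1 a -> (forall u, gl0 (a u)) ->
  0 <= t <= 1 -> transport A gamma t = evo a t.
Proof.
move=> aE pa ga t01.
have pe := evo_prim pa.
have [_ _ [S dS]] := iffLR (vprimP _ _ ler01) pe.
have te : is_transport A gamma (evo a).
  split; [exact: evo0|by move=> u u01; exact: GL0_evo|split; first exact: (vprim_vcontinuous pe)].
  by exists S => u u01 uS; rewrite aE; exact: dS.
(* [transport] selects an arbitrary solution [g]. For each of them [evi a u \o g u] has zero
   derivative off a finite set, so the value does not depend on the choice. *)
have uniq g : is_transport A gamma g -> g t = evo a t.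
  move=> [g0 _ [cg [S1 dg]]].
  have pi := evi_prim pa; have [_ _ [S2 di]] := iffLR (vprimP _ _ ler01) pi.
  have bc := @bil_comp R V.
  have cF := vcontinuous_bil bc (vprim_vcontinuous pi) cg.
  have h : (evi a t \o g t)%VF = (evi a 0 \o g 0)%VF.
    apply: (zero_derivative (F := fun u => (evi a u \o g u)%VF) (S := S1 ++ S2) cF) => // u u01.
    rewrite mem_cat negb_or => /andP[u1 u2].
    have := is_vderive_bil bc (di u u01 u2) (dg u u01 u1).
    by rewrite aE comp_lfunNr comp_lfunA subrr.
  by rewrite -[g t]comp_lfun1l -(eviK pa t01) -comp_lfunA h g0 evi0// !comp_lfun1r.
rewrite /transport; case: xgetP => [f _ [g tg <-]|/(_ (evo a t)) h]; first exact: uniq.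
by exfalso; apply: h; exists (evo a).
Qed.

Lemma transport_GL0 n (M : manifold R n) (A : dform M 1 E) (gamma : R^o -> M) t :
  unit_itv t -> GL0 (transport A gamma t).
Proof.
move=> t01; rewrite /transport; case: xgetP => [f _ [g [_ hg _] <-]|_]; first exact: hg.
split; first exact: gl0_1.
by apply/lker0P => x y; rewrite !id_lfunE.
Qed.

End Transport.

Section Tools.
Variable R : realType.

(** Connectedness of [0, 1]: the indicator of [Pr] is locally constant, hence constant by
    [const_off_seq]. It carries along a whole level what is proved within one chart. *)
Lemma segment_ind (Pr : R -> Prop) :
  (forall x0, 0 <= x0 <= 1 -> exists2 r, 0 < r & forall x1 x2, 0 <= x1 <= 1 -> 0 <= x2 <= 1 ->
    `|x1 - x0| < r -> `|x2 - x0| < r -> Pr x1 -> Pr x2) ->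
  Pr 0 -> forall x, 0 <= x <= 1 -> Pr x.
Proof.
move=> hloc Pr0 x x01; pose f (t : R) : R^o := if `[< Pr t >] then 1 else 0.
have floc x0 : 0 <= x0 <= 1 -> exists2 r, 0 < r & forall x1, 0 <= x1 <= 1 -> `|x1 - x0| < r -> f x1 = f x0.
  move=> x001; have [r r0 h] := hloc x0 x001; exists r => // x1 x101 x1r; rewrite /f.
  have -> // : `[< Pr x1 >] = `[< Pr x0 >].
  by apply/asboolP/asboolP; apply: h => //; rewrite ?subrr ?normr0.
have /andP[x0 x1] := x01.
suff : f 0 = f x.
  rewrite /f; case: asboolP => // _; case: asboolP => // _ /eqP.
  by rewrite oner_eq0.
apply: (@const_off_seq R f [::] 0 x x0).
  apply/subspace_continuousP => t /=; rewrite in_itv/= => /andP[t0 tx].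
  have t01 : 0 <= t <= 1 by rewrite t0 (le_trans tx).
  have [r r0 h] := floc t t01.
  have nu : \forall u \near t, `|u - t| < r.
    by have := @nbhsx_ballx _ _ t _ r0; apply: filterS => u; rewrite -ball_normE /= distrC.
  apply/cvgrPdist_lt => e e0; rewrite near_withinE; apply: filterS nu => u ur /=.
  by rewrite in_itv/= => /andP[u0 ux]; rewrite /from_subspace h ?subrr ?normr0// ?u0 ?(le_trans ux).
move=> t /andP[t0 tx] _; have t01 : 0 <= t <= 1 by rewrite (ltW t0) (le_trans (ltW tx)).
have [r r0 h] := floc t t01.
have nu : \forall u \near t, `|u - t| < r.
  by have := @nbhsx_ballx _ _ t _ r0; apply: filterS => u; rewrite -ball_normE /= distrC.
have nx : \forall u \near t, 0 < u < x by apply: near_itvoo; rewrite t0.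
have E : \forall u \near t, cst (f t) u = f u.
  apply: filterS2 nu nx => u ur /andP[u0 u1]; rewrite /cst h// (ltW u0)//=.
  exact: le_trans (ltW u1) x1.
have dc : is_derive (t : R^o) 1 (cst (f t) : R^o -> R^o) 0 by exact: is_derive_cst.
exact: (@near_eq_is_derive R R^o R^o (cst (f t)) f t 1 0 E dc).
Unshelve. all: by end_near. Qed.

Lemma vprim_sum (W : vectType R) (k : nat) a b (F f : 'I_k -> R -> W) :
  (forall i, vprim a b (F i) (f i)) -> vprim a b (fun t => \sum_i F i t) (fun t => \sum_i f i t).
Proof.
move=> h; elim: k F f h => [|k IH] F f h.
  have E0 (H : 'I_0 -> R -> W) : (fun t => \sum_i H i t) = fun=> 0.
    by apply/funext => t; rewrite big_ord0.
  by rewrite !E0; exact: vprim_cst0.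
have h1 := vprimD (h ord0) (IH _ _ (fun i => h (lift ord0 i))).
have ES (H : 'I_k.+1 -> R -> W) : (fun t => \sum_i H i t) = fun t => H ord0 t + \sum_(i < k) H (lift ord0 i) t.
  by apply/funext => t; rewrite big_ord_recl.
by rewrite !ES.
Qed.

Lemma vpcb_of_vpc (W : vectType R) a b C (F : R -> W) (S : seq R) : vpc a b F ->
  (forall t, a < t < b -> t \notin S -> vn (F t) <= C) -> vpcb C a b F.
Proof.
move=> [M [T h]] hC; exists (S ++ T) => t tab; rewrite mem_cat negb_or => /andP[tS tT].
by split; [exact: hC|have [] := h t tab tT].
Qed.

Local Notation X := (R^o * R^o)%type.

Section PatchedLine.
Variables (k : nat) (pol : 'I_k -> halfspaces R) (W : vectType R).
Hypothesis cover : square `<=` \bigcup_i hs_set (pol i).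

Lemma line_within d (p : X) (u : R) (D : set R) : (forall x, D x -> square (x *: d + p)) ->
  x *: d + p @[x --> within D (nbhs u)] --> within square (nbhs (u *: d + p)).
Proof.
move=> hD A hA; have h : x *: d + p @[x --> u] --> u *: d + p.
  by apply: cvgD; [apply: cvgZr_tmp; exact: cvg_id|exact: cvg_cst].
have hA' : \forall x \near u, square (x *: d + p) -> A (x *: d + p) by exact: (h _ hA).
change (\forall x \near within D (nbhs u), A (x *: d + p)).
rewrite near_withinE; apply: filterS hA' => x h1 Dx; apply: h1; exact: hD.
Qed.

(** Continuity of [y] across the edges makes up for the jumps of its derivative, which occur at
    finitely many points of the line. *)
Lemma vprim_patched (y : X -> W) d (p : X) a b L : a <= b ->
  (forall u, a <= u <= b -> square (u *: d + p) /\ patched pol y (u *: d + p)) ->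
  (forall u, a <= u <= b -> dgen pol d (u *: d + p) -> vn (vderive y (u *: d + p) d) <= L) ->
  vprim a b (fun u => y (u *: d + p)) (fun u => vderive y (u *: d + p) d).
Proof.
move=> ab hp hL; have [S hS] := dgen_line pol p d.
apply/vprimP => //; split.
- exists L, S => u /andP[au ub] uS.
  have uab : a <= u <= b by rewrite !ltW.
  have [su pu] := hp u uab; have gu := hS u I uS su; split; first exact: hL.
  have c := patchedC_cvg cover (patched_vderive_patchedC d pu) su gu (dgen_open gu).
  have lw := @line_within d p u [set x | a <= x <= b] (fun x xab => (hp x xab).1).
  have h := vcvg_comp lw c; apply: vcvg_trans h => A; rewrite /within/= => hA.
  have nu : \forall x \near u, a < x < b by apply: near_itvoo; rewrite au.
  by apply: filterS2 hA nu => x h1 /andP[x0 x1]; apply: h1; rewrite /= !ltW.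
- move=> j; apply/subspace_continuousP => u /=; rewrite in_itv/= => uab.
  have [su pu] := hp u uab.
  have nI : \forall q \near u *: d + p, square q -> True by apply: filterE.
  have c := patchedC_cvg cover (patched_patchedC pu) su I nI.
  have lw : x *: d + p @[x --> within [set` `[a, b]] (nbhs u)] --> within square (nbhs (u *: d + p)).
    by apply: line_within => x /=; rewrite in_itv/= => /hp[].
  exact: (vcvg_comp lw c).
- exists S => u /andP[au ub] uS; have [su pu] := hp u (introT andP (conj (ltW au) (ltW ub))).
  have gu := hS u I uS su; apply: is_vderive_on_line.
  exact: (nbhs_singleton (patched_is_vderive cover d pu)).
Qed.

Lemma vprim_lipschitz a b (F f : R -> W) L (S : seq R) : a <= b -> vprim a b F f ->
  (forall t, a < t < b -> t \notin S -> vn (f t) <= L) -> vn (F b - F a) <= L * (b - a).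
Proof.
move=> ab [pf h] hL; rewrite (h b) ?ab ?lexx// [F a + _]addrC addrK.
by apply: vint_bound => //; exact: vpcb_of_vpc hL.
Qed.

End PatchedLine.
End Tools.

Section FormHom.
Variable R : realType.

Lemma C1atI (X : normedModType R) (W : vectType R) (F : X -> W) (D : X -> X -> W) q :
  (\forall p \near q, vcvg (nbhs p) F (F p) /\ forall v,
    is_vderive F p v (D p v) /\ vcvg (nbhs p) (fun x => D x v) (D p v)) -> C1at F q.
Proof.
move=> h; have hh := near_join h; apply: filterS2 h hh => p [cF dF] hp; split=> // v.
have E : \forall x \near p, D x v = vderive F x v.
  by apply: filterS hp => x [_ /(_ v)[dx _]]; rewrite (is_vderive_vderive dx).
have [dp cp] := dF v; rewrite (is_vderive_vderive dp); split=> //.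
exact: vcvg_near E cp.
Qed.

Lemma C1at_lin (X : normedModType R) (W1 W2 : vectType R) (L : {linear W1 -> W2}) (F : X -> W1) q :
  C1at F q -> C1at (fun x => L (F x)) q.
Proof.
move=> h; apply: (@C1atI _ _ _ (fun x v => L (vderive F x v))); apply: filterS h => p [cF dF].
split; first exact: (vcvg_lin L cF).
by move=> v; have [d c] := dF v; split; [exact: (is_vderive_lin L d)|exact: (vcvg_lin L c)].
Qed.

Lemma C1atD (X : normedModType R) (W : vectType R) (F H : X -> W) q :
  C1at F q -> C1at H q -> C1at (fun x => F x + H x) q.
Proof.
move=> h h'; apply: (@C1atI _ _ _ (fun x v => vderive F x v + vderive H x v)).
apply: filterS2 h h' => p [cF dF] [cH dH].
split; first exact: (vcvgD cF cH).
move=> v; have [d c] := dF v; have [d' c'] := dH v.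
by split; [exact: (is_vderiveD d d')|exact: (vcvgD c c')].
Qed.

Lemma C1at_sum (X : normedModType R) (W : vectType R) (k : nat) (F : 'I_k -> X -> W) q :
  (forall i, C1at (F i) q) -> C1at (fun x => \sum_i F i x) q.
Proof.
elim: k F => [|k IH] F h.
  have E0 : (fun x => \sum_i F i x) = fun=> 0 by apply/funext => x; rewrite big_ord0.
  rewrite E0; apply: (@C1atI _ _ _ (fun _ _ => 0)); apply: filterE => p.
  split; first exact: vcvg_cst.
  by move=> v; split; [exact: is_vderive_cst|exact: vcvg_cst].
have ES : (fun x => \sum_i F i x) = fun x => F ord0 x + \sum_(i < k) F (lift ord0 i) x.
  by apply/funext => x; rewrite big_ord_recl.
by rewrite ES; apply: C1atD; [exact: h|exact: IH].
Qed.

Variables (n : nat) (M : manifold R n) (W : vectType R) (A : dform M 1 W).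
Hypothesis fA : is_form A.
Local Notation V := 'rV[R]_n.
Local Notation B := (vbasis {:V}).
Local Notation N := (\dim {:V}).

Lemma bil_ev : bil (fun (v : V) (L : 'Hom(V, W)) => L v).
Proof.
split=> [L a u v|v a L L']; first by rewrite linearP.
by rewrite add_lfunE scale_lfunE.
Qed.

Definition crdhom (k : 'I_N) (w : W) : 'Hom(V, W) := linfun (fun v : V => crd k v *: w).

Lemma crdhomE k w v : crdhom k w v = crd k v *: w.
Proof.
have lw : linear (fun v : V => crd k v *: w).
  by move=> a u u'; rewrite crdD crdZ scalerDl scalerA.
pose f := HB.pack_for {linear V -> W} (fun v : V => crd k v *: w)
    (GRing.isLinear.Build R V W _ (fun v : V => crd k v *: w) lw).
exact: (lfunE f).
Qed.

Lemma crdhom_is_linear k : linear (crdhom k).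
Proof.
by move=> a u v; apply/lfunP => x; rewrite add_lfunE scale_lfunE !crdhomE scalerDr !scalerA mulrC.
Qed.
HB.instance Definition _ k := GRing.isLinear.Build R W 'Hom(V, W) _ (crdhom k) (@crdhom_is_linear k).

(** The connection in a chart as a function with values in linear maps: its dependence on the point
    and its evaluation on a vector are then separate arguments of a bilinear operation. *)
Definition formhom c (z : V) : 'Hom(V, W) := \sum_(k < N) crdhom k (A c z (fun _ => B`_k)).

Lemma formhomE c z v : @chart_img _ _ M c z -> formhom c z v = A c z (fun _ => v).
Proof.
move=> cz; have [al _ _] := fA; have lw := form1_linear (al c z cz).
pose f := HB.pack_for {linear V -> W} (fun v : V => A c z (fun _ => v))
    (GRing.isLinear.Build R V W _ (fun v : V => A c z (fun _ => v)) lw).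
rewrite -[RHS]/(f v) [in RHS](sum_crd v) linear_sum sum_lfunE; apply: eq_bigr => k _.
by rewrite linearZ crdhomE.
Qed.

Lemma formhom_C1at c z : @chart_img _ _ M c z -> C1at (formhom c) z.
Proof.
by move=> cz; apply: C1at_sum => k; apply: C1at_lin; exact: is_form_C1at.
Qed.

Lemma formhom_vderive c z u v : @chart_img _ _ M c z ->
  vderive (formhom c) z u v = vderive (fun x => A c x (fun _ => v)) z u.
Proof.
move=> cz; pose ev := fun L : 'Hom(V, W) => L v.
have lev : linear ev by have [_ /(_ v)] := bil_ev.
pose f := HB.pack_for {linear 'Hom(V, W) -> W} ev (GRing.isLinear.Build R 'Hom(V, W) W _ ev lev).
have [_ d] := nbhs_singleton (formhom_C1at cz); have [d1 _] := d u.
have d2 := is_vderive_lin f d1; rewrite -[LHS]/(f (vderive (formhom c) z u)).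
symmetry; apply: is_vderive_vderive; apply: is_vderive_near d2; last by rewrite -formhomE.
have nz : nbhs z (@chart_img _ _ M c) by apply: open_nbhs_nbhs; split; [exact: img_open|exact: cz].
have h : e *: u + z @[e --> (0:R)^'] --> z.
  rewrite -[X in _ --> X]add0r -[X in _ --> X + _](scale0r u); apply: cvgD; last exact: cvg_cst.
  by apply: cvgZr_tmp; exact: nbhs_dnbhs.
have h' : \forall e \near (0:R)^', chart_img c (e *: u + z) by exact: (h _ nz).
by apply: filterS h' => e ce; rewrite -formhomE.
Qed.

End FormHom.

Section VprimLip.
Variables (R : realType) (W : vectType R).

Lemma vprim_lip a b (F f : R -> W) L (S : seq R) : a <= b -> vprim a b F f ->
  (forall t, a < t < b -> t \notin S -> vn (f t) <= L) ->
  forall s t, a <= s <= b -> a <= t <= b -> vn (F t - F s) <= L * `|t - s|.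
Proof.
move=> ab pF hL.
have h s t : a <= s -> s <= t -> t <= b -> vn (F t - F s) <= L * (t - s).
  move=> as_ st tb; apply: (vprim_lipschitz (S := S) st); first exact: vprim_sub pF.
  by move=> u /andP[su ut] uS; apply: hL => //; rewrite (le_lt_trans as_ su) (lt_le_trans ut tb).
move=> s t /andP[as_ sb] /andP[at_ tb]; have [st|/ltW ts] := leP s t.
  by rewrite ger0_norm ?subr_ge0//; exact: h.
by rewrite -vnN opprB distrC ger0_norm ?subr_ge0//; exact: h.
Qed.

End VprimLip.

(** * Transport in a chart up to second order *)

Section ChartTransport.
Variables (R : realType) (n : nat) (M : manifold R n) (U : vectType R).
Local Notation E := 'End(U).
Local Notation X := (R^o * R^o)%type.
Variables (A : dform M 1 E) (G : X -> M) (k : nat) (pol : 'I_k -> halfspaces R).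
Hypothesis fA : is_form A.
Hypothesis cover : square `<=` \bigcup_i hs_set (pol i).
Hypothesis cG : {within square, continuous G}.
Hypothesis sm : forall i, smooth_on (square `&` hs_set (pol i)) G.

Definition near2 (q : X) (r : R) (p : X) := `|p.1 - q.1| < r /\ `|p.2 - q.2| < r.

Lemma near2_convex q r d p (u1 u2 u : R) : u1 <= u <= u2 -> near2 q r (u1 *: d + p) ->
  near2 q r (u2 *: d + p) -> near2 q r (u *: d + p).
Proof.
rewrite /near2 /= => /andP[u1u uu2] [h1 h2] [h3 h4].
have aux (d1 p1 q1 : R) : `|u1 * d1 + p1 - q1| < r -> `|u2 * d1 + p1 - q1| < r -> `|u * d1 + p1 - q1| < r.
  rewrite !ltr_norml => /andP[a1 a2] /andP[b1 b2]; have [d0|/ltW d0] := leP 0 d1.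
    have := ler_wpM2r d0 u1u; have := ler_wpM2r d0 uu2; lra.
  have := ler_wnM2r d0 u1u; have := ler_wnM2r d0 uu2; lra.
by split; exact: aux.
Qed.

Lemma ball2 (q : X) (P : X -> Prop) : (\forall p \near q, P p) ->
  exists2 r, 0 < r & forall p, near2 q r p -> P p.
Proof.
move=> /nbhs_ballP[r /= r0 h]; exists r => // p [h1 h2]; apply: h.
by split; rewrite -ball_normE /= distrC.
Qed.

Local Notation zz c := (fun p => chart_of c (G p)).
Definition yy c (p : X) : 'Hom('rV[R]_n, E) := formhom A c (chart_of c (G p)).

Lemma patched_yy c q : square q -> chart_dom (chart_of c) (G q) -> patched pol (yy c) q.
Proof.
move=> sq cq; apply: (patched_comp (g := formhom A c) sm sq cq).
by apply: formhom_C1at => //; exists (G q).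
Qed.

Lemma chart_ball d q c : square q -> chart_dom (chart_of c) (G q) ->
  exists r L : R, [/\ 0 < r, 0 <= L & forall p, square p -> near2 q r p ->
   [/\ chart_dom (chart_of c) (G p), vn (yy c p) <= L & dgen pol d p ->
     [/\ vn (vderive (zz c) p d) <= L, vn (vderive (yy c) p d) <= L &
         pullback G A p (fun _ => d) = yy c p (vderive (zz c) p d)]]].
Proof.
move=> sq cq.
have n1 := near_chart_dom cG sq cq.
have pz : patched pol (zz c) q by exact: (patched_chart sm sq cq).
have py := patched_yy sq cq.
have [L1 n2] := patchedC_bounded cover (patched_vderive_patchedC d pz).
have [L2 n3] := patchedC_bounded cover (patched_vderive_patchedC d py).
have [L3 n4] := patchedC_bounded cover (patched_patchedC py).
have n5 := near_pullback cover cG sm sq cq (fun _ : 'I_1 => d) fA.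
have [r r0 hr] := ball2 (filterI n1 (filterI n2 (filterI n3 (filterI n4 n5)))).
exists r, (`|L1| + `|L2| + `|L3|); split=> //.
move=> p sp /hr[h1 [h2 [h3 [h4 h5]]]].
have l1 : L1 <= `|L1| + `|L2| + `|L3| by rewrite (le_trans (ler_norm _))// -addrA lerDl addr_ge0.
have l2 : L2 <= `|L1| + `|L2| + `|L3| by rewrite (le_trans (ler_norm _))// addrAC lerDr addr_ge0.
have l3 : L3 <= `|L1| + `|L2| + `|L3| by rewrite (le_trans (ler_norm _))// lerDr addr_ge0.
split; [exact: h1|exact: le_trans (h4 sp I) l3|move=> gp; split].
- exact: le_trans (h2 sp gp) l1.
- exact: le_trans (h3 sp gp) l2.
- rewrite h5//; rewrite /yy formhomE//; exists (G p) => //; exact: h1.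
Qed.

(** The connection along the image of a straight line of the square, whose evolution is the
    transport along it. Levels, columns and the diagonal are all of this form. *)
Definition linefield d p (u : R) : E := pullback G A (u *: d + p) (fun _ => d).

Lemma linefield_bounded d : exists2 L, 0 <= L &
  (forall p, dgen pol d p -> vn (pullback G A p (fun _ => d)) <= L) /\
  forall p, line_in d p -> vpcb L 0 1 (linefield d p).
Proof.
have [L L0 hL] := pullback_bounded cover cG sm (fun _ : 'I_1 => d) fA (contform1 fA).
exists L => //; split; first by move=> p gp; apply: hL => //; have [] := gp.
by move=> p lp; exact: (vpcb_line cover cG sm fA lp hL).
Qed.

Lemma evo_bounded d : exists2 C, 0 <= C & forall p, line_in d p -> forall u, 0 <= u <= 1 ->
  vn (evo (linefield d p) u) <= C /\ vn (evi (linefield d p) u) <= C.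
Proof.
have [L L0 [_ hL]] := linefield_bounded d; have [K K0 hK] := evo_spec U.
exists (K * expR (K * L)); first by rewrite mulr_ge0// expR_ge0.
by move=> p lp u u01; have [_ _ _ h] := hK L _ L0 (hL p lp); exact: h.
Qed.

Lemma vprim_chart d p c lo hi r L q : lo <= hi -> 0 <= lo -> hi <= 1 -> line_in d p ->
  near2 q r (lo *: d + p) -> near2 q r (hi *: d + p) ->
  (forall p, square p -> near2 q r p ->
   [/\ chart_dom (chart_of c) (G p), vn (yy c p) <= L & dgen pol d p ->
     [/\ vn (vderive (zz c) p d) <= L, vn (vderive (yy c) p d) <= L &
         pullback G A p (fun _ => d) = yy c p (vderive (zz c) p d)]]) ->
  vprim lo hi (fun u => zz c (u *: d + p)) (fun u => vderive (zz c) (u *: d + p) d) /\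
  vprim lo hi (fun u => yy c (u *: d + p)) (fun u => vderive (yy c) (u *: d + p) d).
Proof.
move=> lohi lo0 hi1 lp nlo nhi hr.
have sq u : lo <= u <= hi -> square (u *: d + p).
  by move=> /andP[lu uh]; apply: lp; rewrite (le_trans lo0 lu) (le_trans uh hi1).
have nr u : lo <= u <= hi -> near2 q r (u *: d + p) by move=> h; exact: near2_convex h nlo nhi.
split; apply: (vprim_patched (L := L) cover lohi) => u uh.
- split; first exact: sq.
  by have [cu _ _] := hr _ (sq u uh) (nr u uh); exact: (patched_chart sm (sq u uh) cu).
- by move=> gu; have [_ _ /(_ gu)[]] := hr _ (sq u uh) (nr u uh).
- split; first exact: sq.
  by have [cu _ _] := hr _ (sq u uh) (nr u uh); exact: (patched_yy (sq u uh) cu).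
- by move=> gu; have [_ _ /(_ gu)[]] := hr _ (sq u uh) (nr u uh).
Qed.

(** The first-order term is the connection frozen at [u1] and evaluated on a chord of chart
    coordinates, not on a tangent vector. It needs no derivative at the ends, which may lie on
    edges, and chords add up along broken lines. *)
Lemma transport_chart d q c : square q -> chart_dom (chart_of c) (G q) ->
  exists r C : R, [/\ 0 < r, 0 <= C & forall p, line_in d p ->
    forall u1 u2, 0 <= u1 <= 1 -> 0 <= u2 <= 1 -> near2 q r (u1 *: d + p) -> near2 q r (u2 *: d + p) ->
    vn (((\1 + yy c (u1 *: d + p) (zz c (u2 *: d + p) - zz c (u1 *: d + p))) \o
          evo (linefield d p) u2)%VF - evo (linefield d p) u1) <= C * (u2 - u1) ^+ 2].
Proof.
move=> sq cq; have [r [L [r0 L0 hr]]] := chart_ball d sq cq.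
have [L' L'0 [hL' hv]] := linefield_bounded d; have [KT KT0 hT] := evo_bounded d.
have [Kc Kc0 hKc] := vn_comp U; have [Ke Ke0 hKe] := vn_bil (bil_ev n E).
pose C := Kc * (Ke * L * L) * KT + Kc * (Kc * (Ke * L * L) * L') * KT.
exists r, C; split=> //; first by rewrite addr_ge0// !mulr_ge0.
move=> p lp.
pose g u1 u := ((\1 + yy c (u1 *: d + p) (zz c (u *: d + p) - zz c (u1 *: d + p))) \o
          evo (linefield d p) u)%VF.
have main lo hi u1 : lo <= hi -> 0 <= lo -> hi <= 1 -> near2 q r (lo *: d + p) -> near2 q r (hi *: d + p) ->
    lo <= u1 <= hi ->
    vn (g u1 hi - g u1 lo) <= C * (hi - lo) ^+ 2.
  move=> lohi lo0 hi1 nlo nhi u1h.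
  have [vz vy] := vprim_chart lohi lo0 hi1 lp nlo nhi hr.
  have pa : vpc 0 1 (linefield d p) by exists L'; exact: hv.
  have vT := vprim_sub lo0 lohi hi1 (evo_prim pa).
  have [S hS] := dgen_line pol p d.
  pose Y := yy c (u1 *: d + p); pose z u := zz c (u *: d + p).
  have vY : vprim lo hi (fun u => \1%VF + Y (z u - z u1)) (fun u => 0 + Y (vderive (zz c) (u *: d + p) d - 0)).
    by apply: vprimD (vprim_cst0 _ _ _) _; apply: vprim_lin; exact: vprimB vz (vprim_cst0 _ _ _).
  have vg := vprim_bil lohi (bil_comp U) vY vT.
  have bz := vprim_lip (S := S) (L := L) lohi vz.
  have by_ := vprim_lip (S := S) (L := L) lohi vy.
  have sqh u : lo <= u <= hi -> square (u *: d + p).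
    by move=> /andP[lu uh]; apply: lp; rewrite (le_trans lo0 lu) (le_trans uh hi1).
  have hru u : lo <= u <= hi -> _ := fun h => hr _ (sqh u h) (near2_convex h nlo nhi).
  have gen u : lo < u < hi -> u \notin S -> dgen pol d (u *: d + p).
    by move=> /andP[lu uh] uS; apply: hS => //; apply: sqh; rewrite !ltW.
  have le2 (u : R) : lo <= u <= hi -> `|u - u1| <= hi - lo.
    by move: u1h => /andP[a1 a2] /andP[b1 b2]; rewrite ler_norml; lra.
  have D0 : 0 <= hi - lo by rewrite subr_ge0.
  rewrite expr2 mulrA; apply: (vprim_lipschitz (S := S) lohi vg) => u uh uS.
  have uh' : lo <= u <= hi by case/andP: uh => a b; rewrite !ltW.
  have [_ bY gu] := hru u uh'; have {gu} [bzu byu ea] := gu (gen u uh uS).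
  have [_ bY1 _] := hru u1 u1h.
  have u01 : 0 <= u <= 1 by case/andP: uh' => a b; rewrite (le_trans lo0 a) (le_trans b hi1).
  have [bT _] := hT p lp u u01.
  have ea' : linefield d p u = _ := ea.
  rewrite add0r subr0 ea' comp_lfunNr comp_lfunA comp_lfunDl comp_lfun1l comp_lfunDl opprD addrA.
  rewrite -comp_lfunNl -comp_lfunDl.
  have -> : Y (vderive (zz c) (u *: d + p) d) - yy c (u *: d + p) (vderive (zz c) (u *: d + p) d) =
      (Y - yy c (u *: d + p)) (vderive (zz c) (u *: d + p) d).
    by rewrite add_lfunE opp_lfunE.
  rewrite -ea' /C mulrDl; apply: le_trans (vnB _ _) _; apply: lerD.
    apply: le_trans (hKc _ _) _; rewrite [leRHS]mulrAC ler_pM ?mulr_ge0 ?vn_ge0//.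
    rewrite -[leRHS]mulrA ler_wpM2l//; apply: le_trans (hKe _ _) _.
    rewrite -!mulrA ler_wpM2l// ler_pM ?vn_ge0// -vnN opprB.
    apply: le_trans (by_ _ _ _ u1h uh') _; last by rewrite ler_wpM2l ?le2.
    by move=> t th tS; have [_ _ /(_ (gen t th tS))[]] := hru t (introT andP (conj (ltW (andP th).1) (ltW (andP th).2))).
  apply: le_trans (hKc _ _) _; rewrite [leRHS]mulrAC ler_pM ?mulr_ge0 ?vn_ge0//.
  rewrite -[leRHS]mulrA ler_wpM2l//.
  apply: le_trans (hKc _ _) _; rewrite [leRHS]mulrAC ler_pM ?mulr_ge0 ?vn_ge0//; last first.
    by rewrite /linefield; apply: hL'; exact: gen.
  rewrite -[leRHS]mulrA ler_wpM2l//; apply: le_trans (hKe _ _) _.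
  rewrite [leRHS]mulrAC ler_pM ?mulr_ge0 ?vn_ge0// -mulrA ler_wpM2l//.
  apply: le_trans (bz _ _ _ u1h uh') _; last by rewrite ler_wpM2l ?le2.
  by move=> t th tS; have [_ _ /(_ (gen t th tS))[]] := hru t (introT andP (conj (ltW (andP th).1) (ltW (andP th).2))).
move=> u1 u2 /andP[u10 u11] /andP[u20 u21] n1 n2.
have E1 : g u1 u1 = evo (linefield d p) u1 by rewrite /g subrr linear0 addr0 comp_lfun1l.
rewrite -[X in _ - X]E1 -/(g u1 u2); have [u12|/ltW u21'] := leP u1 u2.
  by apply: main => //; rewrite lexx.
by rewrite -vnN opprB -sqrrN opprB; apply: main => //; rewrite lexx andbT.
Qed.

End ChartTransport.

(** * The nonabelian Stokes formula *)

Section Stokes.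
Variables (R : realType) (n : nat) (M : manifold R n) (U : vectType R).
Local Notation E := 'End(U).
Local Notation X := (R^o * R^o)%type.
Variables (A : dform M 1 E) (G : X -> M) (k : nat) (pol : 'I_k -> halfspaces R).
Hypothesis fA : is_form A.
Hypothesis cover : square `<=` \bigcup_i hs_set (pol i).
Hypothesis cG : {within square, continuous G}.
Hypothesis sm : forall i, smooth_on (square `&` hs_set (pol i)) G.

Local Notation zz c := (fun p => chart_of c (G p)).
Local Notation yy := (yy A G).
Local Notation linefield := (linefield A G).
Local Notation e1 := ((1, 0) : X).
Local Notation e2 := ((0, 1) : X).

Lemma line_cvg_within d (p : X) (u0 : R) (T : Type) (H : set_system T) {FH : Filter H} (u : T -> R^o) (q : T -> X) :
  u t @[t --> H] --> u0 -> q t @[t --> H] --> p -> (\forall t \near H, square (u t *: d + q t)) ->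
  u t *: d + q t @[t --> H] --> within square (nbhs (u0 *: d + p)).
Proof.
move=> cu cq sq B hB.
have h : u t *: d + q t @[t --> H] --> u0 *: d + p by apply: cvgD => //; exact: cvgZr_tmp.
have hB' : \forall t \near H, square (u t *: d + q t) -> B (u t *: d + q t) by exact: (h _ hB).
change (\forall t \near H, B (u t *: d + q t)).
by apply: filterS2 hB' sq => t h1 h2; exact: h1.
Qed.

Lemma vpcb_pullback_line (W : vectType R) l (w : dform M l W) (v : 'I_l -> X) L d p (S : seq R) :
  is_form w -> contform w -> line_in d p ->
  (forall u, 0 < u < 1 -> u \notin S -> mdgen pol v (u *: d + p)) ->
  (forall p, square p -> mdgen pol v p -> vn (pullback G w p v) <= L) ->
  vpcb L 0 1 (fun u => pullback G w (u *: d + p) v).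
Proof.
move=> fw cw ld hS hL; exists S => u /andP[u0 u1] uS.
have su : square (u *: d + p) by apply: ld; rewrite !ltW.
have gu : mdgen pol v (u *: d + p) by apply: hS => //; rewrite u0.
split; first exact: hL.
have ct : x *: d + p @[x --> u] --> within square (nbhs (u *: d + p)).
  apply: line_cvg_within; [exact: cvg_id|exact: cvg_cst|].
  have nu : \forall x \near u, 0 < x < 1 by apply: near_itvoo; rewrite u0.
  by apply: filterS nu => x /andP[x0 x1]; apply: ld; rewrite !ltW.
exact: (vcvg_comp ct (pullback_cvg cover cG sm fw cw su gu)).
Qed.

Lemma evo_line_cvg d (p : R -> X) (D : set R^o) (s0 : R^o) (u : R) : 0 <= u <= 1 ->
  (forall s, D s -> line_in d (p s)) -> line_in d (p s0) -> p s @[s --> within D (nbhs s0)] --> p s0 ->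
  vcvg (within D (nbhs s0)) (fun s => evo (linefield d (p s)) u) (evo (linefield d (p s0)) u) /\
  vcvg (within D (nbhs s0)) (fun s => evi (linefield d (p s)) u) (evi (linefield d (p s0)) u).
Proof.
move=> u01 hD l0 cp; have [L L0 [hL hv]] := linefield_bounded fA cover cG sm d.
have [C C0 hC] := evo_dist U L0; have [S hS] := dgen_line pol (p s0) d.
have nD : \forall s \near within D (nbhs s0), D s by rewrite near_withinE; apply: filterE.
have ic : ig 0 1 (fun t => vn (linefield d (p s) t - linefield d (p s0) t)) @[s --> within D (nbhs s0)] --> (0 : R^o).
  apply: (@dominated_vcvg R E R^o D s0 0 1 (fun s => linefield d (p s)) (linefield d (p s0)) L ler01).
  - by apply: filterS nD => s Ds; apply: hv; exact: hD.
  - by exists L; exact: hv.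
  exists S => t /andP[t0 t1] tS; have st : square (t *: d + p s0) by apply: l0; rewrite !ltW.
  have gt : mdgen pol (fun _ : 'I_1 => d) (t *: d + p s0) by move=> a; exact: hS.
  have ct : t *: d + p s @[s --> within D (nbhs s0)] --> within square (nbhs (t *: d + p s0)).
    apply: (line_cvg_within (u := fun=> t)) => //; first exact: cvg_cst.
    by apply: filterS nD => s Ds; apply: hD => //; rewrite !ltW.
  exact: (vcvg_comp ct (pullback_cvg cover cG sm fA (contform1 fA) st gt)).
have ic' : C * ig 0 1 (fun t => vn (linefield d (p s) t - linefield d (p s0) t)) @[s --> within D (nbhs s0)] --> (0 : R).
  rewrite -[X in _ --> X](mulr0 C).
  have cc : (fun _ : R^o => C : R) @ within D (nbhs s0) --> C by exact: cvg_cst.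
  exact: (cvgM cc ic).
split; apply: (vcvg_squeeze _ ic'); apply: filterS nD => s Ds.
  by have [_ _ h _] := hC _ _ (hv _ (hD s Ds)) (hv _ l0) u u01.
by have [_ _ _ h] := hC _ _ (hv _ (hD s Ds)) (hv _ l0) u u01.
Qed.

Definition fgen p := dgen pol e1 p /\ dgen pol e2 p.

(** A wall parallel to the levels lies on one of them only, and any other wall meets each level in
    one point at most. Levels and columns are treated at once, since both carry integrals later. *)
Lemma fgen_lines : exists S : seq R, forall y, 0 <= y <= 1 -> y \notin S ->
  exists S' : seq R, forall x, 0 <= x <= 1 -> x \notin S' -> fgen (x, y) /\ fgen (y, x) .
Proof.
have aux (a b c : R) : exists S : seq R, forall y, y \notin S -> exists S' : seq R, forall x, x \notin S' ->
    x * a + y * b = c -> a = 0 /\ b = 0.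
  have [->|a0] := eqVneq a 0.
    have [->|b0] := eqVneq b 0; first by exists [::] => y _; exists [::].
    have [S hS] := affine_root 0 c b0; exists S => y yS; exists [::] => x _.
    by have := hS y I yS; rewrite addr0 mulr0 add0r => /eqP.
  exists [::] => y _; have [S hS] := affine_root (y * b) c a0; exists S => x xS /eqP.
  by rewrite (negbTE (hS x I xS)).
have [S hS] : exists S : seq R, forall y, True -> y \notin S -> forall i (j : 'I_(hs_num (pol i))),
    exists S' : seq R, forall x, x \notin S' ->
    (hs_form j (x, y) = hs_bound j -> hs_form j e1 = 0 /\ hs_form j e2 = 0) /\
    (hs_form j (y, x) = hs_bound j -> hs_form j e1 = 0 /\ hs_form j e2 = 0).
  apply: ex_seq_fin => i; apply: ex_seq_fin => j.
  have [S1 h1] := aux (hs_form j e1) (hs_form j e2) (hs_bound j).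
  have [S2 h2] := aux (hs_form j e2) (hs_form j e1) (hs_bound j).
  exists (S1 ++ S2) => y _; rewrite mem_cat negb_or => /andP[/h1[S1' h1'] /h2[S2' h2']].
  exists (S1' ++ S2') => x; rewrite mem_cat negb_or => /andP[x1 x2]; split; rewrite lin2E /=.
    exact: h1'.
  by rewrite addrC => e; have [] := h2' x x2 e.
exists (S ++ [:: 0; 1]) => y y01; rewrite mem_cat negb_or !inE negb_or => /and3P[yS y0 y1].
have [S' hS'] : exists S' : seq R, forall x, True -> x \notin S' -> forall i (j : 'I_(hs_num (pol i))),
    (hs_form j (x, y) = hs_bound j -> hs_form j e1 = 0 /\ hs_form j e2 = 0) /\
    (hs_form j (y, x) = hs_bound j -> hs_form j e1 = 0 /\ hs_form j e2 = 0).
  apply: ex_seq_fin => i; apply: ex_seq_fin => j; have [S' h] := hS y I yS i j.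
  by exists S' => x _; exact: h.
exists (S' ++ [:: 0; 1]) => x x01; rewrite mem_cat negb_or !inE negb_or => /and3P[xS x0 x1].
have no (v : R) (P : Prop) : v != 0 -> v != 1 -> v = 0 \/ v = 1 -> P by move=> /eqP v0 /eqP v1 [].
by split; split; split; rewrite /= //; try (by apply: no); move=> i j h; have [h1 h2] := hS' x I xS i j;
  first [by case: (h1 h)|by case: (h2 h)].
Qed.

Lemma lineh (u y : R) : u *: e1 + (0, y) = (u, y) :> X.
Proof. by congr pair; rewrite /= ?mulr1 ?mulr0 ?addr0 ?add0r // /GRing.scale /= ?mulr1 ?addr0 ?mulr0 ?add0r. Qed.
Lemma linev (u x : R) : u *: e2 + (x, 0) = (x, u) :> X.
Proof. by congr pair; rewrite /= ?mulr1 ?mulr0 ?addr0 ?add0r // /GRing.scale /= ?mulr1 ?addr0 ?mulr0 ?add0r. Qed.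
Lemma line_stepv (h x y : R) : h *: e2 + (x, y) = (x, h + y) :> X.
Proof. by congr pair; rewrite /= ?mulr1 ?mulr0 ?addr0 ?add0r // /GRing.scale /= ?mulr1 ?addr0 ?mulr0 ?add0r. Qed.

Lemma line_inh y : 0 <= y <= 1 -> line_in e1 (0, y).
Proof. by move=> y01 u u01; rewrite lineh. Qed.
Lemma line_inv x : 0 <= x <= 1 -> line_in e2 (x, 0).
Proof. by move=> y01 u u01; rewrite linev. Qed.

End Stokes.

Lemma stokes_algebra (R : realType) (U : vectType R) (a b d h w p q : 'End(U)) (s : R) :
  s *: ((((q \o a) \o (\1 + h) + (q \o (0 + ((w - a) + d)))) \o p)%VF +
    ((q \o (\1 + h)) \o - (b \o p))%VF - 0) =
  ((q \o (s *: d - s *: (b - w) + ((a \o (s *: h)) - ((s *: h) \o b)))) \o p)%VF.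
Proof.
rewrite subr0 add0r -!comp_lfunZr -!comp_lfunZl -!scalerBr -scalerDr -!comp_lfunZr -!comp_lfunZl.
congr (_ *: _).
rewrite !(comp_lfunDl, comp_lfunDr, comp_lfunNl, comp_lfunNr) !comp_lfunA !comp_lfun1r.
by apply: crd_inj => j; rewrite !(crdD, crdB, raddfN) /=; ring.
Qed.

Section StokesStep.
Variables (R : realType) (n : nat) (M : manifold R n) (U : vectType R).
Local Notation E := 'End(U).
Local Notation X := (R^o * R^o)%type.
Variables (A : dform M 1 E) (F2 : dform M 2 E) (G : X -> M) (k : nat) (pol : 'I_k -> halfspaces R).
Hypothesis fA : is_form A.
Hypothesis fF : is_form F2.
Hypothesis hF : forall c z u v, @chart_img _ _ M c z -> F2 c z (pair2 u v) =
  vderive (fun x => A c x (fun _ => v)) z u - vderive (fun x => A c x (fun _ => u)) z v +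
  ((A c z (fun _ => u) \o A c z (fun _ => v))%VF - (A c z (fun _ => v) \o A c z (fun _ => u))%VF).
Hypothesis cover : square `<=` \bigcup_i hs_set (pol i).
Hypothesis cG : {within square, continuous G}.
Hypothesis sm : forall i, smooth_on (square `&` hs_set (pol i)) G.

Local Notation zz c := (fun p => chart_of c (G p)).
Local Notation yy := (yy A G).
Local Notation linefield := (linefield A G).
Local Notation e1 := ((1, 0) : X).
Local Notation e2 := ((0, 1) : X).
Local Notation P y := (evo (linefield e1 (0, y))).
Local Notation Q y := (evi (linefield e1 (0, y))).

Definition fcurv (p : X) : E := pullback G F2 p (pair2 e1 e2).
Definition gcurv y (u : R) : E := (Q y u \o (fcurv (u, y) \o P y u))%VF.
(** Used for two forms: for the curvature of [A] it is the logarithmic derivative of the gauges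
    below, and for alpha^2 it is an element of degree -1 of which the former is minus the
    differential. *)
Definition bt y x : E := vintegral 0 x (gcurv y).

Lemma P_vpc y : 0 <= y <= 1 -> vpc 0 1 (linefield e1 (0, y)).
Proof.
move=> y01; have [L L0 [_ hv]] := linefield_bounded fA cover cG sm e1.
by exists L; apply: hv; exact: line_inh.
Qed.

Lemma mdgen_pair2 p : fgen pol p -> mdgen pol (pair2 e1 e2) p.
Proof. by move=> [h1 h2] a; rewrite /pair2; case: ifP. Qed.

Lemma fcurv_bounded : exists2 L, 0 <= L & forall y, 0 <= y <= 1 ->
  (exists S : seq R, forall x, 0 <= x <= 1 -> x \notin S -> fgen pol (x, y)) ->
  vpcb L 0 1 (fun u => fcurv (u, y)).
Proof.
have [L L0 hL] := pullback_bounded cover cG sm (pair2 e1 e2) fF (contform2 fF).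
exists L => // y y01 [S hS].
have -> : (fun u => fcurv (u, y)) = fun u => pullback G F2 (u *: e1 + (0, y)) (pair2 e1 e2).
  by apply/funext => u; rewrite lineh.
apply: (vpcb_pullback_line (S := S) cover cG sm fF (contform2 fF) (line_inh y01)) => //.
by move=> u /andP[u0 u1] uS; rewrite lineh; apply: mdgen_pair2; apply: hS => //; rewrite !ltW.
Qed.

Lemma gcurv_bounded : exists2 L, 0 <= L & forall y, 0 <= y <= 1 ->
  (exists S : seq R, forall x, 0 <= x <= 1 -> x \notin S -> fgen pol (x, y)) ->
  vpcb L 0 1 (gcurv y).
Proof.
have [L L0 hL] := fcurv_bounded; have [C C0 hC] := evo_bounded fA cover cG sm e1.
have [K K0 hK] := vn_comp U.
exists (K * C * (K * L * C)); first by rewrite !mulr_ge0.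
move=> y y01 gy; have pf : vpc 0 1 (fun u => fcurv (u, y)) by exists L; exact: hL.
have pP := P_vpc y01.
have pg : vpc 0 1 (gcurv y).
  apply: (vpc_bil (bil_comp U)); first exact: (vprim_pc ler01 (evi_prim pP)).
  by apply: (vpc_bil (bil_comp U)) => //; exact: (vprim_pc ler01 (evo_prim pP)).
have [S hS] := hL y y01 gy; apply: (vpcb_of_vpc (S := S) pg) => u u01 uS.
have [bf _] := hS u u01 uS.
have u01' : 0 <= u <= 1 by case/andP: u01 => a b; rewrite !ltW.
have [b1 b2] := hC _ (line_inh y01) u u01'.
apply: le_trans (hK _ _) _; rewrite ler_pM ?mulr_ge0 ?vn_ge0// ?ler_wpM2l//.
by apply: le_trans (hK _ _) _; rewrite ler_pM ?mulr_ge0 ?vn_ge0// ler_wpM2l.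
Qed.

(** The holonomy, minus 1 and divided by [e], of the strip between two levels: out along the level
    [e + y], across at [x] by the first-order expansion of transport in the chart, and back along
    the level [y]. *)
Definition stokes_quot c y x (e : R) : E :=
  e^-1 *: ((Q y x \o (\1 + yy c (x, y) (zz c (x, e + y) - zz c (x, y))) \o P (e + y) x)%VF - \1%VF).

(** The derivative of [stokes_quot] in [x], arranged so that every factor stays bounded or is a
    divided difference. As [e] tends to 0 the bracket becomes dA plus the commutator on the two
    tangent vectors, that is, the curvature. *)
Definition stokes_int c y (e x : R) : E :=
  let eta := e^-1 *: (zz c (x, e + y) - zz c (x, y)) in
  let Y := yy c (x, y) in
  (Q y x \o (vderive (yy c) (x, y) e1 eta - (e^-1 *: (yy c (x, e + y) - Y)) (vderive (zz c) (x, e + y) e1)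
     + ((linefield e1 (0, y) x \o Y eta)%VF - (Y eta \o linefield e1 (0, e + y) x)%VF)) \o P (e + y) x)%VF.

Lemma stokes_int_cvg c y x : fgen pol (x, y) -> 0 < y < 1 -> 0 <= x <= 1 -> chart_dom (chart_of c) (G (x, y)) ->
  vcvg 0^' (fun e : R => stokes_int c y e x) (gcurv y x).
Proof.
move=> gxy y01 x01 cxy; have y01' : 0 <= y <= 1 by case/andP: y01 => a b; rewrite !ltW.
have sq : square (x, y) by split.
have ny : \forall e \near (0 : R)^', 0 <= e + y <= 1.
  apply: nbhs_dnbhs; have : \forall t \near y, 0 < t < 1 by apply: near_itvoo.
  have h : e + y @[e --> (0 : R)] --> y.
    by rewrite -[X in _ --> X]add0r; apply: cvgD; [exact: cvg_id|exact: cvg_cst].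
  move=> nt; have nt' : \forall e \near (0 : R), 0 < e + y < 1 by exact: (h _ nt).
  by apply: filterS nt' => e /andP[a b]; rewrite !ltW.
have lc : (x, e + y) @[e --> (0 : R)^'] --> within square (nbhs ((x, y) : X)).
  have -> : (fun e : R => (x, e + y) : X) = fun e => (e : R^o) *: e2 + ((x, y) : X).
    by apply/funext => e; rewrite line_stepv.
  have <- : within square (nbhs ((0 : R^o) *: e2 + ((x, y) : X))) = within square (nbhs ((x, y) : X)).
    by rewrite scale0r add0r.
  apply: line_cvg_within; [exact: nbhs_dnbhs|exact: cvg_cst|].
  by apply: filterS ny => e ey; rewrite line_stepv.
have [ge1 ge2] := gxy.
have pz := patched_chart sm sq cxy; have py := patched_yy fA sm sq cxy.
have dz1 := nbhs_singleton (near_chart_vderive cover sm sq cxy e1) ge1.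
have dz2 := nbhs_singleton (near_chart_vderive cover sm sq cxy e2) ge2.
have dy1 := nbhs_singleton (patched_is_vderive cover e1 py) ge1.
have dy2 := nbhs_singleton (patched_is_vderive cover e2 py) ge2.
have ceta : vcvg 0^' (fun e : R => e^-1 *: (zz c (x, e + y) - zz c (x, y))) (vderive (zz c) (x, y) e2).
  move/is_vderiveP: dz2; apply: vcvg_near; apply: filterE => e.
  by rewrite line_stepv.
have cdy : vcvg 0^' (fun e : R => e^-1 *: (yy c (x, e + y) - yy c (x, y))) (vderive (yy c) (x, y) e2).
  move/is_vderiveP: dy2; apply: vcvg_near; apply: filterE => e.
  by rewrite line_stepv.
have cz1 : vcvg 0^' (fun e : R => vderive (zz c) (x, e + y) e1) (vderive (zz c) (x, y) e1).
  exact: (vcvg_comp lc (patchedC_cvg cover (patched_vderive_patchedC e1 pz) sq ge1 (dgen_open ge1))).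
have ca : vcvg 0^' (fun e : R => linefield e1 (0, e + y) x) (linefield e1 (0, y) x).
  have g1 : mdgen pol (fun _ : 'I_1 => e1) (x, y) by [].
  generalize (vcvg_comp lc (pullback_cvg cover cG sm fA (contform1 fA) sq g1)).
  rewrite /linefield lineh; apply: vcvg_near; apply: filterE => e /=.
  by rewrite lineh.
have cP : vcvg 0^' (fun e : R => P (e + y) x) (P y x).
  have cl : (0, s) @[s --> within [set s : R^o | 0 <= s <= 1] (nbhs (y : R^o))] --> ((0, y) : X).
    have -> : (fun s : R^o => (0, s) : X) = fun s => s *: e2 + (0, 0) by apply/funext => s; rewrite linev.
    rewrite -[X in _ --> X]linev; apply: cvgD; last exact: cvg_cst.
    by apply: cvgZr_tmp; exact: cvg_within.
  have [h _] := evo_line_cvg fA cover cG sm x01 (fun s => @line_inh R s) (line_inh y01') cl.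
  have cs : e + y @[e --> (0 : R)^'] --> within [set s : R^o | 0 <= s <= 1] (nbhs (y : R^o)).
    move=> B hB; have h1 : e + y @[e --> (0 : R)^'] --> (y : R^o).
      rewrite -[X in _ --> X]add0r; apply: cvgD; last exact: cvg_cst.
      exact: nbhs_dnbhs.
    have h2 : \forall e \near (0 : R)^', 0 <= e + y <= 1 -> B (e + y) by exact: (h1 _ hB).
    change (\forall e \near (0 : R)^', B (e + y)).
    by apply: filterS2 h2 ny => e a b; exact: a.
  exact: (vcvg_comp cs h).
have ev := bil_ev n E; have co := bil_comp U.
have cE : vcvg 0^' (fun e : R => stokes_int c y e x)
   (Q y x \o (vderive (yy c) (x, y) e1 (vderive (zz c) (x, y) e2) -
       vderive (yy c) (x, y) e2 (vderive (zz c) (x, y) e1)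
     + ((linefield e1 (0, y) x \o yy c (x, y) (vderive (zz c) (x, y) e2))%VF -
        (yy c (x, y) (vderive (zz c) (x, y) e2) \o linefield e1 (0, y) x)%VF)) \o P y x)%VF.
  apply: (vcvg_bil co) => //; apply: (vcvg_bil co); first exact: vcvg_cst.
  apply: vcvgD; [apply: vcvgB|apply: vcvgB].
  - exact: (vcvg_lin (vderive (yy c) (x, y) e1) ceta).
  - exact: (vcvg_bil ev cz1 cdy).
  - by apply: (vcvg_bil co); [exact: vcvg_cst|exact: (vcvg_lin (yy c (x, y)) ceta)].
  - by apply: (vcvg_bil co) => //; exact: (vcvg_lin (yy c (x, y)) ceta).
match type of cE with vcvg _ _ ?l => have E0 : gcurv y x = l; last by rewrite E0 end.
have ci : chart_img c (chart_of c (G (x, y))) by exists (G (x, y)).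
have gm := mdgen_pair2 gxy.
have -> : linefield e1 (0, y) x = A c (chart_of c (G (x, y))) (fun _ => vderive (zz c) (x, y) e1).
  have g1 : mdgen pol (fun _ : 'I_1 => e1) (x, y) by [].
  by rewrite /linefield lineh (nbhs_singleton (near_pullback cover cG sm sq cxy (fun _ : 'I_1 => e1) fA) sq g1).
rewrite /gcurv /fcurv (nbhs_singleton (near_pullback cover cG sm sq cxy (pair2 e1 e2) fF) sq gm).
rewrite comp_lfunA; congr (_ \o _ \o _)%VF.
have -> : (fun a => vderive (zz c) (x, y) (pair2 e1 e2 a)) = pair2 (vderive (zz c) (x, y) e1) (vderive (zz c) (x, y) e2).
  by apply/funext => a; rewrite /pair2; case: ifP.
rewrite hF//; have Cf := formhom_C1at fA ci.
have -> : vderive (yy c) (x, y) e1 = vderive (formhom A c) (zz c (x, y)) (vderive (zz c) (x, y) e1).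
  by apply: is_vderive_vderive; exact: (C1at_chainE Cf dz1).
have -> : vderive (yy c) (x, y) e2 = vderive (formhom A c) (zz c (x, y)) (vderive (zz c) (x, y) e2).
  by apply: is_vderive_vderive; exact: (C1at_chainE Cf dz2).
have ey : yy c (x, y) = formhom A c (zz c (x, y)) by [].
rewrite ey.
have h1 := formhom_vderive fA (vderive (zz c) (x, y) e1) (vderive (zz c) (x, y) e2) ci.
have h2 := formhom_vderive fA (vderive (zz c) (x, y) e2) (vderive (zz c) (x, y) e1) ci.
have h3 := formhomE fA (vderive (zz c) (x, y) e2) ci.
have cong (a b a' b' u v v' : E) : a' = a -> b' = b -> v' = v ->
  a - b + ((u \o v)%VF - (v \o u)%VF) = a' - b' + ((u \o v')%VF - (v' \o u)%VF) by move=> -> -> ->.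
exact: (cong _ _ _ _ _ _ _ h1 h2 h3).
Qed.

Definition chart_bounds c q r L d := forall p, square p -> near2 q r p ->
   [/\ chart_dom (chart_of c) (G p), vn (yy c p) <= L & dgen pol d p ->
     [/\ vn (vderive (zz c) p d) <= L, vn (vderive (yy c) p d) <= L &
         pullback G A p (fun _ => d) = yy c p (vderive (zz c) p d)]].

Lemma vprim_charth c q r L y lo hi : chart_bounds c q r L e1 -> lo <= hi -> 0 <= lo -> hi <= 1 -> 0 <= y <= 1 ->
  near2 q r (lo, y) -> near2 q r (hi, y) ->
  vprim lo hi (fun u => zz c (u, y)) (fun u => vderive (zz c) (u, y) e1) /\
  vprim lo hi (fun u => yy c (u, y)) (fun u => vderive (yy c) (u, y) e1).
Proof.
move=> hc lohi lo0 hi1 y01; rewrite -(lineh lo) -(lineh hi) => nlo nhi.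
have [h1 h2] := vprim_chart fA cover sm lohi lo0 hi1 (line_inh y01) nlo nhi hc.
have eF (W : Type) (f : X -> W) : (fun u : R => f (u *: e1 + (0, y))) = fun u => f (u, y).
  by apply/funext => u; rewrite lineh.
by rewrite (eF _ (zz c)) (eF _ (fun p => vderive (zz c) p e1)) in h1;
  rewrite (eF _ (yy c)) (eF _ (fun p => vderive (yy c) p e1)) in h2.
Qed.

Lemma vert_lip c q r L x y y' : chart_bounds c q r L e2 -> 0 <= x <= 1 -> 0 <= y <= 1 -> 0 <= y' <= 1 ->
  near2 q r (x, y) -> near2 q r (x, y') ->
  vn (zz c (x, y') - zz c (x, y)) <= L * `|y' - y| /\ vn (yy c (x, y') - yy c (x, y)) <= L * `|y' - y|.
Proof.
move=> hc x01; wlog yy' : y y' / y <= y'.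
  move=> h y01 y'01 n1 n2; have [|/ltW] := leP y y'; first by move=> ?; exact: h.
  by move=> y'y; have [h1 h2] := h y' y y'y y'01 y01 n2 n1; rewrite distrC; split; rewrite -vnN opprB.
move=> /andP[y0 y1] /andP[y'0 y'1]; rewrite -(linev y) -(linev y') => n1 n2.
have [h1 h2] := vprim_chart fA cover sm yy' y0 y'1 (line_inv x01) n1 n2 hc.
have [S hS] := dgen_line pol ((x, 0) : X) e2.
have aux u : y < u < y' -> u \notin S ->
    vn (vderive (zz c) (u *: e2 + (x, 0)) e2) <= L /\ vn (vderive (yy c) (u *: e2 + (x, 0)) e2) <= L.
  move=> /andP[u0 u1] uS; have u01 : y <= u <= y' by rewrite !ltW.
  have sq : square (u *: e2 + (x, 0)).
    by apply: (line_inv x01); rewrite (le_trans y0 (ltW u0)) (le_trans (ltW u1) y'1).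
  by have [_ _ /(_ (hS u I uS sq))[]] := hc _ sq (near2_convex u01 n1 n2).
split.
  by apply: (vprim_lip (S := S) yy' h1) => [u u1 u2||]; rewrite ?lexx ?yy'//; have [] := aux u u1 u2.
by apply: (vprim_lip (S := S) yy' h2) => [u u1 u2||]; rewrite ?lexx ?yy'//; have [] := aux u u1 u2.
Qed.

Lemma stokes_prim c q r L y e lo hi : chart_bounds c q r L e1 -> chart_bounds c q r L e2 -> e != 0 ->
  lo <= hi -> 0 <= lo -> hi <= 1 -> 0 <= y <= 1 -> 0 <= e + y <= 1 ->
  near2 q r (lo, y) -> near2 q r (hi, y) -> near2 q r (lo, e + y) -> near2 q r (hi, e + y) ->
  vprim lo hi (fun x => stokes_quot c y x e) (stokes_int c y e).
Proof.
move=> hc1 hc2 e0 lohi lo0 hi1 y01 ey01 n1 n2 n3 n4.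
have [vz vy] := vprim_charth hc1 lohi lo0 hi1 y01 n1 n2.
have [vze _] := vprim_charth hc1 lohi lo0 hi1 ey01 n3 n4.
have vQ := vprim_sub lo0 lohi hi1 (evi_prim (P_vpc y01)).
have vP := vprim_sub lo0 lohi hi1 (evo_prim (P_vpc ey01)).
have vY := vprimD (vprim_cst0 lo hi (\1%VF : E)) (vprim_bil lohi (bil_ev n E) (vprimB vze vz) vy).
have vZ := vprim_bil lohi (bil_comp U) (vprim_bil lohi (bil_comp U) vQ vY) vP.
have h := vprim_lin ( *:%R e^-1 : {linear E -> E}) (vprimB vZ (vprim_cst0 lo hi (\1%VF : E))).
have [S1 g1] := dgen_line pol ((0, y) : X) e1; have [S2 g2] := dgen_line pol ((0, e + y) : X) e1.
apply: (vprim_eq (S := S1 ++ S2) lohi _ _ h) => // x xlh; rewrite mem_cat negb_or => /andP[x1 x2].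
have xlh' : lo <= x <= hi by case/andP: xlh => a b; rewrite !ltW.
have x01 : 0 <= x <= 1 by case/andP: xlh' => a b; rewrite (le_trans lo0 a) (le_trans b hi1).
have sq y' : 0 <= y' <= 1 -> square (x, y') by [].
have nx y' : near2 q r (lo, y') -> near2 q r (hi, y') -> near2 q r (x, y').
  by rewrite -(lineh lo) -(lineh hi) -(lineh x); exact: near2_convex.
have [_ _ h1] := hc1 _ (sq y y01) (nx y n1 n2); have [_ _ h2] := hc1 _ (sq _ ey01) (nx _ n3 n4).
have gx1 := g1 x I x1; have gx2 := g2 x I x2; rewrite lineh in gx1; rewrite lineh in gx2.
have [_ _ a1] := h1 (gx1 (sq _ y01)); have [_ _ a2] := h2 (gx2 (sq _ ey01)).
rewrite -[(x, y)]lineh -/(linefield e1 (0, y) x) lineh in a1.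
rewrite -[(x, e + y)]lineh -/(linefield e1 (0, e + y) x) lineh in a2.
rewrite /stokes_int a1 a2.
have lB (H : 'Hom('rV[R]_n, E)) u v : H (u - v) = H u - H v by exact: linearB.
have lZ (H : 'Hom('rV[R]_n, E)) s u : H (s *: u) = s *: H u by exact: linearZ.
rewrite !lZ scale_lfunE add_lfunE opp_lfunE (lB (yy c (x, y)) (vderive (zz c) (x, e + y) e1)).
exact: stokes_algebra.
Qed.

(** The bound is independent of [e], as dominated convergence requires: the divided differences are
    controlled by the Lipschitz constants in the vertical direction. *)
Lemma stokes_int_bounded : exists2 K : R, 0 <= K & forall c q r L y e x S, 0 <= L ->
  chart_bounds c q r L e1 -> chart_bounds c q r L e2 -> e != 0 ->
  0 <= x <= 1 -> 0 <= y <= 1 -> 0 <= e + y <= 1 -> near2 q r (x, y) -> near2 q r (x, e + y) ->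
  dgen pol e1 (x, y) -> dgen pol e1 (x, e + y) -> S = (L * L : R) -> vn (stokes_int c y e x) <= K * S.
Proof.
have [Ke Ke0 hKe] := vn_bil (bil_ev n E); have [Kc Kc0 hKc] := vn_comp U.
have [C C0 hC] := evo_bounded fA cover cG sm e1.
have [L' L'0 [hL' hv]] := linefield_bounded fA cover cG sm e1.
exists (Kc * (Kc * C * (Ke + Ke + (Kc * L' * Ke + Kc * Ke * L'))) * C).
  by rewrite !mulr_ge0 ?addr_ge0 ?mulr_ge0.
move=> c q r L y e x S L0 hc1 hc2 e0 x01 y01 ey01 n1 n2 g1 g2 SE.
have [bz by_] := vert_lip hc2 x01 y01 ey01 n1 n2; rewrite addrK in bz by_.
have sq y' : 0 <= y' <= 1 -> square (x, y') by [].
have [_ bY /(_ g1)[_ bdY _]] := hc1 _ (sq y y01) n1.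
have [_ _ /(_ g2)[bzd _ _]] := hc1 _ (sq _ ey01) n2.
have ce (W : vectType R) (w : W) : vn w <= L * `|e| -> vn (e^-1 *: w) <= L.
  by move=> h; rewrite vnZ normrV ?unitfE// mulrC ler_pdivrMr ?normr_gt0.
have beta := ce _ _ bz; have bdy := ce _ _ by_.
have [bQ _] := conj (hC _ (line_inh y01) x x01).2 I.
have bP := (hC _ (line_inh ey01) x x01).1.
have ba1 : vn (linefield e1 (0, y) x) <= L' by rewrite /linefield lineh; exact: hL'.
have ba2 : vn (linefield e1 (0, e + y) x) <= L' by rewrite /linefield lineh; exact: hL'.
have bYe : vn (yy c (x, y) (e^-1 *: (zz c (x, e + y) - zz c (x, y)))) <= Ke * S.
  by apply: le_trans (hKe _ _) _; rewrite SE mulrA ler_pM ?mulr_ge0 ?vn_ge0 ?ler_wpM2l.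
rewrite /stokes_int; apply: le_trans (hKc _ _) _.
rewrite [leRHS]mulrAC ler_pM ?mulr_ge0 ?vn_ge0//.
rewrite -[leRHS]mulrA ler_wpM2l//; apply: le_trans (hKc _ _) _.
rewrite -[leRHS]mulrA ler_pM ?mulr_ge0 ?vn_ge0 ?ler_wpM2l// !mulrDl.
apply: le_trans (vnD _ _) _; apply: lerD; apply: le_trans (vnB _ _) _; apply: lerD.
- by apply: le_trans (hKe _ _) _; rewrite SE mulrA ler_pM ?mulr_ge0 ?vn_ge0 ?ler_wpM2l.
- by apply: le_trans (hKe _ _) _; rewrite SE mulrA ler_pM ?mulr_ge0 ?vn_ge0 ?ler_wpM2l.
- apply: le_trans (hKc _ _) _; rewrite -[leRHS]mulrA; apply: ler_pM; [by rewrite mulr_ge0 ?vn_ge0|exact: vn_ge0|by rewrite ler_wpM2l|exact: bYe].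
- apply: le_trans (hKc _ _) _; rewrite -[Kc * Ke * L' * S]mulrA [L' * S]mulrC !mulrA ler_pM ?mulr_ge0 ?vn_ge0//.
  by rewrite -mulrA ler_wpM2l.
Qed.

Lemma gcurv_vpc y : 0 <= y <= 1 ->
  (exists S : seq R, forall x, 0 <= x <= 1 -> x \notin S -> fgen pol (x, y)) -> vpc 0 1 (gcurv y).
Proof. by move=> y01 gy; have [L _ h] := gcurv_bounded; exists L; exact: h. Qed.

(** Within one chart only the increment between two abscissas is obtained, by passing to the limit
    under the integral; the value itself must come from a point where it is known, ultimately x =
    0. *)
Lemma stokes_increment c q r L y lo hi : 0 < r -> 0 <= L -> chart_bounds c q r L e1 -> chart_bounds c q r L e2 ->
  lo <= hi -> 0 <= lo -> hi <= 1 -> 0 < y < 1 -> q.2 = y ->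
  (exists S : seq R, forall x, 0 <= x <= 1 -> x \notin S -> fgen pol (x, y)) ->
  `|lo - q.1| < r -> `|hi - q.1| < r ->
  vcvg 0^' (fun e : R => stokes_quot c y hi e - stokes_quot c y lo e) (bt y hi - bt y lo).
Proof.
move=> r0 L0 hc1 hc2 lohi lo0 hi1 y01 qy gy nlo nhi; have y01' : 0 <= y <= 1 by case/andP: y01 => a b; rewrite !ltW.
have pg := gcurv_vpc y01' gy; have [K K0 hK] := stokes_int_bounded.
have lo1 : lo <= 1 by exact: le_trans hi1. have hi0 : 0 <= hi by exact: le_trans lohi.
have -> : bt y hi - bt y lo = vintegral lo hi (gcurv y).
  rewrite /bt (vint_chasles (c := lo)) ?lo0//; first by rewrite addrC addKr.
  exact: (vpc_sub (lexx 0) hi1 pg).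
have ny : \forall e \near (0 : R)^', [/\ e != 0, 0 <= e + y <= 1 & `|e| < r].
  have n1 : \forall e \near (0 : R)^', 0 <= e + y <= 1.
    apply: nbhs_dnbhs; have nt : \forall t \near y, 0 < t < 1 by apply: near_itvoo.
    have h : e + y @[e --> (0 : R)] --> y.
      by rewrite -[X in _ --> X]add0r; apply: cvgD; [exact: cvg_id|exact: cvg_cst].
    have nt' : \forall e \near (0 : R), 0 < e + y < 1 by exact: (h _ nt).
    by apply: filterS nt' => e /andP[a b]; rewrite !ltW.
  have n2 : \forall e \near (0 : R)^', `|e| < r by apply: nbhs_dnbhs; exact: (@nbhs0_lt R R^o r r0).
  have n3 : \forall e \near (0 : R)^', e != 0 by exact: nbhs_dnbhs_neq.
  by apply: filterS3 n1 n2 n3.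
have nn x e : lo <= x <= hi -> `|e| < r -> near2 q r (x, y) /\ near2 q r (x, e + y).
  move=> /andP[xl xh] er; have xq : `|x - q.1| < r.
    by move: nlo nhi; rewrite !ltr_norml => /andP[a1 a2] /andP[b1 b2]; apply/andP; split; lra.
  by split; split; rewrite //= qy ?subrr ?normr0// addrK.
have vst e : e != 0 -> 0 <= e + y <= 1 -> `|e| < r ->
    vprim lo hi (fun x => stokes_quot c y x e) (stokes_int c y e).
  move=> e0 ey er; have [n1 n3] := nn lo e (introT andP (conj (lexx _) lohi)) er.
  have [n2 n4] := nn hi e (introT andP (conj lohi (lexx _))) er.
  exact: (stokes_prim hc1 hc2 e0 lohi lo0 hi1 y01' ey n1 n2 n3 n4).
have [S hS] := dgen_line pol ((0, y) : X) e1.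
have gen1 (S' : seq R) (y' x : R) : (forall u, True -> u \notin S' -> square (u *: e1 + ((0, y') : X)) -> dgen pol e1 (u *: e1 + ((0, y') : X))) ->
    0 <= y' <= 1 -> lo < x < hi -> x \notin S' -> dgen pol e1 (x, y').
  move=> h y'01 /andP[xl xh] xS; have := h x I xS; rewrite lineh; apply; split => //.
  by rewrite /unit_itv /= (le_trans lo0 (ltW xl)) (le_trans (ltW xh) hi1).
have x01 x : lo < x < hi -> 0 <= x <= 1.
  by move=> /andP[xl xh]; rewrite (le_trans lo0 (ltW xl)) (le_trans (ltW xh) hi1).
have dom : vcvg 0^' (fun e : R => vintegral lo hi (stokes_int c y e)) (vintegral lo hi (gcurv y)).
  apply: (@dominated_vint R E R^o _ 0 lo hi (fun e : R^o => stokes_int c y e) (gcurv y) (K * (L * L)) lohi).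
  - apply: filterS ny => e [e0 ey er]; have [pe _] := vst e e0 ey er.
    have [S2 hS2] := dgen_line pol ((0, e + y) : X) e1.
    apply: (vpcb_of_vpc (S := S ++ S2) pe) => x xlh; rewrite mem_cat negb_or => /andP[xS xS2].
    have [n1 n2] := nn x e (introT andP (conj (ltW (andP xlh).1) (ltW (andP xlh).2))) er.
    exact: (hK c q r L y e x (L * L) L0 hc1 hc2 e0 (x01 x xlh) y01' ey n1 n2 (gen1 S y x hS y01' xlh xS) (gen1 S2 (e + y) x hS2 ey xlh xS2) erefl).
  - exact: vpc_sub pg.
  have [S3 hS3] := gy; exists S3 => x xlh xS; apply: stokes_int_cvg => //; [by apply: hS3 => //; exact: x01|exact: x01|].
  have [n1 _] := nn x 0 (introT andP (conj (ltW (andP xlh).1) (ltW (andP xlh).2))) ltac:(by rewrite normr0).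
  have sx : square ((x, y) : X) by split; [exact: (x01 x xlh)|exact: y01'].
  by have [] := hc1 _ sx n1.
apply: vcvg_near dom; apply: filterS ny => e [e0 ey er].
by have [_ h] := vst e e0 ey er; rewrite (h hi) ?lohi ?lexx// addrC addKr.
Qed.

Lemma stokes_step y x0 c : 0 < y < 1 -> 0 <= x0 <= 1 ->
  (exists S : seq R, forall x, 0 <= x <= 1 -> x \notin S -> fgen pol (x, y)) ->
  chart_dom (chart_of c) (G (x0, y)) -> exists2 r : R, 0 < r & forall x1 x2, 0 <= x1 <= 1 -> 0 <= x2 <= 1 ->
    `|x1 - x0| < r -> `|x2 - x0| < r ->
    vcvg 0^' (stokes_quot c y x1) (bt y x1) -> vcvg 0^' (stokes_quot c y x2) (bt y x2).
Proof.
move=> y01 x001 gy cq; have y01' : 0 <= y <= 1 by case/andP: y01 => a b; rewrite !ltW.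
have sq : square ((x0, y) : X) by split.
have [r1 [L1 [r10 L10 h1]]] := chart_ball fA cover cG sm e1 sq cq.
have [r2 [L2 [r20 L20 h2]]] := chart_ball fA cover cG sm e2 sq cq.
pose r := Num.min r1 r2; pose L := Num.max L1 L2.
have nr p : near2 ((x0, y) : X) r p -> near2 ((x0, y) : X) r1 p /\ near2 ((x0, y) : X) r2 p.
  by move=> []; rewrite !lt_min => /andP[a b] /andP[a' b'].
have L1L : L1 <= L by rewrite le_max lexx. have L2L : L2 <= L by rewrite le_max lexx orbT.
have hc1 : chart_bounds c (x0, y) r L e1.
  move=> p sp /nr[np _]; have [a b d] := h1 p sp np; split=> //; first exact: le_trans b L1L.
  by move=> /d[d1 d2 d3]; split => //; [exact: le_trans d1 L1L|exact: le_trans d2 L1L].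
have hc2 : chart_bounds c (x0, y) r L e2.
  move=> p sp /nr[_ np]; have [a b d] := h2 p sp np; split=> //; first exact: le_trans b L2L.
  by move=> /d[d1 d2 d3]; split => //; [exact: le_trans d1 L2L|exact: le_trans d2 L2L].
have L0 : 0 <= L by exact: le_trans L1L. have r0 : 0 < r by rewrite lt_min r10.
exists r; first exact: r0.
move=> x1 x2 /andP[a1 b1] /andP[a2 b2] n1 n2 h; have [x12|/ltW x21] := leP x1 x2.
  generalize (vcvgD (stokes_increment r0 L0 hc1 hc2 x12 a1 b2 y01 erefl gy n1 n2) h).
  by rewrite subrK; apply: vcvg_near; apply: filterE => e; rewrite subrK.
generalize (vcvgB h (stokes_increment r0 L0 hc1 hc2 x21 a2 b1 y01 erefl gy n2 n1)).
by rewrite subKr; apply: vcvg_near; apply: filterE => e; rewrite subKr.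
Qed.

End StokesStep.

Section EviUnique.
Variables (R : realType) (U : vectType R).
Local Notation E := 'End(U).

Lemma evi_unique (a w : R -> E) (S : seq R) (wd : R -> E) : vpc 0 1 a -> vprim 0 1 w wd ->
  (forall t, 0 < t < 1 -> t \notin S -> wd t = (w t \o a t)%VF) ->
  forall t, 0 <= t <= 1 -> w t = (w 0 \o evi a t)%VF.
Proof.
move=> pa pw hw t t01; have h := vprim_bil ler01 (bil_comp U) pw (evo_prim pa).
have z u : 0 < u < 1 -> u \notin S -> (wd u \o evo a u)%VF + (w u \o - (a u \o evo a u))%VF = 0.
  by move=> u01 uS; rewrite hw// comp_lfunNr comp_lfunA subrr.
have := vprim_const ler01 z h t01; rewrite evo0// comp_lfun1r => <-.
by rewrite -comp_lfunA eviK// comp_lfun1r.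
Qed.

End EviUnique.

Section StokesGlobal.
Variables (R : realType) (n : nat) (M : manifold R n) (U : vectType R).
Local Notation E := 'End(U).
Local Notation X := (R^o * R^o)%type.
Variables (A : dform M 1 E) (F2 : dform M 2 E) (G : X -> M) (k : nat) (pol : 'I_k -> halfspaces R).
Hypothesis fA : is_form A.
Hypothesis fF : is_form F2.
Hypothesis hF : forall c z u v, @chart_img _ _ M c z -> F2 c z (pair2 u v) =
  vderive (fun x => A c x (fun _ => v)) z u - vderive (fun x => A c x (fun _ => u)) z v +
  ((A c z (fun _ => u) \o A c z (fun _ => v))%VF - (A c z (fun _ => v) \o A c z (fun _ => u))%VF).
Hypothesis cover : square `<=` \bigcup_i hs_set (pol i).
Hypothesis cG : {within square, continuous G}.
Hypothesis sm : forall i, smooth_on (square `&` hs_set (pol i)) G.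
Hypothesis left_const : forall s : R, 0 <= s <= 1 -> G (0, s) = G (0, 0).

Local Notation zz c := (fun p => chart_of c (G p)).
Local Notation yy := (yy A G).
Local Notation linefield := (linefield A G).
Local Notation bt := (bt A F2 G).
Local Notation gcurv := (gcurv A F2 G).
Local Notation stokes_quot := (stokes_quot A G).
Local Notation e1 := ((1, 0) : X).
Local Notation e2 := ((0, 1) : X).
Local Notation P y := (evo (linefield e1 (0, y))).
Local Notation Q y := (evi (linefield e1 (0, y))).
Local Notation T x := (evo (linefield e2 (x, 0))).
Local Notation Ti x := (evi (linefield e2 (x, 0))).
Local Notation gen_level y := (exists S : seq R, forall x, 0 <= x <= 1 -> x \notin S -> fgen pol (x, y)).

Lemma near_level (y : R) : 0 < y < 1 -> \forall e \near (0 : R)^', 0 <= e + y <= 1.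
Proof.
move=> y01; apply: nbhs_dnbhs; have nt : \forall t \near y, 0 < t < 1 by apply: near_itvoo.
have h : e + y @[e --> (0 : R)] --> y.
  by rewrite -[X in _ --> X]add0r; apply: cvgD; [exact: cvg_id|exact: cvg_cst].
have nt' : \forall e \near (0 : R), 0 < e + y < 1 by exact: (h _ nt).
by apply: filterS nt' => e /andP[a b]; rewrite !ltW.
Qed.

Lemma near_dnbhs_lt (r : R) : 0 < r -> \forall e \near (0 : R)^', `|e| < r.
Proof. by move=> r0; apply: nbhs_dnbhs; exact: (@nbhs0_lt R R^o r r0). Qed.

Lemma T_vpc x : 0 <= x <= 1 -> vpc 0 1 (linefield e2 (x, 0)).
Proof.
move=> y01; have [L L0 [_ hv]] := linefield_bounded fA cover cG sm e2.
by exists L; apply: hv; exact: line_inv.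
Qed.

Definition stokes_vert y x (e : R) : E :=
  e^-1 *: ((Q y x \o (T x y \o Ti x (e + y)) \o P (e + y) x)%VF - \1%VF).

(** [stokes_quot] depends on a chart, while [stokes_vert] uses the true vertical transport and can
    be handed from one chart to the next. They differ by the quadratic error of [transport_chart]
    divided by [e]. *)
Lemma stokes_vertP y x c (l : E) : 0 < y < 1 -> 0 <= x <= 1 -> chart_dom (chart_of c) (G (x, y)) ->
  vcvg 0^' (stokes_vert y x) l <-> vcvg 0^' (stokes_quot c y x) l.
Proof.
move=> y01 x01 cq; have y01' : 0 <= y <= 1 by case/andP: y01 => a b; rewrite !ltW.
have sq : square ((x, y) : X) by split.
have [r [C [r0 C0 h]]] := transport_chart fA cover cG sm e2 sq cq.
have [K K0 hK] := vn_comp U.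
have [C1 C10 hC1] := evo_bounded fA cover cG sm e1; have [C2 C20 hC2] := evo_bounded fA cover cG sm e2.
suff d0 : vcvg 0^' (fun e : R => stokes_quot c y x e - stokes_vert y x e) 0.
  split=> hl.
    generalize (vcvgD d0 hl); rewrite add0r; apply: vcvg_near; apply: filterE => e.
    by rewrite subrK.
  generalize (vcvgB hl d0); rewrite subr0; apply: vcvg_near; apply: filterE => e.
  by rewrite subKr.
pose B := K * (K * C1 * (K * C * C2)) * C1.
have cB : B * `|e| @[e --> (0 : R)^'] --> (0 : R).
  rewrite -[X in _ --> X](mulr0 B); apply: cvgM; first exact: cvg_cst.
  rewrite -[X in _ --> X](@normr0 _ R^o); apply: cvg_norm; exact: nbhs_dnbhs.
apply: (vcvg_squeeze _ cB).
have n3 : \forall e \near (0 : R)^', e != 0 by exact: nbhs_dnbhs_neq.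
apply: filterS3 (near_level y01) (near_dnbhs_lt r0) n3 => e ey er e0; rewrite subr0.
have nr1 : near2 ((x, y) : X) r (y *: e2 + (x, 0)) by rewrite linev; split; rewrite /= subrr normr0.
have nr2 : near2 ((x, y) : X) r ((e + y) *: e2 + (x, 0)).
  by rewrite linev; split; rewrite /= ?subrr ?normr0// addrK.
have := h _ (line_inv x01) y (e + y) y01' ey nr1 nr2; rewrite addrK !linev.
set Y := \1%VF + _; move=> hY.
have -> : stokes_quot c y x e - stokes_vert y x e =
    e^-1 *: (Q y x \o (((Y \o T x (e + y))%VF - T x y) \o Ti x (e + y)) \o P (e + y) x)%VF.
  rewrite /stokes_quot /stokes_vert -scalerBr; congr (_ *: _); rewrite opprB addrA subrK -/Y.
  have -> : (((Y \o T x (e + y)) - T x y) \o Ti x (e + y) = Y - (T x y \o Ti x (e + y)))%VF.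
    by rewrite comp_lfunDl comp_lfunNl -comp_lfunA (eviK (T_vpc x01) ey) comp_lfun1r.
  by rewrite !(comp_lfunDr, comp_lfunDl, comp_lfunNl, comp_lfunNr).
rewrite vnZ normrV ?unitfE// mulrC ler_pdivrMr ?normr_gt0// -mulrA -expr2 -normrX ger0_norm ?sqr_ge0//.
have [bP _] := hC1 _ (line_inh ey) x x01; have [_ bQ] := hC1 _ (line_inh y01') x x01.
have [_ bT] := hC2 _ (line_inv x01) _ ey.
rewrite /B; apply: le_trans (hK _ _) _; rewrite [leRHS]mulrAC.
apply: ler_pM => //; [by rewrite mulr_ge0 ?vn_ge0|exact: vn_ge0|].
rewrite -[leRHS]mulrA; apply: ler_wpM2l => //; apply: le_trans (hK _ _) _.
rewrite -[leRHS]mulrA; apply: ler_pM => //; [by rewrite mulr_ge0 ?vn_ge0|exact: vn_ge0|by apply: ler_wpM2l|].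
apply: le_trans (hK _ _) _; rewrite [leRHS]mulrAC; apply: ler_pM => //; [by rewrite mulr_ge0 ?vn_ge0|exact: vn_ge0|].
by rewrite -mulrA; apply: ler_wpM2l.
Qed.

Lemma left_transport u : 0 <= u <= 1 -> T 0 u = \1%VF.
Proof.
move=> u01; have p := T_vpc (introT andP (conj (lexx 0) ler01)).
rewrite -(evo0 p); apply: (vprim_const (S := [::]) ler01 _ (evo_prim p)) => // t t01 _.
suff -> : linefield e2 (0, 0) t = 0 by rewrite comp_lfun0l oppr0.
rewrite /linefield linev /pullback; set c := chart_at _.
have ci : chart_img c (chart_of c (G (0, t))) by exists (G (0, t)) => //; exact: chart_atP.
have -> : (fun _ : 'I_1 => vderive (chart_of c \o G) (0, t) e2) = fun _ => 0.
  apply/funext => _; apply: is_vderive_vderive.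
  apply: (is_vderive_near (F := fun _ => chart_of c (G (0, 0)))) => //=; last first.
  - exact: is_vderive_cst.
  - by rewrite [in RHS]left_const// !ltW; case/andP: t01.
  apply: filterS (near_level t01) => e et.
  by rewrite line_stepv [in RHS]left_const.
by rewrite -(formhomE fA _ ci) linear0.
Qed.

(** The nonabelian Stokes formula at a generic level. It starts at x = 0, where the constant left
    side makes the quotient vanish, and advances chart by chart through [stokes_vertP]. *)
Lemma stokes y x : 0 < y < 1 -> 0 <= x <= 1 -> gen_level y -> vcvg 0^' (stokes_vert y x) (bt y x).
Proof.
move=> y01 x01 gy; have y01' : 0 <= y <= 1 by case/andP: y01 => a b; rewrite !ltW.
apply: (segment_ind (Pr := fun x => vcvg 0^' (stokes_vert y x) (bt y x))) x01 => [x0 x001|].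
  pose c := chart_at (G (x0, y)); have cq := chart_atP (G (x0, y)).
  have sq : square ((x0, y) : X) by split.
  have [r r0 h] := stokes_step fA fF hF cover cG sm y01 x001 gy cq.
  have nc := near_chart_dom cG sq cq.
  have [r' r'0 h'] := ball2 nc.
  exists (Num.min r r'); first by rewrite lt_min r0.
  move=> x1 x2 x101 x201; rewrite !lt_min => /andP[a1 b1] /andP[a2 b2].
  have c1 : chart_dom (chart_of c) (G (x1, y)) by apply: h' => //; split; rewrite //= subrr normr0.
  have c2 : chart_dom (chart_of c) (G (x2, y)) by apply: h' => //; split; rewrite //= subrr normr0.
  by move=> /(stokes_vertP _ y01 x101 c1) /(h _ _ x101 x201 a1 a2) /(stokes_vertP _ y01 x201 c2).
rewrite /bt vint_point; generalize (vcvg_cst (0 : R)^' (0 : E)); apply: vcvg_near.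
apply: filterS (near_level y01) => e ey.
have i0 t : 0 <= t <= 1 -> Ti 0 t = \1%VF.
  by move=> t01; have := evoK (T_vpc (introT andP (conj (lexx 0) ler01))) t01; rewrite left_transport// comp_lfun1r.
rewrite /stokes_vert left_transport// i0// (evi0 (P_vpc fA cover cG sm y01')) (evo0 (P_vpc fA cover cG sm ey)).
by rewrite !comp_lfun1l subrr scaler0.
Qed.

(** Along the level [y] to the abscissa [x], then down to the bottom edge; at y = 0 it is the
    transport along the bottom. *)
Definition vert_gauge x y : E := (Ti x y \o P y x)%VF.

Lemma vert_gauge_derive x y : 0 < y < 1 -> 0 <= x <= 1 -> gen_level y ->
  is_vderive (vert_gauge x) y 1 (vert_gauge x y \o bt y x)%VF.
Proof.
move=> y01 x01 gy; have y01' : 0 <= y <= 1 by case/andP: y01 => a b; rewrite !ltW.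
apply/is_vderiveP; generalize (vcvg_bil (bil_comp U) (vcvg_cst (0 : R)^' (vert_gauge x y)) (stokes y01 x01 gy)).
apply: vcvg_near; apply: filterS (near_level y01) => e ey.
rewrite /stokes_vert -comp_lfunZr; congr (_ *: _).
rewrite comp_lfunDr comp_lfunNr comp_lfun1r [e *: 1]mulr1; congr (_ - _).
rewrite /vert_gauge !comp_lfunA -(comp_lfunA _ (P y x)) (eviK (P_vpc fA cover cG sm y01'))// comp_lfun1r.
by rewrite (evoK (T_vpc x01))// comp_lfun1l.
Qed.

Lemma fgen_levels : exists S : seq R, forall y, 0 <= y <= 1 -> y \notin S -> gen_level y.
Proof.
have [S hS] := fgen_lines pol; exists S => y y01 /(hS y y01)[S' h]; exists S' => x x01 xS.
by have [] := h x x01 xS.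
Qed.

End StokesGlobal.

Section Levels.
Variables (R : realType) (n : nat) (M : manifold R n) (U : vectType R).
Local Notation E := 'End(U).
Local Notation X := (R^o * R^o)%type.
Variables (A : dform M 1 E) (F2 : dform M 2 E) (G : X -> M) (k : nat) (pol : 'I_k -> halfspaces R).
Hypothesis fA : is_form A.
Hypothesis fF : is_form F2.
Hypothesis cover : square `<=` \bigcup_i hs_set (pol i).
Hypothesis cG : {within square, continuous G}.
Hypothesis sm : forall i, smooth_on (square `&` hs_set (pol i)) G.
Local Notation linefield := (linefield A G).
Local Notation bt := (bt A F2 G).
Local Notation gcurv := (gcurv A F2 G).
Local Notation fcurv := (fcurv F2 G).
Local Notation e1 := ((1, 0) : X).
Local Notation e2 := ((0, 1) : X).
Local Notation P y := (evo (linefield e1 (0, y))).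
Local Notation Q y := (evi (linefield e1 (0, y))).
Local Notation gen_level y := (exists S : seq R, forall x, 0 <= x <= 1 -> x \notin S -> fgen pol (x, y)).
Local Notation I01 := [set s : R^o | 0 <= s <= 1].

Lemma level_line_cvg (y : R^o) : (0, s) @[s --> within I01 (nbhs y)] --> ((0, y) : X).
Proof.
have -> : (fun s : R^o => (0, s) : X) = fun s => s *: e2 + (0, 0) by apply/funext => s; rewrite linev.
rewrite -[X in _ --> X]linev; apply: cvgD; last exact: cvg_cst.
by apply: cvgZr_tmp; exact: cvg_within.
Qed.

Lemma level_cvg (y x : R) : 0 <= y <= 1 -> 0 <= x <= 1 ->
  vcvg (within I01 (nbhs (y : R^o))) (fun s => P s x) (P y x) /\
  vcvg (within I01 (nbhs (y : R^o))) (fun s => Q s x) (Q y x).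
Proof.
move=> y01 x01.
exact: (evo_line_cvg fA cover cG sm x01 (fun s => @line_inh R s) (line_inh y01) (@level_line_cvg y)).
Qed.

Lemma within_interior (W : vectType R) (F : R^o -> W) (y : R) l : 0 < y < 1 ->
  vcvg (within I01 (nbhs (y : R^o))) F l -> vcvg (nbhs y) F l.
Proof.
move=> y01; apply: vcvg_trans => B; rewrite /within /= => hB.
have ny : \forall s \near y, 0 < s < 1 by apply: near_itvoo.
by apply: filterS2 hB ny => s h /andP[a b]; apply: h; rewrite /= !ltW.
Qed.

Lemma gcurv_cvg (y x : R) : 0 < y < 1 -> 0 <= x <= 1 -> fgen pol (x, y) ->
  vcvg (nbhs y) (fun s => gcurv s x) (gcurv y x).
Proof.
move=> y01 x01 gxy; have y01' : 0 <= y <= 1 by case/andP: y01 => a b; rewrite !ltW.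
have [cP cQ] := level_cvg y01' x01.
have sq : square ((x, y) : X) by split.
have cf : vcvg (within I01 (nbhs (y : R^o))) (fun s : R^o => fcurv (x, s)) (fcurv (x, y)).
  have lc : (x, s) @[s --> within I01 (nbhs (y : R^o))] --> within square (nbhs ((x, y) : X)).
    have -> : (fun s : R^o => (x, s) : X) = fun s => s *: e2 + (x, 0) by apply/funext => s; rewrite linev.
    rewrite -(linev y x); apply: line_cvg_within; [exact: cvg_within|exact: cvg_cst|].
    by rewrite near_withinE; apply: filterE => s s01; exact: line_inv.
  exact: (vcvg_comp lc (pullback_cvg cover cG sm fF (contform2 fF) sq (mdgen_pair2 gxy))).
apply: within_interior => //; apply: (vcvg_bil (bil_comp U)) => //.
by apply: (vcvg_bil (bil_comp U)).
Qed.

Lemma bt_lip : exists2 L, 0 <= L & forall y, 0 <= y <= 1 -> gen_level y ->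
  vpcb L 0 1 (gcurv y) /\ forall x x', 0 <= x <= 1 -> 0 <= x' <= 1 -> vn (bt y x' - bt y x) <= L * `|x' - x|.
Proof.
have [L L0 hL] := gcurv_bounded fA fF cover cG sm; exists L => // y y01 gy; split; first exact: hL.
have hv := hL y y01 gy; have pg : vpc 0 1 (gcurv y) by exists L.
have [S hS] := hv.
move=> x x' x01 x'01; apply: (vprim_lip (S := S) ler01 (vprim_int pg)) => // t t01 tS.
by have [] := hS t t01 tS.
Qed.

(** With a moving abscissa [xi s], the Lipschitz bound in the abscissa is uniform over the generic
    levels, so only continuity in the level at a fixed abscissa is left to dominated convergence. *)
Lemma bt_vcts (xi : R -> R) (y : R) : (forall u, 0 <= u <= 1 -> 0 <= xi u <= 1) -> 0 < y < 1 ->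
  xi u @[u --> y] --> xi y -> (\forall s \near y, 0 <= s <= 1 /\ gen_level s) ->
  vcts (fun s => bt s (xi s)) y.
Proof.
move=> hxi y01 cxi ng; have y01' : 0 <= y <= 1 by case/andP: y01 => a b; rewrite !ltW.
have [L L0 hL] := bt_lip; have [_ gy] := nbhs_singleton ng.
have c1 : vcvg (nbhs y) (fun s => bt s (xi y)) (bt y (xi y)).
  have /andP[x0 x1] := hxi y y01'.
  have pg : vpc 0 (xi y) (gcurv y) by apply: (vpc_sub (lexx 0) x1); exists L; have [] := hL y y01' gy.
  have d : vcvg (within setT (nbhs (y : R^o))) (fun s => vintegral 0 (xi y) (gcurv s)) (vintegral 0 (xi y) (gcurv y)).
    apply: (@dominated_vint R E R^o setT y 0 (xi y) gcurv (gcurv y) L x0) => //.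
      rewrite near_withinE; apply: filterS ng => s [s01 gs] _.
      by apply: (vpcb_sub (lexx 0) x1); have [] := hL s s01 gs.
    have [S hS] := gy; exists S => u /andP[u0 u1] uS.
    have u01 : 0 <= u <= 1 by rewrite (ltW u0) (le_trans (ltW u1)).
    apply: vcvg_trans (gcurv_cvg y01 u01 (hS u u01 uS)); exact: cvg_within.
  apply: vcvg_trans d => B; rewrite /within /= => hB.
  by apply: filterS hB => s h; exact: h.
have c2 : vcvg (nbhs y) (fun s => bt s (xi s) - bt s (xi y)) 0.
  have ce : L * `|xi s - xi y| @[s --> y] --> (0 : R).
    rewrite -[X in _ --> X](mulr0 L); apply: cvgM; first exact: cvg_cst.
    rewrite -[X in _ --> X](@normr0 _ R^o); apply: cvg_norm.
    by rewrite -[X in _ --> X](subrr (xi y)); apply: cvgB => //; exact: cvg_cst.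
  apply: (vcvg_squeeze _ ce); apply: filterS ng => s [s01 gs]; rewrite subr0.
  by have [_ h] := hL s s01 gs; apply: h; exact: hxi.
generalize (vcvgD c2 c1); rewrite add0r; apply: vcvg_near; apply: filterE => s.
by rewrite subrK.
Qed.

Lemma bt_vpc (xi : R -> R) : (forall u, 0 <= u <= 1 -> 0 <= xi u <= 1) -> continuous (xi : R -> R) ->
  vpc 0 1 (fun s => bt s (xi s)).
Proof.
move=> hxi cxi; have [L L0 hL] := bt_lip; have [S hS] := fgen_levels pol.
exists L, S => y y01 yS; have y01' : 0 <= y <= 1 by case/andP: y01 => a b; rewrite !ltW.
have gy := hS y y01' yS; split.
  have [_ h] := hL y y01' gy; have := h 0 (xi y) (introT andP (conj (lexx 0) ler01)) (hxi y y01').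
  rewrite /bt vint_point !subr0 => h'; apply: le_trans h' _; rewrite -[leRHS]mulr1 ler_wpM2l//.
  by have /andP[a b] := hxi y y01'; rewrite ger0_norm.
apply: bt_vcts => //; first exact: cxi.
have n1 : \forall s \near y, 0 < s < 1 by apply: near_itvoo.
have n2 : \forall s \near y, s \notin S by exact: near_notin.
by apply: filterS2 n1 n2 => s /andP[a b] sS; split; [rewrite !ltW|apply: hS => //; rewrite !ltW].
Qed.

Lemma P_lip : exists2 L, 0 <= L & forall y, 0 <= y <= 1 -> forall x x', 0 <= x <= 1 -> 0 <= x' <= 1 ->
  vn (P y x' - P y x) <= L * `|x' - x|.
Proof.
have [L L0 [_ hv]] := linefield_bounded fA cover cG sm e1; have [C C0 hC] := evo_bounded fA cover cG sm e1.
have [K K0 hK] := vn_comp U; exists (K * L * C); first by rewrite !mulr_ge0.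
move=> y y01 x x' x01 x'01; have hb := hv _ (line_inh y01); have [S hS] := hb.
have pa : vpc 0 1 (linefield e1 (0, y)) by exists L.
apply: (vprim_lip (S := S) ler01 (evo_prim pa)) => // t t01 tS; rewrite vnN.
have t01' : 0 <= t <= 1 by case/andP: t01 => a b; rewrite !ltW.
have [b1 _] := hS t t01 tS; have [b2 _] := hC _ (line_inh y01) t t01'.
apply: le_trans (hK _ _) _; apply: ler_pM => //; [by rewrite mulr_ge0 ?vn_ge0|exact: vn_ge0|by apply: ler_wpM2l].
Qed.

Lemma P_xi_vcontinuous (xi : R -> R) : (forall u, 0 <= u <= 1 -> 0 <= xi u <= 1) -> continuous (xi : R -> R) ->
  vcontinuous unit_itv (fun s : R^o => P s (xi s)).
Proof.
move=> hxi cxi j; apply/subspace_continuousP => y /= y01.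
have [L L0 hL] := P_lip; have [c1 _] := level_cvg y01 (hxi y y01).
have c2 : vcvg (within I01 (nbhs (y : R^o))) (fun s => P s (xi s) - P s (xi y)) 0.
  have ce : L * `|xi s - xi y| @[s --> within I01 (nbhs (y : R^o))] --> (0 : R).
    rewrite -[X in _ --> X](mulr0 L); apply: cvgM; first exact: cvg_cst.
    rewrite -[X in _ --> X](@normr0 _ R^o); apply: cvg_norm.
    rewrite -[X in _ --> X](subrr (xi y)); apply: cvgB; last exact: cvg_cst.
    by apply: cvg_within_filter; exact: cxi.
  apply: (vcvg_squeeze _ ce); rewrite near_withinE; apply: filterE => s s01; rewrite subr0.
  by apply: hL => //; exact: hxi.
have c3 : vcvg (within I01 (nbhs (y : R^o))) (fun s : R^o => P s (xi s)) (P y (xi y)).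
  generalize (vcvgD c2 c1); rewrite add0r; apply: vcvg_near; apply: filterE => s.
  by rewrite subrK.
exact: c3.
Qed.

End Levels.

(** * Comparison of transports along columns and along the diagonal *)

Section BigO.
Variable R : realType.
Implicit Type W : vectType R.

Definition isO W j (f : R -> W) := exists2 C, 0 <= C & \forall e \near (0 : R)^', vn (f e) <= C * `|e| ^+ j.

Lemma isO_bounded W C (f : R -> W) : 0 <= C -> (\forall e \near (0 : R)^', vn (f e) <= C) -> isO 0 f.
Proof. by move=> C0 h; exists C => //; apply: filterS h => e; rewrite expr0 mulr1. Qed.

Lemma isO_cst W (w : W) : isO 0 (fun=> w).
Proof. by apply: (isO_bounded (C := vn w)); [exact: vn_ge0|exact: filterE]. Qed.

Lemma isOD W j (f g : R -> W) : isO j f -> isO j g -> isO j (fun e => f e + g e).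
Proof.
move=> [C C0 hf] [D D0 hg]; exists (C + D); first exact: addr_ge0.
by apply: filterS2 hf hg => e hf hg; apply: le_trans (vnD _ _) _; rewrite mulrDl lerD.
Qed.

Lemma isON W j (f : R -> W) : isO j f -> isO j (fun e => - f e).
Proof. by move=> [C C0 hf]; exists C => //; apply: filterS hf => e; rewrite vnN. Qed.

Lemma isOB W j (f g : R -> W) : isO j f -> isO j g -> isO j (fun e => f e - g e).
Proof. by move=> hf hg; apply: isOD => //; exact: isON. Qed.

Lemma isO_bil (W1 W2 W3 : vectType R) (op : W1 -> W2 -> W3) i j f g : bil op -> isO i f -> isO j g ->
  isO (i + j) (fun e => op (f e) (g e)).
Proof.
move=> /vn_bil[K K0 hK] [C C0 hf] [D D0 hg]; exists (K * C * D); first by rewrite !mulr_ge0.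
apply: filterS2 hf hg => e hf hg; apply: le_trans (hK _ _) _.
have -> : K * C * D * `|e| ^+ (i + j) = (K * (C * `|e| ^+ i)) * (D * `|e| ^+ j) by rewrite exprD; ring.
by apply: ler_pM; rewrite ?mulr_ge0 ?vn_ge0// ler_wpM2l.
Qed.

Lemma isO2_cvg W (f : R -> W) : isO 2 f -> vcvg 0^' (fun e : R => e^-1 *: f e) 0.
Proof.
move=> [C C0 h]; have ce : C * `|e| @[e --> (0 : R)^'] --> (0 : R).
  rewrite -[X in _ --> X](mulr0 C); apply: cvgM; first exact: cvg_cst.
  by rewrite -[X in _ --> X](@normr0 _ R^o); apply: cvg_norm; exact: nbhs_dnbhs.
apply: (vcvg_squeeze _ ce); have n3 : \forall e \near (0 : R)^', e != 0 by exact: nbhs_dnbhs_neq.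
apply: filterS2 h n3 => e h e0; rewrite subr0 vnZ normrV ?unitfE// mulrC ler_pdivrMr ?normr_gt0//.
by rewrite -mulrA -expr2.
Qed.

Lemma isO_near W j (f g : R -> W) : (\forall e \near (0 : R)^', f e = g e) -> isO j f -> isO j g.
Proof. by move=> h [C C0 hf]; exists C => //; apply: filterS2 h hf => e <-. Qed.

End BigO.

(** The difference between descending to (y, y) along the diagonal and along the column, expressed
    through the remainders [rd], [rv], [rh] of three first-order expansions, a product of two chord
    terms, and the defect [a - b - h] in the addition of the chords. *)
Lemma diag_algebra (R : realType) (U : vectType R) (a b h td tdi td' tv tv' tvi p' pm : 'End(U)) :
  (td' \o tdi = \1)%VF -> (tv' \o tvi = \1)%VF ->
  let rd := (((\1 + a) \o td') - td)%VF in let rv := (((\1 + b) \o tv') - tv)%VF in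
  let rh := (((\1 + h) \o p') - pm)%VF in
  ((td \o tdi \o p') - (tv \o tvi \o pm))%VF =
  (((a - b - h) \o p') - (b \o h \o p') - (rd \o tdi \o p') + (tv \o tvi \o rh) + (rv \o tvi \o (\1 + h) \o p'))%VF.
Proof.
move=> e1 e2 rd rv rh; rewrite /rd /rv /rh.
rewrite !(comp_lfunDl, comp_lfunDr, comp_lfunNl, comp_lfunNr, comp_lfun1l, comp_lfun1r) !comp_lfunA.
have E1 (x : 'End(U)) : (x \o td' \o tdi = x)%VF by rewrite -comp_lfunA e1 comp_lfun1r.
have E2 (x : 'End(U)) : (x \o tv' \o tvi = x)%VF by rewrite -comp_lfunA e2 comp_lfun1r.
rewrite ?E1 ?E2 ?e1 ?e2 !comp_lfun1l.
by apply: crd_inj => j; rewrite !(crdD, crdB, raddfN) /=; ring.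
Qed.

Lemma diag_quot (R : realType) (U : vectType R) (td tdi tdi' p p' q tt pm : 'End(U)) (s : R) :
  (tdi \o td = \1)%VF -> (p \o q = \1)%VF ->
  (((tdi \o p) \o (s *: ((q \o tt \o pm) - \1))) + (tdi \o (s *: ((td \o tdi' \o p') - (tt \o pm)))))%VF =
  s *: ((tdi' \o p') - (tdi \o p))%VF.
Proof.
move=> e1 e2; rewrite -!comp_lfunZr -scalerDr; congr (_ *: _).
rewrite !(comp_lfunDr, comp_lfunNr) comp_lfun1r !comp_lfunA e1 comp_lfun1l -(comp_lfunA tdi p) e2 comp_lfun1r.
by apply: crd_inj => j; rewrite !(crdD, crdB, raddfN) /=; ring.
Qed.

Section Gauge.
Variables (R : realType) (n : nat) (M : manifold R n) (U : vectType R).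
Local Notation E := 'End(U).
Local Notation X := (R^o * R^o)%type.
Variables (A : dform M 1 E) (F2 : dform M 2 E) (G : X -> M) (k : nat) (pol : 'I_k -> halfspaces R).
Hypothesis fA : is_form A.
Hypothesis fF : is_form F2.
Hypothesis hF : forall c z u v, @chart_img _ _ M c z -> F2 c z (pair2 u v) =
  vderive (fun x => A c x (fun _ => v)) z u - vderive (fun x => A c x (fun _ => u)) z v +
  ((A c z (fun _ => u) \o A c z (fun _ => v))%VF - (A c z (fun _ => v) \o A c z (fun _ => u))%VF).
Hypothesis cover : square `<=` \bigcup_i hs_set (pol i).
Hypothesis cG : {within square, continuous G}.
Hypothesis sm : forall i, smooth_on (square `&` hs_set (pol i)) G.
Hypothesis left_const : forall s : R, 0 <= s <= 1 -> G (0, s) = G (0, 0).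

Local Notation zz c := (fun p => chart_of c (G p)).
Local Notation yy := (yy A G).
Local Notation linefield := (linefield A G).
Local Notation bt := (bt A F2 G).
Local Notation e1 := ((1, 0) : X).
Local Notation e2 := ((0, 1) : X).
Local Notation e12 := ((1, 1) : X).
Local Notation P y := (evo (linefield e1 (0, y))).
Local Notation Q y := (evi (linefield e1 (0, y))).
Local Notation T x := (evo (linefield e2 (x, 0))).
Local Notation Ti x := (evi (linefield e2 (x, 0))).
Local Notation Td := (evo (linefield e12 (0, 0))).
Local Notation Tdi := (evi (linefield e12 (0, 0))).
Local Notation gen_level y := (exists S : seq R, forall x, 0 <= x <= 1 -> x \notin S -> fgen pol (x, y)).

Lemma lined (u : R) : u *: e12 + (0, 0) = (u, u) :> X.
Proof. by congr pair; rewrite /= /GRing.scale /= mulr1 addr0. Qed.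
Lemma line_ind : line_in e12 ((0, 0) : X).
Proof. by move=> u u01; rewrite lined. Qed.

Lemma Td_vpc : vpc 0 1 (linefield e12 (0, 0)).
Proof.
have [L L0 [_ hv]] := linefield_bounded fA cover cG sm e12.
by exists L; apply: hv; exact: line_ind.
Qed.

Definition diag_gauge y : E := (Tdi y \o P y y)%VF.

(** The triangle (y, y), (y, e + y), (e + y, e + y) contributes O(e^2) only, so the rate of change
    is the one given by the Stokes formula at x = y. *)
Lemma diag_gauge_derive y : 0 < y < 1 -> gen_level y ->
  is_vderive diag_gauge y 1 (diag_gauge y \o bt y y)%VF.
Proof.
move=> y01 gy; have y01' : 0 <= y <= 1 by case/andP: y01 => a b; rewrite !ltW.
pose c := chart_at (G (y, y)); have cq : chart_dom (chart_of c) (G (y, y)) by exact: chart_atP.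
have sq : square ((y, y) : X) by split.
have [r1 [C1 [r10 C10 h1]]] := transport_chart fA cover cG sm e12 sq cq.
have [r2 [C2 [r20 C20 h2]]] := transport_chart fA cover cG sm e2 sq cq.
have [r3 [C3 [r30 C30 h3]]] := transport_chart fA cover cG sm e1 sq cq.
have [r4 [L4 [r40 L40 h4]]] := chart_ball fA cover cG sm e1 sq cq.
have [r5 [L5 [r50 L50 h5]]] := chart_ball fA cover cG sm e2 sq cq.
have [D1 D10 hD1] := evo_bounded fA cover cG sm e1.
have [D2 D20 hD2] := evo_bounded fA cover cG sm e2.
have [D3 D30 hD3] := evo_bounded fA cover cG sm e12.
have near_r r : 0 < r -> \forall e \near (0 : R)^', [/\ 0 <= e + y <= 1, near2 ((y, y) : X) r (y, e + y) &
    near2 ((y, y) : X) r (e + y, e + y)].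
  move=> r0; apply: filterS2 (near_level y01) (near_dnbhs_lt r0) => e ey er.
  by split=> //; split; rewrite /= ?subrr ?normr0// addrK.
have nyy r : 0 < r -> near2 ((y, y) : X) r (y, y) by move=> r0; split; rewrite /= subrr normr0.
pose z0 := zz c (y, y); pose z1 e := zz c (y, e + y); pose z2 e := zz c (e + y, e + y).
pose Y0 := yy c (y, y); pose Y1 e := yy c (y, e + y).
have oz1 : isO 1 (fun e : R => z1 e - z0).
  exists L5 => //; apply: filterS (near_r r5 r50) => e [ey n1 n2].
  by have [h _] := vert_lip fA cover sm h5 y01' y01' ey (nyy _ r50) n1; rewrite addrK in h.
have oY1 : isO 1 (fun e : R => Y1 e - Y0).
  exists L5 => //; apply: filterS (near_r r5 r50) => e [ey n1 n2].
  by have [_ h] := vert_lip fA cover sm h5 y01' y01' ey (nyy _ r50) n1; rewrite addrK in h.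
have oz2 : isO 1 (fun e : R => z2 e - z1 e).
  exists L4 => //; apply: filterS (near_r r4 r40) => e [ey n1 n2].
  have hz lo hi : lo <= hi -> 0 <= lo <= 1 -> 0 <= hi <= 1 -> near2 ((y, y) : X) r4 (lo, e + y) ->
      near2 ((y, y) : X) r4 (hi, e + y) -> vn (zz c (hi, e + y) - zz c (lo, e + y)) <= L4 * `|hi - lo|.
    move=> lohi /andP[lo0 lo1] /andP[hi0 hi1] nl nh.
    have [vz _] := vprim_charth fA cover sm h4 lohi lo0 hi1 ey nl nh.
    have [S hS] := dgen_line pol ((0, e + y) : X) e1.
    apply: (vprim_lip (S := S) lohi vz); rewrite ?lexx ?lohi// => t /andP[lt th] tS.
    have sqt : square ((t, e + y) : X).
      by split => //; rewrite /unit_itv /= (le_trans lo0 (ltW lt)) (le_trans (ltW th) hi1).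
    have gt := hS t I tS; rewrite lineh in gt.
    have nt : near2 ((y, y) : X) r4 (t, e + y).
      have lth : lo <= t <= hi by rewrite !ltW.
      by have := near2_convex (d := e1) (p := (0, e + y)) lth; rewrite !lineh; apply.
    by have [_ _ /(_ (gt sqt))[]] := h4 _ sqt nt.
  rewrite /z2 /z1; have [ye|/ltW ye] := leP y (e + y).
    by have := hz y (e + y) ye y01' ey n1 n2; rewrite addrK.
  by have := hz (e + y) y ye ey y01' n2 n1; rewrite -vnN opprB distrC addrK.
have ev := bil_ev n E; have co := bil_comp U.
have oY0 : isO 0 (fun _ : R => Y0) by exact: isO_cst.
have oYb : isO 0 Y1.
  apply: (isO_near (f := fun e => (Y1 e - Y0) + Y0)); first by apply: filterE => e; rewrite subrK.
  apply: isOD => //; have [K K0 hK] := oY1; apply: (isO_bounded (C := K)) => //.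
  apply: filterS2 hK (near_dnbhs_lt ltr01) => e h e1'; apply: le_trans h _.
  by rewrite expr1 -[leRHS]mulr1 ler_wpM2l// ltW.
have oa : isO 1 (fun e : R => Y0 (z2 e - z0)).
  have h := isO_bil ev (isOD oz2 oz1) oY0; rewrite addn0 in h.
  by apply: isO_near h; apply: filterE => e; rewrite addrA subrK.
have ob : isO 1 (fun e : R => Y0 (z1 e - z0)) by exact: (isO_bil ev oz1 oY0).
have oh : isO 1 (fun e : R => Y1 e (z2 e - z1 e)) by exact: (isO_bil ev oz2 oYb).
(* Since [Y0] is linear and chords add up, what remains is [Y1 - Y0] on the horizontal chord, a
   product of two quantities of order 1. *)
have oabh : isO 2 (fun e : R => Y0 (z2 e - z0) - Y0 (z1 e - z0) - Y1 e (z2 e - z1 e)).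
  have h := isON (isO_bil ev oz2 oY1); apply: isO_near h; apply: filterE => e /=.
  by rewrite -linearB /= opprB addrA subrK add_lfunE opp_lfunE opprB.
have lt01 e : 0 <= e + y <= 1 -> _ := fun h => (hD1 _ (line_inh h), hD2 _ (line_inv y01')).
have op' : isO 0 (fun e : R => P (e + y) (e + y)).
  by apply: (isO_bounded (C := D1)) => //; apply: filterS (near_level y01) => e ey; have [] := hD1 _ (line_inh ey) _ ey.
have otdi : isO 0 (fun e : R => Tdi (e + y)).
  by apply: (isO_bounded (C := D3)) => //; apply: filterS (near_level y01) => e ey; have [] := hD3 _ line_ind _ ey.
have otvi : isO 0 (fun e : R => Ti y (e + y)).
  by apply: (isO_bounded (C := D2)) => //; apply: filterS (near_level y01) => e ey; have [] := hD2 _ (line_inv y01') _ ey.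
have ord : isO 2 (fun e : R => ((\1 + Y0 (z2 e - z0)) \o Td (e + y))%VF - Td y).
  exists C1 => //; apply: filterS (near_r r1 r10) => e [ey n1 n2].
  have := h1 _ line_ind y (e + y) y01' ey; rewrite !lined addrK => h; have := h (nyy _ r10) n2.
  by rewrite -normrX ger0_norm ?sqr_ge0.
have orv : isO 2 (fun e : R => ((\1 + Y0 (z1 e - z0)) \o T y (e + y))%VF - T y y).
  exists C2 => //; apply: filterS (near_r r2 r20) => e [ey n1 n2].
  have := h2 _ (line_inv y01') y (e + y) y01' ey; rewrite !linev addrK => h; have := h (nyy _ r20) n1.
  by rewrite -normrX ger0_norm ?sqr_ge0.
have orh : isO 2 (fun e : R => ((\1 + Y1 e (z2 e - z1 e)) \o P (e + y) (e + y))%VF - P (e + y) y).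
  exists C3 => //; apply: filterS (near_r r3 r30) => e [ey n1 n2].
  have := h3 _ (line_inh ey) y (e + y) y01' ey; rewrite !lineh addrK => h; have := h n1 n2.
  by rewrite -normrX ger0_norm ?sqr_ge0.
have o1h : isO 0 (fun e : R => \1%VF + Y1 e (z2 e - z1 e)).
  apply: isOD; first exact: isO_cst.
  have [K K0 hK] := oh; apply: (isO_bounded (C := K)) => //.
  apply: filterS2 hK (near_dnbhs_lt ltr01) => e h e1'; apply: le_trans h _.
  by rewrite expr1 -[leRHS]mulr1 ler_wpM2l// ltW.
have oD : isO 2 (fun e : R => (Td y \o Tdi (e + y) \o P (e + y) (e + y))%VF - (T y y \o Ti y (e + y) \o P (e + y) y)%VF).
  have h := isOD (isOD (isOB (isOB (isO_bil co oabh op') (isO_bil co (isO_bil co ob oh) op'))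
     (isO_bil co (isO_bil co ord otdi) op')) (isO_bil co (isO_bil co (isO_cst (T y y)) otvi) orh))
     (isO_bil co (isO_bil co (isO_bil co orv otvi) o1h) op').
  apply: isO_near h; apply: filterS (near_level y01) => e ey.
  by rewrite -diag_algebra//; [exact: (eviK Td_vpc)|exact: (eviK (T_vpc fA cover cG sm y01'))].
apply/is_vderiveP.
have s1 := stokes fA fF hF cover cG sm left_const y01 y01' gy.
generalize (vcvgD (vcvg_bil co (vcvg_cst (0 : R)^' (diag_gauge y)) s1)
  (vcvg_bil co (vcvg_cst (0 : R)^' (Tdi y)) (isO2_cvg oD))).
rewrite comp_lfun0r addr0; apply: vcvg_near; apply: filterS (near_level y01) => e ey.
rewrite [e *: 1]mulr1.
exact: (diag_quot _ _ _ _ _ (evoK Td_vpc y01') (eviK (P_vpc fA cover cG sm y01') y01')).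
Qed.

(** The derivative is known at generic levels only; continuity on [0, 1] turns it into a primitive.
    A constant [xi] gives the column gauges and the identity the diagonal one. *)
Lemma gauge_xi_prim (gg : R -> E) (g gd : R -> E) (xi : R -> R) : continuous (xi : R -> R) ->
  (forall u, 0 <= u <= 1 -> 0 <= xi u <= 1) -> vprim 0 1 g gd ->
  (forall y, gg y = (g y \o P y (xi y))%VF) ->
  (forall y, 0 < y < 1 -> gen_level y -> is_vderive gg y 1 (gg y \o bt y (xi y))%VF) ->
  vprim 0 1 gg (fun y => (gg y \o bt y (xi y))%VF).
Proof.
move=> cxi hxi pg ggE dg; have cP := P_xi_vcontinuous fA cover cG sm hxi cxi.
have [S hS] := fgen_levels pol; have [D D0 hD] := evo_bounded fA cover cG sm e1.
have cg : vcontinuous unit_itv (gg : R^o -> E).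
  rewrite (_ : gg = fun y => (g y \o P y (xi y))%VF); last exact/funext.
  by apply: vcontinuous_bil; [exact: bil_comp|exact: vprim_vcontinuous pg|exact: cP].
have pP : vpc 0 1 (fun y => P y (xi y)).
  exists D, [::] => y y01 _; have y01' : 0 <= y <= 1 by case/andP: y01 => a b; rewrite !ltW.
  split; first by have [] := hD _ (line_inh y01') _ (hxi y y01').
  have c : vcvg (within [set s : R^o | 0 <= s <= 1] (nbhs (y : R^o))) (fun s : R^o => P s (xi s)) (P y (xi y)).
    by move=> j; have /subspace_continuousP h := cP j; exact: (h y y01').
  exact: within_interior c.
apply/vprimP => //; split.
- apply: (vpc_bil (bil_comp U)); last exact: (bt_vpc fA fF cover cG sm hxi cxi).
  rewrite (_ : gg = fun y => (g y \o P y (xi y))%VF); last exact/funext.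
  by apply: (vpc_bil (bil_comp U)) => //; exact: (vprim_pc ler01 pg).
- by move=> j; rewrite -unit_itvE; exact: cg.
- exists S => y y01 yS; apply: dg => //; apply: hS => //.
  by case/andP: y01 => a b; rewrite !ltW.
Qed.

(** From the left side, where transport is trivial, to (x, 0) by two routes, along the level [y] and
    down, or along the bottom: they differ by the solution of w' = w b. *)
Lemma vert_gaugeE x y : 0 <= x <= 1 -> 0 <= y <= 1 ->
  (Ti x y \o P y x = P 0 x \o evi (fun u => bt u x) y)%VF.
Proof.
move=> x01 y01; have cc : continuous ((fun=> x) : R -> R) by move=> u; exact: cvg_cst.
have p := gauge_xi_prim (gg := vert_gauge A G x) cc (fun _ _ => x01) (evi_prim (T_vpc fA cover cG sm x01)) (fun=> erefl)
  (fun y h1 h2 => vert_gauge_derive fA fF hF cover cG sm left_const h1 x01 h2).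
have := evi_unique (S := [::]) (bt_vpc fA fF cover cG sm (fun _ _ => x01) cc) p (fun _ _ _ => erefl) y01.
by rewrite /vert_gauge (evi0 (T_vpc fA cover cG sm x01)) comp_lfun1l.
Qed.

Lemma diag_gaugeE y : 0 <= y <= 1 -> (Tdi y \o P y y = evi (fun u => bt u u) y)%VF.
Proof.
move=> y01; have cc : continuous ((fun u => u) : R -> R) by move=> u; exact: cvg_id.
have p := gauge_xi_prim (gg := diag_gauge) cc (fun _ h => h) (evi_prim Td_vpc) (fun=> erefl) diag_gauge_derive.
have := evi_unique (S := [::]) (bt_vpc fA fF cover cG sm (fun _ h => h) cc) p (fun _ _ _ => erefl) y01.
rewrite /diag_gauge (evi0 Td_vpc) comp_lfun1l.
by rewrite (evo0 (P_vpc fA cover cG sm (introT andP (conj (lexx 0) ler01)))) comp_lfun1l.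
Qed.

End Gauge.

(** * The forms of which the integral is taken *)

Section PermSums.
Variables (R : realType) (W : vectType R).

(** A permutation amounts to the image of the first letter and a permutation of the others. Factors
    of a wedge product are peeled off from the left in this way. *)
Lemma sum_perm_lift n (F : 'S_n.+1 -> W) :
  \sum_s F s = \sum_(j < n.+1) \sum_(u : 'S_n) F (lift_perm ord0 j u).
Proof.
pose h (x : 'I_n.+1 * 'S_n) := lift_perm ord0 x.1 x.2.
have hi : injective h.
  move=> [j u] [j' u']; rewrite /h /= => e.
  have ej : j = j' by rewrite -(lift_perm_id ord0 j u) e lift_perm_id.
  subst j'; congr pair; apply/permP => i; apply: (@lift_inj _ j).
  by rewrite -!(lift_perm_lift ord0) e.
have hb : bijective h.
  apply: inj_card_bij hi _; rewrite card_prod card_ord !card_Sn.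
  by rewrite factS.
rewrite pair_big /= (reindex h) //; exact: onW_bij.
Qed.

End PermSums.

Section Wedge.
Variables (R : realType) (X : lmodType R).

(** The sign rule is what makes the terms of a sum over permutations equal, and products of forms
    have it by reindexing alone ([wedge_permalt]). *)
Definition permalt k (W : lmodType R) (w : @vform R X k W) :=
  forall v (u : 'S_k), w (fun a => v (u a)) = (-1) ^+ u *: w v.

Variables (W1 : Type) (W2 W3 : vectType R).

Lemma wedge_permalt (W2' : vectType R) (op' : W1 -> W2' -> W3) p q n (e : (p + q)%N = n) (w1 : @vform R X p W1) (w2 : @vform R X q W2') :
  forall v (u : 'S_n), ((p`! * q`!)%N%:R)^-1 *: (\sum_(s : 'S_n) (-1) ^+ s *:
    op' (w1 (fun a => v (u (s (cast_ord e (lshift q a)))))) (w2 (fun b => v (u (s (cast_ord e (rshift p b))))))) =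
  (-1 : R) ^+ u *: (((p`! * q`!)%N%:R)^-1 *: (\sum_(s : 'S_n) (-1) ^+ s *:
    op' (w1 (fun a => v (s (cast_ord e (lshift q a))))) (w2 (fun b => v (s (cast_ord e (rshift p b))))))) .
Proof.
move=> v u; rewrite scalerA mulrC -scalerA; congr (_ *: _).
rewrite [in RHS](reindex_inj (mulIg u)) scaler_sumr; apply: eq_bigr => s _.
rewrite scalerA odd_permM signr_addb mulrCA -signr_addb addbb mulr1; congr (_ *: op' (w1 _) (w2 _)).
  by apply/funext => a; rewrite permM.
by apply/funext => a; rewrite permM.
Qed.

Lemma wedge1 (W1' : vectType R) (op' : W1' -> W2 -> W3) q (w1 : @vform R X 1 W1') (w2 : @vform R X q W2) v :
  (forall x a y, op' x (a *: y) = a *: op' x y) -> permalt w2 ->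
  wedge_form op' (erefl (1 + q)%N) w1 w2 v =
  \sum_(j < q.+1) (-1) ^+ j *: op' (w1 (fun _ => v j)) (w2 (fun b => v (lift j b))).
Proof.
move=> oZ h2; rewrite /wedge_form (@sum_perm_lift _ _ q) scaler_sumr; apply: eq_bigr => j _.
under eq_bigr => u _.
  have -> : w1 (fun a => v (lift_perm ord0 j u (cast_ord (erefl (1 + q)%N) (lshift q a)))) = w1 (fun _ => v j).
    congr w1; apply/funext => a; congr v; rewrite (_ : cast_ord _ _ = ord0) ?lift_perm_id//.
    by apply: val_inj; rewrite /= (ord1 a).
  have -> : w2 (fun b => v (lift_perm ord0 j u (cast_ord (erefl (1 + q)%N) (rshift 1 b)))) =
      (-1) ^+ u *: w2 (fun b => v (lift j b)).
    rewrite -(h2 (fun b => v (lift j b)) u); congr w2; apply/funext => b.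
    rewrite (_ : cast_ord _ _ = lift ord0 b) ?lift_perm_lift//.
    by apply: val_inj; rewrite /= /bump.
  rewrite oZ scalerA odd_lift_perm /= signr_addb -mulrA -signr_addb addbb mulr1 signr_odd.
  over.
rewrite sumr_const card_Sn -[X in _ *: X]scaler_nat scalerA -[1`!]/1%N mul1n mulVf ?scale1r//.
Qed.

(** The sum is over ordered pairs of arguments for the 2-form, whence the remaining factor 1/2. *)
Lemma wedge2 (W1' : vectType R) (op' : W1' -> W2 -> W3) q (w1 : @vform R X 2 W1') (w2 : @vform R X q W2) v :
  (forall x a y, op' x (a *: y) = a *: op' x y) -> permalt w2 ->
  wedge_form op' (erefl (2 + q)%N) w1 w2 v =
  2^-1 *: \sum_(j < q.+2) \sum_(l < q.+1) (-1) ^+ (j + l) *: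
    op' (w1 (pair2 (v j) (v (lift j l)))) (w2 (fun b => v (lift j (lift l b)))).
Proof.
move=> oZ h2; rewrite /wedge_form (@sum_perm_lift _ _ q.+1).
have E : forall j l, \sum_(t : 'S_q) (-1) ^+ (lift_perm ord0 j (lift_perm ord0 l t)) *:
    op' (w1 (fun a => v (lift_perm ord0 j (lift_perm ord0 l t) (cast_ord (erefl (2 + q)%N) (lshift q a)))))
      (w2 (fun b => v (lift_perm ord0 j (lift_perm ord0 l t) (cast_ord (erefl (2 + q)%N) (rshift 2 b))))) =
    q`!%:R *: ((-1) ^+ (j + l) *:
    op' (w1 (pair2 (v j) (v (lift j l)))) (w2 (fun b => v (lift j (lift l b))))).
  move=> j l; under eq_bigr => t _.
    have -> : (fun a => v (lift_perm ord0 j (lift_perm ord0 l t) (cast_ord (erefl (2 + q)%N) (lshift q a)))) =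
        pair2 (v j) (v (lift j l)).
      apply/funext => a; rewrite /pair2; case: ifP => [/eqP->|a0].
        by rewrite (_ : cast_ord _ _ = ord0) ?lift_perm_id//; apply: val_inj.
      rewrite (_ : cast_ord _ _ = lift ord0 ord0) ?lift_perm_lift ?lift_perm_id//.
      by apply: val_inj => /=; case: a a0 => [[|[|]]].
    have -> : w2 (fun b => v (lift_perm ord0 j (lift_perm ord0 l t) (cast_ord (erefl (2 + q)%N) (rshift 2 b)))) =
        (-1) ^+ t *: w2 (fun b => v (lift j (lift l b))).
      rewrite -(h2 (fun b => v (lift j (lift l b))) t); congr w2; apply/funext => b.
      rewrite (_ : cast_ord _ _ = lift ord0 (lift ord0 b)) ?lift_perm_lift//.
      by apply: val_inj; rewrite /= /bump.
    rewrite oZ scalerA !odd_lift_perm /= addbA signr_addb -mulrA -signr_addb addbb mulr1 signr_addb !signr_odd -exprD.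
    over.
  by rewrite sumr_const card_Sn -scaler_nat.
under eq_bigr => j _ do rewrite (@sum_perm_lift _ _ q).
under eq_bigr => j _ do under eq_bigr => l _ do rewrite E.
under eq_bigr => j _ do rewrite -scaler_sumr.
rewrite -scaler_sumr scalerA; congr (_ *: _).
by rewrite natrM invfM -mulrA mulVf ?mulr1// pnatr_eq0 -lt0n fact_gt0.
Qed.

End Wedge.

Section Coordinates.
Variables (R : realType) (n : nat) (M : manifold R n) (K : nat).
Local Notation X := (R^o * R^o)%type.
Variable f : X -> M.

Definition coord2 (i : nat) (y : 'rV[R]_K.+1) : X := (y 0 (inord i), y 0 ord_max).

Lemma vderive_coord2 (W : vectType R) (F : X -> W) i (x v : 'rV[R]_K.+1) :
  vderive (fun y => F (coord2 i y)) x v = vderive F (coord2 i x) (coord2 i v).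
Proof.
rewrite /vderive; f_equal; apply/funext => j; rewrite /derive; f_equal; f_equal.
apply/funext => h /=; congr (_ *: (crd j (F _) - _)).
by rewrite /coord2 !mxE.
Qed.

Lemma vderive_dir0 (W : vectType R) (F : X -> W) x : vderive F x 0 = 0.
Proof.
apply: is_vderive_vderive; apply/is_vderiveP.
generalize (vcvg_cst (0 : R)^' (0 : W)); apply: vcvg_near; apply: filterE => h.
by rewrite scaler0 add0r subrr scaler0.
Qed.

Lemma pullback_coord2 (W : Type) k (w : dform M k W) i (x : 'rV[R]_K.+1) (v : 'I_k -> 'rV[R]_K.+1) :
  pullback (fun y => f (coord2 i y)) w x v = pullback f w (coord2 i x) (fun a => coord2 i (v a)).
Proof.
rewrite /pullback; congr (w _ _ _); apply/funext => a.
exact: (vderive_coord2 (chart_of (chart_at (f (coord2 i x))) \o f)).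
Qed.

Definition dvec (j : nat) : 'rV[R]_K.+1 := delta_mx 0 (inord j).

Lemma coord2_dvec i j : (i < K)%N -> (j <= K)%N -> coord2 i (dvec j) = ((j == i)%:R, (j == K)%:R) :> X.
Proof.
move=> iK jK; rewrite /coord2 /dvec !mxE /=; congr pair.
  by congr (_%:R); rewrite eq_sym; congr (nat_of_bool _); apply/eqP/eqP => [/(congr1 val)|->//]; rewrite /= !inordK// ltnS ltnW.
congr (_%:R); congr (nat_of_bool _); apply/eqP/eqP => [/(congr1 val)|->]; first by rewrite /= inordK.
by apply: val_inj; rewrite /= inordK.
Qed.

End Coordinates.

Lemma alt2_pairs (R : realType) (n : nat) (W : vectType R) (w : vform 'rV[R]_n 2 W)
    (D : R^o * R^o -> 'rV[R]_n) (a b a' b' : bool) : alternating w -> D 0 = 0 -> ~~ (a && b) -> ~~ (a' && b') ->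
  w (fun k => D (pair2 ((a%:R, b%:R) : R^o * R^o) (a'%:R, b'%:R) k)) =
  if a && b' then w (fun k => D (pair2 (1, 0) (0, 1) k)) else
  if b && a' then - w (fun k => D (pair2 (1, 0) (0, 1) k)) else 0.
Proof.
move=> aw D0; have [bl br] := form2_bil aw; have [_ alt] := aw.
have pE (u v : R^o * R^o) : (fun k => D (pair2 u v k)) = pair2 (D u) (D v).
  by apply/funext => k; rewrite /pair2; case: ifP.
rewrite !pE.
have w0l v : w (pair2 0 v) = 0.
  by have h := bl v 1 0 0; rewrite /= !scale1r addr0 in h; apply: (addrI (w (pair2 0 v))); rewrite -h addr0.
have w0r v : w (pair2 v 0) = 0.
  by have h := br v 1 0 0; rewrite /= !scale1r addr0 in h; apply: (addrI (w (pair2 v 0))); rewrite -h addr0.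
have wd v : w (pair2 v v) = 0 by apply: (alt _ ord0 ord_max).
have wn u v : w (pair2 u v) = - w (pair2 v u).
  have a1 := bl (1 *: u + v) 1 u v; have a2 := br u 1 u v; have a3 := br v 1 u v.
  move: a1; rewrite wd a2 a3 !wd !scale1r add0r addr0 => /esym/eqP.
  by rewrite addr_eq0 => /eqP.
have z00 : ((0%:R, 0%:R) : R^o * R^o) = 0 by [].
case: a; case: b => //= _; case: a'; case: b' => //= _; rewrite ?z00 ?D0 ?wd ?w0l ?w0r//.
Qed.

Section SprodsBasis.
Variables (R : realType) (n : nat) (M : manifold R n) (V : cochain_complex R).
Local Notation X := (R^o * R^o)%type.
Variables (alpha : forall k, dform M k 'End(V)) (f : X -> M) (K : nat) (x : 'rV[R]_K.+1).
Arguments alpha : clear implicits.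
Hypothesis falpha : forall k, is_form (alpha k).
Local Notation e1 := ((1, 0) : X).
Local Notation e2 := ((0, 1) : X).
Local Notation dvec := (@dvec R K).

Definition wfac i k := pullback (fun y : 'rV[R]_K.+1 => f (coord2 i y)) (alpha k) x.
Arguments wfac : clear implicits.
Definition afac i := pullback f (alpha 1%N) (coord2 i x) (fun _ => e1).
Definition cfac i := pullback f (alpha 2%N) (coord2 i x) (pair2 e1 e2).

(** The i-th factor is pulled back along a map that depends on t_i and s only, so the vector of any
    other t_j kills it. *)
Lemma wfac1 i j : (i < K)%N -> (j < K)%N -> wfac i 1%N (fun _ => dvec j) = if j == i then afac i else 0.
Proof.
move=> iK jK; rewrite /wfac pullback_coord2 coord2_dvec// 1?ltnW// (ltn_eqF jK).
have [|_] := eqVneq j i; first by [].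
rewrite /pullback vderive_dir0; set c := chart_at _.
have ci : chart_img c (chart_of c (f (coord2 i x))) by exists (f (coord2 i x)) => //; exact: chart_atP.
by rewrite -(formhomE (falpha 1%N) _ ci) linear0.
Qed.

Lemma wfac2 i j l : (i < K)%N -> (j <= K)%N -> (l <= K)%N ->
  wfac i 2%N (pair2 (dvec j) (dvec l)) =
  if (j == i) && (l == K) then cfac i else if (j == K) && (l == i) then - cfac i else 0.
Proof.
move=> iK jK lK; rewrite /wfac pullback_coord2.
have -> : (fun a => coord2 i (pair2 (dvec j) (dvec l) a)) =
    pair2 (((j == i)%:R, (j == K)%:R) : X) (((l == i)%:R, (l == K)%:R) : X).
  by apply/funext => a; rewrite /pair2; case: ifP => _; rewrite coord2_dvec.
rewrite /cfac /pullback; pose c := chart_at (f (coord2 i x)).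
have ci : chart_img c (chart_of c (f (coord2 i x))) by exists (f (coord2 i x)) => //; exact: chart_atP.
have [al _ _] := falpha 2%N.
have h1 : ~~ ((j == i) && (j == K)) by apply/negP => /andP[/eqP-> /eqP h]; move: iK; rewrite h ltnn.
have h2 : ~~ ((l == i) && (l == K)) by apply/negP => /andP[/eqP-> /eqP h]; move: iK; rewrite h ltnn.
exact: (alt2_pairs (al c _ ci) (vderive_dir0 (chart_of c \o f) (coord2 i x)) h1 h2).
Qed.

Lemma sprods_permalt i ms : permalt (sprods wfac i ms).
Proof.
case: ms => [|m ms] v u /=.
  by rewrite (_ : u = 1%g) ?odd_perm1 ?expr0 ?scale1r//; apply/permP => -[].
have h := wedge_permalt (fun f g : 'End(V) => (f \o g)%VF) (erefl (m + sumn ms)%N) (wfac i m) (sprods wfac i.+1 ms) v u.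
rewrite /sprod /wedge_form; rewrite h !scalerA; congr (_ *: _).
by rewrite -!mulrA mulrCA.
Qed.

Fixpoint aprod i p := if p is p'.+1 then (afac i \o aprod i.+1 p')%VF else \1%VF.
Fixpoint cprod i m p := if m is m'.+1 then (afac i \o cprod i.+1 m' p)%VF else (cfac i \o aprod i.+1 p)%VF.

(** The factor of degree 2 depends on its own t_i and on s, so one of its arguments must be the
    vector of s. Without that vector the product vanishes. *)
Lemma sprods_nolast m p i (v : 'I_(sumn (nseq m 1%N ++ 2%N :: nseq p 1%N)) -> 'rV[R]_K.+1) (g : 'I_(sumn (nseq m 1%N ++ 2%N :: nseq p 1%N)) -> nat) : (i + m < K)%N ->
  (forall b, v b = dvec (g b)) -> (forall b, (g b < K)%N) ->
  sprods wfac i (nseq m 1%N ++ 2%N :: nseq p 1%N) v = 0.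
Proof.
elim: m i v g => [|m IH] i v g iK hv hg /=; rewrite /sprod /wedge_form big1 ?scaler0// => s _.
  rewrite (_ : (fun a => _) = pair2 (dvec (g (s (cast_ord erefl (lshift (sumn (nseq p 1%N)) ord0)))))
     (dvec (g (s (cast_ord erefl (lshift (sumn (nseq p 1%N)) ord_max)))))); last first.
    apply/funext => a; rewrite /pair2 hv; case: ifP => [/eqP->//|a0]; congr (dvec (g (s _))).
    by apply: val_inj => /=; case: a a0 => [[|[|]]].
  rewrite wfac2 ?(ltnW (hg _))//; last by rewrite addn0 in iK.
  by rewrite !(ltn_eqF (hg _)) andbF comp_lfun0l scaler0.
rewrite (IH i.+1 _ (fun b => g (s (cast_ord erefl (rshift 1 b))))) ?comp_lfun0r ?scaler0//.
by rewrite addSnnS.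
Qed.

Let opZ (u : 'End(V)) a (w : 'End(V)) : (u \o (a *: w))%VF = a *: (u \o w)%VF.
Proof. by rewrite comp_lfunZr. Qed.

Lemma sprods_ones p i (v : 'I_(sumn (nseq p 1%N)) -> 'rV[R]_K.+1) : (i + p <= K)%N -> (forall b, v b = dvec (i + b)) ->
  sprods wfac i (nseq p 1%N) v = aprod i p.
Proof.
elim: p i v => [//|p IH] i v iK hv /=.
have iK' : (i < K)%N by rewrite (leq_trans _ iK)// -addSnnS leq_addr.
have sz : sumn (nseq p 1%N) = p by rewrite sumn_nseq mul1n.
rewrite /sprod subrr mul0r expr0z scale1r wedge1//; last exact: sprods_permalt.
rewrite (bigD1 ord0)//= big1 ?addr0 => [|j j0].
  rewrite expr0 scale1r hv addn0 wfac1// eqxx IH//; first by rewrite addSnnS.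
  by move=> b; rewrite hv /= /bump /= addnCA add1n.
have jp : (j < p.+1)%N by rewrite -{2}sz.
rewrite hv wfac1//; last by rewrite (leq_trans _ iK)// ltn_add2l.
by rewrite -{2}[i]addn0 eqn_add2l -[_ == 0%N]/(j == ord0) (negbTE j0) comp_lfun0l scaler0.
Qed.

(** Each 1-form must take the vector of its own variable, and the 2-form that of its variable and
    that of s. Moving s past the [p] later variables costs (-1)^p, which the Koszul sign of alpha^2,
    of endomorphism degree -1, against [p] forms of degree 1 cancels. The two orders of the pair
    cancel the 1/2 of [wedge2]. *)
Lemma sprods_mix m p i (v : 'I_(sumn (nseq m 1%N ++ 2%N :: nseq p 1%N)) -> 'rV[R]_K.+1) : (i + m + p).+1 = K ->
  (forall b, v b = dvec (i + b)) ->
  sprods wfac i (nseq m 1%N ++ 2%N :: nseq p 1%N) v = cprod i m p.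
Proof.
elim: m i v => [|m IH] i v iK hv /=.
  have sz : sumn (nseq p 1%N) = p by rewrite sumn_nseq mul1n.
  have iK' : (i < K)%N by rewrite -iK addn0 ltnS leq_addr.
  rewrite /sprod wedge2//; last exact: sprods_permalt.
  change ('I_(sumn (nseq p 1%N)).+2 -> 'rV[R]_K.+1) in v.
  change (forall b : 'I_(sumn (nseq p 1%N)).+2, v b = dvec (i + b)) in hv.
  set q := sumn (nseq p 1%N) in v hv *.
  have main (j : 'I_q.+2) (l : 'I_q.+1) : (-1) ^+ (j + l) *:
      (wfac i 2%N (pair2 (v j) (v (lift j l))) \o sprods wfac i.+1 (nseq p 1%N) (fun b => v (lift j (lift l b))))%VF =
      if ((j == ord0) && (l == ord_max)) || ((j == ord_max) && (l == ord0)) then (-1) ^+ q *: (cfac i \o aprod i.+1 p)%VF else 0.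
    have jb : (j <= q.+1)%N by rewrite -ltnS.
    have lb : (lift j l <= q.+1)%N by rewrite -ltnS.
    have Kq : K = (i + q.+1)%N by rewrite -iK addn0 addnS /q sz.
    rewrite !hv wfac2//; [|by rewrite Kq leq_add2l|by rewrite Kq leq_add2l].
    have eK b : ((i + b)%N == K) = (b == q.+1) by rewrite Kq eqn_add2l.
    have ei b : ((i + b)%N == i) = (b == 0%N) by rewrite -{2}[i]addn0 eqn_add2l.
    rewrite !eK !ei.
    have [j0|j0] := eqVneq j ord0.
      rewrite j0 eqxx /= orbF /bump /= add1n eqSS.
      have -> : (l == ord_max) = (nat_of_ord l == q) by [].
      have [lq|lq] := eqVneq (nat_of_ord l) q; last by rewrite comp_lfun0l scaler0.
      rewrite lq add0n sprods_ones//; first by rewrite addSn -iK addn0.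
      move=> b; rewrite hv /= /bump /= (_ : (l <= b)%N = false) ?add0n ?add1n ?addnS ?addSn//.
      by rewrite lq; apply/negbTE; rewrite -ltnNge.
    rewrite -[nat_of_ord j == 0%N]/(j == ord0) (negbTE j0) /=.
    have -> : (j == ord_max) = (nat_of_ord j == q.+1) by [].
    have [jq|jq] := eqVneq (nat_of_ord j) q.+1; last by rewrite comp_lfun0l scaler0.
    rewrite /= /bump jq (_ : (q < l)%N = false) ?add0n; last by apply/negbTE; rewrite -leqNgt -ltnS.
    rewrite -[nat_of_ord l == 0%N]/(l == ord0); have [l0|l0] := eqVneq l ord0; last by rewrite comp_lfun0l scaler0.
    rewrite l0 addn0 exprS mulN1r scaleNr comp_lfunNl scalerN opprK; congr (_ *: (_ \o _)%VF).
    apply: sprods_ones; first by rewrite addSn -iK addn0.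
    move=> b; rewrite hv /= /bump jq /= (_ : (q < 1 + b)%N = false) ?add0n ?add1n ?addnS ?addSn//.
    by apply/negbTE; rewrite -leqNgt.
  under eq_bigr => j _ do under eq_bigr => l _ do rewrite main.
  rewrite (bigD1 ord0)//= (bigD1 ord_max)//= big1; last first.
    by move=> l ll; rewrite (negbTE ll).
  rewrite (bigD1 ord_max)//= (bigD1 ord0)//= big1; last first.
    by move=> l ll; rewrite (negbTE ll) andbF.
  rewrite [X in _ + (_ + X)]big1 => [|j /andP[j0 j1]]; last first.
    by rewrite big1// => l _; rewrite (negbTE j0) (negbTE j1).
  have half (w : 'End(V)) : 2^-1 *: (w + w) = w.
    by rewrite -mulr2n -[X in _ *: X]scaler_nat scalerA mulVf ?scale1r ?pnatr_eq0.
  rewrite ?eqxx ?andbT ?orbT /= !addr0 half.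
  have -> : (-1) ^ ((1 - 2%:Z) * q%:Z) = (-1 : R) ^+ q.
    by rewrite (_ : (1 - 2%:Z) * q%:Z = - q%:Z) ?mulN1r// -invr_expz invr_sign.
  have s2 : (-1 : R) ^+ q * (-1) ^+ q = 1 by rewrite -expr2 sqrr_sign.
  by rewrite scalerA s2 scale1r.
have sz : sumn (nseq m 1%N ++ 2%N :: nseq p 1%N) = (m + p).+2.
  by rewrite sumn_cat /= !sumn_nseq !mul1n addnCA.
have iK' : (i < K)%N by rewrite -iK -addnA addSn !addnS ltnS ltnW// ltnS leq_addr.
rewrite /sprod subrr mul0r expr0z scale1r wedge1//; last exact: sprods_permalt.
change ('I_(sumn (nseq m 1%N ++ 2%N :: nseq p 1%N)).+1 -> 'rV[R]_K.+1) in v.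
change (forall b : 'I_(sumn (nseq m 1%N ++ 2%N :: nseq p 1%N)).+1, v b = dvec (i + b)) in hv.
set q := sumn (nseq m 1%N ++ 2%N :: nseq p 1%N) in v hv sz *.
rewrite (bigD1 ord0)//= big1 ?addr0 => [|j j0].
  rewrite expr0 scale1r hv addn0 wfac1// eqxx IH//; first by rewrite addSnnS.
  by move=> b; rewrite hv /= /bump /= addnCA add1n.
have [jq|jq] := eqVneq (nat_of_ord j) q.
  rewrite (sprods_nolast (g := fun b => (i + lift j b)%N)) ?comp_lfun0r ?scaler0//.
    by rewrite -iK addSn ltnS -addnS leq_addr.
  move=> b; have -> : nat_of_ord (lift j b) = b by rewrite /= /bump jq leqNgt ltn_ord.
  rewrite -iK.
  by rewrite (leq_trans (_ : (i + b < i + q)%N))// ?ltn_add2l// sz !addnS !addSn addnA.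
have jb : (j < q)%N by rewrite ltn_neqAle jq -ltnS ltn_ord.
rewrite hv wfac1//; last by rewrite -iK (leq_trans (_ : (i + j < i + q)%N))// ?ltn_add2l// sz !addnS !addSn addnA.
by rewrite -{2}[i]addn0 eqn_add2l -[_ == 0%N]/(j == ord0) (negbTE j0) comp_lfun0l scaler0.
Qed.

End SprodsBasis.

(** * The double series as a double integral *)

Section TwoVariables.
Variable R : realType.
Implicit Types W : vectType R.

(** Genericity in the iterated sense, suited to iterated integrals: no measurability in the plane is
    involved, at the price of asking for both orders of the variables in [thin2]. *)
Definition thin (P : R -> R -> Prop) := exists S : seq R, forall t, 0 < t < 1 -> t \notin S ->
  exists S' : seq R, forall s, 0 < s < 1 -> s \notin S' -> P t s.

Definition thin2 (P : R -> R -> Prop) := thin P /\ thin (fun s t => P t s).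

Lemma thinI P Q : thin P -> thin Q -> thin (fun t s => P t s /\ Q t s).
Proof.
move=> [S1 h1] [S2 h2]; exists (S1 ++ S2) => t t01; rewrite mem_cat negb_or => /andP[/(h1 t t01)[S1' h1'] /(h2 t t01)[S2' h2']].
exists (S1' ++ S2') => s s01; rewrite mem_cat negb_or => /andP[s1 s2].
by split; [exact: h1'|exact: h2'].
Qed.

Lemma thinS (P Q : R -> R -> Prop) : (forall t s, 0 < t < 1 -> 0 < s < 1 -> P t s -> Q t s) -> thin P -> thin Q.
Proof.
move=> PQ [S h]; exists S => t t01 /(h t t01)[S' h']; exists S' => s s01 sS.
by apply: PQ => //; exact: h'.
Qed.

Lemma thin2I P Q : thin2 P -> thin2 Q -> thin2 (fun t s => P t s /\ Q t s).
Proof. by move=> [p p'] [q q']; split; exact: thinI. Qed.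

Lemma thin2S (P Q : R -> R -> Prop) : (forall t s, 0 < t < 1 -> 0 < s < 1 -> P t s -> Q t s) -> thin2 P -> thin2 Q.
Proof.
move=> PQ [p p']; split; first exact: thinS p.
by apply: thinS p' => t s t01 s01; exact: PQ.
Qed.

(** Separate continuity suffices, since all double integrals are treated as iterated ones. *)
Definition sep W M (f : R -> R -> W) :=
  thin2 (fun t s => [/\ vn (f t s) <= M, vcts (f^~ s) t & vcts (f t) s]).

Lemma sep_vpcb W M (f : R -> R -> W) : sep M f -> exists S : seq R, forall s, 0 < s < 1 -> s \notin S ->
  vpcb M 0 1 (f^~ s).
Proof.
move=> [_ [S h]]; exists S => s s01 sS; have [S' h'] := h s s01 sS; exists S' => t t01 tS.
by have [] := h' t t01 tS.
Qed.

Lemma sep_swap W M (f : R -> R -> W) : sep M f -> sep M (fun s t => f t s).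
Proof.
move=> [p p']; split; first by apply: thinS p' => t s _ _ [].
by apply: thinS p => t s _ _ [].
Qed.

Lemma sep_bil (W1 W2 W3 : vectType R) (op : W1 -> W2 -> W3) : bil op -> exists2 K, 0 <= K &
  forall M N f g, 0 <= M -> sep M f -> sep N g -> sep (K * M * N) (fun t s => op (f t s) (g t s)).
Proof.
move=> bo; have [K K0 hK] := vn_bil bo; exists K => // M N f g M0 hf hg.
apply: thin2S (thin2I hf hg) => t s _ _ [[b1 c1 d1] [b2 c2 d2]]; split.
- by apply: le_trans (hK _ _) _; apply: ler_pM; rewrite ?mulr_ge0 ?vn_ge0// ler_wpM2l.
- exact: (vcvg_bil bo c1 c2).
- exact: (vcvg_bil bo d1 d2).
Qed.

Lemma sep_1s W M (f : R -> W) : vpcb M 0 1 f -> sep M (fun _ s => f s).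
Proof.
move=> [S h]; split.
  exists [::] => t _ _; exists S => s s01 sS; have [b c] := h s s01 sS.
  by split=> //; exact: vcvg_cst.
exists S => s s01 sS; exists [::] => t _ _; have [b c] := h s s01 sS.
by split=> //; exact: vcvg_cst.
Qed.

Lemma sep_1t W M (f : R -> W) : vpcb M 0 1 f -> sep M (fun t _ => f t).
Proof. by move=> h; have := sep_swap (sep_1s h). Qed.

Lemma dominated_nbhs W (F : R -> R -> W) f M a b (s0 : R) : a <= b ->
  (\forall s \near s0, vpcb M a b (F s)) -> vpc a b f ->
  (exists S : seq R, forall t, a < t < b -> t \notin S -> vcvg (nbhs s0) (F^~ t) (f t)) ->
  vcvg (nbhs s0) (fun s => vintegral a b (F s)) (vintegral a b f).
Proof.
move=> ab pF pf [S hS].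
have d : vcvg (within setT (nbhs (s0 : R^o))) (fun s => vintegral a b (F s)) (vintegral a b f).
  apply: (@dominated_vint R W R^o setT s0 a b F f M ab) => //.
    by rewrite near_withinE; apply: filterS pF.
  exists S => t tab tS; apply: vcvg_trans (hS t tab tS); exact: cvg_within.
apply: vcvg_trans d => B; rewrite /within /= => hB.
by apply: filterS hB => s h; exact: h.
Qed.

Lemma near_off (S : seq R) (t : R) : 0 < t < 1 -> t \notin S -> \forall u \near t, 0 < u < 1 /\ u \notin S.
Proof.
move=> t01 tS; have n1 : \forall u \near t, 0 < u < 1 by apply: near_itvoo.
by have n2 := near_notin tS; exact: (filterI n1 n2).
Qed.

Lemma sep_vint_vcts W M (f : R -> R -> W) : sep M f -> exists S : seq R, forall s, 0 < s < 1 -> s \notin S ->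
  forall x y, 0 <= x -> x <= y -> y <= 1 -> vcts (fun s => vintegral x y (f^~ s)) s /\ vn (vintegral x y (f^~ s)) <= M * (y - x).
Proof.
move=> h; have [S hS] := sep_vpcb h; have [_ [S2 h2]] := h.
exists (S ++ S2) => s s01; rewrite mem_cat negb_or => /andP[sS sS2] x y x0 xy y1; split.
  apply: (@dominated_nbhs W (fun s t => f t s) (f^~ s) M x y s xy).
  - apply: filterS (near_off s01 sS) => u [u01 uS]; apply: vpcb_sub; [exact: x0|exact: y1|exact: hS].
  - by exists M; apply: vpcb_sub; [exact: x0|exact: y1|exact: hS].
  have [S' h'] := h2 s s01 sS2; exists S' => t /andP[tx ty] tS.
  by have [] := h' t (introT andP (conj (le_lt_trans x0 tx) (lt_le_trans ty y1))) tS.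
by apply: vint_bound => //; apply: vpcb_sub; [exact: x0|exact: y1|exact: hS].
Qed.

Lemma sep_prim W M (f : R -> R -> W) : 0 <= M -> sep M f -> sep M (fun t s => vintegral 0 t (f^~ s)).
Proof.
move=> M0 h; have [S hS] := sep_vint_vcts h; have [S2 hS2] := sep_vpcb h.
have main s t : 0 < s < 1 -> s \notin S ++ S2 -> 0 < t < 1 ->
    [/\ vn (vintegral 0 t (f^~ s)) <= M, vcts (fun t => vintegral 0 t (f^~ s)) t & vcts (fun s => vintegral 0 t (f^~ s)) s].
  move=> s01; rewrite mem_cat negb_or => /andP[sS sS2] t01; have /andP[t0 t1] := t01.
  have [c b] := hS s s01 sS 0 t (lexx 0) (ltW t0) (ltW t1); split=> //.
    by apply: le_trans b _; rewrite subr0 -[leRHS]mulr1 ler_wpM2l// ltW.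
  by apply: (@vprim_cts _ _ 0 1) => //; apply: vprim_int; exists M; exact: hS2.
split.
  by exists [::] => t t01 _; exists (S ++ S2) => s s01 sS; exact: main.
by exists (S ++ S2) => s s01 sS; exists [::] => t t01 _; exact: main.
Qed.

Lemma vint_derive W a b (f : R -> W) t : a < t < b -> vpc a b f -> vcts f t ->
  is_vderive (fun x : R^o => vintegral a x f) t 1 (f t).
Proof.
move=> tab pf cf j; have h := ig_derive tab (pc_crd j pf) (cf j).
have -> : (fun y : R^o => crd j (vintegral a y f)) = (fun x => ig a x (fun t => crd j (f t)) : R^o).
  by apply/funext => x; rewrite crd_vint.
exact: h.
Qed.

(** As functions of [b] both sides vanish at 0 and have derivative the integral of [f t] over s. The
    right side is differentiated under the integral sign by dominated convergence, so no measure on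
    the plane intervenes. *)
Lemma sep_fubini W M (f : R -> R -> W) b : 0 <= M -> sep M f -> 0 <= b <= 1 ->
  vintegral 0 b (fun t => vintegral 0 1 (f t)) = vintegral 0 1 (fun s => vintegral 0 b (f^~ s)).
Proof.
move=> M0 h b01; have h' := sep_swap h.
have [S hS] := sep_vpcb h; have [S1 hS1] := sep_vint_vcts h.
have [T hT] := sep_vpcb h'; have [T1 hT1] := sep_vint_vcts h'.
have pin : vpc 0 1 (fun t => vintegral 0 1 (f t)).
  exists M, T1 => t t01 tT; have [c bd] := hT1 t t01 tT 0 1 (lexx 0) ler01 (lexx 1).
  by split=> //; rewrite subr0 mulr1 in bd.
have pout x y : 0 <= x -> x <= y -> y <= 1 -> vpcb (M * (y - x)) 0 1 (fun s => vintegral x y (f^~ s)).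
  by move=> x0 xy y1; exists S1 => s s01 sS; have [] := hS1 s s01 sS x y x0 xy y1.
pose g b := vintegral 0 1 (fun s => vintegral 0 b (f^~ s)).
have gB x y : 0 <= x -> x <= y -> y <= 1 -> g y - g x = vintegral 0 1 (fun s => vintegral x y (f^~ s)).
  move=> x0 xy y1; rewrite /g -vintB//.
  - apply: (eq_vint_off (S := S)) => //.
      by apply: vpcB; [exists (M * (y - 0)); apply: pout => //; exact: le_trans xy|exists (M * (x - 0)); apply: pout => //; exact: le_trans xy y1].
    move=> s s01 sS; rewrite (vint_chasles (c := x)) ?x0//; first by rewrite addrC addKr.
    by apply: (vpc_sub (lexx 0) y1); exists M; exact: hS.
  - by exists (M * (y - 0)); apply: pout => //; exact: le_trans xy.
  - by exists (M * (x - 0)); apply: pout => //; exact: le_trans xy y1.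
have glip x y : 0 <= x -> x <= y -> y <= 1 -> vn (g y - g x) <= M * (y - x).
  move=> x0 xy y1; rewrite gB//; apply: le_trans (vint_bound ler01 (pout x y x0 xy y1)) _.
  by rewrite subr0 mulr1.
have pg : vprim 0 1 g (fun t => vintegral 0 1 (f t)).
  apply/vprimP => //; split; [exact: pin| |].
    move=> j; apply/subspace_continuousP => t /=; rewrite in_itv/= => /andP[t0 t1].
    have c : vcvg (within [set` `[0, 1]] (nbhs (t : R^o))) g (g t).
      have ce : M * `|u - t| @[u --> within [set` `[0, 1]] (nbhs (t : R^o))] --> (0 : R).
        rewrite -[X in _ --> X](mulr0 M); apply: cvgM; first exact: cvg_cst.
        rewrite -[X in _ --> X](@normr0 _ R^o); apply: cvg_norm.
        rewrite -[X in _ --> X](subrr t); apply: cvgB; last exact: cvg_cst.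
        exact: cvg_within.
      apply: (vcvg_squeeze _ ce); rewrite near_withinE; apply: filterE => u /=; rewrite in_itv/= => /andP[u0 u1].
      have [tu|/ltW ut] := leP t u; first by rewrite ger0_norm ?subr_ge0//; exact: glip.
      by rewrite -vnN opprB distrC ger0_norm ?subr_ge0//; exact: glip.
    exact: c.
  have [[T2 hT2] _] := h.
  exists T2 => t t01 tT2; have [S' hS'] := hT2 t t01 tT2; have /andP[t0 t1] := t01.
  apply/is_vderiveP.
  pose D (e : R^o) (s : R) := e^-1 *: (vintegral 0 (e + t) (f^~ s) - vintegral 0 t (f^~ s)).
  have ne : \forall e \near (0 : R)^', 0 < e + t < 1.
    apply: nbhs_dnbhs; have nt : \forall u \near t, 0 < u < 1 by apply: near_itvoo.
    have he : e + t @[e --> (0 : R)] --> t.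
      by rewrite -[X in _ --> X]add0r; apply: cvgD; [exact: cvg_id|exact: cvg_cst].
    exact: (he _ nt).
  have n0 : \forall e \near (0 : R)^', e != 0 by exact: nbhs_dnbhs_neq.
  have pO u : 0 < u < 1 -> vpc 0 1 (fun s => vintegral 0 u (f^~ s)).
    by move=> /andP[u0 u1]; exists (M * (u - 0)); apply: pout => //; exact: ltW.
  have vD : vcvg 0^' (fun e : R => vintegral 0 1 (D e)) (vintegral 0 1 (f t)).
    apply: (@dominated_vint R W R^o _ 0 0 1 D (f t) M ler01).
    - apply: filterS2 ne n0 => e et e0; have /andP[et0 et1] := et.
      have pD : vpc 0 1 (D e) by apply: vpcZ; apply: vpcB; exact: pO.
      apply: (vpcb_of_vpc (S := S) pD) => s s01 sS; have hv := hS s s01 sS.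
      rewrite /D vnZ normrV ?unitfE// mulrC ler_pdivrMr ?normr_gt0//.
      have pf : vpc 0 1 (f^~ s) by exists M.
      have [S3 hS3] := hv.
      have := vprim_lip (S := S3) (L := M) ler01 (vprim_int pf) _ (introT andP (conj (ltW t0) (ltW t1))) (introT andP (conj (ltW et0) (ltW et1))).
      by rewrite addrK; apply=> u u01 uS; have [] := hS3 u u01 uS.
    - exists M, S' => s s01 sS; have [bd _ c] := hS' s s01 sS; by split.
    exists (S ++ S') => s s01; rewrite mem_cat negb_or => /andP[sS sS'].
    have pf : vpc 0 1 (f^~ s) by exists M; exact: hS.
    have [_ c _] := hS' s s01 sS'.
    generalize (iffLR (is_vderiveP _ _ _ _) (vint_derive t01 pf c)); apply: vcvg_near; apply: filterE => e.
    by rewrite /D [e *: 1]mulr1.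
  apply: vcvg_near vD; apply: filterS ne => e et; rewrite [e *: 1]mulr1 /g /D vintZ//; last first.
    by apply: vpcB; exact: pO.
  by rewrite vintB//; exact: pO.
have [_ e] := pg; rewrite -[RHS]/(g b) (e b b01) /g.
rewrite (_ : vintegral 0 1 _ = 0) ?add0r//.
by rewrite -[RHS](vint0 W 0 1); apply: eq_vint => s _; rewrite vint_point.
Qed.

End TwoVariables.

Section Words.
Variables (R : realType) (U : vectType R).
Local Notation E := 'End(U).
Implicit Types (f : R -> R -> E) (ws : seq (R -> R -> E)).

Fixpoint wprod ws (ts : seq R) (s : R) : E :=
  if ws is f :: ws' then
    if ts is t :: ts' then (f t s \o wprod ws' ts' s)%VF else 0
  else \1%VF.

Fixpoint wint ws (s b : R) : E :=
  if ws is f :: ws' then vintegral 0 b (fun t => (f t s \o wint ws' s t)%VF) else \1%VF.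

Fixpoint allsep ws : Prop := if ws is f :: ws' then (exists2 M, 0 <= M & sep M f) /\ allsep ws' else True.

Lemma vpcb_weaken (W : vectType R) M N a b (f : R -> W) : M <= N -> vpcb M a b f -> vpcb N a b f.
Proof. by move=> MN [S h]; exists S => t tab tS; have [bd c] := h t tab tS; split=> //; exact: le_trans bd MN. Qed.

Lemma sep_comp M N (f g : R -> R -> E) : 0 <= M -> 0 <= N -> sep M f -> sep N g ->
  exists2 B, 0 <= B & sep B (fun t s => (f t s \o g t s)%VF).
Proof.
move=> M0 N0 hf hg; have [K K0 hK] := sep_bil (bil_comp U).
by exists (K * M * N); [rewrite !mulr_ge0|exact: hK].
Qed.

Lemma wint_sep ws : allsep ws -> exists2 B, 0 <= B & sep B (fun t s => wint ws s t).
Proof.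
elim: ws => [|f ws IH] /=.
  move=> _; exists (vn (\1%VF : E)); first exact: vn_ge0.
  by apply: sep_1t; exists [::] => t _ _; split=> //; exact: vcvg_cst.
move=> [[M M0 hf] /IH[N N0 hw]]; have [B B0 hB] := sep_comp M0 N0 hf hw.
by exists B => //; exact: (sep_prim B0 hB).
Qed.

Lemma eq_simplex (W : vectType R) k b (F G : seq R -> W) : (forall ts, size ts = k -> F ts = G ts) ->
  simplex_integral k b F = simplex_integral k b G.
Proof.
elim: k b F G => [|k IH] b F G h /=; first exact: h.
by congr vintegral; apply/funext => t; apply: IH => ts sts; apply: h; rewrite /= sts.
Qed.

Lemma sep_inner_vpc (W : vectType R) M (f : R -> R -> W) : sep M f -> vpc 0 1 (fun t => vintegral 0 1 (f t)).
Proof.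
move=> h; have [T hT] := sep_vint_vcts (sep_swap h); exists (M * (1 - 0)), T => t t01 tT.
by have [c bd] := hT t t01 tT 0 1 (lexx 0) ler01 (lexx 1).
Qed.

(** [L] carries the factors already peeled off, with their times frozen; this generality is what the
    induction on the word needs. Fubini then moves the integral over s outward past one time at a
    time. *)
Lemma simplex_exchange ws (L : R -> E) b : allsep ws -> vpc 0 1 L -> 0 <= b <= 1 ->
  simplex_integral (size ws) b (fun ts => vintegral 0 1 (fun s => (L s \o wprod ws ts s)%VF)) =
  vintegral 0 1 (fun s => (L s \o wint ws s b)%VF).
Proof.
elim: ws L b => [//|f ws IH] L b /= [[M M0 hf] hws] pL b01; have /andP[b0 b1] := b01.
have [N N0 hw] := wint_sep hws; have [B B0 hB] := sep_comp M0 N0 hf hw.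
have [ML hL] := pL; have ML0 : 0 <= Num.max ML 0 by rewrite le_max lexx orbT.
have hL' : sep (Num.max ML 0) (fun (_ s : R) => L s).
  by apply: sep_1s; apply: vpcb_weaken hL; rewrite le_max lexx.
have [D D0 hD] := sep_comp ML0 B0 hL' hB.
have [T hT] := sep_vpcb (sep_swap hf).
transitivity (vintegral 0 b (fun t => vintegral 0 1 (fun s => (L s \o (f t s \o wint ws s t))%VF))).
  symmetry; apply: (eq_vint_off (S := T)) => //.
    exact: (vpc_sub (lexx 0) b1 (sep_inner_vpc hD)).
  move=> t /andP[t0 tb] tT; have t01 : 0 < t < 1 by rewrite t0 (lt_le_trans tb b1).
  have pLf : vpc 0 1 (fun s => (L s \o f t s)%VF).
    by apply: (vpc_bil (bil_comp U)) => //; exists M; exact: hT.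
  under [RHS]eq_simplex => ts _ do under eq_fun do rewrite comp_lfunA.
  rewrite IH//; last by rewrite !ltW//; case/andP: t01.
  by congr vintegral; apply/funext => s; rewrite comp_lfunA.
rewrite (sep_fubini D0 hD b01); have [S hS] := sep_vpcb hB.
have [S1 hS1] := sep_vint_vcts hD.
apply: (eq_vint_off (S := S)) => //.
  exists (D * (b - 0)), S1 => s s01 sS; by have [] := hS1 s s01 sS 0 b (lexx 0) b0 b1.
move=> s s01 sS; have [_ oplin] := bil_comp U.
pose lf := HB.pack_for {linear E -> E} (fun w : E => (L s \o w)%VF)
   (GRing.isLinear.Build R E E _ (fun w : E => (L s \o w)%VF) (oplin (L s))).
apply: (vint_lin lf) => //; apply: (vpc_sub (lexx 0) b1); exists B; exact: hS.
Qed.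

End Words.

(** * Resummation of the Picard series *)

Section Series.
Variables (R : realType) (U : vectType R).
Local Notation E := 'End(U).

Lemma comp_lfun_sumr n (x : E) (F : 'I_n -> E) : (x \o (\sum_i F i) = \sum_i (x \o F i))%VF.
Proof.
elim: n F => [|n IH] F; first by rewrite !big_ord0 comp_lfun0r.
by rewrite !big_ord_recl comp_lfunDr IH.
Qed.

Lemma duhamel (a : R -> E) (F q : R -> E) : vpc 0 1 a -> vpc 0 1 q -> vprim 0 1 F (fun t => q t - (a t \o F t)%VF) ->
  forall t, 0 <= t <= 1 -> F t = (evo a t \o (F 0 + vintegral 0 t (fun u => evi a u \o q u)%VF))%VF.
Proof.
move=> pa pq pF t t01; have h := vprim_bil ler01 (bil_comp U) (evi_prim pa) pF.
have pEq : vpc 0 1 (fun u => (evi a u \o q u)%VF) by apply: (vpc_bil (bil_comp U)) => //; exact: (vprim_pc ler01 (evi_prim pa)).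
have h2 : vprim 0 1 (fun t => F 0 + vintegral 0 t (fun u => evi a u \o q u)%VF) (fun u => 0 + (evi a u \o q u)%VF).
  by apply: vprimD; [exact: vprim_cst0|exact: vprim_int].
have -> : F 0 + vintegral 0 t (fun u => (evi a u \o q u)%VF) = (evi a t \o F t)%VF.
  symmetry; apply: (vprim_unique (S := [::]) ler01 _ _ h h2 t01) => [u _ _|].
    by rewrite comp_lfunDr comp_lfunNr comp_lfunA add0r addrC subrK.
  by rewrite (evi0 pa) comp_lfun1l vint_point addr0.
by rewrite comp_lfunA (eviK pa t01) comp_lfun1l.
Qed.

(** Truncating the alternating series leaves a single error term in the equation, the one that
    contains the last summand. *)
Lemma alternating_sum (a : R -> E) (F : nat -> R -> E) (g0 : R -> E) : vprim 0 1 (F 0%N) g0 ->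
  (forall n, vprim 0 1 (F n.+1) (fun t => (a t \o F n t)%VF)) -> forall N,
  vprim 0 1 (fun t => \sum_(n < N.+1) (-1) ^+ n *: F n t)
    (fun t => (g0 t + (-1) ^+ N *: (a t \o F N t)%VF) - (a t \o (\sum_(n < N.+1) (-1) ^+ n *: F n t))%VF).
Proof.
move=> h0 hS N; elim: N => [|N IH].
  apply: (vprim_eq (S := [::]) ler01 _ _ h0) => t *; rewrite big_ord_recr big_ord0 /= add0r expr0 !scale1r//.
  by rewrite addrK.
have h := vprimD IH (vprim_lin ( *:%R ((-1) ^+ N.+1) : {linear E -> E}) (hS N)).
apply: (vprim_eq (S := [::]) ler01 _ _ h) => t *; rewrite [in RHS]big_ord_recr//=.
rewrite comp_lfunDr -comp_lfunZr opprD; set x := (a t \o \sum_(_ < _) _)%VF.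
rewrite exprS mulN1r !scaleNr opprK; set y := _ *: (a t \o F N t)%VF; set z := _ *: (a t \o F N.+1 t)%VF.
by apply: crd_inj => j; rewrite !(crdD, crdB, raddfN) /=; ring.
Qed.

(** The partial sums over [p], then those over [m], solve the linear equation up to their last term,
    which is of size 2^-k because each integration against the field halves the weight exp(2 K M t).
    [duhamel] converts these errors into errors on the solutions: [CR] bounds that of the inner sum,
    and [C] combines it with the last outer term, whose sum over [p] is geometric. *)
Lemma series_bound (M N : R) : 0 <= M -> 0 <= N -> exists2 C, 0 <= C &
  forall a c : R -> R -> E, forall s, vpcb M 0 1 (a^~ s) -> vpcb N 0 1 (c^~ s) -> forall k,
  vn (\sum_(m < k.+1) \sum_(p < k.+1) (-1) ^+ (m + p) *: wint (nseq m a ++ c :: nseq p a) s 1 -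
    (evo (a^~ s) 1 \o vintegral 0 1 (fun t => evi (a^~ s) t \o (c t s \o evo (a^~ s) t)))%VF) <= C * 2^-1 ^+ k.
Proof.
move=> M0 N0; have [K K0 hK] := vn_comp U; have [KE KE0 hKE] := evo_spec U.
pose B := KE * expR (KE * M); have B0 : 0 <= B by rewrite mulr_ge0 ?expR_ge0.
pose Ex (t : R) := expR (2 * (K * M) * t); pose v1 := vn (\1%VF : E); have v10 : 0 <= v1 by exact: vn_ge0.
pose E1 := Ex 1; have E10 : 0 <= E1 by exact: expR_ge0.
pose B1 := K * N * (v1 * E1); have B10 : 0 <= B1 by rewrite !mulr_ge0.
pose CR := K * B * (K * B * (K * M * (v1 * E1))).
pose C := K * B * (K * B * (K * N * CR + K * M * (2 * B1 * E1))).
exists C => [|a c s pa pc k]; first by rewrite /C /CR !(mulr_ge0, addr_ge0).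
have va : vpc 0 1 (a^~ s) by exists M. have vc : vpc 0 1 (c^~ s) by exists N.
have [_ _ _ hB] := hKE M (a^~ s) M0 pa.
have Ege t : 0 <= t -> 1 <= Ex t by move=> t0; rewrite -expR0 ler_expR !mulr_ge0.
have Ele t : 0 <= t <= 1 -> Ex t <= E1 by move=> /andP[t0 t1]; rewrite ler_expR ler_wpM2l// !mulr_ge0.
have stepB (F : R -> E) D t : 0 <= t <= 1 -> 0 <= D -> vpc 0 1 F -> (forall u, 0 <= u <= 1 -> vn (F u) <= D * Ex u) ->
    vn (vintegral 0 t (fun u => (a u s \o F u)%VF)) <= D / 2 * Ex t.
  move=> t01 D0 pF hF; apply: le_trans (vint_op_le (bil_comp U) K0 M0 hK pa t01 D0 pF hF) _.
  rewrite -/(Ex t) -[leRHS]mulrA ler_wpM2l// [leRHS]mulrC ler_wpM2r ?invr_ge0//.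
  by rewrite lerBlDr lerDl.
pose Rp p t := wint (nseq p a) s t; pose I m p t := wint (nseq m a ++ c :: nseq p a) s t.
have pw ws : (forall f, f \in [::] -> True) -> True by [].
have vRS p : vpc 0 1 (Rp p) -> vprim 0 1 (Rp p.+1) (fun t => (a t s \o Rp p t)%VF).
  by move=> h; apply: vprim_int; exact: (vpc_bil (bil_comp U) va h).
have vRp p : vpc 0 1 (Rp p).
  by elim: p => [|p IH]; [exact: vpc_cst|exact: (vprim_pc ler01 (vRS p IH))].
have vI0 p : vprim 0 1 (I 0%N p) (fun t => (c t s \o Rp p t)%VF).
  by apply: vprim_int; exact: (vpc_bil (bil_comp U) vc (vRp p)).
have vIS m p : vpc 0 1 (I m p) -> vprim 0 1 (I m.+1 p) (fun t => (a t s \o I m p t)%VF).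
  by move=> h; apply: vprim_int; exact: (vpc_bil (bil_comp U) va h).
have vIp m p : vpc 0 1 (I m p).
  by elim: m => [|m IH]; [exact: (vprim_pc ler01 (vI0 p))|exact: (vprim_pc ler01 (vIS m p IH))].
have g0 n : 0 <= (2^-1 : R) ^+ n by rewrite exprn_ge0.
have bR p t : 0 <= t <= 1 -> vn (Rp p t) <= v1 * 2^-1 ^+ p * Ex t.
  elim: p t => [|p IH] t t01; first by rewrite expr0 mulr1 ler_peMr// Ege//; case/andP: t01.
  rewrite exprSr mulrA; apply: stepB => //; [by rewrite mulr_ge0|exact: vRp].
have bI m p t : 0 <= t <= 1 -> vn (I m p t) <= B1 * 2^-1 ^+ p * 2^-1 ^+ m * Ex t.
  elim: m t => [|m IH] t t01; last first.
    rewrite exprSr mulrA; apply: stepB => //; [by rewrite !mulr_ge0|exact: vIp].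
  have /andP[t0 t1] := t01; rewrite expr0 mulr1.
  apply: le_trans (_ : B1 * 2^-1 ^+ p * t <= _); last first.
    by rewrite ler_wpM2l ?mulr_ge0// (le_trans t1)// Ege.
  rewrite -[X in _ * X]subr0; have [S hS] := pc.
  apply: vint_bound => //; apply: (vpcb_of_vpc (S := S)).
    by apply: (vpc_sub (lexx 0) t1); exact: (vpc_bil (bil_comp U) vc (vRp p)).
  move=> u /andP[u0 ut] uS; have u01 : 0 < u < 1 by rewrite u0 (lt_le_trans ut t1).
  have [bc _] := hS u u01 uS; have u01' : 0 <= u <= 1 by case/andP: u01 => x y; rewrite !ltW.
  apply: le_trans (hK _ _) _; rewrite /B1 -(mulrA (K * N)).
  apply: ler_pM; rewrite ?mulr_ge0 ?vn_ge0 ?ler_wpM2l//.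
  apply: le_trans (bR p u u01') _; rewrite mulrAC ler_wpM2r// ler_wpM2l//; exact: Ele.
pose RN t := \sum_(p < k.+1) (-1) ^+ p *: Rp p t.
have vRN := alternating_sum (vprim_cst0 0 1 (\1%VF : E)) (fun p => vRS p (vRp p)) k.
have pRN : vpc 0 1 RN by exact: (vprim_pc ler01 vRN).
have RN0 : RN 0 = \1%VF.
  rewrite /RN big_ord_recl expr0 scale1r big1 ?addr0// => i _.
  by rewrite /Rp /= vint_point scaler0.
have pq1 : vpc 0 1 (fun t => 0 + (-1) ^+ k *: (a t s \o Rp k t)%VF).
  by apply: vpcD; [exact: vpc_cst|apply: vpcZ; exact: (vpc_bil (bil_comp U) va (vRp k))].
have eU u t : 0 <= t <= 1 -> u t = vn (evo (a^~ s) t) -> u t <= B by move=> t01 ->; have [] := hB t t01.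
have bduh (q : R -> E) D t : 0 <= t <= 1 -> 0 <= D -> vpc 0 1 q ->
    (exists S : seq R, forall u, 0 < u < 1 -> u \notin S -> vn (q u) <= D) ->
    vn (evo (a^~ s) t \o vintegral 0 t (fun u => (evi (a^~ s) u \o q u)%VF))%VF <= K * B * (K * B * D).
  move=> t01 D0 pq [S hS]; have /andP[t0 t1] := t01; have [bt _] := hB t t01.
  apply: le_trans (hK _ _) _; apply: ler_pM; rewrite ?mulr_ge0 ?vn_ge0 ?ler_wpM2l//.
  apply: le_trans (_ : K * B * D * (t - 0) <= _); last first.
    by rewrite subr0 -[leRHS]mulr1 ler_wpM2l ?mulr_ge0.
  apply: vint_bound => //; apply: (vpcb_of_vpc (S := S)).
    apply: (vpc_sub (lexx 0) t1); apply: (vpc_bil (bil_comp U) _ pq).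
    exact: (vprim_pc ler01 (evi_prim va)).
  move=> u /andP[u0 ut] uS; have u01 : 0 < u < 1 by rewrite u0 (lt_le_trans ut t1).
  have u01' : 0 <= u <= 1 by case/andP: u01 => x y; rewrite !ltW.
  have [_ bi] := hB u u01'; apply: le_trans (hK _ _) _.
  by apply: ler_pM; rewrite ?mulr_ge0 ?vn_ge0 ?ler_wpM2l ?hS.
have [Sa hSa] := pa; have [Sc hSc] := pc.
have dR t : 0 <= t <= 1 -> vn (RN t - evo (a^~ s) t) <= CR * 2^-1 ^+ k.
  move=> t01; rewrite [RN t](duhamel va pq1 vRN t01) -/(RN 0) RN0 comp_lfunDr comp_lfun1r addrC addKr.
  have -> : CR * 2^-1 ^+ k = K * B * (K * B * (K * M * (v1 * 2^-1 ^+ k * E1))) by rewrite /CR; ring.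
  apply: bduh => //; first by rewrite !mulr_ge0.
  exists Sa => u u01 uS; have [ba _] := hSa u u01 uS.
  have u01' : 0 <= u <= 1 by case/andP: u01 => x y; rewrite !ltW.
  rewrite add0r vnZ normrX normrN1 expr1n mul1r; apply: le_trans (hK _ _) _.
  apply: ler_pM; rewrite ?mulr_ge0 ?vn_ge0 ?ler_wpM2l//.
  apply: le_trans (bR k u u01') _; rewrite ler_wpM2l ?mulr_ge0//; exact: Ele.
pose Fm m t := \sum_(p < k.+1) (-1) ^+ p *: I m p t.
have vF0 : vprim 0 1 (Fm 0%N) (fun t => (c t s \o RN t)%VF).
  have h := vprim_sum (fun p : 'I_k.+1 => vprim_lin ( *:%R ((-1) ^+ p) : {linear E -> E}) (vI0 p)).
  apply: (vprim_eq (S := [::]) ler01 _ _ h) => t *; first by [].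
  by rewrite /RN comp_lfun_sumr; apply: eq_bigr => p _; rewrite -comp_lfunZr.
have vFS m : vprim 0 1 (Fm m.+1) (fun t => (a t s \o Fm m t)%VF).
  have h := vprim_sum (fun p : 'I_k.+1 => vprim_lin ( *:%R ((-1) ^+ p) : {linear E -> E}) (vIS m p (vIp m p))).
  apply: (vprim_eq (S := [::]) ler01 _ _ h) => t *; first by [].
  by rewrite /Fm comp_lfun_sumr; apply: eq_bigr => p _; rewrite -comp_lfunZr.
have vT := alternating_sum vF0 vFS k.
have pFm : vpc 0 1 (Fm k).
  by case: (k in Fm k) => [|k']; [exact: (vprim_pc ler01 vF0)|exact: (vprim_pc ler01 (vFS k'))].
have pq2 : vpc 0 1 (fun t => (c t s \o RN t)%VF + (-1) ^+ k *: (a t s \o Fm k t)%VF).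
  by apply: vpcD; [exact: (vpc_bil (bil_comp U) vc pRN)|apply: vpcZ; exact: (vpc_bil (bil_comp U) va pFm)].
have i01 : 0 <= (1 : R) <= 1 by rewrite ler01 lexx.
have e1 := duhamel va pq2 vT i01.
have T0 : \sum_(m < k.+1) (-1) ^+ m *: Fm m 0 = 0.
  rewrite big1// => m _; rewrite /Fm big1 ?scaler0// => p _.
  by rewrite /I; case: (nat_of_ord m) => [|m'] /=; rewrite vint_point scaler0.
have -> : \sum_(m < k.+1) \sum_(p < k.+1) (-1) ^+ (m + p) *: wint (nseq m a ++ c :: nseq p a) s 1 =
    \sum_(m < k.+1) (-1) ^+ m *: Fm m 1.
  apply: eq_bigr => m _; rewrite /Fm scaler_sumr; apply: eq_bigr => p _.
  by rewrite scalerA exprD.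
rewrite e1 T0 add0r -comp_lfunNr -comp_lfunDr -vintB//; last 2 first.
- by apply: (vpc_bil (bil_comp U)) => //; exact: (vprim_pc ler01 (evi_prim va)).
- apply: (vpc_bil (bil_comp U)); first exact: (vprim_pc ler01 (evi_prim va)).
  by apply: (vpc_bil (bil_comp U)) => //; exact: (vprim_pc ler01 (evo_prim va)).
pose q3 t := (c t s \o (RN t - evo (a^~ s) t))%VF + (-1) ^+ k *: (a t s \o Fm k t)%VF.
have -> : (fun t => (evi (a^~ s) t \o ((c t s \o RN t) + (-1) ^+ k *: (a t s \o Fm k t)))%VF -
    (evi (a^~ s) t \o (c t s \o evo (a^~ s) t))%VF) = fun t => (evi (a^~ s) t \o q3 t)%VF.
  apply/funext => t; rewrite /q3 -comp_lfunNr -comp_lfunDr; congr (_ \o _)%VF.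
  by rewrite comp_lfunDr comp_lfunNr addrAC.
have -> : C * 2^-1 ^+ k = K * B * (K * B * (K * N * (CR * 2^-1 ^+ k) + K * M * (2 * B1 * E1 * 2^-1 ^+ k))).
  by rewrite /C; ring.
have CR0 : 0 <= CR by rewrite /CR !mulr_ge0.
apply: bduh => //.
- by rewrite addr_ge0// !mulr_ge0.
- apply: vpcD; last by apply: vpcZ; exact: (vpc_bil (bil_comp U) va pFm).
  by apply: (vpc_bil (bil_comp U) vc); apply: vpcB => //; exact: (vprim_pc ler01 (evo_prim va)).
exists (Sa ++ Sc) => u u01; rewrite mem_cat negb_or => /andP[uSa uSc].
have [ba _] := hSa u u01 uSa; have [bc _] := hSc u u01 uSc.
have u01' : 0 <= u <= 1 by case/andP: u01 => x y; rewrite !ltW.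
rewrite /q3; apply: le_trans (vnD _ _) _; apply: lerD.
  apply: le_trans (hK _ _) _; apply: ler_pM; rewrite ?mulr_ge0 ?vn_ge0 ?ler_wpM2l//.
  exact: dR.
rewrite vnZ normrX normrN1 expr1n mul1r; apply: le_trans (hK _ _) _.
apply: ler_pM; rewrite ?mulr_ge0 ?vn_ge0 ?ler_wpM2l//.
apply: le_trans (vn_sum _ _) _.
apply: le_trans (_ : \sum_(p < k.+1) B1 * E1 * 2^-1 ^+ k * 2^-1 ^+ p <= _).
  apply: ler_sum => p _; rewrite vnZ normrX normrN1 expr1n mul1r.
  apply: le_trans (bI k p u u01') _.
  have -> : B1 * E1 * 2^-1 ^+ k * 2^-1 ^+ p = B1 * 2^-1 ^+ p * 2^-1 ^+ k * E1 by ring.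
  by rewrite ler_wpM2l ?mulr_ge0//; exact: Ele.
rewrite -mulr_sumr.
have gs : \sum_(p < k.+1) (2^-1 : R) ^+ p <= 2.
  suff -> : \sum_(p < k.+1) (2^-1 : R) ^+ p = 2 - 2^-1 ^+ k by rewrite gerBl.
  elim: (k) => [|k' IHk]; first by rewrite big_ord_recr big_ord0 /= !expr0; ring.
  by rewrite big_ord_recr /= IHk exprS; field.
have -> : 2 * B1 * E1 * 2^-1 ^+ k = B1 * E1 * 2^-1 ^+ k * 2 by ring.
by rewrite ler_wpM2l ?mulr_ge0.
Qed.

End Series.

Section SepEvolution.
Variables (R : realType) (U : vectType R).
Local Notation E := 'End(U).

(** Off finitely many [s] the fields share a bound, so [evo_dist] and dominated convergence give
    continuity in [s], up to and including t = 1. *)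
Lemma evo_vcts M (a : R -> R -> E) : 0 <= M -> sep M a -> exists2 B, 0 <= B & exists S : seq R,
  forall s, 0 < s < 1 -> s \notin S -> vpcb M 0 1 (a^~ s) /\ forall t, 0 <= t <= 1 ->
  [/\ vn (evo (a^~ s) t) <= B, vn (evi (a^~ s) t) <= B,
      vcts (fun s => evo (a^~ s) t) s & vcts (fun s => evi (a^~ s) t) s].
Proof.
move=> M0 h; have [C C0 hC] := evo_dist U M0; have [S hS] := sep_vpcb h; have [_ [S2 hS2]] := h.
exists C => //; exists (S ++ S2) => s s01; rewrite mem_cat negb_or => /andP[sS sS2]; have hs := hS s s01 sS.
split=> // t t01; have [b1 b2 _ _] := hC _ _ hs hs t t01; split=> //.
all: have ic : ig 0 1 (fun u => vn (a u s' - a u s)) @[s' --> within setT (nbhs (s : R^o))] --> (0 : R^o) by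
  [apply: (@dominated_vcvg R E R^o setT s 0 1 (fun s' u => a u s') (fun u => a u s) M ler01);
   [rewrite near_withinE; apply: filterS (near_off s01 sS) => u [u01 uS] _; exact: hS
   |by exists M
   |have [S' h'] := hS2 s s01 sS2; exists S' => u u01 uS; have [_ _ c] := h' u u01 uS;
    apply: vcvg_trans c; exact: cvg_within]].
all: have ic0 : ig 0 1 (fun u => vn (a u s' - a u s)) @[s' --> s] --> (0 : R) by
  [move=> B hB;
   have hB' : \forall x \near s, True -> B (ig 0 1 (fun u => vn (a u x - a u s))) by [exact: (ic _ hB)];
   change (\forall x \near s, B (ig 0 1 (fun u => vn (a u x - a u s))));
   apply: filterS hB' => x hx; exact: hx].
all: have ic' : C * ig 0 1 (fun u => vn (a u s' - a u s)) @[s' --> s] --> (0 : R) by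
  [rewrite -[X in _ --> X](mulr0 C);
   have cc : (fun _ : R => C : R) @ s --> C by [exact: cvg_cst];
   exact: (cvgM cc ic0)].
all: apply: (vcvg_squeeze _ ic'); apply: filterS (near_off s01 sS) => u [u01 uS].
all: by have [_ _ d1 d2] := hC _ _ (hS u u01 uS) hs t t01.
Qed.

Lemma evo_sep M (a : R -> R -> E) : 0 <= M -> sep M a -> exists2 B, 0 <= B &
  sep B (fun t s => evo (a^~ s) t) /\ sep B (fun t s => evi (a^~ s) t).
Proof.
move=> M0 h; have [B B0 [S hS]] := evo_vcts M0 h; exists B => //.
have main s t : 0 < s < 1 -> s \notin S -> 0 < t < 1 ->
    [/\ vn (evo (a^~ s) t) <= B, vcts (evo (a^~ s)) t & vcts (fun s => evo (a^~ s) t) s] /\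
    [/\ vn (evi (a^~ s) t) <= B, vcts (evi (a^~ s)) t & vcts (fun s => evi (a^~ s) t) s].
  move=> s01 sS t01; have t01' : 0 <= t <= 1 by case/andP: t01 => x y; rewrite !ltW.
  have [pa /(_ t t01')[b1 b2 c1 c2]] := hS s s01 sS.
  have va : vpc 0 1 (a^~ s) by exists M.
  by split; split=> //; [exact: (vprim_cts (evo_prim va) t01)|exact: (vprim_cts (evi_prim va) t01)].
split; split.
- by exists [::] => t t01 _; exists S => s s01 sS; have [] := main s t s01 sS t01.
- by exists S => s s01 sS; exists [::] => t t01 _; have [] := main s t s01 sS t01.
- by exists [::] => t t01 _; exists S => s s01 sS; have [] := main s t s01 sS t01.
- by exists S => s s01 sS; exists [::] => t t01 _; have [] := main s t s01 sS t01.
Qed.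

(** The sum of the series at fixed s: up to sign, the first variation of the transport of [a] when
    the field is moved in the direction [c]. *)
Definition zint (a c : R -> R -> E) s : E :=
  (evo (a^~ s) 1 \o vintegral 0 1 (fun t => evi (a^~ s) t \o (c t s \o evo (a^~ s) t)))%VF.

Lemma zint_vpc M N (a c : R -> R -> E) : 0 <= M -> 0 <= N -> sep M a -> sep N c -> vpc 0 1 (zint a c).
Proof.
move=> M0 N0 ha hc; have [B B0 [S hS]] := evo_vcts M0 ha; have [B' B'0 [s1 s2]] := evo_sep M0 ha.
have [D D0 hD] := sep_comp N0 B'0 hc s1; have [D' D'0 hD'] := sep_comp B'0 D0 s2 hD.
apply: (vpc_bil (bil_comp U)).
  exists B, S => s s01 sS; have i1 : 0 <= (1 : R) <= 1 by rewrite ler01 lexx.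
  by have [_ /(_ 1 i1)[]] := hS s s01 sS.
by have := sep_inner_vpc (sep_swap hD').
Qed.

End SepEvolution.

Section Sums.
Variables (R : realType) (W : vectType R).

Lemma vpc_sum a b n (F : 'I_n -> R -> W) : (forall i, vpc a b (F i)) -> vpc a b (fun t => \sum_i F i t).
Proof.
elim: n F => [|n IH] F h.
  have -> : (fun t => \sum_i F i t) = fun=> 0 by apply/funext => t; rewrite big_ord0.
  exact: vpc_cst.
have -> : (fun t => \sum_i F i t) = fun t => F ord0 t + \sum_(i < n) F (lift ord0 i) t.
  by apply/funext => t; rewrite big_ord_recl.
by apply: vpcD => //; exact: IH.
Qed.

Lemma vint_sum a b n (F : 'I_n -> R -> W) : a <= b -> (forall i, vpc a b (F i)) ->
  vintegral a b (fun t => \sum_i F i t) = \sum_i vintegral a b (F i).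
Proof.
move=> ab; elim: n F => [|n IH] F h.
  have -> : (fun t => \sum_i F i t) = fun=> 0 by apply/funext => t; rewrite big_ord0.
  by rewrite big_ord0 vint0.
have -> : (fun t => \sum_i F i t) = fun t => F ord0 t + \sum_(i < n) F (lift ord0 i) t.
  by apply/funext => t; rewrite big_ord_recl.
by rewrite vintD// ?IH ?big_ord_recl//; exact: vpc_sum.
Qed.

Lemma vlim_geometric (u : nat -> W) (l : W) C : (forall k, vn (u k.+1 - l) <= C * 2^-1 ^+ k) -> vlim u = l.
Proof.
move=> h; apply: crd_inj => j; rewrite /vlim of_crdK; apply/cvg_lim => //.
rewrite -(@cvg_shiftS _ (fun N => crd j (u N) : R^o)).
have ce : C * 2^-1 ^+ k @[k --> \oo] --> (0 : R).
  by rewrite -[X in _ --> X](mulr0 C); apply: cvgMr; apply: cvg_expr; rewrite ger0_norm//; lra.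
apply/cvgrPdist_le => e e0; move/cvgrPdist_le : ce => /(_ e e0); apply: filterS => k; rewrite sub0r normrN => hk.
rewrite distrC -crdB; apply: le_trans (crd_vn _ _) _; apply: le_trans (h k) _.
exact: le_trans (ler_norm _) hk.
Qed.

End Sums.

Section Int2.
Variables (R : realType) (n : nat) (M : manifold R n) (V : cochain_complex R).
Local Notation X := (R^o * R^o)%type.
Local Notation E := 'End(V).
Variables (alpha : forall k, dform M k E) (sigma : X -> M).
Arguments alpha : clear implicits.
Hypothesis falpha : forall k, is_form (alpha k).
Local Notation e1 := ((1, 0) : X).
Local Notation e2 := ((0, 1) : X).

Definition athe (t s : R) : E := pullback (fun p => sigma (Theta p)) (alpha 1%N) ((t, s) : X) (fun _ => e1).
Definition cthe (t s : R) : E := pullback (fun p => sigma (Theta p)) (alpha 2%N) ((t, s) : X) (pair2 e1 e2).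

Lemma aprod_wprod K (x : 'rV[R]_K.+1) s ts i p : (forall i, (i < size ts)%N -> coord2 i x = (ts`_i, s) :> X) ->
  size ts = (i + p)%N -> aprod alpha (fun p => sigma (Theta p)) x i p = wprod (nseq p athe) (drop i ts) s.
Proof.
move=> hx; elim: p i => [//|p IH] i sts; have ilt : (i < size ts)%N by rewrite sts -addSnnS leq_addr.
have e : afac alpha (fun p => sigma (Theta p)) x i = athe ts`_i s by rewrite /afac hx.
rewrite (drop_nth 0 ilt) /= IH; first by rewrite e.
by rewrite sts addSnnS.
Qed.

Lemma cprod_wprod K (x : 'rV[R]_K.+1) s ts i m p : (forall i, (i < size ts)%N -> coord2 i x = (ts`_i, s) :> X) ->
  size ts = (i + m + p).+1 ->
  cprod alpha (fun p => sigma (Theta p)) x i m p = wprod (nseq m athe ++ cthe :: nseq p athe) (drop i ts) s.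
Proof.
move=> hx; elim: m i => [|m IH] i sts; have ilt : (i < size ts)%N by rewrite sts ltnS -addnA leq_addr.
  have e : cfac alpha (fun p => sigma (Theta p)) x i = cthe ts`_i s by rewrite /cfac hx.
  rewrite (drop_nth 0 ilt) /= (aprod_wprod hx); first by rewrite e.
  by rewrite sts addn0.
have e : afac alpha (fun p => sigma (Theta p)) x i = athe ts`_i s by rewrite /afac hx.
rewrite (drop_nth 0 ilt) /= IH; first by rewrite e.
by rewrite sts -addSnnS.
Qed.

Lemma int2_form_wprod m p ts s : size ts = (m + p + 1)%N ->
  int2_form alpha sigma (\row_(j < (m + p).+2) (rcons ts s)`_j) (fun a => delta_mx 0 (inord a)) =
  wprod (nseq m athe ++ cthe :: nseq p athe) ts s.
Proof.
move=> sts; have h := @sprods_mix R n M V alpha (fun p => sigma (Theta p)) (m + p).+1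
  (\row_(j < (m + p).+2) (rcons ts s)`_j) falpha m p 0 (fun a => delta_mx 0 (inord a)) erefl (fun=> erefl).
rewrite [LHS]h (@cprod_wprod _ _ s ts) ?drop0//; last by rewrite sts addn1.
move=> i; rewrite sts addn1 => ilt; rewrite /coord2 !mxE nth_rcons sts addn1 inordK; last exact: ltnW.
by rewrite ilt nth_rcons sts addn1 /= ltnn eqxx.
Qed.

Variables (Ma Mc : R).
Hypotheses (Ma0 : 0 <= Ma) (Mc0 : 0 <= Mc) (ha : sep Ma athe) (hc : sep Mc cthe).

Lemma words_allsep m p : allsep (nseq m athe ++ cthe :: nseq p athe).
Proof.
elim: m => [|m IH] /=; last by split; [exists Ma|].
by split; [exists Mc|elim: p => //= p IH; split; [exists Ma|]].
Qed.

Lemma int2_termE m p : int2_term alpha sigma m p =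
  vintegral 0 1 (fun s => wint (nseq m athe ++ cthe :: nseq p athe) s 1).
Proof.
have sz : size (nseq m athe ++ cthe :: nseq p athe) = (m + p + 1)%N by rewrite size_cat /= !size_nseq addn1 addnS.
have i1 : 0 <= (1 : R) <= 1 by rewrite ler01 lexx.
have h := simplex_exchange (words_allsep m p) (vpc_cst (\1%VF : E) 0 1) i1.
have e : (fun s => (\1 \o wint (nseq m athe ++ cthe :: nseq p athe) s 1)%VF) =
    fun s => wint (nseq m athe ++ cthe :: nseq p athe) s 1 by apply/funext => s; rewrite comp_lfun1l.
rewrite e in h; rewrite /int2_term.
rewrite -h sz; apply: eq_simplex => ts sts; congr vintegral; apply/funext => s.
by rewrite comp_lfun1l; exact: int2_form_wprod.
Qed.

Lemma wint_vpc m p : vpc 0 1 (fun s => wint (nseq m athe ++ cthe :: nseq p athe) s 1).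
Proof.
have hws := words_allsep m p.
suff h f ws : allsep (f :: ws) -> vpc 0 1 (fun s => wint (f :: ws : seq (R -> R -> E)) s 1).
  by case: m hws => [|m] /h.
move=> [[M0 M00 hf] hw]; have [B B0 hB] := wint_sep hw; have [D D0 hD] := sep_comp M00 B0 hf hB.
by have := sep_inner_vpc (sep_swap hD).
Qed.

(** The partial sums over squares are exactly those controlled by [series_bound], whose constant is
    uniform in s and so survives the integration. The outer sign is the extra -1 in the sign of the
    series. *)
Lemma int2E : int2 alpha sigma = - vintegral 0 1 (zint athe cthe).
Proof.
have [C C0 hC] := series_bound V Ma0 Mc0.
have pz := zint_vpc Ma0 Mc0 ha hc.
apply: (@vlim_geometric _ _ _ _ C) => k; rewrite opprK.
have -> : \sum_(m < k.+1) \sum_(p < k.+1) (-1) ^+ (m + p + 1) *: int2_term alpha sigma m p =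
   - vintegral 0 1 (fun s => \sum_(m < k.+1) \sum_(p < k.+1) (-1) ^+ (m + p) *: wint (nseq m athe ++ cthe :: nseq p athe) s 1).
  rewrite vint_sum// => [|m]; last by apply: vpc_sum => p; apply: vpcZ; exact: wint_vpc.
  rewrite -sumrN; apply: eq_bigr => m _.
  rewrite vint_sum// => [|p]; last by apply: vpcZ; exact: wint_vpc.
  rewrite -sumrN; apply: eq_bigr => p _; rewrite vintZ//; last exact: wint_vpc.
  by rewrite int2_termE addn1 exprS mulN1r scaleNr.
have pS : vpc 0 1 (fun s => \sum_(m < k.+1) \sum_(p < k.+1) (-1) ^+ (m + p) *: wint (nseq m athe ++ cthe :: nseq p athe) s 1).
  by apply: vpc_sum => m; apply: vpc_sum => p; apply: vpcZ; exact: wint_vpc.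
rewrite addrC -vintB//; have [Sa hSa] := sep_vpcb ha; have [Sc hSc] := sep_vpcb hc.
rewrite -vnN -vintN ?ler01//; last exact: vpcB.
apply: le_trans (vint_bound (M := C * 2^-1 ^+ k) ler01 _) _; last by rewrite subr0 mulr1.
apply: (vpcb_of_vpc (S := Sa ++ Sc)); first by apply: vpcN; exact: vpcB.
move=> s s01; rewrite mem_cat negb_or => /andP[/(hSa s s01) h1 /(hSc s s01) h2].
by rewrite opprB; exact: hC.
Qed.

End Int2.

(** * The map Theta *)

Section ThetaRegions.
Variables (R : realType) (n : nat) (M : manifold R n) (V : cochain_complex R).
Local Notation X := (R^o * R^o)%type.
Local Notation E := 'End(V).
Variables (alpha : forall k, dform M k E) (sigma : X -> M) (k : nat) (pol : 'I_k -> halfspaces R).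
Arguments alpha : clear implicits.
Hypothesis falpha : forall k, is_form (alpha k).
Hypothesis cover : square `<=` \bigcup_i hs_set (pol i).
Hypothesis cG : {within square, continuous sigma}.
Hypothesis sm : forall i, smooth_on (square `&` hs_set (pol i)) sigma.
Local Notation e1 := ((1, 0) : X).
Local Notation e2 := ((0, 1) : X).
Local Notation e12 := ((1, 1) : X).
Local Notation athe := (athe alpha sigma).
Local Notation cthe := (cthe alpha sigma).
Local Notation zz c := (fun p => chart_of c (sigma p)).

Lemma is_vderive_scale (W : vectType R) (F : X -> W) p d (w : W) (l : R) :
  is_vderive F p d w -> is_vderive F p (l *: d) (l *: w).
Proof.
move=> h; apply/is_vderive_along; have h' := iffLR (is_vderive_along _ _ _ _) h.
have h0 : is_vderive (fun x : R^o => F (x *: d + p)) (l * 0 + 0) 1 w by rewrite mulr0 addr0.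
have := is_vderive_affine h0; apply: is_vderive_near.
  by apply: filterE => x; rewrite [x *: 1]mulr1 !addr0 scalerA mulrC.
by rewrite mulr0 addr0 !scale0r.
Qed.

Lemma scaleRoE (a : R) (b : R^o) : a *: b = a * b. Proof. by []. Qed.

(** Near [q] the map [Theta] moves along a straight line in direction [d] at speed [l], so the
    genericity of [p] for [d] alone gives the derivative, even if [p] lies on an edge. *)
Lemma theta_dir c (q v p d : X) (l : R) : Theta q = p -> dgen pol d p -> chart_dom (chart_of c) (sigma p) ->
  (\forall h \near (0 : R), Theta (h *: v + q) = h *: (l *: d) + p) ->
  vderive (chart_of c \o (fun p => sigma (Theta p))) q v = l *: vderive (zz c) p d.
Proof.
move=> Tq gp cp hT; have [sq _ _ _] := gp.
have dz := nbhs_singleton (near_chart_vderive cover sm sq cp d) gp.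
apply: is_vderive_vderive; apply/is_vderive_along.
have := iffLR (is_vderive_along _ _ _ _) (is_vderive_scale l dz); apply: is_vderive_near.
  apply: nbhs_dnbhs; apply: filterS hT => h hh.
  by rewrite /= [h *: 1]mulr1 addr0 hh.
by rewrite /= !scale0r !add0r Tq.
Qed.

(** For fixed s, the path t |-> Theta (t, s) descends the diagonal from (1, 1) to (s, s), then the
    column to (s, 0), then follows the bottom to (0, 0). The three regions are the open sets of
    times of these stretches, and [Phi1], [Phi2], [Phi3] are the formulas for [Theta] there. *)
Definition reg1 (q : X) := (0 < q.2) && (0 < q.1) && (q.2 < 1 - 2 * q.1).
Definition reg2 (q : X) := (q.1 < 2^-1) && (1 - 2 * q.1 < q.2) && (q.2 < 1).
Definition reg3 (q : X) := (2^-1 < q.1) && (q.1 < 1) && (0 < q.2) && (q.2 < 1).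

Definition Phi1 (q : X) : X := (1 - 2 * q.1, 1 - 2 * q.1).
Definition Phi2 (q : X) : X := (q.2, 1 - 2 * q.1).
Definition Phi3 (q : X) : X := (q.2 * (2 - 2 * q.1), 0).

Lemma Theta1 q : reg1 q -> Theta q = Phi1 q.
Proof.
rewrite /reg1 /Theta /lambda_map /qmap => /andP[/andP[s0 t0] st].
have t2 : q.1 <= 2^-1 by lra.
rewrite t2 /= /Phi1; congr pair; apply/max_idPr; exact: ltW.
Qed.

Lemma Theta2 q : reg2 q -> Theta q = Phi2 q.
Proof.
rewrite /reg2 /Theta /lambda_map /qmap => /andP[/andP[t2 st] s1].
rewrite (ltW t2) /= /Phi2; congr pair; apply/max_idPl; exact: ltW.
Qed.

Lemma Theta3 q : reg3 q -> Theta q = Phi3 q.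
Proof.
rewrite /reg3 /Theta /lambda_map /qmap => /andP[/andP[/andP[t2 t1] s0] s1].
rewrite leNgt t2 /= /Phi3; congr pair; apply/max_idPl; apply: mulr_ge0; lra.
Qed.

Lemma cts1 (q : X) : {for q, continuous (fun p : X => p.1)}. Proof. exact: cvg_fst. Qed.
Lemma cts2 (q : X) : {for q, continuous (fun p : X => p.2)}. Proof. exact: cvg_snd. Qed.

Lemma near_ltX (f g : X -> R^o) (q : X) : {for q, continuous f} -> {for q, continuous g} -> f q < g q ->
  \forall p \near q, f p < g p.
Proof.
move=> cf cg fg; have h : {for q, continuous (fun p => g p - f p : R^o)} by apply: cvgB; [exact: cg|exact: cf].
have fg' : 0 < g q - f q by rewrite subr_gt0.
have n1 : \forall p \near q, 0 < g p - f p by exact: (cvgr_gt _ h).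
by apply: filterS n1 => p; rewrite subr_gt0.
Qed.

Lemma cts_aff (q : X) : {for q, continuous (fun p : X => 1 - 2 * p.1 : R^o)}.
Proof. by apply: cvgB; [exact: cvg_cst|apply: cvgMr; exact: cts1]. Qed.

Lemma near_reg1 q : reg1 q -> \forall p \near q, reg1 p.
Proof.
move=> /andP[/andP[a b] c]; have cc (x : R) : {for q, continuous (fun _ : X => x : R^o)} by exact: cvg_cst.
have n1 := near_ltX (cc 0) (@cts2 q) a; have n2 := near_ltX (cc 0) (@cts1 q) b.
have n3 := near_ltX (@cts2 q) (@cts_aff q) c.
by apply: filterS3 n1 n2 n3 => p x y z; rewrite /reg1 x y z.
Qed.

Lemma near_reg2 q : reg2 q -> \forall p \near q, reg2 p.
Proof.
move=> /andP[/andP[a b] c]; have cc (x : R) : {for q, continuous (fun _ : X => x : R^o)} by exact: cvg_cst.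
have n1 := near_ltX (@cts1 q) (cc 2^-1) a; have n2 := near_ltX (@cts_aff q) (@cts2 q) b.
have n3 := near_ltX (@cts2 q) (cc 1) c.
by apply: filterS3 n1 n2 n3 => p x y z; rewrite /reg2 x y z.
Qed.

Lemma near_reg3 q : reg3 q -> \forall p \near q, reg3 p.
Proof.
move=> /andP[/andP[/andP[a b] c] d]; have cc (x : R) : {for q, continuous (fun _ : X => x : R^o)} by exact: cvg_cst.
have n1 := near_ltX (cc 2^-1) (@cts1 q) a; have n2 := near_ltX (@cts1 q) (cc 1) b.
have n3 := near_ltX (cc 0) (@cts2 q) c; have n4 := near_ltX (@cts2 q) (cc 1) d.
by apply: filterS3 (filterI n1 n2) n3 n4 => p [x y] z w; rewrite /reg3 x y z w.
Qed.

Lemma near_line0 (q v : X) (P : X -> Prop) : (\forall p \near q, P p) -> \forall h \near (0 : R), P (h *: v + q).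
Proof. by move=> h; have c := @line_cvg R q v; exact: (c _ h). Qed.

Lemma chart_img_at (x : M) : chart_img (chart_at x) (chart_of (chart_at x) x).
Proof. by exists x => //; exact: chart_atP. Qed.

Lemma pullback_scale1 (w : dform M 1 E) (q p d : X) l : is_form w -> Theta q = p ->
  vderive (chart_of (chart_at (sigma p)) \o (fun p => sigma (Theta p))) q e1 = l *: vderive (zz (chart_at (sigma p))) p d ->
  pullback (fun p => sigma (Theta p)) w q (fun _ => e1) = l *: pullback sigma w p (fun _ => d).
Proof.
move=> fw Tq h; rewrite /pullback Tq h.
rewrite -(formhomE fw _ (chart_img_at (sigma p))) linearZ /=.
by rewrite (formhomE fw _ (chart_img_at (sigma p))).
Qed.

Lemma athe1 q : reg1 q -> dgen pol e12 (Phi1 q) -> athe q.1 q.2 = -2 *: pullback sigma (alpha 1%N) (Phi1 q) (fun _ => e12).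
Proof.
move=> rq gq; have hT : \forall h \near (0 : R), Theta (h *: e1 + q) = h *: (-2 *: e12) + Phi1 q.
  apply: filterS (near_line0 e1 (near_reg1 rq)) => h /Theta1->.
  by congr pair; rewrite /= !scaleRoE; ring.
rewrite /athe -surjective_pairing; apply: pullback_scale1; [exact: falpha|exact: Theta1|].
exact: (theta_dir (Theta1 rq) gq (chart_atP _) hT).
Qed.

Lemma athe2 q : reg2 q -> dgen pol e2 (Phi2 q) -> athe q.1 q.2 = -2 *: pullback sigma (alpha 1%N) (Phi2 q) (fun _ => e2).
Proof.
move=> rq gq; have hT : \forall h \near (0 : R), Theta (h *: e1 + q) = h *: (-2 *: e2) + Phi2 q.
  apply: filterS (near_line0 e1 (near_reg2 rq)) => h /Theta2->.
  by congr pair; rewrite /= !scaleRoE; ring.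
rewrite /athe -surjective_pairing; apply: pullback_scale1; [exact: falpha|exact: Theta2|].
exact: (theta_dir (Theta2 rq) gq (chart_atP _) hT).
Qed.

Lemma athe3 q : reg3 q -> dgen pol e1 (Phi3 q) -> athe q.1 q.2 = (-2 * q.2) *: pullback sigma (alpha 1%N) (Phi3 q) (fun _ => e1).
Proof.
move=> rq gq; have hT : \forall h \near (0 : R), Theta (h *: e1 + q) = h *: ((-2 * q.2) *: e1) + Phi3 q.
  apply: filterS (near_line0 e1 (near_reg3 rq)) => h /Theta3->.
  by congr pair; rewrite /= !scaleRoE; ring.
rewrite /athe -surjective_pairing; apply: pullback_scale1; [exact: falpha|exact: Theta3|].
exact: (theta_dir (Theta3 rq) gq (chart_atP _) hT).
Qed.

Lemma pullback_scale2 (w : dform M 2 E) (q p : X) u v : is_form w -> Theta q = p ->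
  vderive (chart_of (chart_at (sigma p)) \o (fun p => sigma (Theta p))) q e1 = u ->
  vderive (chart_of (chart_at (sigma p)) \o (fun p => sigma (Theta p))) q e2 = v ->
  pullback (fun p => sigma (Theta p)) w q (pair2 e1 e2) = w (chart_at (sigma p)) (chart_of (chart_at (sigma p)) (sigma p)) (pair2 u v).
Proof.
move=> fw Tq hu hv; rewrite /pullback Tq; congr (w _ _ _); apply/funext => a.
by rewrite /pair2; case: ifP.
Qed.

Lemma form2_rules (w : dform M 2 E) x : is_form w -> let c := chart_at x in let W u v := w c (chart_of c x) (pair2 u v) in
  [/\ forall u, W u 0 = 0, forall a b u, W (a *: u) (b *: u) = 0 & forall a u v, W (a *: v) u = (- a) *: W u v].
Proof.
move=> [al _ _] c W; have [bl br] := form2_bil (al _ _ (chart_img_at x)); have [_ alt] := al _ _ (chart_img_at x).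
have W0r v : W v 0 = 0.
  by have h := br v 1 0 0; rewrite /= !scale1r addr0 in h; apply: (addrI (W v 0)); rewrite addr0 {3}/W h.
have W0l v : W 0 v = 0.
  by have h := bl v 1 0 0; rewrite /= !scale1r addr0 in h; apply: (addrI (W 0 v)); rewrite addr0 {3}/W h.
have Wd v : W v v = 0 by apply: (alt _ ord0 ord_max).
have WZl a u v : W (a *: u) v = a *: W u v by have h := bl v a u 0; rewrite /= addr0 in h; rewrite {1}/W h -/(W 0 v) W0l addr0.
have WZr a u v : W u (a *: v) = a *: W u v by have h := br u a v 0; rewrite /= addr0 in h; rewrite {1}/W h -/(W u 0) W0r addr0.
have Wn u v : W u v = - W v u.
  have a1 := bl (1 *: u + v) 1 u v; have a2 := br u 1 u v; have a3 := br v 1 u v.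
  move: a1; rewrite /= -/(W _ _) Wd a2 a3 -!/(W _ _) !Wd !scale1r add0r addr0 => /esym/eqP.
  by rewrite addr_eq0 => /eqP.
split=> // [a b u|a u v]; first by rewrite WZl WZr Wd !scaler0.
by rewrite WZl Wn scalerN scaleNr.
Qed.

(** In this region [Theta] does not depend on s, and in the third it stays on the bottom edge. Its
    rank is below 2 in both, so alpha^2 contributes along the columns only. *)
Lemma cthe1 q : reg1 q -> cthe q.1 q.2 = 0.
Proof.
move=> rq; rewrite /cthe -surjective_pairing.
have hT : \forall h \near (0 : R)^', (chart_of (chart_at (sigma (Phi1 q))) \o (fun p => sigma (Theta p))) q =
    (chart_of (chart_at (sigma (Phi1 q))) \o (fun p => sigma (Theta p))) (h *: e2 + q).
  apply: nbhs_dnbhs; apply: filterS (near_line0 e2 (near_reg1 rq)) => h rh.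
  rewrite /= (Theta1 rh) (Theta1 rq) /Phi1; congr (chart_of _ (sigma (_, _))); rewrite /= !scaleRoE; ring.
have d2 : vderive (chart_of (chart_at (sigma (Phi1 q))) \o (fun p => sigma (Theta p))) q e2 = 0.
  by apply: is_vderive_vderive; apply: (is_vderive_near (F := fun _ => (chart_of (chart_at (sigma (Phi1 q))) \o (fun p => sigma (Theta p))) q) hT) => //; exact: is_vderive_cst.
rewrite (pullback_scale2 (falpha 2%N) (Theta1 rq) erefl d2).
by have [h _ _] := form2_rules (sigma (Phi1 q)) (falpha 2%N); exact: h.
Qed.

Lemma cthe3 q : reg3 q -> dgen pol e1 (Phi3 q) -> cthe q.1 q.2 = 0.
Proof.
move=> rq gq; rewrite /cthe -surjective_pairing.
have hT1 : \forall h \near (0 : R), Theta (h *: e1 + q) = h *: ((-2 * q.2) *: e1) + Phi3 q.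
  apply: filterS (near_line0 e1 (near_reg3 rq)) => h /Theta3->.
  by congr pair; rewrite /= !scaleRoE; ring.
have hT2 : \forall h \near (0 : R), Theta (h *: e2 + q) = h *: ((2 - 2 * q.1) *: e1) + Phi3 q.
  apply: filterS (near_line0 e2 (near_reg3 rq)) => h /Theta3->.
  by congr pair; rewrite /= !scaleRoE; ring.
rewrite (pullback_scale2 (falpha 2%N) (Theta3 rq) (theta_dir (Theta3 rq) gq (chart_atP _) hT1) (theta_dir (Theta3 rq) gq (chart_atP _) hT2)).
by have [_ h _] := form2_rules (sigma (Phi3 q)) (falpha 2%N); exact: h.
Qed.

(** [Theta] sends the first basis vector to -2 times the vertical one and the second to the
    horizontal one. Exchanging the two arguments turns -2 into 2. *)
Lemma cthe2 q : reg2 q -> fgen pol (Phi2 q) -> cthe q.1 q.2 = 2 *: pullback sigma (alpha 2%N) (Phi2 q) (pair2 e1 e2).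
Proof.
move=> rq [g1 g2]; rewrite /cthe -surjective_pairing.
have hT1 : \forall h \near (0 : R), Theta (h *: e1 + q) = h *: (-2 *: e2) + Phi2 q.
  apply: filterS (near_line0 e1 (near_reg2 rq)) => h /Theta2->.
  by congr pair; rewrite /= !scaleRoE; ring.
have hT2 : \forall h \near (0 : R), Theta (h *: e2 + q) = h *: (1 *: e1) + Phi2 q.
  apply: filterS (near_line0 e2 (near_reg2 rq)) => h /Theta2->.
  by congr pair; rewrite /= !scaleRoE; ring.
rewrite (pullback_scale2 (falpha 2%N) (Theta2 rq) (theta_dir (Theta2 rq) g2 (chart_atP _) hT1) (theta_dir (Theta2 rq) g1 (chart_atP _) hT2)).
have [_ _ h] := form2_rules (sigma (Phi2 q)) (falpha 2%N); rewrite h opprK scale1r; congr (_ *: _).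
rewrite /pullback; congr (alpha 2%N _ _ _); apply/funext => a.
by rewrite /pair2; case: ifP.
Qed.

End ThetaRegions.

Lemma seq_affine (R : realType) (k c : R) (S : seq R) : k != 0 ->
  exists S' : seq R, forall u, u \notin S' -> k * u + c \notin S.
Proof.
move=> k0; exists [seq (v - c) / k | v <- S] => u; apply: contra => uS.
by apply/mapP; exists (k * u + c) => //; rewrite addrK mulrC mulKf.
Qed.

Section ThetaSep.
Variables (R : realType) (n : nat) (M : manifold R n) (V : cochain_complex R).
Local Notation X := (R^o * R^o)%type.
Local Notation E := 'End(V).
Variables (alpha : forall k, dform M k E) (sigma : X -> M) (k : nat) (pol : 'I_k -> halfspaces R).
Arguments alpha : clear implicits.
Hypothesis falpha : forall k, is_form (alpha k).
Hypothesis cover : square `<=` \bigcup_i hs_set (pol i).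
Hypothesis cG : {within square, continuous sigma}.
Hypothesis sm : forall i, smooth_on (square `&` hs_set (pol i)) sigma.
Local Notation e1 := ((1, 0) : X).
Local Notation e2 := ((0, 1) : X).
Local Notation e12 := ((1, 1) : X).
Local Notation athe := (athe alpha sigma).
Local Notation cthe := (cthe alpha sigma).

Definition good_theta t s := [\/ reg1 (t, s) /\ dgen pol e12 (Phi1 (t, s)),
  reg2 (t, s) /\ fgen pol (Phi2 (t, s)) | reg3 (t, s) /\ dgen pol e1 (Phi3 (t, s))].

Lemma good_theta_thin : thin2 good_theta.
Proof.
have [S1 h1] := dgen_line pol ((0, 0) : X) e1; have [S2 h2] := dgen_line pol ((0, 0) : X) e12.
have [S3 h3] := fgen_lines pol.
have n2 : (-2 : R) != 0 by rewrite oppr_eq0 pnatr_eq0.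
have sq1 (x : R) : x \notin S1 -> 0 <= x <= 1 -> dgen pol e1 ((x, 0) : X).
  by move=> xS x01; have := h1 x I xS; rewrite lineh; apply; split; rewrite //= /unit_itv /= lexx ler01.
have sq2 (x : R) : x \notin S2 -> 0 <= x <= 1 -> dgen pol e12 ((x, x) : X).
  by move=> xS x01; have := h2 x I xS; rewrite lined; apply.
have [S2' h2'] := seq_affine 1 S2 n2; have [S3' h3'] := seq_affine 1 S3 n2.
have e (t : R) : -2 * t + 1 = 1 - 2 * t by ring.
split.
  exists (2^-1 :: S2' ++ S3') => t /andP[t0 t1]; rewrite inE mem_cat !negb_or => /and3P[th tS2 tS3].
  have [tlt|tgt|teq] := ltgtP t 2^-1; last by rewrite teq eqxx in th.
    have y01 : 0 <= 1 - 2 * t <= 1 by apply/andP; split; lra.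
    have y3 : 1 - 2 * t \notin S3 by rewrite -e; exact: h3'.
    have [S' h'] := h3 _ y01 y3; exists ((1 - 2 * t) :: S') => s /andP[s0 s1]; rewrite inE negb_or => /andP[st sS].
    have [slt|sgt|seq] := ltgtP s (1 - 2 * t); last by rewrite seq eqxx in st.
      apply: Or31; split; first by rewrite /reg1 s0 t0 slt.
      by apply: sq2 => //; rewrite /= -e; exact: h2'.
    apply: Or32; split; first by rewrite /reg2 tlt sgt s1.
    by have [] := h' s (introT andP (conj (ltW s0) (ltW s1))) sS.
  have k0 : 2 - 2 * t != 0 by apply: lt0r_neq0; lra.
  have [S' h'] := seq_affine 0 S1 k0; exists S' => s /andP[s0 s1] sS; apply: Or33.
  split; first by rewrite /reg3 tgt t1 s0 s1.
  apply: sq1; first by have := h' s sS; rewrite addr0 mulrC.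
  rewrite /=; apply/andP; split; first by apply: mulr_ge0; lra.
  by rewrite -[leRHS]mulr1; apply: ler_pM; lra.
exists S3 => s /andP[s0 s1] s3; have s01 : 0 <= s <= 1 by rewrite !ltW.
have [S' h'] := h3 s s01 s3; have [S'' h''] := seq_affine 1 S' n2.
have k0 : -2 * s != 0 by rewrite mulf_neq0// gt_eqF.
have [S4 h4] := seq_affine (2 * s) S1 k0.
exists (2^-1 :: (1 - s) / 2 :: S2' ++ S'' ++ S4) => t /andP[t0 t1].
rewrite !inE !mem_cat !negb_or => /and5P[th ts tS2 tS' tS4].
have [tlt|tgt|teq] := ltgtP t 2^-1; last by rewrite teq eqxx in th.
  have y01 : 0 <= 1 - 2 * t <= 1 by apply/andP; split; lra.
  have [slt|sgt|seq] := ltgtP s (1 - 2 * t); last first.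
    by move/eqP: ts; case; rewrite seq; field.
    apply: Or32; split; first by rewrite /reg2 tlt sgt s1.
    have yS : 1 - 2 * t \notin S' by rewrite -e; exact: h''.
    by have [] := h' _ y01 yS.
  apply: Or31; split; first by rewrite /reg1 s0 t0 slt.
  by apply: sq2 => //; rewrite /= -e; exact: h2'.
apply: Or33; split; first by rewrite /reg3 tgt t1 s0 s1.
apply: sq1.
  by have := h4 t tS4; rewrite (_ : -2 * s * t + 2 * s = s * (2 - 2 * t)); last by ring.
rewrite /=; apply/andP; split; first by apply: mulr_ge0; lra.
by rewrite -[leRHS]mulr1; apply: ler_pM; lra.
Qed.

Lemma model_cvg l (w : dform M l E) (v : 'I_l -> X) (Phi : X -> X) (kf : X -> R^o) (F : X -> E) q :
  is_form w -> contform w -> {for q, continuous Phi} -> {for q, continuous kf} ->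
  (\forall p \near q, square (Phi p)) -> mdgen pol v (Phi q) ->
  (\forall p \near q, mdgen pol v (Phi p) -> F p = kf p *: pullback sigma w (Phi p) v) ->
  vcvg (nbhs q) F (F q).
Proof.
move=> fw cw cPhi ck nsq gq nF.
have sq : square (Phi q) by exact: (nbhs_singleton nsq).
have cP : Phi p @[p --> q] --> within square (nbhs (Phi q)).
  move=> A hA; have h : \forall p \near q, square (Phi p) -> A (Phi p) by exact: (cPhi _ hA).
  change (\forall p \near q, A (Phi p)).
  by apply: filterS2 h nsq => p a b; exact: a.
have ng : \forall p \near q, mdgen pol v (Phi p) by exact: (cP _ (mdgen_open gq)).
rewrite (nbhs_singleton nF gq).
have c : vcvg (nbhs q) (fun p => kf p *: pullback sigma w (Phi p) v) (kf q *: pullback sigma w (Phi q) v).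
  by apply: (vcvgZ ck); exact: (vcvg_comp cP (pullback_cvg cover cG sm fw cw sq gq)).
apply: vcvg_near c; apply: filterS2 nF ng => p a b.
by rewrite a.
Qed.

Lemma vcvg_sep (F : X -> E) (t s : R) : vcvg (nbhs ((t, s) : X)) F (F (t, s)) ->
  vcts (fun t => F (t, s)) t /\ vcts (fun s => F (t, s)) s.
Proof.
move=> c; split.
  have ct : (x, s) @[x --> t] --> ((t, s) : X).
    have -> : (fun x : R => (x, s) : X) = fun x => (x : R^o) *: e1 + (0, s) by apply/funext => x; rewrite lineh.
    rewrite -(lineh t); apply: cvgD; [apply: cvgZr_tmp; exact: cvg_id|exact: cvg_cst].
  exact: (vcvg_comp ct c).
have ct : (t, x) @[x --> s] --> ((t, s) : X).
  have -> : (fun x : R => (t, x) : X) = fun x => (x : R^o) *: e2 + (t, 0) by apply/funext => x; rewrite linev.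
  rewrite -(linev s); apply: cvgD; [apply: cvgZr_tmp; exact: cvg_id|exact: cvg_cst].
exact: (vcvg_comp ct c).
Qed.

Lemma Phi_cts q : [/\ {for q, continuous (@Phi1 R)}, {for q, continuous (@Phi2 R)} & {for q, continuous (@Phi3 R)}].
Proof.
have a1 := @cts_aff R q; have a2 := @cts2 R q.
have a3 : {for q, continuous (fun p : X => p.2 * (2 - 2 * p.1) : R^o)}.
  by apply: cvgM; [exact: cts2|apply: cvgB; [exact: cvg_cst|apply: cvgMr; exact: cts1]].
have a0 : {for q, continuous (fun _ : X => 0 : R^o)} by exact: cvg_cst.
by split; [exact: (cvg_pair a1 a1)|exact: (cvg_pair a2 a1)|exact: (cvg_pair a3 a0)].
Qed.

Lemma Phi_square (q : X) : [/\ reg1 q -> square (Phi1 q), reg2 q -> 0 < q.1 -> square (Phi2 q) & reg3 q -> square (Phi3 q)].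
Proof.
rewrite /reg1 /reg2 /reg3 /square /unit_itv; split.
- move=> /andP[/andP[a b] c]; split; rewrite /=; apply/andP; split; lra.
- move=> /andP[/andP[a b] c] d; split; rewrite /=; apply/andP; split; lra.
move=> /andP[/andP[/andP[a b] c] d]; split; rewrite /=; last by rewrite lexx ler01.
apply/andP; split; first by apply: mulr_ge0; lra.
by rewrite -[leRHS]mulr1; apply: ler_pM; lra.
Qed.

Lemma near_pos1 (q : X) : 0 < q.1 -> \forall p \near q, 0 < (p : X).1.
Proof.
by move=> q0; have cc : {for q, continuous (fun _ : X => 0 : R^o)} by [exact: cvg_cst]; exact: (near_ltX cc (@cts1 R q) q0).
Qed.

Lemma athe_cvg t s : 0 < t < 1 -> good_theta t s -> vcvg (nbhs ((t, s) : X)) (fun q => athe q.1 q.2) (athe t s).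
Proof.
move=> /andP[t0 _]; have [c1 c2 c3] := Phi_cts ((t, s) : X).
have [fa ca] := (falpha 1%N, contform1 (falpha 1%N)).
have cc (x : R) : {for ((t, s) : X), continuous (fun _ : X => x : R^o)} by exact: cvg_cst.
case=> [[r g]|[r g]|[r g]].
- apply: (@model_cvg 1 _ (fun _ => e12) (@Phi1 R) (fun _ => -2) (fun q => athe q.1 q.2) (t, s) fa ca c1 (cc _)) => //.
    by apply: filterS (near_reg1 r) => p; have [] := Phi_square p.
  by apply: filterS (near_reg1 r) => p rp gp; apply: (athe1 falpha cover sm rp); exact: gp ord0.
- apply: (@model_cvg 1 _ (fun _ => e2) (@Phi2 R) (fun _ => -2) (fun q => athe q.1 q.2) (t, s) fa ca c2 (cc _)) => //.
  + apply: filterS2 (near_reg2 r) (near_pos1 (q := (t, s)) t0) => p rp p0.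
    by have [_ h _] := Phi_square p; exact: h.
  + by move=> a; have [] := g.
  + by apply: filterS (near_reg2 r) => p rp gp; apply: (athe2 falpha cover sm rp); exact: gp ord0.
- apply: (@model_cvg 1 _ (fun _ => e1) (@Phi3 R) (fun q => -2 * q.2) (fun q => athe q.1 q.2) (t, s) fa ca c3 _) => //.
  + by apply: cvgMr; exact: cts2.
  + by apply: filterS (near_reg3 r) => p; have [] := Phi_square p.
  + by apply: filterS (near_reg3 r) => p rp gp; apply: (athe3 falpha cover sm rp); exact: gp ord0.
Qed.

Lemma cthe_cvg t s : 0 < t < 1 -> good_theta t s -> vcvg (nbhs ((t, s) : X)) (fun q => cthe q.1 q.2) (cthe t s).
Proof.
move=> /andP[t0 _]; have [c1 c2 c3] := Phi_cts ((t, s) : X).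
have [fa ca] := (falpha 2%N, contform2 (falpha 2%N)).
have cc (x : R) : {for ((t, s) : X), continuous (fun _ : X => x : R^o)} by exact: cvg_cst.
case=> [[r g]|[r g]|[r g]].
- rewrite (cthe1 sigma falpha r : cthe t s = 0); generalize (vcvg_cst (nbhs ((t, s) : X)) (0 : E)); apply: vcvg_near.
  by apply: filterS (near_reg1 r) => p rp; rewrite (cthe1 sigma falpha rp).
- apply: (@model_cvg 2 _ (pair2 e1 e2) (@Phi2 R) (fun _ => 2) (fun q => cthe q.1 q.2) (t, s) fa ca c2 (cc _)).
  + apply: filterS2 (near_reg2 r) (near_pos1 (q := (t, s)) t0) => p rp p0.
    by have [_ h _] := Phi_square p; exact: h.
  + exact: mdgen_pair2.
  + apply: filterS (near_reg2 r) => p rp gp; apply: (cthe2 falpha cover sm rp).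
    by split; [exact: gp ord0|exact: gp ord_max].
- rewrite (cthe3 falpha cover sm r g : cthe t s = 0); generalize (vcvg_cst (nbhs ((t, s) : X)) (0 : E)); apply: vcvg_near.
  have nsq : \forall p \near ((t, s) : X), square (Phi3 p) by apply: filterS (near_reg3 r) => p; have [] := Phi_square p.
  have ng : \forall p \near ((t, s) : X), square (Phi3 p) -> dgen pol e1 (Phi3 p) by exact: (c3 _ (dgen_open g)).
  by apply: filterS3 (near_reg3 r) nsq ng => p rp sp gp; rewrite (cthe3 falpha cover sm rp)//; exact: gp.
Qed.

Lemma athe_sep : exists2 Ma, 0 <= Ma & sep Ma athe.
Proof.
have [L1 L10 h1] := pullback_bounded cover cG sm (fun _ : 'I_1 => e12) (falpha 1%N) (contform1 (falpha 1%N)).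
have [L2 L20 h2] := pullback_bounded cover cG sm (fun _ : 'I_1 => e2) (falpha 1%N) (contform1 (falpha 1%N)).
have [L3 L30 h3] := pullback_bounded cover cG sm (fun _ : 'I_1 => e1) (falpha 1%N) (contform1 (falpha 1%N)).
exists (2 * (L1 + L2 + L3)); first by rewrite mulr_ge0 ?addr_ge0.
apply: thin2S good_theta_thin => t s t01 s01 g; have [ct cs] := vcvg_sep (athe_cvg t01 g).
split; [|exact: ct|exact: cs]; have /andP[s0 s1] := s01.
case: g => [[r g]|[r [_ g]]|[r g]].
- rewrite (athe1 falpha cover sm r g : athe t s = _) vnZ normrN ger0_norm// ler_wpM2l//.
  have [sq _ _ _] := g; apply: le_trans (h1 _ sq (fun=> g)) _; lra.
- rewrite (athe2 falpha cover sm r g : athe t s = _) vnZ normrN ger0_norm// ler_wpM2l//.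
  have [sq _ _ _] := g; apply: le_trans (h2 _ sq (fun=> g)) _; lra.
- have s0' : 0 <= s by exact: ltW.
  have n2s : `|-2 * s| = 2 * s by rewrite mulNr normrN ger0_norm// mulr_ge0.
  rewrite (athe3 falpha cover sm r g : athe t s = _) vnZ [(t, s).2]/= n2s -mulrA ler_wpM2l//.
  have [sq _ _ _] := g; rewrite -[leRHS]mul1r; apply: ler_pM; [exact: s0'|exact: vn_ge0|exact: ltW|].
  by apply: le_trans (h3 _ sq (fun=> g)) _; lra.
Qed.

Lemma cthe_sep : exists2 Mc, 0 <= Mc & sep Mc cthe.
Proof.
have [L L0 h] := pullback_bounded cover cG sm (pair2 e1 e2) (falpha 2%N) (contform2 (falpha 2%N)).
exists (2 * L); first by rewrite mulr_ge0.
apply: thin2S good_theta_thin => t s t01 s01 g; have [ct cs] := vcvg_sep (cthe_cvg t01 g).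
split; [|exact: ct|exact: cs]; case: g => [[r g]|[r g]|[r g]].
- by rewrite (cthe1 sigma falpha r : cthe t s = 0) vn0 mulr_ge0.
- rewrite (cthe2 falpha cover sm r g : cthe t s = _) vnZ ger0_norm// ler_wpM2l//.
  by apply: h; [have [[]] := g|exact: mdgen_pair2].
- by rewrite (cthe3 falpha cover sm r g : cthe t s = 0) vn0 mulr_ge0.
Qed.

End ThetaSep.

Section ConstantFactors.
Variables (R : realType) (U : vectType R).
Local Notation E := 'End(U).

Lemma vpc_comp a b (f g : R -> E) : vpc a b f -> vpc a b g -> vpc a b (fun t => (f t \o g t)%VF).
Proof. by move=> pf pg; exact: (vpc_bil (bil_comp U) pf pg). Qed.

Lemma vint_compl a b (x : E) (f : R -> E) : a <= b -> vpc a b f ->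
  vintegral a b (fun t => x \o f t)%VF = (x \o vintegral a b f)%VF.
Proof.
move=> ab pf; have := vprim_bil ab (bil_comp U) (vprim_cst0 a b x) (vprim_int pf).
move=> [_ /(_ b)]; rewrite vint_point comp_lfun0r add0r => ->; last by rewrite ab lexx.
by apply: eq_vint => t _; rewrite comp_lfun0l add0r.
Qed.

Lemma vint_compr a b (x : E) (f : R -> E) : a <= b -> vpc a b f ->
  vintegral a b (fun t => f t \o x)%VF = (vintegral a b f \o x)%VF.
Proof.
move=> ab pf; have := vprim_bil ab (bil_comp U) (vprim_int pf) (vprim_cst0 a b x).
move=> [_ /(_ b)]; rewrite vint_point comp_lfun0l add0r => ->; last by rewrite ab lexx.
by apply: eq_vint => t _; rewrite comp_lfun0r addr0.
Qed.

End ConstantFactors.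

Section ThetaTimes.
Variables (R : realType) (s t : R).

Lemma theta_diag_time : 0 < s -> s < 1 -> 0 <= t -> t <= (1 - s) / 2 -> 0 <= -2 * t + 1 <= 1.
Proof. by move=> s0 s1 a b; apply/andP; split; lra. Qed.

Lemma theta_diag_time_lt : 0 < s -> s < 1 -> 0 < t -> t < (1 - s) / 2 -> 0 < -2 * t + 1 < 1.
Proof. by move=> s0 s1 a b; apply/andP; split; lra. Qed.

Lemma theta_vert_time : 0 < s -> s < 1 -> (1 - s) / 2 <= t -> t <= 2^-1 -> 0 <= -2 * t + 1 <= 1.
Proof. by move=> s0 s1 a b; apply/andP; split; lra. Qed.

Lemma theta_vert_time_lt : 0 < s -> s < 1 -> (1 - s) / 2 < t -> t < 2^-1 -> 0 < -2 * t + 1 < 1.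
Proof. by move=> s0 s1 a b; apply/andP; split; lra. Qed.

Lemma theta_bottom_time : 0 < s -> s < 1 -> 2^-1 <= t -> t <= 1 -> 0 <= -2 * s * t + 2 * s <= 1.
Proof.
move=> s0 s1 a b; have -> : -2 * s * t + 2 * s = s * (2 - 2 * t) by ring.
apply/andP; split; first by apply: mulr_ge0; lra.
by rewrite -[leRHS]mulr1; apply: ler_pM; lra.
Qed.

Lemma theta_bottom_time_lt : 0 < s -> s < 1 -> 2^-1 < t -> t < 1 -> 0 < -2 * s * t + 2 * s < 1.
Proof.
move=> s0 s1 a b; have -> : -2 * s * t + 2 * s = s * (2 - 2 * t) by ring.
apply/andP; split; first by apply: mulr_gt0; lra.
by apply: le_lt_trans (_ : s * 1 < 1); [apply: ler_wpM2l; lra|rewrite mulr1].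
Qed.

Lemma theta_diag_or_bottom : 0 < s -> s < 1 -> t < 2^-1 -> 1 - 2 * t < s -> ~~ ((t < (1 - s) / 2) || (2^-1 < t)).
Proof. by move=> s0 s1 a b; rewrite negb_or -!leNgt; apply/andP; split; lra. Qed.

End ThetaTimes.

Lemma vint_affine (R : realType) (W : vectType R) (b : R) (h : R -> W) : 0 <= b ->
  vpc ((1 - b) / 2) 2^-1 h ->
  vpc 0 b (fun u => h ((1 - u) / 2)) /\
  vintegral ((1 - b) / 2) 2^-1 h = 2^-1 *: vintegral 0 b (fun u => h ((1 - u) / 2)).
Proof.
move=> b0 ph; have k0 : (- 2^-1 : R) != 0 by rewrite oppr_eq0 invr_neq0.
have e u : - 2^-1 * u + 2^-1 = (1 - u) / 2 :> R by field.
have mb : (1 - b) / 2 <= 2^-1 :> R by lra.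
have := vprim_affine (k := - 2^-1) (c := 2^-1) mb b0 k0 _ _ (vprim_int ph).
have -> : (fun s => - 2^-1 *: h (- 2^-1 * s + 2^-1)) = (fun s => - 2^-1 *: h ((1 - s) / 2)) by apply/funext => s; rewrite e.
case; [by move=> s /andP[s0 sb]; rewrite e; apply/andP; split; lra|by move=> s /andP[s0 sb]; rewrite e; apply/andP; split; lra|].
move=> ph' /(_ b); rewrite e mulr0 add0r vint_point b0 lexx => /(_ isT) /esym/eqP; rewrite addrC addr_eq0 => /eqP e1.
have ph2 : vpc 0 b (fun u => h ((1 - u) / 2)).
  have := vpcZ (-2) ph'; apply: (vpc_eq (S := [::])) => t _ _.
  by rewrite scalerA mulrNN mulfV// scale1r.
split=> //; have -> : vintegral ((1 - b) / 2) 2^-1 h = - vintegral 0 b (fun s => - 2^-1 *: h ((1 - s) / 2)) by rewrite e1 opprK.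
by rewrite vintZ// scaleNr opprK.
Qed.

(** The algebra of the three stretches, separated from the geometry. [D] is the transport along the
    first stretch, [b] the field of the column, [P] the transport along the bottom to (s, 0). Only
    the middle stretch contributes, and the substitution u = 1 - 2 t absorbs the factor 2 of the
    integrand. *)
Lemma zint_pieces (R : realType) (U' : vectType R) (s : R) (a c b cur : R -> 'End(U')) (D P Pi : 'End(U')) (S : seq R) :
  0 < s < 1 -> vpc 0 1 a -> vpc 0 1 c -> vpc 0 1 b -> evo a ((1 - s) / 2) = D ->
  (forall t, (1 - s) / 2 <= t <= 2^-1 -> (evo a t \o (evi a ((1 - s) / 2) \o evo b s))%VF = evo b (-2 * t + 1)) ->
  (evo a 1 \o (evi a (2^-1)%R \o P))%VF = \1%VF -> (P \o Pi)%VF = \1%VF ->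
  (forall t, 0 < t < 1 -> t \notin S -> (t < (1 - s) / 2) || (2^-1 < t) -> c t = 0) ->
  (forall t, (1 - s) / 2 < t < 2^-1 -> t \notin S -> c t = 2 *: cur (1 - 2 * t)) ->
  vpc 0 s (fun u => evi b u \o (cur u \o evo b u))%VF /\
  (evo a 1 \o vintegral 0 1 (fun t => evi a t \o (c t \o evo a t)))%VF =
  (Pi \o (vintegral 0 s (fun u => evi b u \o (cur u \o evo b u)) \o (evi b s \o D)))%VF.
Proof.
set m := (1 - s) / 2; pose U := evo a; pose Ui := evi a.
move=> s01 pa pc pT Um u2 u3 PPi c0 c2.
have /andP[s0 s1] := s01; have s01' : 0 <= s <= 1 by rewrite !ltW.
have m0 : 0 <= m by rewrite /m; lra.
have mh : m <= 2^-1 by rewrite /m; lra.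
have m1 : m <= 1 by rewrite /m; lra.
have h1' : 2^-1 <= 1 :> R by lra.
have h0 : 0 <= 2^-1 :> R by rewrite invr_ge0.
have m01 : 0 <= m <= 1 by rewrite m0 m1.
have h01 : 0 <= (2^-1 : R) <= 1 by rewrite h0 h1'.
have o01 : 0 <= (1 : R) <= 1 by rewrite ler01 lexx.
have eh : -2 * 2^-1 + 1 = 0 :> R by field.
have [Rw RwE] : exists Rw, Rw = (Ui m \o evo b s)%VF by exists (Ui m \o evo b s)%VF.
have [R' R'E] : exists R', R' = (evi b s \o U m)%VF by exists (evi b s \o U m)%VF.
rewrite -/U -/Ui -RwE in u2.
have RR' : (Rw \o R' = \1)%VF.
  by rewrite RwE R'E -comp_lfunA (comp_lfunA (evo b s)) (eviK pT s01') comp_lfun1l (evoK pa m01).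
have R'R : (R' \o Rw = \1)%VF.
  by rewrite RwE R'E -comp_lfunA (comp_lfunA (U m)) (eviK pa m01) comp_lfun1l (evoK pT s01').
have x01 t : m <= t <= 2^-1 -> 0 <= -2 * t + 1 <= 1 by clear -m0; move=> /andP[ta tb]; apply/andP; split; lra.
have tt01 t : m <= t <= 2^-1 -> 0 <= t <= 1 by move=> /andP[ta tb]; rewrite (le_trans m0 ta) (le_trans tb).
have Ut t : m <= t <= 2^-1 -> U t = (evo b (-2 * t + 1) \o R')%VF.
  by move=> ht; rewrite -(u2 t ht) -comp_lfunA RR' comp_lfun1r.
have Uit t : m <= t <= 2^-1 -> Ui t = (Rw \o evi b (-2 * t + 1))%VF.
  move=> ht; rewrite -[LHS]comp_lfun1r -(eviK pT (x01 t ht)) -(u2 t ht) !comp_lfunA.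
  by rewrite (evoK pa (tt01 t ht)) comp_lfun1l.
have hh : m <= (2^-1 : R) <= 2^-1 by rewrite mh lexx.
have Rwh : Rw = Ui (2^-1)%R.
  rewrite (Uit _ hh) eh (evi0 pT) comp_lfun1r //.
have {u3}UR : (U 1 \o Rw)%VF = Pi.
  by move: u3; rewrite -/U -/Ui -Rwh comp_lfunA => e; rewrite -[LHS]comp_lfun1r -PPi comp_lfunA e comp_lfun1l.
pose g t := (Ui t \o (c t \o U t))%VF.
have pg : vpc 0 1 g.
  apply: vpc_comp; first exact: vprim_pc ler01 (evi_prim pa).
  by apply: vpc_comp => //; exact: vprim_pc ler01 (evo_prim pa).
have pgm : vpc m 2^-1 g by exact: vpc_sub pg.
have Ig : vintegral 0 1 g = vintegral m 2^-1 g.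
  rewrite (vint_chasles m01 pg) (vint_chasles (c := 2^-1) (a := m) (b := 1)) ?mh//; last exact: vpc_sub pg.
  rewrite (@eq_vint_off _ _ 0 m g (fun=> 0) S)//; [|exact: vpc_sub pg|]; last first.
    move=> t /andP[t0 tm] tS; have t01 : 0 < t < 1 by rewrite t0 (lt_le_trans tm).
    by rewrite /g c0 ?tm// comp_lfun0l comp_lfun0r.
  rewrite (@eq_vint_off _ _ 2^-1 1 g (fun=> 0) S)//; [|exact: vpc_sub pg|]; last first.
    move=> t /andP[t0 tm] tS; have t01 : 0 < t < 1 by rewrite tm (le_lt_trans _ t0).
    by rewrite /g c0 ?t0 ?orbT// comp_lfun0l comp_lfun0r.
  by rewrite !vint0 add0r addr0.
pose h2 t := (R' \o (g t \o Rw))%VF.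
have ph2 : vpc m 2^-1 h2 by apply: vpc_comp; [exact: vpc_cst|apply: vpc_comp => //; exact: vpc_cst].
have Ih2 : vintegral m 2^-1 h2 = (R' \o (vintegral m (2^-1)%R g \o Rw))%VF.
  by rewrite /h2 vint_compl// ?vint_compr//; apply: vpc_comp => //; exact: vpc_cst.
have h2E t : m < t < 2^-1 -> t \notin S -> h2 t = 2 *: (evi b (1 - 2 * t) \o (cur (1 - 2 * t) \o evo b (1 - 2 * t)))%VF.
  move=> /andP[tm th] tS; have tmh : m <= t <= 2^-1 by rewrite !ltW.
  have ct := c2 t (introT andP (conj tm th)) tS.
  rewrite /h2 /g ct (Ut t tmh) (Uit t tmh) (_ : -2 * t + 1 = 1 - 2 * t); last by ring.
  rewrite !comp_lfunA R'R comp_lfun1l -!comp_lfunA R'R comp_lfun1r.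
  by rewrite -comp_lfunZl -comp_lfunZr.
have [ph3 Ih3] := vint_affine (ltW s0) ph2.
have k2 : (- 2^-1 : R) != 0 by rewrite oppr_eq0 invr_neq0.
have [S' hS'] := seq_affine 2^-1 S k2.
pose f u := (evi b u \o (cur u \o evo b u))%VF.
have fE u : 0 < u < s -> u \notin S' -> 2^-1 *: h2 ((1 - u) / 2) = f u.
  move=> /andP[u0 us] uS; rewrite h2E; first last.
  - by have := hS' u uS; rewrite (_ : - 2^-1 * u + 2^-1 = (1 - u) / 2)//; field.
  - by rewrite /m; apply/andP; split; lra.
  by rewrite scalerA mulVf// scale1r (_ : 1 - 2 * ((1 - u) / 2) = u)//; field.
have pf : vpc 0 s f by apply: vpc_eq fE (vpcZ 2^-1 ph3).
have If : vintegral 0 s f = (R' \o (vintegral m (2^-1)%R g \o Rw))%VF.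
  have e1 := eq_vint_off (ltW s0) (vpcZ 2^-1 ph3) fE.
  have e2 := vintZ 2^-1 (ltW s0) ph3.
  exact: (etrans (esym e1) (etrans e2 (etrans (esym Ih3) Ih2))).
have fin (J I : 'End(U')) : J = (R' \o (I \o Rw))%VF -> (U 1 \o I)%VF = (Pi \o (J \o (evi b s \o D)))%VF.
  move=> ->; rewrite -Um -UR -!comp_lfunA -R'E RR' comp_lfun1r.
  by rewrite (comp_lfunA Rw) RR' comp_lfun1l.
split; first exact: pf.
exact: (etrans (congr1 (fun x => (U 1 \o x)%VF) Ig) (fin _ _ If)).
Qed.

Section EvolutionTheta.
Variables (R : realType) (n : nat) (M : manifold R n) (V : cochain_complex R).
Local Notation X := (R^o * R^o)%type.
Local Notation E := 'End(V).
Variables (alpha : forall k, dform M k E) (sigma : X -> M) (k : nat) (pol : 'I_k -> halfspaces R).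
Arguments alpha : clear implicits.
Hypothesis falpha : forall k, is_form (alpha k).
Hypothesis cover : square `<=` \bigcup_i hs_set (pol i).
Hypothesis cG : {within square, continuous sigma}.
Hypothesis sm : forall i, smooth_on (square `&` hs_set (pol i)) sigma.
Local Notation e1 := ((1, 0) : X).
Local Notation e2 := ((0, 1) : X).
Local Notation e12 := ((1, 1) : X).
Local Notation athe := (athe alpha sigma).
Local Notation cthe := (cthe alpha sigma).
Local Notation lf := (linefield (alpha 1%N) sigma).
Local Notation P0 := (evo (lf e1 (0, 0))).
Local Notation P0i := (evi (lf e1 (0, 0))).
Local Notation T x := (evo (lf e2 (x, 0))).
Local Notation Ti x := (evi (lf e2 (x, 0))).
Local Notation Td := (evo (lf e12 (0, 0))).
Local Notation Tdi := (evi (lf e12 (0, 0))).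
Local Notation cur := (fcurv (alpha 2%N) sigma).

Lemma evo_affine_piece (a b : R -> E) p q (kk c : R) (S : seq R) : vpc 0 1 a -> vpc 0 1 b -> kk != 0 ->
  0 <= p -> p <= q -> q <= 1 ->
  (forall s, p <= s <= q -> 0 <= kk * s + c <= 1) ->
  (forall s, p < s < q -> 0 < kk * s + c < 1) ->
  (forall t, p < t < q -> t \notin S -> a t = kk *: b (kk * t + c)) ->
  forall t, p <= t <= q -> (evo a t \o (evi a p \o evo b (kk * p + c)))%VF = evo b (kk * t + c).
Proof.
move=> pa pb k0 p0 pq q1 h1 h2 hab t tpq.
have v := vprim_affine ler01 pq k0 h1 h2 (evo_prim pb).
apply: (evo_unique (S := S) pa p0 pq q1 _ v tpq) => u u1 u2.
by rewrite hab// -comp_lfunZl scalerN.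
Qed.

Definition vert_int s : E := vintegral 0 s (fun u => Ti s u \o (cur (s, u) \o T s u))%VF.

(** Read from the right: along the diagonal from (1, 1) to (s, s), down the column to (s, 0), the
    integral of alpha^2 along that column transported to (s, 0), and back along the bottom to the
    origin. *)
Lemma zint_theta : exists S : seq R, forall s, 0 < s < 1 -> s \notin S ->
  vpc 0 s (fun u => Ti s u \o (cur (s, u) \o T s u))%VF /\
  zint athe cthe s = (P0i s \o (vert_int s \o (Ti s s \o (Td s \o Tdi 1))))%VF.
Proof.
have [fA cA] := (falpha 1%N, contform1 (falpha 1%N)).
have [Ma Ma0 ha] := athe_sep falpha cover cG sm; have [Mc Mc0 hc] := cthe_sep falpha cover cG sm.
have [S1 h1] := sep_vpcb ha; have [S2 h2] := sep_vpcb hc; have [_ [S3 h3]] := good_theta_thin pol.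
exists (S1 ++ S2 ++ S3) => s s01; rewrite !mem_cat !negb_or => /and3P[/(h1 s s01) pa /(h2 s s01) pc /(h3 s s01)[S good]].
have {}pa : vpc 0 1 (athe^~ s) by exists Ma.
have {}pc : vpc 0 1 (cthe^~ s) by exists Mc.
have /andP[s0 s1] := s01; have s01' : 0 <= s <= 1 by rewrite !ltW.
have z01 : 0 <= (0 : R) <= 1 by rewrite lexx ler01.
have pd := Td_vpc fA cover cG sm; have pT := T_vpc fA cover cG sm s01'.
have pP := P_vpc fA cover cG sm z01.
pose m := (1 - s) / 2; have m0 : 0 <= m by rewrite /m; lra.
have mh : m <= 2^-1 by rewrite /m; lra.
have m1 : m <= 1 by rewrite /m; lra.
have h1' : 2^-1 <= 1 :> R by lra.
have n2 : (-2 : R) != 0 by rewrite oppr_eq0 pnatr_eq0.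
have n2s : -2 * s != 0 by rewrite mulf_neq0// gt_eqF.
have a1 t : 0 < t < m -> t \notin S -> athe t s = -2 *: lf e12 (0, 0) (-2 * t + 1).
  move=> /andP[t0 tm] tS; have t01 : 0 < t < 1 by rewrite t0 (lt_le_trans tm).
  have r1 : reg1 (t, s) by rewrite /reg1 /= s0 t0 /=; rewrite /m in tm; lra.
  have [[_ g]|[r _]|[r _]] := good t t01 tS.
  - rewrite (athe1 falpha cover sm r1 g : athe t s = _) /linefield lined /Phi1 /=.
    by rewrite (_ : -2 * t + 1 = 1 - 2 * t)//; ring.
  - by exfalso; move: r; rewrite /reg2 /m in tm *; case/andP=> /andP[a b] c; rewrite /= in b; lra.
  - by exfalso; move: r; rewrite /reg3 /m in tm *; case/andP=> /andP[/andP[a b] c] d; rewrite /= in a; lra.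
have a2 t : m < t < 2^-1 -> t \notin S -> athe t s = -2 *: lf e2 (s, 0) (-2 * t + 1) /\
    cthe t s = 2 *: cur (s, 1 - 2 * t).
  move=> /andP[tm th] tS; have t01 : 0 < t < 1 by rewrite (le_lt_trans m0 tm) /=; lra.
  have r2 : reg2 (t, s) by rewrite /reg2 /= th s1 andbT /=; rewrite /m in tm; lra.
  have [[r _]|[_ g]|[r _]] := good t t01 tS.
  - by exfalso; move: r; rewrite /reg1 /m in tm *; case/andP=> /andP[a b] c; rewrite /= in c; lra.
  - split; last exact: (cthe2 falpha cover sm r2 g).
    have [_ g2] := g; rewrite (athe2 falpha cover sm r2 g2 : athe t s = _) /linefield linev /Phi2 /=.
    by rewrite (_ : -2 * t + 1 = 1 - 2 * t)//; ring.
  - by exfalso; move: r; rewrite /reg3 /m in tm *; case/andP=> /andP[/andP[a b] c] d; rewrite /= in a; lra.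
have a3 t : 2^-1 < t < 1 -> t \notin S -> athe t s = (-2 * s) *: lf e1 (0, 0) (-2 * s * t + 2 * s).
  move=> /andP[th t1] tS; have t01 : 0 < t < 1 by rewrite t1 andbT; lra.
  have r3 : reg3 (t, s) by rewrite /reg3 /= th t1 s0.
  have [[r _]|[r _]|[_ g]] := good t t01 tS.
  - by exfalso; move: r; rewrite /reg1; case/andP=> /andP[a b] c; rewrite /= in a b c; lra.
  - by exfalso; move: r; rewrite /reg2; case/andP=> /andP[a b] c; rewrite /= in a; lra.
  - rewrite (athe3 falpha cover sm r3 g : athe t s = _) /linefield lineh /Phi3 /=.
    by rewrite (_ : -2 * s * t + 2 * s = s * (2 - 2 * t))//; ring.
have c0 t : 0 < t < 1 -> t \notin S -> (t < m) || (2^-1 < t) -> cthe t s = 0.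
  move=> t01 tS tm; have [[r _]|[r _]|[r g]] := good t t01 tS.
  - exact: (cthe1 sigma falpha r).
  - by move: r => /andP[/andP[a b] _]; move: (theta_diag_or_bottom s0 s1 a b); rewrite tm.
  - exact: (cthe3 falpha cover sm r g).
pose U := evo (athe^~ s); pose Ui := evi (athe^~ s).
have u1 t : 0 <= t <= m -> (U t \o (Ui 0 \o Td (-2 * 0 + 1)))%VF = Td (-2 * t + 1).
  apply: (evo_affine_piece pa pd n2 (lexx 0) m0 m1 _ _ a1) => t' /andP[t0 tm]; [exact: (theta_diag_time s0 s1)|exact: (theta_diag_time_lt s0 s1)].
have u2 t : m <= t <= 2^-1 -> (U t \o (Ui m \o T s (-2 * m + 1)))%VF = T s (-2 * t + 1).
  apply: (evo_affine_piece pa pT n2 m0 mh h1' _ _ (fun t a b => proj1 (a2 t a b))) => t' /andP[t0 tm]; [exact: (theta_vert_time s0 s1)|exact: (theta_vert_time_lt s0 s1)].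
have h0 : 0 <= 2^-1 :> R by rewrite invr_ge0.
have u3 t : 2^-1 <= t <= 1 -> (U t \o (Ui (2^-1)%R \o P0 (-2 * s * 2^-1 + 2 * s)%R))%VF = P0 (-2 * s * t + 2 * s).
  apply: (evo_affine_piece pa pP n2s h0 h1' (lexx 1) _ _ a3) => t' /andP[t0 tm]; [exact: (theta_bottom_time s0 s1)|exact: (theta_bottom_time_lt s0 s1)].
have m01 : 0 <= m <= 1 by rewrite m0 m1.
have h01 : 0 <= (2^-1 : R) <= 1 by rewrite h0 h1'.
have o01 : 0 <= (1 : R) <= 1 by rewrite ler01 lexx.
have em : -2 * m + 1 = s by rewrite /m; field.
have eh : -2 * 2^-1 + 1 = 0 :> R by field.
have {u1}Um : U m = (Td s \o Tdi 1)%VF.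
  have := u1 m; rewrite m0 lexx /Ui (evi0 pa) comp_lfun1l mulr0 add0r em => /(_ isT) <-.
  by rewrite -comp_lfunA (eviK pd o01) comp_lfun1r.
have u3' : (U 1 \o (Ui (2^-1)%R \o P0 s))%VF = \1%VF.
  have := u3 1; rewrite h1' lexx => /(_ isT).
  have -> : -2 * s * 2^-1 + 2 * s = s by field.
  have -> : -2 * s * 1 + 2 * s = 0 by ring.
  by rewrite (evo0 pP).
rewrite em in u2.
exact: (zint_pieces (S := S) s01 pa pc pT Um u2 u3' (eviK pP s01') c0 (fun t th tS => proj2 (a2 t th tS))).
Qed.

End EvolutionTheta.

(** * The difference of the two simplices *)

Section Swap.
Variables (R : realType) (n : nat) (M : manifold R n).
Local Notation X := (R^o * R^o)%type.

(** Of the two triangles of a 2-path, one is its restriction and the other its composite with this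
    reflection, so the results on [int2] apply to both once the pieces are reflected. *)
Definition swap (p : X) : X := (p.2, p.1).

Lemma swap_linear : linear swap. Proof. by []. Qed.
HB.instance Definition _ := GRing.isLinear.Build R X X *:%R swap swap_linear.

Lemma swap_cts : continuous swap.
Proof. by move=> p; exact: (cvg_pair (@cts2 R p) (@cts1 R p)). Qed.

Definition swap_halfspaces (q : halfspaces R) := HalfSpaces (fun j => (hs_form j \o swap : {linear X -> R^o})) (@hs_bound R q).

Lemma Ck_swap l U (f : X -> R^o) : Ck l U f -> Ck l (swap @^-1` U) (f \o swap).
Proof.
elim: l U f => [|l IH] U f [cf h].
  by split=> // x Ux; apply: continuous_comp; [exact: swap_cts|exact: cf].
split; first by move=> x Ux; apply: continuous_comp; [exact: swap_cts|exact: cf].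
move=> v; have [d c] := h (swap v); split; first by move=> x Ux; exact: (d (swap x) Ux).
exact: (IH _ _ c).
Qed.

Variables (G : X -> M) (k : nat) (pol : 'I_k -> halfspaces R).

Lemma swap_square x : square x -> square (swap x). Proof. by case. Qed.

Lemma swap_cover : square `<=` \bigcup_i hs_set (pol i) -> square `<=` \bigcup_i hs_set (swap_halfspaces (pol i)).
Proof. by move=> cov x /swap_square/cov[i _ h]; exists i. Qed.

Lemma swap_continuous : {within square, continuous G} -> {within square, continuous (G \o swap)}.
Proof.
move=> /subspace_continuousP cG; apply/subspace_continuousP => x sx.
have sc : swap y @[y --> within square (nbhs x)] --> within square (nbhs (swap x)).
  move=> B hB; have h : \forall y \near x, square (swap y) -> B (swap y) by exact: (swap_cts hB).
  by apply: filterS h => y hy sy; apply: hy; exact: swap_square.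
exact: (cvg_comp _ _ sc (cG _ (swap_square sx))).
Qed.

Lemma swap_smooth i : smooth_on (square `&` hs_set (pol i)) G ->
  smooth_on (square `&` hs_set (swap_halfspaces (pol i))) (G \o swap).
Proof.
move=> sm x [sx hx]; have [c [U [F [oU Ux sF h]]]] := sm _ (conj (swap_square sx) hx).
exists c, (swap @^-1` U), (F \o swap); split=> //.
- by apply: open_comp => // y _; exact: swap_cts.
- by move=> l j; exact: (Ck_swap (sF l j)).
- by move=> y Uy [sy hy]; apply: h => //; split=> //; exact: swap_square.
Qed.

Lemma pullback_swap (W : Type) l (w : dform M l W) p v : pullback (G \o swap) w p v = pullback G w (swap p) (fun a => swap (v a)).
Proof. by []. Qed.

End Swap.

Section Difference.
Variables (R : realType) (n : nat) (M : manifold R n) (V : cochain_complex R).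
Local Notation X := (R^o * R^o)%type.
Local Notation E := 'End(V).
Variables (alpha : forall k, dform M k E) (F2 : dform M 2 E) (G : X -> M) (k : nat) (pol : 'I_k -> halfspaces R).
Arguments alpha : clear implicits.
Local Notation A := (alpha 1%N).
Hypothesis falpha : forall k, is_form (alpha k).
Hypothesis fF : is_form F2.
Hypothesis hF : forall c z u v, @chart_img _ _ M c z -> F2 c z (pair2 u v) =
  vderive (fun x => A c x (fun _ => v)) z u - vderive (fun x => A c x (fun _ => u)) z v +
  ((A c z (fun _ => u) \o A c z (fun _ => v))%VF - (A c z (fun _ => v) \o A c z (fun _ => u))%VF).
Hypothesis cover : square `<=` \bigcup_i hs_set (pol i).
Hypothesis cG : {within square, continuous G}.
Hypothesis sm : forall i, smooth_on (square `&` hs_set (pol i)) G.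
Hypothesis left_const : forall s : R, 0 <= s <= 1 -> G (0, s) = G (0, 0).
Local Notation e1 := ((1, 0) : X).
Local Notation e2 := ((0, 1) : X).
Local Notation e12 := ((1, 1) : X).
Local Notation lf := (linefield A G).
Local Notation P y := (evo (lf e1 (0, y))).
Local Notation Q y := (evi (lf e1 (0, y))).
Local Notation T x := (evo (lf e2 (x, 0))).
Local Notation Ti x := (evi (lf e2 (x, 0))).
Local Notation Td := (evo (lf e12 (0, 0))).
Local Notation Tdi := (evi (lf e12 (0, 0))).
Local Notation cur := (fcurv (alpha 2%N) G).
Local Notation ct := (gcurv A (alpha 2%N) G).
Local Notation cint := (bt A (alpha 2%N) G).
Local Notation bt := (bt A F2 G).
Local Notation o := (0 : R).

Definition vcol x := evo (fun u => bt u x).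
Definition vcoli x := evi (fun u => bt u x).
Definition vdiag := evo (fun u => bt u u).
Definition vdiagi := evi (fun u => bt u u).

Let fA : is_form A. Proof. exact: falpha. Qed.

Lemma left_transport0 t : 0 <= t <= 1 -> T 0 t = \1%VF /\ Ti 0 t = \1%VF.
Proof.
move=> t01; have z01 : 0 <= (0 : R) <= 1 by rewrite lexx ler01.
have pT := T_vpc fA cover cG sm z01.
have T1 : T 0 t = \1%VF.
  have v : forall u, 0 < u < 1 -> u \notin [::] -> (0 : E) = - (lf e2 (0, 0) u \o \1)%VF.
    move=> u /andP[u0 u1] _; rewrite comp_lfun1r /linefield linev /pullback.
    set c := chart_at _; have -> : vderive (chart_of c \o G) (0, u) e2 = 0.
      apply: is_vderive_vderive; apply: (is_vderive_near (F := fun _ => chart_of c (G (0, u)))) => //; last exact: is_vderive_cst.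
      apply: nbhs_dnbhs; have n1 : \forall h \near (0 : R), 0 < h + u < 1.
        have hc : h + u @[h --> (0 : R)] --> u.
          by rewrite -[X in _ --> X]add0r; apply: cvgD; [exact: cvg_id|exact: cvg_cst].
        have n2 : \forall x \near u, 0 < x < 1 by apply: near_itvoo; rewrite u0 u1.
        exact: (hc _ n2).
      apply: filterS n1 => h /andP[h0 h1].
      have -> : h *: e2 + (0, u) = (0, h + u) :> X.
        by congr pair; rewrite /= scaleRoE ?mulr0 ?mulr1 ?addr0.
      by rewrite /= left_const ?(left_const (s := h + u)) ?ltW.
    rewrite -(formhomE fA _ (chart_img_at (G (0, u)))) linear0 oppr0 //.
  have := evo_unique pT (lexx 0) ler01 (lexx 1) v (vprim_cst0 0 1 (\1%VF : E)) t01.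
  by rewrite (evi0 pT) !comp_lfun1r.
by split=> //; rewrite -[LHS]comp_lfun1r -T1 (evoK pT t01).
Qed.

Lemma cur_swap s u : fcurv (alpha 2%N) (G \o @swap R) (s, u) = - cur (u, s).
Proof.
rewrite /fcurv pullback_swap /=; have [_ _ h] := form2_rules (G (u, s)) (falpha 2%N).
rewrite /pullback /= -[RHS]scaleN1r.
set c := chart_at _; set z := chart_of _ _.
have := h 1 (vderive (chart_of c \o G) (u, s) e1) (vderive (chart_of c \o G) (u, s) e2).
rewrite /= scale1r => h'.
have e1' : (fun a => vderive (chart_of c \o G) (swap (s, u)) (swap (pair2 e1 e2 a))) =
    pair2 (vderive (chart_of c \o G) (u, s) e2) (vderive (chart_of c \o G) (u, s) e1).
  by apply/funext => a; rewrite /pair2; case: ifP.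
have e2' : (fun a => vderive (chart_of c \o G) (u, s) (pair2 e1 e2 a)) =
    pair2 (vderive (chart_of c \o G) (u, s) e1) (vderive (chart_of c \o G) (u, s) e2).
  by apply/funext => a; rewrite /pair2; case: ifP.
exact: (etrans (congr1 _ e1') (etrans h' (congr1 (fun v => -1 *: alpha 2%N c z v) (esym e2')))).
Qed.

Definition vert_integrand s : E := (vintegral 0 s (fun u => vcoli s u \o (ct u s \o vcol s u)))%VF.

Lemma conj_gauge (t ti p q p0 q0 v vi c : E) : (ti \o p = p0 \o vi)%VF -> (p \o q = \1)%VF -> (t \o ti = \1)%VF ->
  (p0 \o q0 = \1)%VF -> (vi \o v = \1)%VF ->
  (ti \o (c \o t) = p0 \o ((vi \o ((q \o (c \o p)) \o v)) \o q0))%VF.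
Proof.
move=> h pq tti pq0 viv.
have eti : ti = (p0 \o (vi \o q))%VF by rewrite comp_lfunA -h -comp_lfunA pq comp_lfun1r.
have pE : p = (t \o (p0 \o vi))%VF by rewrite -h comp_lfunA tti comp_lfun1l.
have et : t = (p \o (v \o q0))%VF.
  by rewrite pE -!comp_lfunA (comp_lfunA vi) viv comp_lfun1l pq0 comp_lfun1r.
by rewrite {1}eti {1}et !comp_lfunA.
Qed.

Lemma gauge_factor (td tdi p vd vdi : E) : (td \o tdi = \1)%VF -> (vdi \o vd = \1)%VF -> (tdi \o p = vdi)%VF ->
  td = (p \o vd)%VF.
Proof. by move=> t v h; rewrite -[LHS]comp_lfun1r -v -h !comp_lfunA t comp_lfun1l. Qed.

Lemma gauge_product (q0 p0 I ti td tdi p11 ps vi vd vdi : E) : (q0 \o p0 = \1)%VF -> (ti \o ps = p0 \o vi)%VF ->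
  td = (ps \o vd)%VF -> (tdi \o p11 = vdi)%VF ->
  ((q0 \o ((p0 \o (I \o q0)) \o (ti \o (td \o tdi)))) \o p11 = ((I \o vi) \o vd) \o vdi)%VF.
Proof.
move=> qp h -> <-; rewrite -!comp_lfunA (comp_lfunA ti) h -!comp_lfunA.
by rewrite (comp_lfunA q0 p0 (vi \o _)%VF) qp comp_lfun1l (comp_lfunA q0 p0) qp comp_lfun1l.
Qed.

Lemma gauge_product2 (I q p td tdi p11 vd vdi : E) : (q \o p = \1)%VF -> td = (p \o vd)%VF -> (tdi \o p11 = vdi)%VF ->
  ((- I \o (q \o (td \o tdi))) \o p11 = - ((I \o vd) \o vdi))%VF.
Proof.
by move=> qp -> <-; rewrite !comp_lfunNl -!comp_lfunA (comp_lfunA q) qp comp_lfun1l.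
Qed.

Lemma conj_inv (q p f g : E) : (q \o p = \1)%VF -> f = (p \o (g \o q))%VF -> ((q \o f) \o p = g)%VF.
Proof. by move=> qp ->; rewrite -!comp_lfunA qp comp_lfun1r comp_lfunA qp comp_lfun1l. Qed.

Lemma cancel_right (x w vi v : E) : (vi \o v = \1)%VF -> x = (w \o vi)%VF -> (x \o v = w)%VF.
Proof. by move=> h ->; rewrite -comp_lfunA h comp_lfun1r. Qed.

Lemma gauge_difference (z1 z2 p a c vd vdi : E) : (z1 \o p = (a \o vd) \o vdi)%VF -> (z2 \o p = - ((c \o vd) \o vdi))%VF ->
  ((z1 - z2) \o p = ((a + c) \o vd) \o vdi)%VF.
Proof. by move=> h1 h2; rewrite comp_lfunDl comp_lfunNl h1 h2 opprK !comp_lfunDl. Qed.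

Lemma lf_swap d p : linefield A (G \o @swap R) d p = lf (swap d) (swap p).
Proof. by apply/funext => u; rewrite /linefield pullback_swap. Qed.

(** For [G] the curvature term lies along columns, and the column gauge moves it to the levels,
    giving [vert_integrand]. For the reflected map the columns are levels already, and the reversed
    orientation makes the two terms add up. Right multiplication by the transport along the top
    turns the leftover diagonal transport into [vdiagi 1]. *)
Lemma int2_diff : vpc 0 1 (fun s => ((vert_integrand s \o vcoli s s + cint s s) \o vdiag s)%VF) /\
  ((int2 alpha G - int2 alpha (G \o @swap R)) \o P 1 1)%VF =
  - (vintegral 0 1 (fun s => (vert_integrand s \o vcoli s s + cint s s) \o vdiag s) \o vdiagi 1)%VF.
Proof.
pose G' := G \o @swap R.
have cov' := swap_cover cover; have cG' := swap_continuous cG; have sm' := fun i => swap_smooth (@sm i).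
have [Ma Ma0 ha] := athe_sep falpha cover cG sm; have [Mc Mc0 hc] := cthe_sep falpha cover cG sm.
have [Ma' Ma0' ha'] := athe_sep falpha cov' cG' sm'; have [Mc' Mc0' hc'] := cthe_sep falpha cov' cG' sm'.
have [S1 h1] := zint_theta falpha cover cG sm; have [S2 h2] := zint_theta falpha cov' cG' sm'.
have p1 := zint_vpc Ma0 Mc0 ha hc; have p2 := zint_vpc Ma0' Mc0' ha' hc'.
have z01 : 0 <= (0 : R) <= 1 by rewrite lexx ler01.
have o01 : 0 <= (1 : R) <= 1 by rewrite lexx ler01.
have cid : continuous ((fun u => u) : R -> R) by move=> u; exact: cvg_id.
have pd : vpc 0 1 (fun u => bt u u) by exact: (bt_vpc fA fF cover cG sm (fun _ h => h) cid).
have pTd := Td_vpc fA cover cG sm.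
have TdE s : 0 <= s <= 1 -> Td s = (P s s \o vdiag s)%VF.
  move=> s01; have dg := diag_gaugeE fA fF hF cover cG sm left_const s01.
  exact: (gauge_factor (eviK pTd s01) (evoK pd s01) dg).
have pv s : 0 <= s <= 1 -> vpc 0 1 (fun u => bt u s).
  by move=> s01; apply: (bt_vpc fA fF cover cG sm (fun _ _ => s01)) => u; exact: cvg_cst.
have pP y : 0 <= y <= 1 -> vpc 0 1 (lf e1 (0, y)) by move=> y01; exact: (P_vpc fA cover cG sm y01).
have pT y : 0 <= y <= 1 -> vpc 0 1 (lf e2 (y, 0)) by move=> y01; exact: (T_vpc fA cover cG sm y01).
have dg1 := diag_gaugeE fA fF hF cover cG sm left_const o01.
pose W s : E := ((vert_integrand s \o vcoli s s + cint s s) \o vdiag s)%VF.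
have Z1E s : 0 < s < 1 -> s \notin S1 ->
    (zint (athe alpha G) (cthe alpha G) s \o P 1 1 = ((vert_integrand s \o vcoli s s) \o vdiag s) \o vdiagi 1)%VF.
  move=> s01 /(h1 s s01)[pf ->]; have /andP[s0 s1] := s01; have s01' : 0 <= s <= 1 by rewrite !ltW.
  have vg := vert_gaugeE fA fF hF cover cG sm left_const s01'.
  pose g u : E := (vcoli s u \o (ct u s \o vcol s u))%VF.
  have fE u : 0 <= u <= s -> (Ti s u \o (cur (s, u) \o T s u) = P 0 s \o (g u \o Q 0 s))%VF.
    move=> /andP[u0 us]; have u01 : 0 <= u <= 1 by rewrite u0 (le_trans us)// ltW.
    exact: (conj_gauge _ (vg u u01) (eviK (pP u u01) s01') (eviK (pT s s01') u01) (eviK (pP 0 z01) s01') (evoK (pv s s01') u01)).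
  have pg : vpc 0 s g.
    have := vpc_comp (vpc_comp (vpc_cst (Q 0 s) 0 s) pf) (vpc_cst (P 0 s) 0 s); apply: (vpc_eq (S := [::])) => u /andP[u0 us] _.
    exact: (conj_inv (evoK (pP 0 z01) s01') (fE u (introT andP (conj (ltW u0) (ltW us))))).
  have eI : vert_int alpha G s = (P 0 s \o (vert_integrand s \o Q 0 s))%VF.
    have i1 := vint_compr (Q 0 s) (ltW s0) pg.
    have i2 := vint_compl (P 0 s) (ltW s0) (vpc_comp pg (vpc_cst (Q 0 s) 0 s)).
    exact: (etrans (eq_vint fE) (etrans i2 (congr1 (fun x => P 0 s \o x)%VF i1))).
  rewrite eI.
  exact: (gauge_product _ (evoK (pP 0 z01) s01') (vg s s01') (TdE s s01') dg1).
have Z2E s : 0 < s < 1 -> s \notin S2 ->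
    (zint (athe alpha G') (cthe alpha G') s \o P 1 1 = - ((cint s s \o vdiag s) \o vdiagi 1))%VF.
  move=> s01 /(h2 s s01)[pf ->]; have /andP[s0 s1] := s01; have s01' : 0 <= s <= 1 by rewrite !ltW.
  have l1 : linefield A G' e1 (0, 0) = lf e2 (0, 0) := lf_swap e1 (0, 0).
  have l2 : linefield A G' e2 (s, 0) = lf e1 (0, s) := lf_swap e2 (s, 0).
  have l3 : linefield A G' e12 (0, 0) = lf e12 (0, 0) := lf_swap e12 (0, 0).
  move: pf; rewrite /vert_int l1 l2 l3.
  (* The bottom edge of the reflected triangle is the constant left side of the 2-path, with trivial
     transport. *)
  move=> pf; have [_ l4] := left_transport0 s01'; rewrite [X in ((X \o _) \o _)%VF]l4 comp_lfun1l.
  have fE u : 0 <= u <= s -> (Q s u \o (fcurv (alpha 2%N) G' (s, u) \o P s u) = - ct s u)%VF.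
    by move=> _; rewrite cur_swap comp_lfunNl comp_lfunNr.
  have pc : vpc 0 s (ct s).
    have := vpcN pf; apply: (vpc_eq (S := [::])) => u /andP[u0 us] _.
    exact: (etrans (congr1 -%R (fE u (introT andP (conj (ltW u0) (ltW us))))) (opprK _)).
  have eI : vintegral 0 s (fun u => Q s u \o (fcurv (alpha 2%N) G' (s, u) \o P s u))%VF = - cint s s.
    exact: (etrans (eq_vint fE) (vintN (ltW s0) pc)).
  rewrite eI; exact: (gauge_product2 _ (evoK (pP s s01') s01') (TdE s s01') dg1).
have ZE s : 0 < s < 1 -> s \notin S1 ++ S2 -> ((zint (athe alpha G) (cthe alpha G) s - zint (athe alpha G') (cthe alpha G') s) \o P 1 1 = W s \o vdiagi 1)%VF.
  move=> s01; rewrite mem_cat negb_or => /andP[s1 s2].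
  exact: (gauge_difference (Z1E s s01 s1) (Z2E s s01 s2)).
have pZ : vpc 0 1 (fun s => ((zint (athe alpha G) (cthe alpha G) s - zint (athe alpha G') (cthe alpha G') s) \o P 1 1)%VF).
  by apply: vpc_comp; [exact: vpcB|exact: vpc_cst].
have pW : vpc 0 1 W.
  have := vpc_comp pZ (vpc_cst (vdiag 1) 0 1); apply: (vpc_eq (S := S1 ++ S2)) => s s01 sS.
  exact: (cancel_right (evoK pd o01) (ZE s s01 sS)).
split; first exact: pW.
rewrite (int2E falpha Ma0 Mc0 ha hc) (int2E falpha Ma0' Mc0' ha' hc') -opprD comp_lfunNl; congr (- _).
have i1 := vintB ler01 p1 p2; have i2 := vint_compr (P 1 1) ler01 (vpcB p1 p2).
have i3 := vint_compr (vdiagi 1) ler01 pW.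
exact: (etrans (congr1 (fun x => x \o P 1 1)%VF (esym i1)) (etrans (esym i2) (etrans (eq_vint_off ler01 pZ ZE) i3))).
Qed.

End Difference.

Lemma vpc_vcontinuous (R : realType) (W : vectType R) (F : R -> W) : vcontinuous unit_itv (F : R^o -> W) -> vpc 0 1 F.
Proof.
move=> cF; apply: vpc_crd => j; have cj := cF j; rewrite unit_itvE in cj.
have [c _ hc] := EVT_max ler01 cj; have [c' _ hc'] := EVT_min ler01 cj.
exists (`|crd j (F c)| + `|crd j (F c')|), [::] => t t01 _.
have t01' : 0 <= t <= 1 by case/andP: t01 => p q; rewrite !ltW.
split.
  have := hc t; have := hc' t; rewrite in_itv /= t01' => /(_ isT) h1 /(_ isT) h2.
  have := ler_norm (crd j (F c)); have := ler_norm (- (crd j (F c') : R)); rewrite normrN.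
  have := normr_ge0 (crd j (F c)); have := normr_ge0 (crd j (F c')).
  by rewrite ler_norml => *; apply/andP; split; lra.
have h : vcvg (within [set s : R^o | 0 <= s <= 1] (nbhs (t : R^o))) F (F t).
  by move=> i; have /subspace_continuousP h := cF i; exact: (h t t01').
have h2 : vcvg (nbhs t) F (F t) by exact: (within_interior t01 h).
exact: (h2 j).
Qed.

(** * The exact endomorphisms, and the surface transport *)

Section Continuity.
Variables (R : realType).
Local Notation I01 := [set s : R^o | 0 <= s <= 1].

Lemma vcontinuousP (W : vectType R) (F : R^o -> W) :
  vcontinuous unit_itv F <-> forall y : R^o, 0 <= y <= 1 -> vcvg (within I01 (nbhs y)) F (F y).
Proof.
split=> [h y y01 j|h j]; first by have /subspace_continuousP k := h j; exact: (k y y01).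
by apply/subspace_continuousP => y y01; exact: (h y y01 j).
Qed.

Lemma vcontinuous_lin (W1 W2 : vectType R) (L : {linear W1 -> W2}) (F : R^o -> W1) :
  vcontinuous unit_itv F -> vcontinuous unit_itv (fun t => L (F t)).
Proof. by move=> /vcontinuousP h; apply/vcontinuousP => y y01; exact: (vcvg_lin L (h y y01)). Qed.

Lemma vcontinuousB (W : vectType R) (F H : R^o -> W) :
  vcontinuous unit_itv F -> vcontinuous unit_itv H -> vcontinuous unit_itv (fun t => F t - H t).
Proof.
move=> /vcontinuousP h /vcontinuousP k; apply/vcontinuousP => y y01.
exact: (vcvgB (h y y01) (k y y01)).
Qed.

Lemma vcontinuous_lip (W : vectType R) (F : R^o -> W) K :
  (forall y s : R, 0 <= y <= 1 -> 0 <= s <= 1 -> vn (F s - F y) <= K * `|s - y|) -> vcontinuous unit_itv F.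
Proof.
move=> h; apply/vcontinuousP => y y01.
have ce : K * `|s - y| @[s --> within I01 (nbhs y)] --> (0 : R).
  rewrite -[X in _ --> X](mulr0 K).
  have cc : (fun _ : R => K) @ within I01 (nbhs (y : R^o)) --> K by exact: cvg_cst.
  apply: (cvgM cc); rewrite -[X in _ --> X](@normr0 _ R^o); apply: cvg_norm.
  by rewrite -[X in _ --> X](subrr y); apply: cvgB; [exact: cvg_within|exact: cvg_cst].
apply: (vcvg_squeeze _ ce); rewrite near_withinE; apply: filterE => s /= s01.
exact: h.
Qed.

End Continuity.

Section Exact.
Variables (R : realType) (V : cochain_complex R).
Local Notation E := 'End(V).
Local Notation d := (cdiff V).

Lemma pi1P (x : E) : pi1 x = 0 <-> x \in @exact1 R V.
Proof.
rewrite /pi1 -(linear0 (@projq R E (@exact1 R V))); split=> [/eqP|h]; last apply/eqP; rewrite projq_eq subr0 //.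
Qed.

Lemma gcomm_is_linear k : linear (@gcomm R V k).
Proof. by move=> a f g; exact: comm_lin. Qed.
HB.instance Definition _ k := GRing.isLinear.Build R E E *:%R (@gcomm R V k) (@gcomm_is_linear k).
HB.instance Definition _ := GRing.isLinear.Build R E (qEnd V) *:%R (@pi1 R V) (@projq_is_linear R E (@exact1 R V)).

Lemma pi1_0 : pi1 (0 : E) = 0.
Proof. exact: (linear0 (@pi1 R V)). Qed.

Lemma pi1N (x : E) : pi1 (- x) = - pi1 x.
Proof. exact: (linearN (@pi1 R V)). Qed.

Lemma pi1D (x y : E) : pi1 (x + y) = pi1 x + pi1 y.
Proof. exact: (linearD (@pi1 R V)). Qed.

Lemma pi1Z a (x : E) : pi1 (a *: x) = a *: pi1 x.
Proof. exact: (linearZ_LR (@pi1 R V)). Qed.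

Lemma pi1_eq (x y : E) : x - y \in @exact1 R V -> pi1 x = pi1 y.
Proof. by move=> /pi1P; rewrite pi1D pi1N => /eqP; rewrite subr_eq0 => /eqP. Qed.

Lemma gl0_homogeneous k (f g : E) : homogeneous k f -> gl0 g -> homogeneous k (f \o g)%VF.
Proof. by move=> hf [hg _]; have := homogeneous_comp hf hg; rewrite addr0. Qed.

Lemma homogeneous_gl0 k (f g : E) : gl0 f -> homogeneous k g -> homogeneous k (f \o g)%VF.
Proof. by move=> [hf _] hg; have := homogeneous_comp hf hg; rewrite add0r. Qed.

Lemma gcomm_gl0r k (f g : E) : gl0 g -> gcomm k (f \o g)%VF = (gcomm k f \o g)%VF.
Proof.
by move=> [_ cg]; rewrite /gcomm comp_lfunDl comp_lfunNl -comp_lfunZl -!comp_lfunA cg.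
Qed.

Lemma gcomm_gl0l k (f g : E) : gl0 f -> gcomm k (f \o g)%VF = (f \o gcomm k g)%VF.
Proof.
by move=> [_ cf]; rewrite /gcomm comp_lfunDr comp_lfunNr -comp_lfunZr !comp_lfunA cf.
Qed.

Lemma exact1_gl0 (f g : E) : f \in @exact1 R V -> gl0 g -> (f \o g)%VF \in @exact1 R V.
Proof.
move=> /exact1P[r hr ->] hg; apply/exact1P; exists (r \o g)%VF; first exact: gl0_homogeneous.
by rewrite gcomm_gl0r.
Qed.

(** The element is the differential of [f \o g], of degree -2. So, modulo exact terms, the
    differential can be moved across a product of two elements of degree -1; the identities in the
    quotient below rest on this. *)
Lemma exact1_swap (f g : E) : homogeneous (-1) f -> homogeneous (-1) g ->
  ((gcomm (-1) f \o g)%VF - (f \o gcomm (-1) g)%VF) \in @exact1 R V.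
Proof.
move=> hf hg; apply/exact1P; exists (f \o g)%VF; first exact: (homogeneous_comp hf hg).
rewrite !comm1E comm2E comp_lfunDl comp_lfunDr !comp_lfunA.
by apply: crd_inj => j; rewrite !(crdD, crdB, raddfN) /=; ring.
Qed.

Lemma gl0_gcomm1 (f : E) : homogeneous (-1) f -> gl0 (gcomm (-1) f).
Proof.
move=> hf; split.
  rewrite comm1E -[(d \o f)%VF]scale1r; apply: homogeneous_lin.
    exact: (homogeneous_comp (@homogeneous_diff R V) hf).
  exact: (homogeneous_comp hf (@homogeneous_diff R V)).
by rewrite comm1E comp_lfunDl comp_lfunDr diff_diffl diff_diffr add0r addr0 comp_lfunA.
Qed.

Lemma homogeneousN k (f : E) : homogeneous k f -> homogeneous k (- f).
Proof. by move=> h; rewrite -[- f]addr0 -scaleN1r; apply: homogeneous_lin => //; exact: homogeneous0. Qed.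

Lemma homogeneousB k (f g : E) : homogeneous k f -> homogeneous k g -> homogeneous k (f - g).
Proof. by move=> hf hg; rewrite -[f]scale1r; apply: homogeneous_lin => //; exact: homogeneousN. Qed.

Lemma homogeneous_vint k a b (F : R -> E) : a <= b -> vpc a b F -> (forall t, a < t < b -> homogeneous k (F t)) ->
  homogeneous k (vintegral a b F).
Proof.
move=> ab pF h; apply: (@subspace_vint R E (homogeneous k) (@homogeneous0 R V k) (@homogeneous_lin R V k) a b F [::] ab pF).
by move=> t tab _; exact: h.
Qed.

Lemma exact1_vint a b (F : R -> E) : a <= b -> vpc a b F -> (forall t, a < t < b -> F t \in @exact1 R V) ->
  vintegral a b F \in @exact1 R V.
Proof.
move=> ab pF h; apply: (@subspace_vint R E (fun x => x \in @exact1 R V) _ _ a b F [::] ab pF).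
- exact: mem0v.
- by move=> k u v hu hv; rewrite memvD// memvZ.
by move=> t tab _; exact: h.
Qed.

(** A linear section of [pi1]. The representative [rep1] is an arbitrary choice, with which
    derivatives and integrals need not commute. *)
Definition lift1 : 'Hom(qEnd V, E) := (linfun (@pi1 R V))^-1%VF.

Lemma lift1K q : pi1 (lift1 q) = q.
Proof.
have h : q \in limg (linfun (@pi1 R V)).
  by apply/memv_imgP; exists (rep1 q); rewrite ?memvf// lfunE /=; rewrite /pi1 reprqK.
by have := limg_lfunVK h; rewrite lfunE.
Qed.

Lemma pi1_lift1 (x : E) : lift1 (pi1 x) - x \in @exact1 R V.
Proof. by apply/pi1P; rewrite linearB /= lift1K subrr. Qed.

(* A linear projection of End(V) along exact1. *)
Definition kap (x : E) : E := lift1 (pi1 x).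

Lemma kap_is_linear : linear kap.
Proof. by move=> k x y; rewrite /kap linearP linearP. Qed.
HB.instance Definition _ := GRing.isLinear.Build R E E *:%R kap kap_is_linear.

Lemma kapK (x : E) : kap x - x \in @exact1 R V.
Proof. exact: pi1_lift1. Qed.

Lemma kap_exact (x : E) : x \in @exact1 R V -> kap x = 0.
Proof. by move=> /pi1P h; rewrite /kap h linear0. Qed.

Lemma kap_eq (x y : E) : x - y \in @exact1 R V -> kap x = kap y.
Proof. by move=> /kap_exact/eqP; rewrite linearB subr_eq0 => /eqP. Qed.

Lemma pi1_kap (x : E) : pi1 (kap x) = pi1 x.
Proof. exact: lift1K. Qed.

Lemma kap_gl0 (x b : E) : gl0 b -> kap (kap x \o b)%VF = kap (x \o b)%VF.
Proof.
move=> gb; apply: kap_eq; rewrite -comp_lfunNl -comp_lfunDl.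
exact: exact1_gl0 (kapK x) gb.
Qed.

Lemma vcontinuous_kap (F : R^o -> E) : vcontinuous unit_itv F -> vcontinuous unit_itv (fun t : R^o => kap (F t)).
Proof. by move=> h j; exact: (vcontinuous_lin (L := kap) h). Qed.

Lemma quotient_algebra (H1 H0 p q r m m' : E) (e : R) : H1 - H0 = p + q + r -> r + m \in @exact1 R V ->
  e^-1 *: m = m' -> kap (e^-1 *: p + e^-1 *: q - m') = e^-1 *: (kap H1 - kap H0).
Proof.
have kZ l x : kap (l *: x) = l *: kap x by rewrite /kap !linearZ.
have kD x y : kap (x + y) = kap x + kap y by exact: (linearD kap).
have kB x y : kap (x - y) = kap x - kap y by exact: (linearB kap).
move=> hH /kap_exact/eqP; rewrite kD addr_eq0 => /eqP er <-.
by rewrite -kB hH kB !kD !kZ er !scalerDr scalerN.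
Qed.

(** The derivatives of the two quantities compared in [surface_exact]: modulo exact terms their
    difference is a linear function of the difference of the values, [exact1_swap] disposing of the
    rest. *)
Lemma diag_rhs (h y n W x b vv vi i : E) : (vv \o vi = \1)%VF -> b = - gcomm (-1) x -> W = \1%VF + gcomm (-1) h ->
  y = - (i \o vi)%VF -> homogeneous (-1) h -> homogeneous (-1) x -> gl0 b ->
  kap (- (W \o x)%VF - (n \o W)%VF) - kap (- (((((n \o W)%VF + x) \o vv) \o vi)%VF + (i \o (vi \o b))%VF)) =
  kap ((kap h - kap y) \o b)%VF.
Proof.
move=> hv hb hW hy hh hx gb.
rewrite -[kap h - kap y]linearB kap_gl0// -linearB; apply: kap_eq.
rewrite -(comp_lfunA _ vv vi) hv comp_lfun1r hy !opprK comp_lfunDl (comp_lfunA i).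
have -> : (h \o b)%VF = - (h \o gcomm (-1) x)%VF by rewrite hb comp_lfunNr.
have -> : (W \o x)%VF = x + (gcomm (-1) h \o x)%VF by rewrite hW comp_lfunDl comp_lfun1l.
move: ((n \o W)%VF) (((i \o vi) \o b)%VF) => p q.
set g := (gcomm _ h \o x)%VF; set f := (h \o gcomm _ x)%VF.
have -> : - (x + g) - p + (p + x + q) - (- f + q) = - (g - f).
  by apply: crd_inj => j; rewrite !(crdD, crdB, raddfN) /=; ring.
by rewrite rpredN; exact: exact1_swap.
Qed.

(* The product with a solution of u' = - a u turns the equation y' = y a into
   z' = 0, up to elements of the space exact1, which is closed under composition
   with cochain maps. *)
Lemma quot_ode (a y : R -> E) : vpc 0 1 a -> (forall t, gl0 (a t)) -> vcontinuous unit_itv (y : R^o -> E) -> y 0 = 0 ->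
  (exists S : seq R, forall t, 0 < t < 1 -> t \notin S ->
    is_vderive (y : R^o -> E) t 1 (kap (y t \o a t)%VF)) ->
  forall t, 0 <= t <= 1 -> y t \in @exact1 R V.
Proof.
move=> pa ga cy y0 [S dy] t t01.
pose k s := kap (y s \o a s)%VF.
have pk : vpc 0 1 k by exact: (vpc_lin kap (vpc_comp (vpc_vcontinuous cy) pa)).
have vy : vprim 0 1 y k.
  by apply/(vprimP _ _ ler01); split; [exact: pk|move=> j; rewrite -unit_itvE; exact: cy|exists S].
have /andP[t0 t1] := t01.
have [pz /(_ t t01)] := vprim_bil ler01 (@bil_comp R V) vy (evo_prim pa).
rewrite y0 comp_lfun0l add0r => zE.
have zex : (y t \o evo a t)%VF \in @exact1 R V.
  rewrite zE; apply: exact1_vint => //; first exact: vpc_sub pz.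
  move=> u /andP[u0 ut]; have u01 : 0 <= u <= 1 by rewrite !ltW// (lt_le_trans ut).
  rewrite comp_lfunNr comp_lfunA -comp_lfunNl -comp_lfunDl.
  by apply: exact1_gl0; [exact: kapK|exact: gl0_evo].
have := exact1_gl0 zex (gl0_evi pa ga t01).
by rewrite -comp_lfunA (eviK pa t01) comp_lfun1r.
Qed.

End Exact.

(** * Surface transport and its values on the diagonal *)

Section Surface.
Variables (R : realType) (V : cochain_complex R) (L : R).
Local Notation E := 'End(V).
Local Notation ex := (@exact1 R V).
Variables C c : R -> R -> E.
Hypothesis hC : forall u x, 0 <= x <= 1 -> homogeneous (-1) (C u x).
Hypothesis C0 : forall u, C u 0 = 0.
Hypothesis L0 : 0 <= L.
Hypothesis lipC : forall u x x', 0 <= x <= 1 -> 0 <= x' <= 1 -> vn (C u x' - C u x) <= L * `|x' - x|.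
Hypothesis pC : forall x, 0 <= x <= 1 -> vpc 0 1 (C^~ x).
Hypothesis pCd : vpc 0 1 (fun u => C u u).
Hypothesis genC : exists S : seq R, forall r, 0 < r < 1 -> r \notin S ->
  [/\ vpc 0 1 (c^~ r), vcts (C^~ r) r & exists S' : seq R, forall u, 0 < u < 1 -> u \notin S' ->
      is_vderive (fun x : R^o => C u x) r 1 (c u r)].

Definition bC u x : E := gcomm (-1) (- C u x).
Local Notation v x := (evo (bC^~ x)).
Local Notation w x := (evi (bC^~ x)).
Definition Fs x u : E := (w x u \o C u x)%VF.
Definition hs x y : E := - vintegral 0 y (Fs x).

Lemma gl0_bC u x : 0 <= x <= 1 -> gl0 (bC u x).
Proof. by move=> x01; apply: gl0_gcomm1; apply: homogeneousN; exact: hC. Qed.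

Lemma bC_vpc x : 0 <= x <= 1 -> vpc 0 1 (bC^~ x).
Proof. by move=> x01; exact: (vpc_lin (@gcomm R V (-1)) (vpcN (pC x01))). Qed.

Let gw x u : 0 <= x <= 1 -> 0 <= u <= 1 -> gl0 (w x u).
Proof. by move=> x01 u01; apply: gl0_evi => //; [exact: bC_vpc|move=> t; exact: gl0_bC]. Qed.

Let gv x u : 0 <= x <= 1 -> 0 <= u <= 1 -> gl0 (v x u).
Proof. by move=> x01 u01; apply: gl0_evo => //; [exact: bC_vpc|move=> t; exact: gl0_bC]. Qed.

Lemma Fs_vpc x : 0 <= x <= 1 -> vpc 0 1 (Fs x).
Proof. by move=> x01; apply: vpc_comp; [exact: vprim_pc ler01 (evi_prim (bC_vpc x01))|exact: pC]. Qed.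

Lemma Fs_homogeneous x u : 0 <= x <= 1 -> 0 <= u <= 1 -> homogeneous (-1) (Fs x u).
Proof. by move=> x01 u01; apply: homogeneous_gl0; [exact: gw|exact: hC]. Qed.

Lemma hs_prim x : 0 <= x <= 1 -> vprim 0 1 (hs x) (fun u => - Fs x u).
Proof. by move=> x01; exact: (vprimN (vprim_int (Fs_vpc x01))). Qed.

Lemma hs_homogeneous x y : 0 <= x <= 1 -> 0 <= y <= 1 -> homogeneous (-1) (hs x y).
Proof.
move=> x01 /andP[y0 y1]; apply: homogeneousN; apply: homogeneous_vint => //.
  exact: vpc_sub (lexx 0) y1 (Fs_vpc x01).
by move=> t /andP[t0 ty]; apply: Fs_homogeneous => //; rewrite (ltW t0) (le_trans (ltW ty)).
Qed.

(** Integrate w' = w b with b = - [d, C]: as [w] is a cochain map of degree 0, w [d, C] =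
    [d, w C]. *)
Lemma w_hs x y : 0 <= x <= 1 -> 0 <= y <= 1 -> w x y = \1%VF + gcomm (-1) (hs x y).
Proof.
move=> x01 y01; have vh := vprimD (vprim_cst0 0 1 (\1%VF : E)) (vprim_lin (@gcomm R V (-1)) (hs_prim x01)).
apply: (vprim_unique (S := [::]) ler01 _ _ (evi_prim (bC_vpc x01)) vh y01); last first.
  by rewrite (evi0 (bC_vpc x01)) /hs vint_point oppr0 linear0 addr0.
move=> t /andP[t0 t1] _; have t01 : 0 <= t <= 1 by rewrite !ltW.
by rewrite add0r /= -(gcomm_gl0l _ _ (gw x01 t01)) comp_lfunNr.
Qed.

(** The variation of [C] between the columns [x] and [x'], conjugated by the gauges and integrated.
    Its differential measures the variation of [w], as [w_diff] shows. *)
Definition ms x x' y : E := vintegral 0 y (fun u => w x' u \o ((C u x' - C u x) \o v x u))%VF.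

Let vpc_ms x x' : 0 <= x <= 1 -> 0 <= x' <= 1 -> vpc 0 1 (fun u => w x' u \o ((C u x' - C u x) \o v x u))%VF.
Proof.
move=> x01 x'01; apply: vpc_comp; first exact: vprim_pc ler01 (evi_prim (bC_vpc x'01)).
apply: vpc_comp; first by apply: vpcB; exact: pC.
exact: vprim_pc ler01 (evo_prim (bC_vpc x01)).
Qed.

Let msh x x' u : 0 <= x <= 1 -> 0 <= x' <= 1 -> 0 <= u <= 1 ->
  homogeneous (-1) (w x' u \o ((C u x' - C u x) \o v x u))%VF.
Proof.
move=> x01 x'01 u01; apply: homogeneous_gl0; first exact: gw.
by apply: gl0_homogeneous; [apply: homogeneousB; exact: hC|exact: gv].
Qed.

Lemma ms_homogeneous x x' y : 0 <= x <= 1 -> 0 <= x' <= 1 -> 0 <= y <= 1 -> homogeneous (-1) (ms x x' y).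
Proof.
move=> x01 x'01 /andP[y0 y1]; apply: homogeneous_vint => //; first exact: vpc_sub (lexx 0) y1 (vpc_ms x01 x'01).
by move=> t /andP[t0 ty]; apply: msh => //; rewrite (ltW t0) (le_trans (ltW ty)).
Qed.

Lemma w_diff x x' y : 0 <= x <= 1 -> 0 <= x' <= 1 -> 0 <= y <= 1 ->
  w x' y - w x y = - (gcomm (-1) (ms x x' y) \o w x y)%VF.
Proof.
move=> x01 x'01 y01; have /andP[y0 y1] := y01.
rewrite (evi_diff (bC_vpc x01) (bC_vpc x'01) y01) -comp_lfunNl; congr (_ \o _)%VF.
have pm := vpc_sub (lexx 0) y1 (vpc_ms x01 x'01).
have i1 := vint_lin (@gcomm R V (-1)) y0 pm; have i2 := vintN y0 (vpc_lin (@gcomm R V (-1)) pm).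
rewrite /ms -[gcomm _ _]i1 -i2; apply: eq_vint => t /andP[t0 ty].
have t01 : 0 <= t <= 1 by rewrite t0 (le_trans ty).
rewrite /= (gcomm_gl0l _ _ (gw x'01 t01)) (gcomm_gl0r _ _ (gv x01 t01)) /bC -raddfB /= -!comp_lfunA -comp_lfunNr -comp_lfunNl.
have e : - C t x' - - C t x = - (C t x' - C t x) by rewrite opprK opprB addrC.
by congr (_ \o (_ \o _))%VF; rewrite e; exact: (raddfN (@gcomm R V (-1))).
Qed.

Lemma shift_algebra (w1 w0 x1 x0 V0 m Z b g : E) : (V0 \o w0 = \1)%VF -> w1 - w0 = - (Z \o w0)%VF -> b = - g ->
  - (w1 \o x1)%VF - (- (w0 \o x0)%VF) + (((w1 \o ((x1 - x0) \o V0)) \o w0)%VF + (m \o (w0 \o b))%VF) =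
  ((Z \o (w0 \o x0))%VF - (m \o (w0 \o g))%VF).
Proof.
move=> vw hw ->; rewrite -(comp_lfunA w1) -(comp_lfunA (x1 - x0)) vw comp_lfun1r.
rewrite (comp_lfunA Z) -[(Z \o w0)%VF]opprK -hw !(comp_lfunDl, comp_lfunDr, comp_lfunNl, comp_lfunNr).
by apply: crd_inj => j; rewrite !(crdD, crdB, raddfN) /=; ring.
Qed.

(** Differentiated in [y], the sum reduces to [d, ms] Fs - ms [d, Fs], which is exact by
    [exact1_swap]; integration preserves exactness. *)
Lemma hs_shift x x' y : 0 <= x <= 1 -> 0 <= x' <= 1 -> 0 <= y <= 1 ->
  hs x' y - hs x y + (ms x x' y \o w x y)%VF \in ex.
Proof.
move=> x01 x'01 y01; have /andP[y0 y1] := y01.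
have [pz /(_ y y01)] := vprimD (vprimB (hs_prim x'01) (hs_prim x01))
  (vprim_bil ler01 (@bil_comp R V) (vprim_int (vpc_ms x01 x'01)) (evi_prim (bC_vpc x01))).
rewrite /ms => ->; rewrite /hs !vint_point comp_lfun0l oppr0 subr0 addr0 add0r.
apply: exact1_vint => //; first exact: vpc_sub (lexx 0) y1 pz.
move=> t /andP[t0 ty]; have t01 : 0 <= t <= 1 by rewrite (ltW t0) (le_trans (ltW ty)).
have wd := w_diff x01 x'01 t01; have vw := eviK (bC_vpc x01) t01.
have bN : bC t x = - gcomm (-1) (C t x) by exact: (raddfN (@gcomm R V (-1))).
rewrite (shift_algebra _ _ _ vw wd bN).
rewrite -(gcomm_gl0l _ _ (gw x01 t01)); apply: exact1_swap; last exact: Fs_homogeneous.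
exact: ms_homogeneous.
Qed.

End Surface.

Section SurfaceDerivative.
Variables (R : realType) (V : cochain_complex R) (L : R).
Local Notation E := 'End(V).
Local Notation ex := (@exact1 R V).
Variables C c : R -> R -> E.
Hypothesis hC : forall u x, 0 <= x <= 1 -> homogeneous (-1) (C u x).
Hypothesis C0 : forall u, C u 0 = 0.
Hypothesis L0 : 0 <= L.
Hypothesis lipC : forall u x x', 0 <= x <= 1 -> 0 <= x' <= 1 -> vn (C u x' - C u x) <= L * `|x' - x|.
Hypothesis pC : forall x, 0 <= x <= 1 -> vpc 0 1 (C^~ x).
Hypothesis pCd : vpc 0 1 (fun u => C u u).
Hypothesis genC : exists S : seq R, forall r, 0 < r < 1 -> r \notin S ->
  [/\ vpc 0 1 (c^~ r), vcts (C^~ r) r & exists S' : seq R, forall u, 0 < u < 1 -> u \notin S' ->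
      is_vderive (fun x : R^o => C u x) r 1 (c u r)].
Local Notation bC := (bC C).
Local Notation v x := (evo (bC^~ x)).
Local Notation w x := (evi (bC^~ x)).
Local Notation Fs := (Fs C).
Local Notation hs := (hs C).
Local Notation ms := (ms C).

Lemma ig_const_le (f : R -> R) M : pc 0 1 f -> (forall t, 0 < t < 1 -> f t <= M) -> ig 0 1 f <= M.
Proof.
move=> pf h; have pM : pc 0 1 (fun=> M) by exists `|M|; exact: pcb_cst.
have := ig_le (S := [::]) ler01 pf pM (fun t t01 _ => h t t01).
by rewrite ig_cst// subr0 mulr1.
Qed.

Lemma comp_increment (a a' f f' : E) : (a' \o f')%VF - (a \o f)%VF = ((a' - a) \o f')%VF + (a \o (f' - f))%VF.
Proof. by rewrite comp_lfunDl comp_lfunNl comp_lfunDr comp_lfunNr addrA subrK. Qed.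

Lemma surface_bounds : exists2 K, 0 <= K & forall x u, 0 <= x <= 1 -> 0 <= u <= 1 ->
  [/\ vn (w x u) <= K, vn (v x u) <= K, vn (Fs x u) <= K &
   forall x', 0 <= x' <= 1 -> vn (w x' u - w x u) <= K * `|x' - x| /\ vn (Fs x' u - Fs x u) <= K * `|x' - x|].
Proof.
have [Kg Kg0 hKg] := vn_lin (@gcomm R V (-1)); have [K1 K10 hK1] := vn_comp V.
have CL u x : 0 <= x <= 1 -> vn (C u x) <= L.
  move=> x01; rewrite -[C u x]subr0 -(C0 u); apply: le_trans (lipC _ _ x01) _; first by rewrite lexx ler01.
  by rewrite subr0 -[leRHS]mulr1 ler_wpM2l//; case/andP: x01 => a b; rewrite ger0_norm.
have bd u x x' : 0 <= x <= 1 -> 0 <= x' <= 1 -> vn (bC u x' - bC u x) <= Kg * L * `|x' - x|.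
  move=> x01 x'01; rewrite /bC -(raddfB (@gcomm R V (-1))); apply: le_trans (hKg _) _; rewrite -mulrA ler_wpM2l//.
  by rewrite opprK addrC -vnN opprB; exact: lipC.
have pb x (x01 : 0 <= x <= 1) : vpcb (Kg * L) 0 1 (bC^~ x).
  apply: (vpcb_of_vpc (S := [::]) (bC_vpc pC x01)) => u _ _; apply: le_trans (hKg _) _.
  by rewrite ler_wpM2l// vnN; exact: CL.
have [B B0 hB] := evo_dist V (mulr_ge0 Kg0 L0).
pose K := B + B * (Kg * L) + K1 * B * L + K1 * (B * (Kg * L)) * L.
have q1 : 0 <= B * (Kg * L) by rewrite !mulr_ge0.
have q2 : 0 <= K1 * B * L by rewrite !mulr_ge0.
have q3 : 0 <= K1 * (B * (Kg * L)) * L by rewrite !mulr_ge0.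
exists K; first by rewrite /K !addr_ge0.
move=> x u x01 u01; have [b1 b2 _ _] := hB _ _ (pb x x01) (pb x x01) u u01.
have wl x' : 0 <= x' <= 1 -> vn (w x' u - w x u) <= B * (Kg * L) * `|x' - x|.
  move=> x'01; have [_ _ _ d] := hB _ _ (pb x' x'01) (pb x x01) u u01; apply: le_trans d _.
  rewrite -mulrA ler_wpM2l//; apply: ig_const_le; last by move=> t _; exact: bd.
  by apply: pc_vn; apply: vpcB; exact: bC_vpc.
split.
- by apply: le_trans b2 _; rewrite /K; lra.
- by apply: le_trans b1 _; rewrite /K; lra.
- apply: le_trans (hK1 _ _) _; apply: le_trans (_ : K1 * B * L <= _); last by rewrite /K; lra.
  by apply: ler_pM; rewrite ?mulr_ge0 ?vn_ge0 ?ler_wpM2l//; exact: CL.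
move=> x' x'01; split.
  by apply: le_trans (wl x' x'01) _; rewrite ler_wpM2r// /K; lra.
have -> : Fs x' u - Fs x u = ((w x' u - w x u) \o C u x')%VF + (w x u \o (C u x' - C u x))%VF.
  exact: comp_increment.
apply: le_trans (vnD _ _) _.
apply: le_trans (_ : K1 * (B * (Kg * L)) * L * `|x' - x| + K1 * B * L * `|x' - x| <= _); last first.
  by rewrite -mulrDl ler_wpM2r// /K; lra.
apply: lerD; apply: le_trans (hK1 _ _) _.
  rewrite -[leRHS]mulrA [L * _]mulrC !mulrA; apply: ler_pM; rewrite ?mulr_ge0 ?vn_ge0//; last exact: CL.
  by rewrite -!mulrA ler_wpM2l// !mulrA -[leRHS]mulrA; have := wl x' x'01; rewrite !mulrA.
rewrite -[leRHS]mulrA; apply: ler_pM; rewrite ?mulr_ge0 ?vn_ge0//; [by apply: ler_wpM2l|exact: lipC].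
Qed.

(** The bound on the mixed difference lets the derivative along the diagonal be computed from the
    two partial ones, without a total derivative. *)
Lemma hs_lip : exists2 K, 0 <= K & forall x x' y y', 0 <= x <= 1 -> 0 <= x' <= 1 -> 0 <= y <= 1 -> 0 <= y' <= 1 ->
  [/\ vn (hs x y' - hs x y) <= K * `|y' - y|, vn (hs x' y - hs x y) <= K * `|x' - x| &
   vn ((hs x' y' - hs x' y) - (hs x y' - hs x y)) <= K * `|x' - x| * `|y' - y|].
Proof.
have [K K0 hK] := surface_bounds; exists K => // x x' y y' x01 x'01 y01 y'01.
have o01 (u : R) : 0 < u < 1 -> 0 <= u <= 1 by move=> /andP[a b]; rewrite !ltW.
have l1 : vn (hs x y' - hs x y) <= K * `|y' - y|.
  apply: (vprim_lip (S := [::]) ler01 (hs_prim pC x01)) => // t t01 _; rewrite vnN.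
  by have [_ _ h _] := hK x t x01 (o01 t t01).
have l3 z z' : 0 <= z <= 1 -> 0 <= z' <= 1 -> vn ((hs x' z' - hs x z') - (hs x' z - hs x z)) <= K * `|x' - x| * `|z' - z|.
  move=> z01 z'01.
  apply: (vprim_lip (S := [::]) ler01 (vprimB (hs_prim pC x'01) (hs_prim pC x01))) => // t t01 _; rewrite -opprD vnN.
  by have [_ _ _ h] := hK x t x01 (o01 t t01); have [_] := h x' x'01.
split=> //.
  have z01 : 0 <= (0 : R) <= 1 by rewrite lexx ler01.
  have h0 z : hs z 0 = 0 by rewrite /hs vint_point oppr0.
  have := l3 0 y z01 y01; rewrite !h0 !subr0 => h; apply: le_trans h _.
  by rewrite -[leRHS]mulr1 ler_wpM2l ?mulr_ge0//; case/andP: y01 => a b; rewrite ger0_norm.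
have e4 (p q u z : E) : p - q - (u - z) = p - u - (q - z).
  by apply: crd_inj => j; rewrite !(crdD, crdB, raddfN) /=; ring.
by rewrite e4; exact: l3.
Qed.

Definition Ns r : E := vintegral 0 r (fun u => w r u \o (c u r \o v r u))%VF.

Let near_in (r : R) : 0 < r < 1 -> \forall e \near (0 : R)^', 0 < e + r < 1.
Proof.
move=> r01; apply: nbhs_dnbhs; have n : \forall t \near r, 0 < t < 1 by apply: near_itvoo.
have h : e + r @[e --> (0 : R)] --> r.
  by rewrite -[X in _ --> X]add0r; apply: cvgD; [exact: cvg_id|exact: cvg_cst].
exact: (h _ n).
Qed.

Lemma ms_derive r : 0 < r < 1 -> vpc 0 1 (c^~ r) ->
  (exists S' : seq R, forall u, 0 < u < 1 -> u \notin S' -> is_vderive (fun x : R^o => C u x) r 1 (c u r)) ->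
  vcvg 0^' (fun e : R => e^-1 *: ms r (e + r) r) (Ns r).
Proof.
move=> r01 pc [S' dC]; have [K K0 hK] := surface_bounds; have [K1 K10 hK1] := vn_comp V.
have /andP[r0 r1] := r01; have r01' : 0 <= r <= 1 by rewrite !ltW.
have bo := @bil_comp R V.
have pv : vpc 0 1 (v r) by exact: (vprim_pc ler01 (evo_prim (bC_vpc pC r01'))).
pose F (e : R^o) u : E := (w (e + r) u \o ((e^-1 *: (C u (e + r) - C u r)) \o v r u))%VF.
pose f u : E := (w r u \o (c u r \o v r u))%VF.
have pf : vpc 0 r f.
  apply: (vpc_sub (lexx 0) (ltW r1)); apply: vpc_comp; first exact: (vprim_pc ler01 (evi_prim (bC_vpc pC r01'))).
  by apply: vpc_comp.
have pD x : 0 <= x <= 1 -> vpc 0 1 (fun u => C u x - C u r) by move=> x01; apply: vpcB; exact: pC.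
have pF e : 0 < e + r < 1 -> vpc 0 1 (F e).
  move=> er; have er' : 0 <= e + r <= 1 by case/andP: er => a b; rewrite !ltW.
  apply: vpc_comp; first exact: (vprim_pc ler01 (evi_prim (bC_vpc pC er'))).
  by apply: vpc_comp => //; apply: vpcZ; exact: pD.
have ne0 : \forall e \near (0 : R)^', e != 0 by exact: nbhs_dnbhs_neq.
have dom : vcvg 0^' (fun e : R^o => vintegral 0 r (F e)) (vintegral 0 r f).
  apply: (@dominated_vint R E R^o _ 0 0 r F f (K1 * K * (K1 * L * K)) (ltW r0)) => //.
  - apply: filterS2 (near_in r01) ne0 => e er e0; apply: (vpcb_sub (lexx 0) (ltW r1)).
    have er' : 0 <= e + r <= 1 by case/andP: er => a b; rewrite !ltW.
    apply: (vpcb_of_vpc (S := [::]) (pF e er)) => u /andP[u0 u1] _; have u01 : 0 <= u <= 1 by rewrite !ltW.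
    have [w1 _ _ _] := hK (e + r) u er' u01; have [_ v1 _ _] := hK r u r01' u01.
    apply: le_trans (hK1 _ _) _; apply: ler_pM; rewrite ?mulr_ge0 ?vn_ge0 ?ler_wpM2l//.
    apply: le_trans (hK1 _ _) _; apply: ler_pM; rewrite ?mulr_ge0 ?vn_ge0 ?ler_wpM2l//.
    have := lipC u r01' er'; rewrite addrK => lc; rewrite vnZ normfV.
    by rewrite mulrC ler_pdivrMr ?normr_gt0.
  - exists S' => u /andP[u0 ur] uS; have u01 : 0 < u < 1 by rewrite u0 (lt_trans ur).
    have u01' : 0 <= u <= 1 by case/andP: u01 => a b; rewrite !ltW.
    have cw : vcvg 0^' (fun e : R^o => w (e + r) u) (w r u).
      have ce : K * `|e| @[e --> (0 : R)^'] --> (0 : R).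
        rewrite -[X in _ --> X](mulr0 K); have cc : (fun _ : R => K) @ (0 : R)^' --> K by exact: cvg_cst.
        apply: (cvgM cc); rewrite -[X in _ --> X](@normr0 _ R^o); apply: cvg_norm; exact: nbhs_dnbhs.
      apply: (vcvg_squeeze _ ce); apply: filterS (near_in r01) => e /andP[a b].
      by have [_ _ _ h] := hK r u r01' u01'; have [|h1 _] := h (e + r); [rewrite !ltW|rewrite addrK in h1].
    have cd : vcvg 0^' (fun e : R^o => e^-1 *: (C u (e + r) - C u r)) (c u r).
      move/is_vderiveP: (dC u u01 uS); apply: vcvg_near; apply: filterE => e.
      by rewrite [e *: 1]mulr1.
    exact: (vcvg_bil bo cw (vcvg_bil bo cd (vcvg_cst (0 : R)^' (v r u)))).
apply: vcvg_near dom; apply: filterS (near_in r01) => e er.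
have er' : 0 <= e + r <= 1 by case/andP: er => a b; rewrite !ltW.
have pm : vpc 0 r (fun u => w (e + r) u \o ((C u (e + r) - C u r) \o v r u))%VF.
  apply: (vpc_sub (lexx 0) (ltW r1)); apply: vpc_comp; first exact: (vprim_pc ler01 (evi_prim (bC_vpc pC er'))).
  by apply: vpc_comp => //; exact: pD.
have i1 := vintZ e^-1 (ltW r0) pm; rewrite /ms -i1; apply: eq_vint => t _.
by rewrite /F -comp_lfunZl -comp_lfunZr.
Qed.

Definition Hd r : E := hs r r.

(** The mixed difference is O(e^2). The partial derivative in the height is explicit, while the one
    in the abscissa is known through [hs_shift], modulo exact terms only, whence [kap]. *)
Lemma Hd_derive r : 0 < r < 1 -> vpc 0 1 (c^~ r) -> vcts (C^~ r) r ->
  (exists S' : seq R, forall u, 0 < u < 1 -> u \notin S' -> is_vderive (fun x : R^o => C u x) r 1 (c u r)) ->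
  is_vderive (fun s : R^o => kap (Hd s)) r 1 (kap (- Fs r r - (Ns r \o w r r)%VF)).
Proof.
move=> r01 pc cC dC; have [K K0 hK] := hs_lip; have bo := @bil_comp R V.
have /andP[r0 r1] := r01; have r01' : 0 <= r <= 1 by rewrite !ltW.
apply/is_vderiveP.
pose E1 e := (hs (e + r) (e + r) - hs (e + r) r) - (hs r (e + r) - hs r r).
have T1 : vcvg 0^' (fun e : R => e^-1 *: E1 e) 0.
  apply: isO2_cvg; exists K => //; apply: filterS (near_in r01) => e /andP[a b].
  have er : 0 <= e + r <= 1 by rewrite !ltW.
  have [_ _] := hK r (e + r) r (e + r) r01' er r01' er.
  by rewrite addrK -mulrA -expr2.
have cF : vcts (Fs r) r.
  exact: (vcvg_bil bo (vprim_cts (evi_prim (bC_vpc pC r01')) r01) cC).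
have T2 : vcvg 0^' (fun e : R => e^-1 *: (hs r (e + r) - hs r r)) (- Fs r r).
  have d : is_vderive (fun y : R^o => hs r y) r 1 (- Fs r r).
    exact: (is_vderiveN (vint_derive r01 (Fs_vpc pC r01') cF)).
  move/is_vderiveP: d; apply: vcvg_near; apply: filterE => e.
  by rewrite [e *: 1]mulr1.
have T3 : vcvg 0^' (fun e : R => (e^-1 *: ms r (e + r) r) \o w r r)%VF (Ns r \o w r r)%VF.
  exact: (vcvg_bil bo (ms_derive r01 pc dC) (vcvg_cst (0 : R)^' (w r r))).
have T : vcvg 0^' (fun e : R => kap (e^-1 *: E1 e + e^-1 *: (hs r (e + r) - hs r r) - ((e^-1 *: ms r (e + r) r) \o w r r)%VF))
    (kap (0 + - Fs r r - (Ns r \o w r r)%VF)).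
  exact: (vcvg_lin (@kap R V) (vcvgB (vcvgD T1 T2) T3)).
rewrite add0r in T; apply: vcvg_near T; apply: filterS (near_in r01) => e er.
have er' : 0 <= e + r <= 1 by case/andP: er => a b; rewrite !ltW.
have -> : e *: 1 + r = e + r by rewrite [e *: 1]mulr1.
apply: (quotient_algebra _ (hs_shift hC pC r01' er' r01')).
  have e4 (p q u z : E) : p - z = p - q - (u - z) + (u - z) + (q - z).
    by apply: crd_inj => j; rewrite !(crdD, crdB, raddfN) /=; ring.
  exact: e4.
exact: comp_lfunZl.
Qed.

Lemma Hd_vcontinuous : vcontinuous unit_itv (fun s : R^o => kap (Hd s)).
Proof.
have [K K0 hK] := hs_lip.
apply: vcontinuous_kap; apply: (vcontinuous_lip (K := 2 * K)) => y s y01 s01.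
have [h1 _ _] := hK s s y s s01 s01 y01 s01; have [_ h2 _] := hK y s y s y01 s01 y01 s01.
have e3 (p q u : E) : p - u = p - q + (q - u) by rewrite addrA subrK.
rewrite /Hd (e3 (hs s s) (hs s y)); apply: le_trans (vnD _ _) _.
by apply: le_trans (lerD h1 h2) _; rewrite -mulrA mulr_natl mulr2n.
Qed.

Local Notation vd := (evo (fun u => bC u u)).
Local Notation vdi := (evi (fun u => bC u u)).
Definition Ks s : E := (((Ns s \o w s s)%VF + C s s) \o vd s)%VF.

Let pbd : vpc 0 1 (fun u => bC u u).
Proof. exact: (vpc_lin (@gcomm R V (-1)) (vpcN pCd)). Qed.

Definition Yd r : E := - (vintegral 0 r Ks \o vdi r)%VF.

Lemma Yd_prim : vpc 0 1 Ks ->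
  vprim 0 1 Yd (fun r => - ((Ks r \o vdi r)%VF + (vintegral 0 r Ks \o (vdi r \o bC r r))%VF)).
Proof. by move=> pK; exact: (vprimN (vprim_bil ler01 (@bil_comp R V) (vprim_int pK) (evi_prim pbd))). Qed.

Lemma surface_exact : vpc 0 1 Ks -> Hd 1 - Yd 1 \in ex.
Proof.
move=> pK; have [S hS] := genC; have vY := Yd_prim pK.
have [_ _ [S2 dY]] := iffLR (vprimP _ _ ler01) vY.
have z01 : 0 <= (0 : R) <= 1 by rewrite lexx ler01.
have o01 : 0 <= (1 : R) <= 1 by rewrite lexx ler01.
have cY := vprim_vcontinuous vY.
pose y r := kap (Hd r) - kap (Yd r).
have cy : vcontinuous unit_itv (y : R^o -> E).
  exact: (vcontinuousB Hd_vcontinuous (vcontinuous_kap cY)).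
have y0 : y 0 = 0.
  by rewrite /y /Hd /Yd /hs !vint_point comp_lfun0l subrr.
(* [quot_ode] asks for a cochain map at every time, while [bC u u] is known to be one only on
   [0, 1]; outside, the field is set to 0. *)
pose a u := if (0 <= u <= 1) then bC u u else 0.
have pa : vpc 0 1 a.
  by apply: (vpc_eq (S := [::]) _ pbd) => t /andP[t0 t1] _; rewrite /a (ltW t0) (ltW t1).
have ga t : gl0 (a t) by rewrite /a; case: ifP => [t01|_]; [exact: gl0_bC|exact: gl0_0].
have y1 : y 1 \in ex.
  apply: (quot_ode pa ga cy y0 _ o01); exists (S ++ S2) => r r01; rewrite mem_cat negb_or => /andP[/(hS r r01)[pc cC dC] /(dY r r01) dYr].
  have r01' : 0 <= r <= 1 by case/andP: r01 => p q; rewrite !ltW.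
  have := is_vderiveB (Hd_derive r01 pc cC dC) (is_vderive_lin (@kap R V) dYr).
  rewrite /a r01'; congr (is_vderive _ _ _ _).
  have bN : bC r r = - gcomm (-1) (C r r) by exact: (raddfN (@gcomm R V (-1))).
  exact: (diag_rhs (Ns r) (eviK pbd r01') bN (w_hs hC pC r01' r01') (erefl (Yd r)) (hs_homogeneous hC pC r01' r01') (hC r r01') (gl0_bC hC r r01')).
have h := pi1_eq y1; rewrite !pi1_kap in h.
by apply/pi1P; rewrite pi1D pi1N h subrr.
Qed.

End SurfaceDerivative.

Lemma evo_eq_off (R : realType) (U : vectType R) (a b : R -> 'End(U)) (S : seq R) : vpc 0 1 a ->
  (forall t, 0 < t < 1 -> t \notin S -> a t = b t) ->
  forall t, 0 <= t <= 1 -> evo a t = evo b t /\ evi a t = evi b t.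
Proof.
move=> pa ab t t01; have pb : vpc 0 1 b by exact: vpc_eq ab pa.
have e : evo a t = evo b t.
  have h u : 0 < u < 1 -> u \notin S -> - (b u \o evo b u)%VF = - (a u \o evo b u)%VF by move=> u01 uS; rewrite ab.
  by have := evo_unique pa (lexx 0) ler01 (lexx 1) h (evo_prim pb) t01; rewrite (evi0 pa) (evo0 pb) !comp_lfun1r.
by split; [exact: e|exact: (congr1 (fun x => x^-1%VF) e)].
Qed.

Section LeftDifferential.
Variables (R : realType) (V : cochain_complex R).
Local Notation E := 'End(V).

Lemma is_vderive_line0 (W : vectType R) (q z : W) : is_vderive (fun e : R^o => q + e *: z) 0 1 z.
Proof.
apply/is_vderiveP; generalize (vcvg_cst (0 : R)^' z); apply: vcvg_near.
have ne0 : \forall e \near (0 : R)^', e != 0 by exact: nbhs_dnbhs_neq.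
apply: filterS ne0 => e e0.
by rewrite addr0 [e *: 1]mulr1 scale0r addr0 addrAC subrr add0r scalerA mulVf// scale1r.
Qed.

(** The product q + t + q [d, t] is affine in its second factor, so its differential at the unit is
    its linear part. Using [lift1] fixes one representative of [q] for all [e]. *)
Lemma left_differentialE (q : qEnd V) (x : E) : homogeneous (-1) x ->
  left_differential q (pi1 x) = pi1 (x + (lift1 V q \o gcomm (-1) x)%VF).
Proof.
move=> hx; rewrite /left_differential; apply: is_vderive_vderive.
have -> : (fun e : R^o => GL1mul q (e *: pi1 x)) = fun e => q + e *: pi1 (x + (lift1 V q \o gcomm (-1) x)%VF).
  apply/funext => e; have he : homogeneous (-1) (e *: x).
    by rewrite -[e *: x]addr0; apply: homogeneous_lin => //; exact: homogeneous0.
  have pZ y : pi1 (e *: y) = e *: pi1 y := pi1Z e y.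
  have gZ : gcomm (-1) (e *: x) = e *: gcomm (-1) x by rewrite linearZ.
  rewrite -pZ -[X in GL1mul X _](lift1K q) -[X in X + _](lift1K q) -pZ -pi1D.
  by rewrite (GL1mul_pi _ he) gZ -comp_lfunZr -addrA scalerDr.
exact: is_vderive_line0.
Qed.

Lemma GL0_invK (f : E) : GL0 f -> GL0 (f^-1)%VF /\ ((f^-1)^-1)%VF = f.
Proof.
move=> gf; have [_ fi] := gf; have fV := lker0_compVf fi; have Vf := lker0_compfV fi.
have vi : invertible (f^-1)%VF.
  by apply/lker0P => x y xy; rewrite -[x]id_lfunE -[y]id_lfunE -Vf !comp_lfunE xy.
split; first by split; [exact: gl0_inv|exact: vi].
by rewrite -[LHS]comp_lfun1l -Vf -comp_lfunA lker0_compfV// comp_lfun1r.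
Qed.

Lemma comp_sum_congr (i i' v v' x x' d d' : E) : i = i' -> v = v' -> x = x' -> d = d' ->
  (((i \o v)%VF + x) \o d)%VF = (((i' \o v')%VF + x') \o d')%VF.
Proof. by move=> -> -> -> ->. Qed.

Lemma vcontinuous_pi1 (F : R^o -> E) : vcontinuous unit_itv F -> vcontinuous unit_itv (fun t : R^o => pi1 (F t)).
Proof. by move=> h j; exact: (vcontinuous_lin (L := @pi1 R V) h). Qed.

Lemma vcontinuous_lift1 (F : R^o -> qEnd V) : vcontinuous unit_itv F -> vcontinuous unit_itv (fun t : R^o => lift1 V (F t)).
Proof. by move=> h j; exact: (vcontinuous_lin (L := lift1 V) h). Qed.

Lemma solution_algebra (w h x : E) : w = \1%VF + gcomm (-1) h -> homogeneous (-1) h -> homogeneous (-1) x ->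
  homogeneous (-1) (- x) -> pi1 (- (w \o x)%VF) = pi1 (- x + (kap h \o gcomm (-1) (- x))%VF).
Proof.
move=> -> hh hx hN; apply: pi1_eq.
have -> : - ((\1%VF + gcomm (-1) h) \o x)%VF - (- x + (kap h \o gcomm (-1) (- x))%VF) =
    ((gcomm (-1) h \o - x)%VF - (h \o gcomm (-1) (- x))%VF) - ((kap h - h) \o gcomm (-1) (- x))%VF.
  rewrite comp_lfunNr (comp_lfunDl (kap h)) (comp_lfunNl h) (comp_lfunDl \1%VF) comp_lfun1l.
  by apply: crd_inj => j; rewrite !(crdD, crdB, raddfN) /=; ring.
by rewrite memvB ?exact1_swap ?exact1_gl0 ?kapK//; exact: gl0_gcomm1.
Qed.

Lemma difference_algebra (q : qEnd V) (h x b : E) :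
  lift1 V (pi1 (x + (lift1 V q \o b)%VF)) - lift1 V (pi1 (x + (kap h \o b)%VF)) = kap ((lift1 V q - kap h) \o b)%VF.
Proof.
rewrite -!/(kap _) -(linearB (@kap R V)); congr kap.
by rewrite comp_lfunDl comp_lfunNl opprD addrACA subrr add0r.
Qed.

End LeftDifferential.

(** * Holonomy of a 2-path *)

Section Holonomy.
Variables (R : realType) (n : nat) (M : manifold R n) (V : cochain_complex R).
Local Notation X := (R^o * R^o)%type.
Local Notation E := 'End(V).
Variables (alpha : forall k, dform M k E) (G : X -> M) (k : nat) (pol : 'I_k -> halfspaces R).
Arguments alpha : clear implicits.
Local Notation A := (alpha 1%N).
Local Notation al2 := (alpha 2%N).
(** Expressed through alpha^2, it is a form by linearity and visibly exact; flatness provides its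
    other expression, as the curvature of alpha^1. *)
Definition curvature2 : dform M 2 E := fun c z v => - gcomm (-1) (al2 c z v).
Local Notation F2 := curvature2.
Hypothesis falpha : forall k, is_form (alpha k).
Hypothesis fF : is_form F2.
Hypothesis hF : forall c z u v, @chart_img _ _ M c z -> F2 c z (pair2 u v) =
  vderive (fun x => A c x (fun _ => v)) z u - vderive (fun x => A c x (fun _ => u)) z v +
  ((A c z (fun _ => u) \o A c z (fun _ => v))%VF - (A c z (fun _ => v) \o A c z (fun _ => u))%VF).
Hypothesis gA : forall c z v, chart_img c z -> gl0 (A c z v).
Hypothesis h2 : forall c z v, chart_img c z -> homogeneous (-1) (al2 c z v).
Hypothesis cover : square `<=` \bigcup_i hs_set (pol i).
Hypothesis cG : {within square, continuous G}.
Hypothesis sm : forall i, smooth_on (square `&` hs_set (pol i)) G.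
Hypothesis left_const : forall s : R, 0 <= s <= 1 -> G (0, s) = G (0, 0).
Local Notation e1 := ((1, 0) : X).
Local Notation e2 := ((0, 1) : X).
Local Notation lf := (linefield A G).
Local Notation P y := (evo (lf e1 (0, y))).
Local Notation Q y := (evi (lf e1 (0, y))).
Local Notation cur := (fcurv al2 G).
Local Notation ct := (gcurv A al2 G).
Local Notation cint := (bt A al2 G).
Local Notation gen_level y := (exists S : seq R, forall x, 0 <= x <= 1 -> x \notin S -> fgen pol (x, y)).
Local Notation I01 := [set s : R^o | 0 <= s <= 1].

Let fA : is_form A. Proof. exact: falpha. Qed.
Let f2 : is_form al2. Proof. exact: falpha. Qed.

Lemma lf_gl0 d p u : gl0 (lf d p u).
Proof. by apply: gA; exact: chart_img_at. Qed.

Lemma cur_homogeneous p : homogeneous (-1) (cur p).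
Proof. by apply: h2; exact: chart_img_at. Qed.

Lemma P_gl0 y x : 0 <= y <= 1 -> 0 <= x <= 1 -> gl0 (P y x) /\ gl0 (Q y x).
Proof.
move=> y01 x01; have pP := P_vpc fA cover cG sm y01; have g := lf_gl0 e1 (0, y).
by split; [exact: gl0_evo|exact: gl0_evi].
Qed.

Lemma ct_homogeneous y x : 0 <= y <= 1 -> 0 <= x <= 1 -> homogeneous (-1) (ct y x).
Proof.
move=> y01 x01; have [gP gQ] := P_gl0 y01 x01.
exact: (homogeneous_gl0 gQ (gl0_homogeneous (cur_homogeneous _) gP)).
Qed.

Lemma ct_vpc y : 0 <= y <= 1 -> gen_level y -> vpc 0 1 (ct y).
Proof. by move=> y01 gy; have [L _ h] := bt_lip fA f2 cover cG sm; exists L; have [] := h y y01 gy. Qed.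

Lemma cint_homogeneous y x : 0 <= y <= 1 -> gen_level y -> 0 <= x <= 1 -> homogeneous (-1) (cint y x).
Proof.
move=> y01 gy /andP[x0 x1]; apply: homogeneous_vint => //; first exact: vpc_sub (lexx 0) x1 (ct_vpc y01 gy).
by move=> t /andP[t0 tx]; apply: ct_homogeneous => //; rewrite (ltW t0) (le_trans (ltW tx)).
Qed.

(** The transports along a level are cochain maps of degree 0, so the differential commutes with
    conjugation by them, and with the integral by linearity. *)
Lemma bt_cint y x : 0 <= y <= 1 -> gen_level y -> 0 <= x <= 1 -> bt A F2 G y x = gcomm (-1) (- cint y x).
Proof.
move=> y01 gy /andP[x0 x1]; have pc := vpc_sub (lexx 0) x1 (ct_vpc y01 gy).
have i1 := vintN x0 pc; have i2 := vint_lin (@gcomm R V (-1)) x0 (vpcN pc).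
apply: (etrans _ (etrans i2 (congr1 (gcomm (-1)) i1))); apply: eq_vint => t /andP[t0 tx].
have t01 : 0 <= t <= 1 by rewrite t0 (le_trans tx).
have [gP gQ] := P_gl0 y01 t01.
have e : fcurv F2 G (t, y) = gcomm (-1) (- cur (t, y)) by rewrite -[LHS]/(- gcomm (-1) (cur (t, y))); exact: (esym (raddfN (@gcomm R V (-1)) _)).
have e' (q f p f' : E) : gl0 q -> gl0 p -> f' = gcomm (-1) (- f) -> (q \o (f' \o p))%VF = gcomm (-1) (- (q \o (f \o p))%VF).
  by move=> gq gp ->; rewrite -comp_lfunNr -comp_lfunNl gcomm_gl0l// gcomm_gl0r.
exact: (e' _ _ _ _ gQ gP e).
Qed.

Lemma ct_cvg_level y x : 0 < x < 1 -> 0 <= y <= 1 -> fgen pol (x, y) -> vcts (ct y) x.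
Proof.
move=> x01 y01 gxy; have x01' : 0 <= x <= 1 by case/andP: x01 => a b; rewrite !ltW.
have pP := P_vpc fA cover cG sm y01.
have sq : square ((x, y) : X) by split.
have cf : vcvg (within I01 (nbhs (x : R^o))) (fun s : R^o => cur (s, y)) (cur (x, y)).
  have lc : (s, y) @[s --> within I01 (nbhs (x : R^o))] --> within square (nbhs ((x, y) : X)).
    have -> : (fun s : R^o => (s, y) : X) = fun s => s *: e1 + (0, y) by apply/funext => s; rewrite lineh.
    rewrite -(lineh x y); apply: line_cvg_within; [exact: cvg_within|exact: cvg_cst|].
    by rewrite near_withinE; apply: filterE => s s01; exact: line_inh.
  exact: (vcvg_comp lc (pullback_cvg cover cG sm f2 (contform2 f2) sq (mdgen_pair2 gxy))).
have cf' := within_interior x01 cf; have bo := @bil_comp R V.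
exact: (vcvg_bil bo (vprim_cts (evi_prim pP) x01) (vcvg_bil bo cf' (vprim_cts (evo_prim pP) x01))).
Qed.

Lemma ct_bound : exists2 L, 0 <= L & forall y x, 0 <= y <= 1 -> 0 <= x <= 1 -> fgen pol (x, y) -> vn (ct y x) <= L.
Proof.
have [L L0 hL] := pullback_bounded cover cG sm (pair2 e1 e2) f2 (contform2 f2).
have [C C0 hC] := evo_bounded fA cover cG sm e1; have [K K0 hK] := vn_comp V.
exists (K * C * (K * L * C)) => [|y x y01 x01 g]; first by rewrite !mulr_ge0.
have [b1 b2] := hC _ (line_inh y01) x x01.
have sq : square ((x, y) : X) by split.
have b3 := hL _ sq (mdgen_pair2 g).
apply: le_trans (hK _ _) _; rewrite ler_pM ?mulr_ge0 ?vn_ge0// ?ler_wpM2l//.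
by apply: le_trans (hK _ _) _; rewrite ler_pM ?mulr_ge0 ?vn_ge0// ler_wpM2l.
Qed.

Variable S : seq R.
Hypothesis hS : forall y, 0 <= y <= 1 -> y \notin S -> gen_level y.

(* The integral of the curvature along the generic levels, to which the
   remaining ones contribute nothing. *)
Definition Cx (u x : R) : E := if (0 < u < 1) && (u \notin S) then cint u x else 0.

Let levelP u : (0 < u < 1) && (u \notin S) -> 0 <= u <= 1 /\ gen_level u.
Proof.
move=> /andP[/andP[a b] uS]; have u01 : 0 <= u <= 1 by rewrite !ltW.
by split; [exact: u01|exact: hS].
Qed.

Lemma CxE u : 0 < u < 1 -> u \notin S -> Cx u = cint u.
Proof. by move=> u01 uS; apply/funext => x; rewrite /Cx u01 uS. Qed.

Lemma Cx_homogeneous u x : 0 <= x <= 1 -> homogeneous (-1) (Cx u x).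
Proof.
move=> x01; rewrite /Cx; case: ifP => [/levelP[u01 gu]|_]; last exact: homogeneous0.
exact: cint_homogeneous.
Qed.

Lemma Cx0 u : Cx u 0 = 0.
Proof. by rewrite /Cx; case: ifP => // _; exact: vint_point. Qed.

Lemma Cx_lip : exists2 L, 0 <= L & forall u x x', 0 <= x <= 1 -> 0 <= x' <= 1 -> vn (Cx u x' - Cx u x) <= L * `|x' - x|.
Proof.
have [L L0 hL] := bt_lip fA f2 cover cG sm; exists L => // u x x' x01 x'01.
rewrite /Cx; case: ifP => [/levelP[u01 gu]|_]; last by rewrite subrr vn0 mulr_ge0.
by have [_ h] := hL u u01 gu; exact: h.
Qed.

Lemma Cx_vpc (xi : R -> R) : (forall u, 0 <= u <= 1 -> 0 <= xi u <= 1) -> continuous (xi : R -> R) ->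
  vpc 0 1 (fun u => Cx u (xi u)).
Proof.
move=> h c; apply: (vpc_eq (S := S) _ (bt_vpc fA f2 cover cG sm h c)) => t t01 tS.
by rewrite (CxE t01 tS).
Qed.

Lemma Cx_generic : exists S1 : seq R, forall r, 0 < r < 1 -> r \notin S1 ->
  [/\ vpc 0 1 (ct^~ r), vcts (Cx^~ r) r & exists S' : seq R, forall u, 0 < u < 1 -> u \notin S' ->
      is_vderive (fun x : R^o => Cx u x) r 1 (ct u r)].
Proof.
have [S3 h3] := fgen_lines pol; exists (S3 ++ S) => r r01; rewrite mem_cat negb_or => /andP[r3 rS].
have r01' : 0 <= r <= 1 by case/andP: r01 => a b; rewrite !ltW.
have [S' hS'] := h3 r r01' r3; split.
- have [L L0 hL] := ct_bound; exists L, S' => u u01 uS; have u01' : 0 <= u <= 1 by case/andP: u01 => a b; rewrite !ltW.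
  have [_ g] := hS' u u01' uS; split; first exact: hL.
  exact: (gcurv_cvg fA f2 cover cG sm u01 r01' g).
- have n1 : \forall s \near r, 0 < s < 1 by apply: near_itvoo.
  have n2 : \forall s \near r, s \notin S by exact: near_notin.
  have ng : \forall s \near r, 0 <= s <= 1 /\ gen_level s.
    by apply: filterS2 n1 n2 => s a b; apply: levelP; rewrite a b.
  have cc : (fun _ : R => r) u @[u --> r] --> r by exact: cvg_cst.
  have c := @bt_vcts _ _ _ _ _ _ _ _ _ fA f2 cover cG sm (fun=> r) r (fun _ _ => r01') r01 cc ng.
  apply: vcts_near c; apply: filterS2 n1 n2 => s a b.
  by rewrite (CxE a b).
exists (S' ++ S) => u u01; rewrite mem_cat negb_or => /andP[uS' uS].
have [u01' gu] := levelP (introT andP (conj u01 uS)).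
have [_ g] := hS' u u01' uS'; rewrite (CxE u01 uS).
exact: (vint_derive r01 (ct_vpc u01' gu) (ct_cvg_level r01 u01' g)).
Qed.

Local Notation hs := (hs Cx).
Local Notation w x := (evi ((bC Cx)^~ x)).

Let pCx x : 0 <= x <= 1 -> vpc 0 1 (Cx^~ x).
Proof. by move=> x01; apply: (Cx_vpc (xi := fun=> x)) => [u _|]; [exact: x01|move=> u; exact: cvg_cst]. Qed.

Let pCxd : vpc 0 1 (fun u => Cx u u).
Proof. by apply: (Cx_vpc (xi := fun u => u)) => [u|]; [|move=> u; exact: cvg_id]. Qed.

Let hCx u x : 0 <= x <= 1 -> homogeneous (-1) (Cx u x).
Proof. exact: Cx_homogeneous. Qed.

Lemma bt_bC u x : 0 < u < 1 -> u \notin S -> 0 <= x <= 1 -> bC Cx u x = bt A F2 G u x.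
Proof.
move=> u01 uS x01; have [u01' gu] := levelP (introT andP (conj u01 uS)).
by rewrite (bt_cint u01' gu x01) /bC (CxE u01 uS).
Qed.

(** The fields [bC] and [bt] agree off the exceptional levels, which evolutions do not see, so the
    resummed expression is [Yd] at 1 and [surface_exact] applies. *)
Lemma int2_hs : pi1 ((int2 alpha G - int2 alpha (G \o @swap R)) \o P 1 1)%VF = pi1 (hs 1 1).
Proof.
have [pW ->] := int2_diff falpha fF hF cover cG sm left_const.
have [L L0 lip] := Cx_lip.
have pb x : 0 <= x <= 1 -> vpc 0 1 ((bC Cx)^~ x) by move=> x01; exact: (bC_vpc pCx x01).
have pbd : vpc 0 1 (fun u => bC Cx u u) by exact: (vpc_lin (@gcomm R V (-1)) (vpcN pCxd)).
have ev x : 0 <= x <= 1 -> forall t, 0 <= t <= 1 -> evo ((bC Cx)^~ x) t = evo (fun u => bt A F2 G u x) t /\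
    w x t = evi (fun u => bt A F2 G u x) t.
  by move=> x01; apply: (evo_eq_off (S := S) (pb x x01)) => u u01 uS; exact: bt_bC.
have evd : forall t, 0 <= t <= 1 -> evo (fun u => bC Cx u u) t = evo (fun u => bt A F2 G u u) t /\
    evi (fun u => bC Cx u u) t = evi (fun u => bt A F2 G u u) t.
  by apply: (evo_eq_off (S := S) pbd) => u u01 uS; apply: bt_bC => //; case/andP: u01 => a b; rewrite !ltW.
have KE s : 0 < s < 1 -> s \notin S -> Ks Cx ct s = ((vert_integrand alpha F2 G s \o vcoli alpha F2 G s s + cint s s) \o vdiag alpha F2 G s)%VF.
  move=> s01 sS; have s01' : 0 <= s <= 1 by case/andP: s01 => a b; rewrite !ltW.
  apply: comp_sum_congr.
  - apply: eq_vint => u /andP[u0 us]; have u01 : 0 <= u <= 1 by rewrite u0 (le_trans us)//; case/andP: s01'.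
    by have [e1' e2'] := ev s s01' u u01; rewrite e1' e2'.
  - by have [_ e] := ev s s01' s s01'; exact: e.
  - by rewrite (CxE s01 sS).
  - by have [e _] := evd s s01'; exact: e.
have pK : vpc 0 1 (Ks Cx ct) by apply: (vpc_eq (S := S) _ pW) => s s01 sS; exact: (esym (KE s s01 sS)).
have o01 : 0 <= (1 : R) <= 1 by rewrite ler01 lexx.
have eK := eq_vint_off ler01 pK KE; have [_ e1d] := evd 1 o01.
have Xe : - (vintegral 0 1 (fun s => (vert_integrand alpha F2 G s \o vcoli alpha F2 G s s + cint s s) \o vdiag alpha F2 G s) \o vdiagi alpha F2 G 1)%VF = Yd Cx ct 1.
  rewrite -eK; apply: (congr1 (fun x => - (vintegral 0 1 (Ks Cx ct) \o x)%VF)); exact: (esym e1d).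
have h := pi1_eq (surface_exact hCx Cx0 L0 lip pCx pCxd Cx_generic pK).
exact: (etrans (congr1 (@pi1 R V) Xe) (esym h)).
Qed.

Lemma transport_level s t : 0 <= s <= 1 -> 0 <= t <= 1 -> transport A (fun u => G (u, s)) t = P s t.
Proof.
move=> s01 t01; have pP := P_vpc fA cover cG sm s01.
apply: (transportE _ pP (fun u => lf_gl0 e1 (0, s) u) t01) => u.
have eg : (fun u : R^o => G (u, s)) = fun h : R^o => G (h *: e1 + (0, s)) by apply/funext => h; rewrite lineh.
exact: (etrans (congr1 (fun g => pullback g A u (fun _ => 1)) eg) (pullback_line G A e1 (0, s) u)).
Qed.

Local Notation B := (fun c x v => - pi1 (al2 c x v)).
Local Notation rhs s := (vintegral 0 1 (fun t => GLact (transport A (fun u => G (u, s)) t)^-1%VF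
  (pullback G B ((t, s) : X) (pair2 e1 e2)))).

Lemma surface_rhs s : 0 < s < 1 -> s \notin S -> rhs s = pi1 (- Cx s 1).
Proof.
move=> s01 sS; have [s01' gs] := levelP (introT andP (conj s01 sS)); have pc := ct_vpc s01' gs.
have pP := P_vpc fA cover cG sm s01'.
have i1 := vintN ler01 pc; have i2 := vint_lin (@pi1 R V) ler01 (vpcN pc).
have e : rhs s = vintegral 0 1 (fun t => pi1 (- ct s t)).
  apply: eq_vint => t t01; rewrite (transport_level s01' t01).
  have gP : GL0 (P s t) := GL0_evo pP (fun u => lf_gl0 e1 (0, s) u) t01.
  have [gQ QK] := GL0_invK gP.
  have -> : pullback G B ((t, s) : X) (pair2 e1 e2) = pi1 (- cur (t, s)) by exact: esym (pi1N _).
  rewrite (GLact_pi _ gQ) QK; congr pi1.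
  by rewrite comp_lfunNr comp_lfunNl -comp_lfunA.
rewrite e (CxE s01 sS); exact: (etrans i2 (congr1 (@pi1 R V) i1)).
Qed.

(** [Hol] selects an arbitrary solution, so both existence and uniqueness of the final value are
    needed. For existence, -w C with w = 1 + [d, h] equals -C - h [d, C] modulo exact terms, which
    is the prescribed right-hand side; the values lie in GL^-1(V) because 1 + [d, h] is the
    invertible [w]. For uniqueness, the difference of two lifted solutions satisfies the hypotheses
    of [quot_ode]. *)
Lemma surface_transport_exists : is_surface_transport A B G (fun s => pi1 (hs 1 s)) /\
  forall g, is_surface_transport A B G g -> g 1 = pi1 (hs 1 1).
Proof.
have o01 : 0 <= (1 : R) <= 1 by rewrite ler01 lexx.
have vh := hs_prim pCx o01; have [_ _ [S2 dh]] := iffLR (vprimP _ _ ler01) vh.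
have pb := bC_vpc pCx o01; have gb u := gl0_bC hCx u o01.
have hN s : homogeneous (-1) (- Cx s 1) by apply: homogeneousN; exact: hCx.
have in01 (s : R) : 0 < s < 1 -> 0 <= s <= 1 by move=> /andP[a b]; rewrite !ltW.
have rhsE s q : 0 < s < 1 -> s \notin S -> left_differential q (rhs s) = pi1 (- Cx s 1 + (lift1 V q \o bC Cx s 1)%VF).
  by move=> s01 sS; rewrite (surface_rhs s01 sS) left_differentialE.
have solE s : 0 < s < 1 -> pi1 (- Fs Cx 1 s) = pi1 (- Cx s 1 + (kap (hs 1 s) \o bC Cx s 1)%VF).
  move=> s01; have s01' := in01 s s01.
  have e := w_hs hCx pCx o01 s01'; have hh := hs_homogeneous hCx pCx o01 s01'.
  exact: (solution_algebra e hh (hCx s o01) (hN s)).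
have cs : vcontinuous unit_itv (fun s : R^o => pi1 (hs 1 s)).
  exact: (vcontinuous_pi1 (vprim_vcontinuous vh)).
have h0 : hs 1 0 = 0 by rewrite /hs vint_point oppr0.
split.
  split; first exact: (etrans (congr1 (@pi1 R V) h0) (@pi1_0 _ _)).
    move=> s s01; exists (hs 1 s) => //; split; first exact: (hs_homogeneous hCx pCx o01 s01).
    rewrite addrC -(w_hs hCx pCx o01 s01).
    have gv : GL0 (evo ((bC Cx)^~ 1) s) by exact: GL0_evo.
    by have [[_ h] _] := GL0_invK gv; exact: h.
  split; first exact: cs.
  exists (S ++ S2) => s s01; rewrite mem_cat negb_or => /andP[sS sS2].
  rewrite (rhsE s _ s01 sS) -/(kap _) -(solE s s01).
  exact: (is_vderive_lin (@pi1 R V) (dh s s01 sS2)).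
move=> g [g0 _ [cg [S3 dg]]].
pose y s := lift1 V (g s) - kap (hs 1 s).
have cy : vcontinuous unit_itv (y : R^o -> E).
  exact: (vcontinuousB (vcontinuous_lift1 cg) (vcontinuous_kap (vprim_vcontinuous vh))).
have y0 : y 0 = 0 by rewrite /y g0 h0 linear0 (linear0 (@kap R V)) subrr.
have : y 1 \in @exact1 R V.
  apply: (quot_ode pb gb cy y0 _ o01); exists (S ++ S2 ++ S3) => s s01; rewrite !mem_cat !negb_or => /and3P[sS sS2 sS3].
  have d1 := is_vderive_lin (lift1 V) (dg s s01 sS3).
  have d2 := is_vderive_lin (lift1 V) (is_vderive_lin (@pi1 R V) (dh s s01 sS2)).
  have := is_vderiveB d1 d2; congr (is_vderive _ _ _ _).
  exact: (etrans (congr2 (fun p q => lift1 V p - lift1 V q) (rhsE s _ s01 sS) (solE s s01)) (difference_algebra _ _ _ _)).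
move=> /pi1_eq h.
exact: (etrans (esym (lift1K _)) (etrans h (pi1_kap _))).
Qed.

End Holonomy.

(** * The flat 2-connection *)

Section LinearImages.
Variables (R : realType) (X : normedModType R).

Lemma Ck_eq l (U : set X) (f g : X -> R^o) : open U -> (forall x, U x -> f x = g x) -> Ck l U f -> Ck l U g.
Proof.
move=> oU; elim: l f g => [|l IH] f g fg [cf h].
  split=> // x Ux; have n : \forall y \near x, f y = g y by apply: filterS (open_nbhs_nbhs (conj oU Ux)) => y; exact: fg.
  by rewrite /prop_for /continuous_at -(fg x Ux); apply: cvg_trans (cf x Ux); apply: near_eq_cvg.
have nn x : U x -> \forall y \near x, f y = g y by move=> Ux; apply: filterS (open_nbhs_nbhs (conj oU Ux)) => y; exact: fg.
split.
  move=> x Ux; rewrite /prop_for /continuous_at -(fg x Ux); apply: cvg_trans (cf x Ux); apply: near_eq_cvg.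
  exact: nn.
move=> v; have [d c] := h v; split; first by move=> x Ux; apply: near_eq_derivable (d x Ux); exact: nn.
apply: IH c => x Ux; apply: near_eq_derive; exact: nn.
Qed.

Lemma Ck_lin l (U : set X) (f g : X -> R^o) (a : R) : open U -> Ck l U f -> Ck l U g -> Ck l U (fun x => a * f x + g x).
Proof.
move=> oU; elim: l f g => [|l IH] f g [cf hf] [cg hg].
  by split=> // x Ux; apply: cvgD; [apply: cvgMr; exact: cf|exact: cg].
split; first by move=> x Ux; apply: cvgD; [apply: cvgMr; exact: cf|exact: cg].
move=> v; have [df c1] := hf v; have [dg c2] := hg v; split.
  by move=> x Ux; apply: derivableD; [apply: derivableZ; exact: df|exact: dg].
apply: (Ck_eq oU _ (IH _ _ c1 c2)) => x Ux.
rewrite (_ : (fun x => a * f x + g x) = a \*: f + g)//.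
by rewrite deriveD ?deriveZ//; [exact: df|apply: derivableZ; exact: df|exact: dg].
Qed.

Lemma Ck_cst0 l (U : set X) : Ck l U (fun _ : X => 0 : R^o).
Proof.
elim: l => [|l IH]; first by split=> // x _; exact: cvg_cst.
split; first by move=> x _; exact: cvg_cst.
move=> v; split; first by move=> x _; exact: derivable_cst.
by rewrite (_ : 'D_v _ = fun=> 0)//; apply/funext => x; exact: derive_cst.
Qed.

Lemma is_smooth_lin (W1 W2 : vectType R) (L : {linear W1 -> W2}) (U : set X) (F : X -> W1) : open U ->
  is_smooth U F -> is_smooth U (fun x => L (F x)).
Proof.
move=> oU sF l j; rewrite (_ : (fun x => crd j (L (F x))) = fun x => \sum_(k < \dim {:W1}) crd j (L (vbasis {:W1})`_k) * crd k (F x) : R^o); last first.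
  by apply/funext => x; rewrite lin_crd; apply: eq_bigr => k _; rewrite mulrC.
have h (I : seq 'I_(\dim {:W1})) : Ck l U (fun x => \sum_(k <- I) crd j (L (vbasis {:W1})`_k) * crd k (F x) : R^o).
  elim: I => [|k I IH].
    by rewrite (_ : (fun x => _) = fun=> 0); [exact: Ck_cst0|apply/funext => x; rewrite big_nil].
  rewrite (_ : (fun x => _) = fun x => crd j (L (vbasis {:W1})`_k) * crd k (F x) + \sum_(k <- I) crd j (L (vbasis {:W1})`_k) * crd k (F x) : R^o).
    exact: (Ck_lin _ oU (sF l k) IH).
  by apply/funext => x; rewrite big_cons.
exact: h.
Qed.

End LinearImages.

Section FormAlgebra.
Variables (R : realType) (n : nat) (M : manifold R n).

Lemma is_form_lin k (W1 W2 : vectType R) (L : {linear W1 -> W2}) (w : dform M k W1) :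
  is_form w -> is_form (fun c x v => L (w c x v)).
Proof.
move=> [al sw tr]; split.
- move=> c x cx; have [h1 h2] := al c x cx; split=> [v i a y z|v i j ij e].
    by rewrite h1 linearD linearZ.
  by rewrite (h2 v i j ij e) linear0.
- by move=> c v; apply: is_smooth_lin; [exact: img_open|exact: sw].
- by move=> c c' p v h h'; rewrite (tr c c' p v h h').
Qed.

Lemma near_chart_img (c : atlas M) z u : chart_img c z -> \forall e \near (0 : R)^', chart_img c (e *: u + z).
Proof.
move=> cz; have nz : nbhs z (@chart_img _ _ M c) by apply: open_nbhs_nbhs; split; [exact: img_open|exact: cz].
have h : e *: u + z @[e --> (0:R)^'] --> (0 : R) *: u + z.
  by apply: cvgD; [apply: cvgZr_tmp; exact: nbhs_dnbhs|exact: cvg_cst].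
rewrite scale0r add0r in h.
exact: (h _ nz).
Qed.

Lemma extd_lin k (W1 W2 : vectType R) (L : {linear W1 -> W2}) (w : dform M k W1) c x v :
  is_form w -> chart_img c x -> extd (fun c x v => L (w c x v)) c x v = L (extd w c x v).
Proof.
move=> [_ sw _] cx; rewrite /extd linear_sum; apply: eq_bigr => i _; rewrite linearZ; congr (_ *: _).
have nz : nbhs x (@chart_img _ _ M c) by apply: open_nbhs_nbhs; split; [exact: img_open|exact: cx].
have [_ d] := nbhs_singleton (C1at_smooth nz (sw c (fun a => v (lift i a)))).
by have [d1 _] := d (v i); apply: is_vderive_vderive; exact: (is_vderive_lin L d1).
Qed.

Lemma extd0 k (W : vectType R) (w : dform M k W) c x v :
  (forall y u, chart_img c y -> w c y u = 0) -> chart_img c x -> extd w c x v = 0.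
Proof.
move=> w0 cx; rewrite /extd big1// => i _; rewrite [X in _ *: X](_ : _ = 0) ?scaler0//.
apply: is_vderive_vderive; apply: (is_vderive_near (F := fun _ => 0)); last exact: is_vderive_cst.
  by apply: filterS (near_chart_img (v i) cx) => e ce; rewrite w0.
by rewrite w0.
Qed.

Lemma form2_anti (W : vectType R) (w : vform 'rV[R]_n 2 W) u v : alternating w -> w (pair2 u v) = - w (pair2 v u).
Proof.
move=> al; have [bl br] := form2_bil al; have [_ alt] := al.
have Wd y : w (pair2 y y) = 0 by apply: (alt _ ord0 ord_max).
have a1 := bl (1 *: u + v) 1 u v; have a2 := br u 1 u v; have a3 := br v 1 u v.
move: a1; rewrite /= Wd a2 a3 !Wd !scale1r add0r addr0 => /esym/eqP.
by rewrite addr_eq0 => /eqP.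
Qed.

Lemma form2_permalt (W : vectType R) (w : vform 'rV[R]_n 2 W) : alternating w -> permalt w.
Proof.
move=> al v u; have i2 (i : 'I_2) : i = ord0 \/ i = ord_max.
  by case: i => -[|[|//]] h; [left|right]; apply: val_inj.
have [e|e] : u = 1%g \/ u = tperm ord0 ord_max.
  have [u0|u0] := i2 (u ord0); have [u1|u1] := i2 (u ord_max).
  - by have := perm_inj (etrans u0 (esym u1)).
  - by left; apply/permP => i; rewrite perm1; case: (i2 i) => ->.
  - by right; apply/permP => i; case: (i2 i) => ->; rewrite ?tpermL ?tpermR.
  - by have := perm_inj (etrans u0 (esym u1)).
- rewrite e odd_perm1 scale1r; congr w; apply/funext => a; by rewrite perm1.
rewrite e odd_tperm /= expr1 scaleN1r (pair2_eta v) -form2_anti//; congr w.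
by apply/funext => a; case: (i2 a) => ->; rewrite ?tpermL ?tpermR.
Qed.

Lemma form1_permalt (W : vectType R) (w : vform 'rV[R]_n 1 W) : permalt w.
Proof.
move=> v u; have -> : u = 1%g by apply/permP => i; rewrite perm1 (ord1 i) (ord1 (u 0)).
by rewrite odd_perm1 scale1r; congr w; apply/funext => a; rewrite perm1.
Qed.

Variable V : cochain_complex R.
Local Notation E := 'End(V).

(** The second factor in the flatness sum has degree [N - i], equal to [q] only propositionally;
    irrelevance of proofs of equality between numbers removes the mismatch. *)
Lemma sprod_cast (alpha : forall k, vform 'rV[R]_n k E) i p q N (e : (p + q)%N = N) (e' : (i + (N - i))%N = N) v : i = p ->
  sprod (1 - i%:Z) e' (alpha i) (alpha (N - i)%N) v = sprod (1 - p%:Z) e (alpha p) (alpha q) v.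
Proof.
move=> ip; subst i; have qE : (N - p)%N = q by rewrite -e addKn.
by move: e'; rewrite qE => e'; rewrite (eq_irrelevance e' e).
Qed.

Lemma sprod0l deg p q N (e : (p + q)%N = N) (w1 : vform 'rV[R]_n p E) (w2 : vform 'rV[R]_n q E) v :
  (forall u, w1 u = 0) -> sprod deg e w1 w2 v = 0.
Proof.
move=> h; rewrite /sprod /wedge_form big1 ?scaler0// => s _; by rewrite h comp_lfun0l scaler0.
Qed.

Lemma sprod0r deg p q N (e : (p + q)%N = N) (w1 : vform 'rV[R]_n p E) (w2 : vform 'rV[R]_n q E) v :
  (forall u, w2 u = 0) -> sprod deg e w1 w2 v = 0.
Proof.
move=> h; rewrite /sprod /wedge_form big1 ?scaler0// => s _; by rewrite h comp_lfun0r scaler0.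
Qed.

End FormAlgebra.

Section Flat.
Variables (R : realType) (n : nat) (M : manifold R n) (V : cochain_complex R).
Local Notation E := 'End(V).
Variable alpha : forall k, dform M k E.
Arguments alpha : clear implicits.
Hypothesis flat : flat_superconnection alpha.
Local Notation A := (alpha 1%N).
Local Notation al2 := (alpha 2%N).
Local Notation F2 := (curvature2 alpha).

Let falpha k : is_form (alpha k). Proof. by have [h _ _ _] := flat; exact: h. Qed.
Let zero c x v : chart_img c x -> alpha 0%N c x v = 0. Proof. by have [_ h _ _] := flat; exact: h. Qed.
Let hom k c x v : chart_img c x -> homogeneous (1 - k%:Z) (alpha k c x v). Proof. by have [_ _ h _] := flat; exact: h. Qed.

Lemma flat_homogeneous2 c x v : chart_img c x -> homogeneous (-1) (al2 c x v).
Proof. exact: (@hom 2%N). Qed.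

(** Flatness in form degree 1 reduces to [d, alpha^1] = 0, every other term containing alpha^0. *)
Lemma flat_gl0 c x v : chart_img c x -> gl0 (A c x v).
Proof.
move=> cx; split; first exact: (@hom 1%N).
have [_ _ _ /(_ 0%N c x v cx)] := flat.
rewrite (extd0 _ (fun y u => @zero c y u) cx) addr0 big1 => [|[[|[|//]] hi] _]; last 2 first.
- by apply: sprod0l => u; exact: zero.
- by apply: sprod0r => u; exact: zero.
rewrite addr0 expr1 scaleN1r => /eqP; rewrite oppr_eq0 /gcomm subr_eq0 => /eqP.
by rewrite expr0z scale1r.
Qed.

Lemma curvature2_form : is_form F2.
Proof.
pose L : E -> E := fun x => - gcomm (-1) x.
have lL : linear L by move=> a x y; rewrite /L linearP opprD scalerN.
pose f := HB.pack_for {linear E -> E} L (GRing.isLinear.Build R E E _ L lL).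
exact: (is_form_lin f (falpha 2%N)).
Qed.

Lemma flat_curvature c z v : chart_img c z -> F2 c z v = extd A c z v + ((A c z (fun _ => v ord0) \o A c z (fun _ => v ord_max))%VF -
  (A c z (fun _ => v ord_max) \o A c z (fun _ => v ord0))%VF).
Proof.
move=> cz; have [_ _ _ /(_ 1%N c z v cz)] := flat.
pose T : E := sprod 0 (erefl 2) (A c z) (A c z) v.
rewrite (eq_bigr (fun i : 'I_3 => if (i == 1 :> nat) then T else 0)); last first.
  move=> [[|[|[|//]]] hi] _ /=.
  - by apply: sprod0l => u; exact: zero.
  - exact: (@sprod_cast _ _ V (fun k => alpha k c z) _ 1 1 2 erefl).
  - by apply: sprod0r => u; exact: zero.
rewrite !big_ord_recl big_ord0 /= add0r !addr0.
rewrite /T /sprod wedge1; [|by move=> x a y; rewrite comp_lfunZr|exact: form1_permalt].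
rewrite !big_ord_recl big_ord0 addr0 expr0 scale1r expr1 scaleN1r mul0r expr0z scale1r sqrrN expr1n scale1r.
have l1 : (fun b : 'I_1 => v (lift ord0 b)) = fun _ => v ord_max.
  by apply/funext => b; rewrite (ord1 b); congr v; exact: val_inj.
have l2 : (fun b : 'I_1 => v (lift (lift ord0 ord0) b)) = fun _ => v ord0.
  by apply/funext => b; rewrite (ord1 b); congr v; exact: val_inj.
have l3 : v (lift ord0 ord0) = v ord_max by congr v; exact: val_inj.
rewrite l1 l2 l3 -addrA => /eqP; rewrite addr_eq0 => /eqP h.
have h' : gcomm (-1) (al2 c z v) = - (extd A c z v + ((A c z (fun _ => v ord0) \o A c z (fun _ => v ord_max))%VF -
  (A c z (fun _ => v ord_max) \o A c z (fun _ => v ord0))%VF)) by exact: h.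
by rewrite /curvature2 h' opprK.
Qed.

Lemma extd1_pair2 c z u v : extd A c z (pair2 u v) =
  vderive (fun x => A c x (fun _ => v)) z u - vderive (fun x => A c x (fun _ => u)) z v.
Proof.
rewrite /extd !big_ord_recl big_ord0 addr0 expr0 scale1r expr1 scaleN1r.
have e1 y : A c y (fun a => pair2 u v (lift ord0 a)) = A c y (fun _ => v) by congr (A c y _); apply/funext => a.
have e2 y : A c y (fun a => pair2 u v (lift (lift ord0 ord0) a)) = A c y (fun _ => u).
  by congr (A c y _); apply/funext => a; rewrite (ord1 a).
by under eq_fun do rewrite e1; under [X in _ - vderive X _ _]eq_fun do rewrite e2.
Qed.

Lemma flat_curvature_pair2 c z u v : chart_img c z -> F2 c z (pair2 u v) =
  vderive (fun x => A c x (fun _ => v)) z u - vderive (fun x => A c x (fun _ => u)) z v +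
  ((A c z (fun _ => u) \o A c z (fun _ => v))%VF - (A c z (fun _ => v) \o A c z (fun _ => u))%VF).
Proof. by move=> cz; rewrite (flat_curvature _ cz) extd1_pair2. Qed.

Lemma wedge12 (W1 W2 W3 : vectType R) (op : W1 -> W2 -> W3) (a : vform 'rV[R]_n 1 W1) (b : vform 'rV[R]_n 2 W2)
    (v0 v1 v2 : 'rV[R]_n) (v : 'I_3 -> 'rV[R]_n) : v0 = v ord0 -> v1 = v (lift ord0 ord0) -> v2 = v ord_max ->
  alternating b -> (forall x k y, op x (k *: y) = k *: op x y) ->
  wedge_form op (erefl (1 + 2)%N) a b v =
  op (a (fun _ => v0)) (b (pair2 v1 v2)) - op (a (fun _ => v1)) (b (pair2 v0 v2)) + op (a (fun _ => v2)) (b (pair2 v0 v1)).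
Proof.
move=> -> -> -> al oZ; rewrite wedge1//; last exact: form2_permalt.
rewrite !big_ord_recl big_ord0 addr0 expr0 scale1r expr1 scaleN1r sqrrN expr1n scale1r addrA.
have m : lift ord0 (lift ord0 ord0) = ord_max :> 'I_3 by exact: val_inj.
rewrite m; congr (op _ (b _) - op _ (b _) + op _ (b _)).
- rewrite (pair2_eta (fun _ => _)); congr pair2; congr v; exact: val_inj.
- rewrite (pair2_eta (fun _ => _)); congr pair2; congr v; exact: val_inj.
- rewrite (pair2_eta (fun _ => _)); congr pair2; congr v; exact: val_inj.
Qed.

Lemma wedge21 (a : vform 'rV[R]_n 2 E) (b : vform 'rV[R]_n 1 E)
    (v0 v1 v2 : 'rV[R]_n) (v : 'I_3 -> 'rV[R]_n) : v0 = v ord0 -> v1 = v (lift ord0 ord0) -> v2 = v ord_max ->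
  alternating a ->
  wedge_form (fun f g : E => (f \o g)%VF) (erefl (2 + 1)%N) a b v =
  (a (pair2 v1 v2) \o b (fun _ => v0))%VF - (a (pair2 v0 v2) \o b (fun _ => v1))%VF + (a (pair2 v0 v1) \o b (fun _ => v2))%VF.
Proof.
move=> e0 e1 e2 al; rewrite wedge2; [|by move=> x k y; rewrite comp_lfunZr|exact: form1_permalt].
rewrite !big_ord_recl !big_ord0 !addr0 /=.
have i0 : v ord0 = v0 by []. have i1 : v (lift ord0 ord0) = v1 by []. have i2 : v (lift ord0 (lift ord0 ord0)) = v2.
  by rewrite e2; congr v; exact: val_inj.
have j1 : v (lift ord0 ord0) = v1 by [].
have k10 : v (lift (lift ord0 ord0) ord0) = v0 by rewrite e0; congr v; exact: val_inj.
have k11 : v (lift (lift ord0 ord0) (lift ord0 ord0)) = v2 by rewrite e2; congr v; exact: val_inj.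
have k20 : v (lift (lift ord0 (lift ord0 ord0)) ord0) = v0 by rewrite e0; congr v; exact: val_inj.
have k21 : v (lift (lift ord0 (lift ord0 ord0)) (lift ord0 ord0)) = v1 by rewrite e1; congr v; exact: val_inj.
have f1 (p : 'I_3) (q : 'I_2) w : v (lift p (lift q ord0)) = w -> (fun b0 : 'I_1 => v (lift p (lift q b0))) = fun _ => w.
  by move=> <-; apply/funext => b0; rewrite (ord1 b0).
rewrite (f1 ord0 ord0 v2 i2) (f1 ord0 (lift ord0 ord0) v1); last by rewrite e1; congr v; exact: val_inj.
rewrite (f1 (lift ord0 ord0) ord0 v2 k11) (f1 (lift ord0 ord0) (lift ord0 ord0) v0); last by rewrite e0; congr v; exact: val_inj.
rewrite (f1 (lift ord0 (lift ord0 ord0)) ord0 v1 k21) (f1 (lift ord0 (lift ord0 ord0)) (lift ord0 ord0) v0); last by rewrite e0; congr v; exact: val_inj.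
rewrite i0 i1 i2 k10 k11 k20 k21 (form2_anti v1 v0 al) (form2_anti v2 v0 al) (form2_anti v2 v1 al) !comp_lfunNl.
rewrite /bump /= !expr0 !expr1 !exprS !expr0 !mulr1 !mulrN1 ?opprK !scaleN1r !scale1r ?opprK.
move: (_ \o b (fun _ => v0))%VF (_ \o b (fun _ => v1))%VF (_ \o b (fun _ => v2))%VF => p q r.
by apply: crd_inj => j; rewrite !(crdD, crdB, raddfN, crdZ) /=; field.
Qed.

(** Flatness in form degree 3. The Koszul sign of alpha^2 against alpha^1 turns the sum of the two
    products into a commutator, and alpha^3 contributes an exact term only. *)
Lemma flat_bianchi c z v : chart_img c z ->
  extd al2 c z v + (wedge_form (fun f g : E => (f \o g)%VF) (erefl (1 + 2)%N) (A c z) (al2 c z) v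
    - wedge_form (fun f g : E => (f \o g)%VF) (erefl (2 + 1)%N) (al2 c z) (A c z) v) = gcomm (-2) (alpha 3%N c z v).
Proof.
move=> cz; have [_ _ _ /(_ 2%N c z v cz)] := flat.
pose T1 : E := sprod 0 (erefl (1 + 2)%N) (A c z) (al2 c z) v.
pose T2 : E := sprod (-1) (erefl (2 + 1)%N) (al2 c z) (A c z) v.
rewrite (eq_bigr (fun i : 'I_4 => if (i == 1 :> nat) then T1 else if (i == 2 :> nat) then T2 else 0)); last first.
  move=> [[|[|[|[|//]]]] hi] _ /=.
  - by apply: sprod0l => u; exact: zero.
  - exact: (@sprod_cast _ _ V (fun k => alpha k c z) _ 1 2 3 (erefl (1 + 2)%N)).
  - exact: (@sprod_cast _ _ V (fun k => alpha k c z) _ 2 1 3 (erefl (2 + 1)%N)).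
  - by apply: sprod0r => u; exact: zero.
rewrite !big_ord_recl big_ord0 /= !add0r !addr0 {}/T1 {}/T2 /sprod mul0r expr0z scale1r mulr1 exprN1 invrN invr1 scaleN1r.
rewrite exprS sqrrN expr1n mulr1 scaleN1r -addrA => /eqP; rewrite addrC subr_eq0 => /eqP h.
exact: h.
Qed.

Lemma bianchi_sum (Q : vectType R) (r x0 x1 x2 y0 y1 y2 z0 z1 z2 x y z : Q) : z0 = y0 - x0 -> z1 = y1 - x1 -> z2 = y2 - x2 ->
  x = x0 - x1 + x2 -> y = y0 - y1 + y2 -> z = r + (y - x) -> - r + (- z0 - - z1 + - z2) = - z.
Proof. by move=> -> -> -> -> -> ->; apply: crd_inj => j; rewrite !(crdD, crdB, raddfN) /=; ring. Qed.

Lemma linear_sub_add (Q : vectType R) (f : {linear E -> Q}) x y z : f (x - y + z) = f x - f y + f z.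
Proof. by rewrite linearD linearB. Qed.

Lemma linear_add_sub (Q : vectType R) (f : {linear E -> Q}) x y z : f (x + (y - z)) = f x + (f y - f z).
Proof. by rewrite linearD linearB. Qed.

Lemma bianchi_algebra (Q : vectType R) (f : {linear E -> Q}) (r p0 p1 p2 q0 q1 q2 : E) :
  - f r + (- f (q0 - p0) - - f (q1 - p1) + - f (q2 - p2)) = - f (r + ((q0 - q1 + q2) - (p0 - p1 + p2))).
Proof.
exact: (bianchi_sum (linearB f q0 p0) (linearB f q1 p1) (linearB f q2 p2) (linear_sub_add f p0 p1 p2)
  (linear_sub_add f q0 q1 q2) (linear_add_sub f r _ _)).
Qed.

Lemma trunc_flat : flat_2connection (trunc_form alpha).1 (trunc_form alpha).2.
Proof.
have alt2 c x : chart_img c x -> alternating (al2 c x) by move=> cx; have [h _ _] := falpha 2%N; exact: h.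
pose L : E -> qEnd V := fun x => - pi1 x.
have lL : linear L by move=> a x y; rewrite /L linearP opprD scalerN.
pose f := HB.pack_for {linear E -> qEnd V} L (GRing.isLinear.Build R E (qEnd V) _ L lL).
have fB := is_form_lin f (falpha 2%N).
have piN (x : E) : - pi1 x = pi1 (- x) := esym (pi1N x).
split.
- by split; [exact: falpha|exact: fB].
- by move=> c x v cx; exact: flat_gl0.
- move=> c x v cx; exists (- al2 c x v); last exact: piN.
  by apply: homogeneousN; exact: flat_homogeneous2.
- move=> c x v cx; rewrite /= piN gldelta_pi -comm1E.
  have -> : gcomm (-1) (- al2 c x v) = F2 c x v by rewrite linearN.
  rewrite (flat_curvature v cx); congr (_ + _).
  have -> : wedge_form (@glbracket R V) (erefl (1 + 1)%N) (A c x) (A c x) v =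
      glbracket (A c x (fun _ => v ord0)) (A c x (fun _ => v ord_max)) - glbracket (A c x (fun _ => v ord_max)) (A c x (fun _ => v ord0)).
    rewrite wedge1; [|by move=> g k y; rewrite /glbracket -comp_lfunZr -comp_lfunZl scalerBr|exact: form1_permalt].
    rewrite !big_ord_recl big_ord0 addr0 expr0 scale1r expr1 scaleN1r.
    have l1 : (fun b : 'I_1 => v (lift ord0 b)) = fun _ => v ord_max.
      by apply/funext => b; rewrite (ord1 b); congr v; exact: val_inj.
    have l2 : (fun b : 'I_1 => v (lift (lift ord0 ord0) b)) = fun _ => v ord0.
      by apply/funext => b; rewrite (ord1 b); congr v; exact: val_inj.
    have l3 : v (lift ord0 ord0) = v ord_max by congr v; exact: val_inj.
    by rewrite l1 l2 l3.
  rewrite /glbracket; move: (_ \o A c x (fun _ => v ord_max))%VF (_ \o A c x (fun _ => v ord0))%VF => p q.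
  by apply: crd_inj => j; rewrite !(crdZ, crdD, crdB, raddfN) /=; field.
move=> c x v cx; have [alB _ _] := fB.
(* [glact] goes through arbitrary representatives, whereas [op] is linear in the class for every
   [g], as [wedge12] demands. The two agree when [g] is a cochain map of degree 0. *)
pose op (g : E) (y : qEnd V) : qEnd V := pi1 ((g \o lift1 V y)%VF - (lift1 V y \o g)%VF).
have opE g y : gl0 g -> glact g y = op g y by move=> gg; rewrite -{1}(lift1K y) glact_pi.
have opN g (w : E) : gl0 g -> op g (- pi1 w) = - pi1 ((g \o w)%VF - (w \o g)%VF).
  by move=> gg; rewrite -(opE _ _ gg) piN (glact_pi _ gg) comp_lfunNr comp_lfunNl -opprD linearN.
have opZ g k y : op g (k *: y) = k *: op g y.
  have e : lift1 V (k *: y) = k *: lift1 V y by exact: linearZ.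
  by rewrite /op e -comp_lfunZr -comp_lfunZl -scalerBr pi1Z.
have e1 : extd (trunc_form alpha).2 c x v = - pi1 (extd al2 c x v) by exact: (extd_lin f v (falpha 2%N) cx).
have e2 : wedge_form (@glact R V) (erefl (1 + 2)%N) (A c x) (fun u => f (al2 c x u)) v =
    wedge_form op (erefl (1 + 2)%N) (A c x) (fun u => f (al2 c x u)) v.
  rewrite /wedge_form; congr (_ *: _); apply: eq_bigr => s _; congr (_ *: _).
  by apply: opE; exact: flat_gl0.
rewrite e1; apply: (etrans (congr1 (fun y => - pi1 (extd al2 c x v) + y) e2)).
have m0 : v (lift ord0 ord0) = v (lift ord0 ord0) by [].
rewrite (wedge12 (op := op) (A c x) (erefl (v ord0)) m0 (erefl (v ord_max)) (alB c x cx) opZ) /= /L !opN; try exact: flat_gl0.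
have := flat_bianchi v cx.
rewrite (wedge12 (A c x) (erefl (v ord0)) m0 (erefl (v ord_max)) (alt2 c x cx)); last by move=> g k y; rewrite comp_lfunZr.
rewrite (wedge21 (A c x) (erefl (v ord0)) m0 (erefl (v ord_max)) (alt2 c x cx)).
have z3 : pi1 (gcomm (-2) (alpha 3%N c x v)) = 0.
  by apply/pi1P/exact1P; exists (alpha 3%N c x v) => //; exact: (@hom 3%N).
have z4 : - pi1 (gcomm (-2) (alpha 3%N c x v)) = 0 by rewrite z3 oppr0.
move=> h; rewrite -h in z4.
exact: (etrans (bianchi_algebra (@pi1 R V) _ _ _ _ _ _ _) z4).
Qed.

End Flat.

Lemma trunc_rep_two_path (R : realType) (n : nat) (M : manifold R n) (V : cochain_complex R)
    (alpha : forall k, dform M k 'End(V)) (G : R^o * R^o -> M) : flat_superconnection alpha -> is_two_path G ->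
  let H := Hol (trunc_form alpha) in
  GL1 ((trunc_rep (integration alpha)).2 G) /\ (trunc_rep (integration alpha)).2 G = H.2 G.
Proof.
move=> flat [pG cst] H.
have [k [pol [cover cG sm]]] := piecewise_pieces pG.
have falpha l : is_form (alpha l) by have [h _ _ _] := flat.
have left_const (s : R) : 0 <= s <= 1 -> G (0, s) = G (0, 0) by move=> s01; have [h _] := cst s s01; exact: h.
have gA := flat_gl0 flat; have h2 := flat_homogeneous2 flat.
have [S hS] := fgen_levels pol.
have [st su] := surface_transport_exists falpha gA h2 cover cG sm hS.
have i2 := int2_hs falpha (curvature2_form flat) (flat_curvature_pair2 flat) gA h2 cover cG sm left_const hS.
have o01 : 0 <= (1 : R) <= 1 by rewrite ler01 lexx.
(* The reversal of the top path and the one built into [int1] cancel, so the right factor is the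
   transport along the top level. *)
have tE : int1 alpha (fun t : R^o => G (1 - t, 1)) = evo (linefield (alpha 1%N) G (1, 0) (0, 1)) 1.
  rewrite -(transport_level falpha gA cover cG sm o01 o01) /int1; congr (transport _ _ 1).
  by apply/funext => t; rewrite subKr.
have Gb : (fun p : R^o * R^o => G (p.1, p.2)) = G by apply/funext => -[].
have e : (trunc_rep (integration alpha)).2 G = pi1 (hs (Cx alpha G S) 1 1).
  by rewrite /trunc_rep /integration /= Gb tE; exact: i2.
have eH : H.2 G = pi1 (hs (Cx alpha G S) 1 1).
  rewrite /H /Hol /=; case: xgetP => [_ _ [g tg <-]|/(_ (pi1 (hs (Cx alpha G S) 1 1))) nH]; first exact: su.
  by exfalso; apply: nH; exists (fun s : R^o => pi1 (hs (Cx alpha G S) 1 s)).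
have [_ gl _] := st.
by rewrite e eH; split; [exact: (gl 1 o01)|].
Qed.

Theorem theorem4p8 (R : realType) (n : nat) (M : manifold R n) (V : cochain_complex R)
    (alpha : forall k, dform M k 'End(V)) :
  flat_superconnection alpha ->
  flat_2connection (trunc_form alpha).1 (trunc_form alpha).2 /\
  same_holonomy (trunc_rep (integration alpha)) (Hol (trunc_form alpha)).
Proof.
move=> flat; split; first exact: trunc_flat.
split=> [gamma pg|G tG]; last exact: trunc_rep_two_path.
have -> : (trunc_rep (integration alpha)).1 gamma = transport (alpha 1%N) gamma 1.
  rewrite /= /int1; congr (transport _ _ 1); apply/funext => t; congr gamma; exact: subKr.
by split=> //; apply: transport_GL0; rewrite /unit_itv /= ler01 lexx.
Qed.
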